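(* Let $(T,M)$ be a complete local ring containing the rationals, let $n\ge 1$, and let $m_1,\ldots,m_n$ be integers such that $1<m_1<\cdots<m_n<\dim(T)$. Then $T$ is the completion of a countable quasi-excellent local domain that has maximal saturated chains of prime ideals of lengths $m_1,\ldots,m_n$ if and only if the following three conditions hold: (i) $T$ is reduced; (ii) there exist minimal prime ideals $P_1,\ldots,P_n$ of $T$ such that $\dim(T/P_i)=m_i$ for $1\le i\le n$; and (iii) $T/M$ is countable.
   Context: All rings are commutative with identity. A local ring is a Noetherian ring with a unique maximal ideal; $(T,M)$ denotes a local ring $T$ with maximal ideal $M$. For a local ring $A$, $\widehat{A}$ denotes its completion at its maximal ideal, and ''$T$ is the completion of $A$'' means $\widehat{A}\cong T$. A complete local ring is a local ring that is complete with respect to its maximal ideal. ''$T$ contains the rationals'' means that $T$ contains $\mathbb{Q}$ as a subring. The length of a chain of prime ideals $P_0\subsetneq\cdots\subsetneq P_k$ is $k$; the chain is saturated if no prime ideal lies strictly between two consecutive terms. A maximal saturated chain of prime ideals in a local domain $A$ is a saturated chain of prime ideals that starts at $(0)$ and ends at the maximal ideal of $A$. A local ring $A$ is quasi-excellent if: (a) for all prime ideals $P$ of $A$, the ring $\widehat{A}\otimes_A L$ is regular for every finite field extension $L$ of $A_P/PA_P$; and (b) for every finitely generated $A$-algebra $B$, the regular locus $\mathrm{Reg}(B)=\{\mathfrak{q}\in\mathrm{Spec}(B) : B_{\mathfrak{q}} \text{ is a regular local ring}\}$ is open in $\mathrm{Spec}(B)$. *)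

(* Defs.v *)
From HB Require Import structures.
From mathcomp Require Import all_boot all_order all_algebra.
From mathcomp Require Import ring.
From mathcomp Require Import boolp classical_sets cardinality.

Set Implicit Arguments.
Unset Strict Implicit.
Unset Printing Implicit Defensive.

Import GRing.Theory.
Local Open Scope ring_scope.
Local Open Scope quotient_scope.

(* [idealr R] and [prime_idealr R] consist of boolean predicates and contain
   only proper ideals; with classical logic every proper (prime) ideal occurs.
   In particular [prime_idealr R] plays the role of Spec R. Two such structures
   may differ as records while having the same elements, so ideals are always
   compared through their elements. *)

Section Ideals.
Variable R : comNzRingType.

Definition ideal_gen (E : set R) : set R := fun x =>
  exists (k : nat) (c e : 'I_k -> R),
    (forall i, E (e i)) /\ x = \sum_(i < k) c i * e i.

Fixpoint ideal_pow (I : set R) (n : nat) : set R :=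
  if n is k.+1 then
    ideal_gen (fun z => exists a b, [/\ I a, ideal_pow I k b & z = a * b])
  else setT.

Definition strict_sub (I J : {pred R}) : Prop :=
  {subset I <= J} /\ ~ {subset J <= I}.

(* The improper ideal, absent from [idealr R], is generated by 1. *)
Definition noetherian : Prop :=
  forall J : idealr R, exists s : seq R,
    forall x, x \in J <-> ideal_gen [set` s] x.

Definition maximal_ideal (I : idealr R) : Prop :=
  forall J : idealr R, {subset I <= J} -> {subset J <= I}.

Definition local_ring (M : idealr R) : Prop :=
  [/\ noetherian, maximal_ideal M &
      forall N : idealr R, maximal_ideal N -> N =i M].

Definition reduced : Prop := forall (x : R) k, x ^+ k = 0 -> x = 0.

Definition contains_rationals : Prop :=
  exists f : {rmorphism rat -> R}, injective f.

Definition minimal_prime (P : prime_idealr R) : Prop :=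
  forall Q : prime_idealr R, ~ strict_sub Q P.

(* A chain of length k is given by the values c 0, ..., c k. *)
Definition prime_chain (k : nat) (c : nat -> prime_idealr R) : Prop :=
  forall i, (i < k)%N -> strict_sub (c i) (c i.+1).

Definition saturated (k : nat) (c : nat -> prime_idealr R) : Prop :=
  forall i, (i < k)%N -> forall Q : prime_idealr R,
    ~ (strict_sub (c i) Q /\ strict_sub Q (c i.+1)).

Definition has_krull_dim (d : nat) : Prop :=
  (exists c, prime_chain d c) /\
  (forall k c, prime_chain k c -> (k <= d)%N).

Definition max_saturated_chain (M : idealr R) (k : nat)
    (c : nat -> prime_idealr R) : Prop :=
  [/\ prime_chain k c, saturated k c,
      (forall x, x \in c 0%N <-> x = 0) & c k =i M].

End Ideals.

Arguments noetherian : clear implicits.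
Arguments reduced : clear implicits.
Arguments contains_rationals : clear implicits.
Arguments has_krull_dim : clear implicits.

Definition regular_local_ring (R : comNzRingType) : Prop :=
  exists M : idealr R, local_ring M /\
  exists d, has_krull_dim R d /\
  exists s : d.-tuple R, forall x, x \in M <-> ideal_gen [set` s] x.

Section Localization.
Variables (R : comNzRingType) (P : prime_idealr R).

Record loc_frac := LocFrac {
  loc_num : R;
  loc_den : R;
  loc_denP : loc_den \notin P }.

HB.instance Definition _ := gen_eqMixin loc_frac.
HB.instance Definition _ := gen_choiceMixin loc_frac.

Definition loc_equiv (x y : loc_frac) : bool :=
  `[< exists2 u, u \notin P &
      u * (loc_num x * loc_den y - loc_num y * loc_den x) = 0 >].

Lemma primeN_mul u v : u \notin P -> v \notin P -> u * v \notin P.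
Proof. by move=> hu hv; rewrite prime_idealrM negb_or hu. Qed.

Lemma primeN1 : 1 \notin P.
Proof. by rewrite idealr1. Qed.

Lemma loc_equiv_is_equiv : equiv_class_of loc_equiv.
Proof.
split=> [x|x y|y x z].
- by apply/asboolP; exists 1; rewrite ?primeN1 // subrr mulr0.
- by apply/asboolP/asboolP => -[u uP e]; exists u => //;
    rewrite -opprB mulrN e oppr0.
- move=> /asboolP[u uP e] /asboolP[v vP f]; apply/asboolP.
  exists (u * v * loc_den y); first by rewrite !primeN_mul ?loc_denP.
  move: e f; case: x y z => [a s sP] [b t tP] [c r rP] /= e f.
  have -> : u * v * t * (a * r - c * s) =
    v * r * (u * (a * t - b * s)) + u * s * (v * (b * r - c * t)) by ring.
  by rewrite e f !mulr0 addr0.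
Qed.

Canonical loc_equiv_equiv := EquivRelPack loc_equiv_is_equiv.
Canonical loc_equiv_encModRel := defaultEncModRel loc_equiv.

Definition localization := {eq_quot loc_equiv}.

HB.instance Definition _ : EqQuotient loc_frac loc_equiv localization :=
  EqQuotient.on localization.
HB.instance Definition _ := Choice.on localization.

Definition loc_mk (a s : R) (hs : s \notin P) : localization :=
  \pi_localization (LocFrac a hs).

Lemma loc_mkP a s (hs : s \notin P) b t (ht : t \notin P) :
  loc_mk a hs = loc_mk b ht <->
  exists2 u, u \notin P & u * (a * t - b * s) = 0.
Proof.
split=> [/eqP|h]; first by rewrite /loc_mk piE => /asboolP.
by apply/eqP; rewrite /loc_mk piE; apply/asboolP.
Qed.

Lemma loc_mkW (z : localization) :
  exists (a s : R) (hs : s \notin P), z = loc_mk a hs.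
Proof.
by exists (loc_num (repr z)), (loc_den (repr z)), (loc_denP (repr z));
  rewrite /loc_mk; case: (repr z) (reprK z) => //= a s h <-.
Qed.

Definition loc_zero : localization := loc_mk 0 primeN1.
Definition loc_one : localization := loc_mk 1 primeN1.
Definition loc_opp (x : localization) : localization :=
  loc_mk (- loc_num (repr x)) (loc_denP (repr x)).
Definition loc_add (x y : localization) : localization :=
  loc_mk (loc_num (repr x) * loc_den (repr y)
          + loc_num (repr y) * loc_den (repr x))
         (primeN_mul (loc_denP (repr x)) (loc_denP (repr y))).
Definition loc_mul (x y : localization) : localization :=
  loc_mk (loc_num (repr x) * loc_num (repr y))
         (primeN_mul (loc_denP (repr x)) (loc_denP (repr y))).

Lemma loc_repr a s (hs : s \notin P) :
  exists2 u, u \notin P &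
    u * (loc_num (repr (loc_mk a hs)) * s
         - a * loc_den (repr (loc_mk a hs))) = 0.
Proof.
apply/(loc_mkP (loc_num (repr (loc_mk a hs))) (loc_denP (repr (loc_mk a hs)))
  a hs).
rewrite {1}/loc_mk; case: (repr (loc_mk a hs)) (reprK (loc_mk a hs)) => //=.
Qed.

Lemma loc_addE a s (hs : s \notin P) b t (ht : t \notin P) :
  loc_add (loc_mk a hs) (loc_mk b ht)
  = loc_mk (a * t + b * s) (primeN_mul hs ht).
Proof.
apply/loc_mkP.
have [u uP] := loc_repr a hs; have [v vP] := loc_repr b ht.
move: (repr (loc_mk a hs)) (repr (loc_mk b ht)) => [a' s' hs'] [b' t' ht'] /=.
move=> f e; exists (u * v); first exact: primeN_mul.
have -> : u * v * ((a' * t' + b' * s') * (s * t)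
    - (a * t + b * s) * (s' * t')) =
  v * t * t' * (u * (a' * s - a * s')) + u * s * s' * (v * (b' * t - b * t'))
  by ring.
by rewrite e f !mulr0 addr0.
Qed.

Lemma loc_mulE a s (hs : s \notin P) b t (ht : t \notin P) :
  loc_mul (loc_mk a hs) (loc_mk b ht) = loc_mk (a * b) (primeN_mul hs ht).
Proof.
apply/loc_mkP.
have [u uP] := loc_repr a hs; have [v vP] := loc_repr b ht.
move: (repr (loc_mk a hs)) (repr (loc_mk b ht)) => [a' s' hs'] [b' t' ht'] /=.
move=> f e; exists (u * v); first exact: primeN_mul.
have -> : u * v * (a' * b' * (s * t) - a * b * (s' * t')) =
  v * b' * t * (u * (a' * s - a * s')) + u * a * s' * (v * (b' * t - b * t'))
  by ring.
by rewrite e f !mulr0 addr0.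
Qed.

Lemma loc_oppE a s (hs : s \notin P) :
  loc_opp (loc_mk a hs) = loc_mk (- a) hs.
Proof.
apply/loc_mkP; have [u uP e] := loc_repr a hs; exists u => //.
by rewrite !mulNr -opprD mulrN e oppr0.
Qed.

Lemma loc_mk_eq a s (hs : s \notin P) b t (ht : t \notin P) :
  a * t = b * s -> loc_mk a hs = loc_mk b ht.
Proof.
move=> e; apply/loc_mkP; exists 1; first exact: primeN1.
by rewrite e subrr mulr0.
Qed.

Lemma loc_addA : associative loc_add.
Proof.
move=> x y z; have [a [s [hs ->]]] := loc_mkW x.
have [b [t [ht ->]]] := loc_mkW y; have [c [r [hr ->]]] := loc_mkW z.
by rewrite !loc_addE; apply: loc_mk_eq; ring.
Qed.

Lemma loc_addC : commutative loc_add.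
Proof.
move=> x y; have [a [s [hs ->]]] := loc_mkW x.
by have [b [t [ht ->]]] := loc_mkW y; rewrite !loc_addE; apply: loc_mk_eq; ring.
Qed.

Lemma loc_add0 : left_id loc_zero loc_add.
Proof.
move=> x; have [a [s [hs ->]]] := loc_mkW x.
by rewrite loc_addE; apply: loc_mk_eq; ring.
Qed.

Lemma loc_addN : left_inverse loc_zero loc_opp loc_add.
Proof.
move=> x; have [a [s [hs ->]]] := loc_mkW x.
by rewrite loc_oppE loc_addE; apply: loc_mk_eq; ring.
Qed.

HB.instance Definition _ :=
  GRing.isZmodule.Build localization loc_addA loc_addC loc_add0 loc_addN.

Lemma loc_mulA : associative loc_mul.
Proof.
move=> x y z; have [a [s [hs ->]]] := loc_mkW x.
have [b [t [ht ->]]] := loc_mkW y; have [c [r [hr ->]]] := loc_mkW z.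
by rewrite !loc_mulE; apply: loc_mk_eq; ring.
Qed.

Lemma loc_mulC : commutative loc_mul.
Proof.
move=> x y; have [a [s [hs ->]]] := loc_mkW x.
by have [b [t [ht ->]]] := loc_mkW y; rewrite !loc_mulE; apply: loc_mk_eq; ring.
Qed.

Lemma loc_mul1 : left_id loc_one loc_mul.
Proof.
move=> x; have [a [s [hs ->]]] := loc_mkW x.
by rewrite loc_mulE; apply: loc_mk_eq; ring.
Qed.

Lemma loc_mulD : left_distributive loc_mul loc_add.
Proof.
move=> x y z; have [a [s [hs ->]]] := loc_mkW x.
have [b [t [ht ->]]] := loc_mkW y; have [c [r [hr ->]]] := loc_mkW z.
by rewrite !(loc_addE, loc_mulE); apply: loc_mk_eq; ring.
Qed.

Lemma loc_one_neq0 : loc_one != loc_zero.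
Proof.
apply/eqP=> /loc_mkP[u uP]; rewrite mul0r subr0 !mulr1 => u0.
by rewrite u0 idealr0 in uP.
Qed.

HB.instance Definition _ := GRing.Zmodule_isComNzRing.Build localization
  loc_mulA loc_mulC loc_mul1 loc_mulD loc_one_neq0.

Definition loc_map (a : R) : localization := loc_mk a primeN1.

Lemma loc_map_zmod : zmod_morphism loc_map.
Proof.
move=> a b; change (loc_map (a - b) = loc_add (loc_map a) (loc_opp (loc_map b))).
by rewrite /loc_map loc_oppE loc_addE; apply: loc_mk_eq; ring.
Qed.

Lemma loc_map_monoid : monoid_morphism loc_map.
Proof.
split=> // a b; change (loc_map (a * b) = loc_mul (loc_map a) (loc_map b)).
by rewrite /loc_map loc_mulE; apply: loc_mk_eq; ring.
Qed.

HB.instance Definition _ :=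
  GRing.isZmodMorphism.Build R localization loc_map loc_map_zmod.
HB.instance Definition _ :=
  GRing.isMonoidMorphism.Build R localization loc_map loc_map_monoid.

Definition loc_max : localization -> bool := fun z =>
  `[< exists (a s : R) (hs : s \notin P), a \in P /\ z = loc_mk a hs >].

Lemma loc_max_idealr : idealr_closed loc_max.
Proof.
split.
- by apply/asboolP; exists 0, 1, primeN1; rewrite idealr0.
- apply/asboolP=> -[a [s [hs [aP /loc_mkP[u uP]]]]].
  rewrite mul1r mulr1 mulrBr => /subr0_eq e.
  have : u * a \in P by rewrite idealMr.
  by rewrite -e prime_idealrM (negPf uP) (negPf hs).
- move=> w _ _ /asboolP[a [s [hs [aP ->]]]] /asboolP[b [t [ht [bP ->]]]].
  have [c [r [hr ->]]] := loc_mkW w.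
  apply/asboolP.
  exists (c * a * t + b * (r * s)), (r * s * t), (primeN_mul (primeN_mul hr hs) ht).
  split.
    by rewrite rpredD // ?(mulrC _ t) ?(mulrC _ (r * s)) !idealMr.
  by rewrite -loc_addE -loc_mulE.
Qed.

HB.instance Definition _ := isIdealr.Build localization loc_max loc_max_idealr.

End Localization.

Arguments localization {R} P.
Arguments loc_map {R} P.
Arguments loc_max {R} P.

Definition residue_field (R : comNzRingType) (P : prime_idealr R)
  : comNzRingType := {ideal_quot (loc_max P : idealr (localization P))}.

Definition residue_map (R : comNzRingType) (P : prime_idealr R)
    : {rmorphism R -> residue_field P} :=
  \pi_{ideal_quot (loc_max P : idealr (localization P))} \o loc_map P.

Definition regular_ring (R : comNzRingType) : Prop :=
  noetherian R /\ forall P : prime_idealr R, regular_local_ring (localization P).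

Section Completion.
Variables (R : comNzRingType) (I : idealr R).

(* The exponent is shifted: [ideal_powS n] is I^(n+1), so as to stay among
   proper ideals. *)
Definition ideal_powS (n : nat) : R -> bool :=
  fun x => `[< ideal_pow [set` I] n.+1 x >].

Lemma ideal_powS_sub n x : ideal_powS n x -> x \in I.
Proof.
move=> /asboolP[k [c [e [he ->]]]]; apply: rpred_sum => i _.
by have [a [b [aI _ ->]]] := he i; rewrite mulrCA mulrC idealMr.
Qed.

Lemma ideal_powS_idealr n : idealr_closed (ideal_powS n).
Proof.
split.
- by apply/asboolP; exists 0%N, (fun=> 0), (fun=> 0); split;
    [case | rewrite big_ord0].
- by apply/negP=> /ideal_powS_sub; rewrite idealr1.
- move=> w _ _ /asboolP[k [c [e [he ->]]]] /asboolP[l [d [f [hf ->]]]].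
  apply/asboolP; exists (k + l)%N.
  exists (fun i => match split i with inl j => w * c j | inr j => d j end).
  exists (fun i => match split i with inl j => e j | inr j => f j end).
  split; first by move=> i; case: (split i).
  rewrite big_split_ord /= mulr_sumr; congr (_ + _); apply: eq_bigr => i _.
    by rewrite (unsplitK (inl i)) mulrA.
  by rewrite (unsplitK (inr i)).
Qed.

HB.instance Definition _ n := isIdealr.Build R (ideal_powS n)
  (ideal_powS_idealr n).

Definition pow_quot (n : nat) : comNzRingType :=
  {ideal_quot (ideal_powS n : idealr R)}.

Definition pow_proj (n : nat) : {rmorphism R -> pow_quot n} :=
  \pi_{ideal_quot (ideal_powS n : idealr R)}.

(* Membership in the inverse limit: for m <= n the transition map sends the
   n-th component to the m-th one, i.e. both are classes of a common element. *)
Definition compatible (x : forall n, pow_quot n) : Prop :=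
  forall m n, (m <= n)%N -> exists a, x m = pow_proj m a /\ x n = pow_proj n a.

Record completion := Completion {
  comp_val : forall n, pow_quot n;
  comp_valP : compatible comp_val }.

HB.instance Definition _ := gen_eqMixin completion.
HB.instance Definition _ := gen_choiceMixin completion.

Lemma completion_eq (x y : completion) :
  (forall n, comp_val x n = comp_val y n) -> x = y.
Proof.
case: x y => [x hx] [y hy] /= e.
have exy : x = y by apply: functional_extensionality_dep.
by rewrite exy in hx *; congr Completion; apply: Prop_irrelevance.
Qed.

Lemma compat_const a : compatible (fun n => pow_proj n a).
Proof. by move=> m n _; exists a. Qed.

Lemma compat_opp (x : completion) : compatible (fun n => - comp_val x n).
Proof.
move=> m n /(comp_valP x)[a [-> ->]]; exists (- a).
by rewrite !rmorphN.
Qed.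

Lemma compat_add (x y : completion) :
  compatible (fun n => comp_val x n + comp_val y n).
Proof.
move=> m n mn; have [a [-> ->]] := comp_valP x mn.
by have [b [-> ->]] := comp_valP y mn; exists (a + b); rewrite !rmorphD.
Qed.

Lemma compat_mul (x y : completion) :
  compatible (fun n => comp_val x n * comp_val y n).
Proof.
move=> m n mn; have [a [-> ->]] := comp_valP x mn.
by have [b [-> ->]] := comp_valP y mn; exists (a * b); rewrite !rmorphM.
Qed.

Definition completion_map (a : R) : completion := Completion (compat_const a).
Definition comp_opp x : completion := Completion (compat_opp x).
Definition comp_add x y : completion := Completion (compat_add x y).
Definition comp_mul x y : completion := Completion (compat_mul x y).

Lemma comp_addA : associative comp_add.
Proof. by move=> x y z; apply: completion_eq => n /=; rewrite addrA. Qed.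
Lemma comp_addC : commutative comp_add.
Proof. by move=> x y; apply: completion_eq => n /=; rewrite addrC. Qed.
Lemma comp_add0 : left_id (completion_map 0) comp_add.
Proof. by move=> x; apply: completion_eq => n /=; rewrite rmorph0 add0r. Qed.
Lemma comp_addN : left_inverse (completion_map 0) comp_opp comp_add.
Proof. by move=> x; apply: completion_eq => n /=; rewrite rmorph0 addNr. Qed.

HB.instance Definition _ :=
  GRing.isZmodule.Build completion comp_addA comp_addC comp_add0 comp_addN.

Lemma comp_mulA : associative comp_mul.
Proof. by move=> x y z; apply: completion_eq => n /=; rewrite mulrA. Qed.
Lemma comp_mulC : commutative comp_mul.
Proof. by move=> x y; apply: completion_eq => n /=; rewrite mulrC. Qed.
Lemma comp_mul1 : left_id (completion_map 1) comp_mul.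
Proof. by move=> x; apply: completion_eq => n /=; rewrite rmorph1 mul1r. Qed.
Lemma comp_mulD : left_distributive comp_mul comp_add.
Proof. by move=> x y z; apply: completion_eq => n /=; rewrite mulrDl. Qed.
Lemma comp_one_neq0 : completion_map 1 != completion_map 0.
Proof.
apply/eqP=> /(congr1 (fun x => comp_val x 0%N)) /= /eqP.
by rewrite rmorph1 rmorph0 oner_eq0.
Qed.

HB.instance Definition _ := GRing.Zmodule_isComNzRing.Build completion
  comp_mulA comp_mulC comp_mul1 comp_mulD comp_one_neq0.

Lemma completion_map_zmod : zmod_morphism completion_map.
Proof. by move=> a b; apply: completion_eq => n /=; rewrite rmorphB. Qed.
Lemma completion_map_monoid : monoid_morphism completion_map.
Proof. by split=> // a b; apply: completion_eq => n /=; rewrite rmorphM. Qed.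

HB.instance Definition _ :=
  GRing.isZmodMorphism.Build R completion completion_map completion_map_zmod.
HB.instance Definition _ :=
  GRing.isMonoidMorphism.Build R completion completion_map
    completion_map_monoid.

Definition adically_complete : Prop := bijective completion_map.

End Completion.

Definition is_completion_of (T A : comNzRingType) (N : idealr A) : Prop :=
  exists g : {rmorphism completion N -> T}, bijective g.

(* S, with i and j, is the tensor product of the A-algebras B and C: the
   coproduct of B and C in the category of commutative A-algebras. *)
Definition is_tensor_product (A B C S : comNzRingType)
    (f : {rmorphism A -> B}) (g : {rmorphism A -> C})
    (i : {rmorphism B -> S}) (j : {rmorphism C -> S}) : Prop :=
  i \o f =1 j \o g /\
  forall (X : comPzRingType) (u : {rmorphism B -> X}) (v : {rmorphism C -> X}),
    u \o f =1 v \o g ->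
    (exists h : {rmorphism S -> X}, h \o i =1 u /\ h \o j =1 v) /\
    (forall h h' : {rmorphism S -> X},
       h \o i =1 h' \o i -> h \o j =1 h' \o j -> h =1 h').

Definition finite_extension (K : comNzRingType) (L : fieldType)
    (f : {rmorphism K -> L}) : Prop :=
  exists s : seq L, forall y, exists c : 'I_(size s) -> K,
    y = \sum_(k < size s) f (c k) * s`_k.

Definition finitely_generated_algebra (A B : comNzRingType)
    (f : {rmorphism A -> B}) : Prop :=
  exists s : seq B, forall S : {pred B}, subring_closed S ->
    (forall a, f a \in S) -> {subset s <= S} -> forall b, b \in S.

(* Subsets of Spec B are plain predicates: [set (prime_idealr B)] is a universe
   inconsistency. *)
Definition regular_locus (B : comNzRingType) (q : prime_idealr B) : Prop :=
  regular_local_ring (localization q).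

Definition zariski_open (B : comNzRingType) (U : prime_idealr B -> Prop)
    : Prop :=
  exists E : set B, forall q, U q <-> exists2 e, E e & e \notin q.

(* The zero ring is not a [comNzRingType]. This loses nothing: its spectrum is
   empty, so it is regular and its regular locus is open. *)
Definition quasi_excellent (A : comNzRingType) (N : idealr A) : Prop :=
  (forall (P : prime_idealr A) (L : fieldType)
          (f : {rmorphism residue_field P -> L}), finite_extension f ->
    forall (S : comNzRingType) (i : {rmorphism completion N -> S})
           (j : {rmorphism L -> S}),
      is_tensor_product (completion_map N) (f \o residue_map P) i j ->
      regular_ring S) /\
  (forall (B : comNzRingType) (f : {rmorphism A -> B}),
     finitely_generated_algebra f -> zariski_open (@regular_locus B)).

(* Main.v *)
(* Sufficiency follows Heitmann. A countable subring A of T is built by closing up a countable ring under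
   countably many tasks, with the minimal primes of T meeting A only in 0: A contains representatives of T
   modulo M and generators of M, and a linear equation over A that is solvable in T is solvable in A, so that
   T is the completion of A. Moreover A contains generators of every minimal prime Q of the singular
   locus of T/IT, for each ideal I of A, unless Q is a minimal prime of T; if Q /\ A = I then Q = IT, a
   contradiction, so the formal fibres are regular. Finally A contains generators of primes Q_i of
   height one over P_i, outside all other minimal primes, with dim (T/Q_i) = m_i - 1; then 0 < Q_i /\ A,
   followed by a chain of maximal length, is saturated.
   T is a quotient of a power series ring S over a coefficient field. Derivations of S and Nagata's
   Jacobian criterion show that regular loci in T[X_1..X_k] are open, and that regularity of the formal
   fibres persists in T[X_1..X_k]; as the fibres over finite extensions are localizations of quotients of
   these rings, and the regular locus descends along the faithfully flat A[X] -> T[X], A is quasi-excellent.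
   Necessity: T embeds in the regular ring T (x) Frac A, hence is reduced. A maximal saturated chain of A
   lifts to T from the top by going down, adjacent primes being lifted to adjacent primes by the principal
   ideal theorem, so that it ends at a minimal prime; its length is the dimension since T is catenary. *)

Require Import Defs.
From HB Require Import structures.
From mathcomp Require Import all_boot all_order all_algebra.
From mathcomp Require Import ring zify.
From mathcomp Require Import boolp classical_sets cardinality.
From Stdlib Require List.

Set Implicit Arguments.
Unset Strict Implicit.
Unset Printing Implicit Defensive.

Import GRing.Theory.
Local Open Scope ring_scope.
Local Open Scope classical_set_scope.
Local Open Scope quotient_scope.

(** * Ideals and primes as subsets *)

Create HintDb isdb.

(** Apart from residue fields, localizations and quotients are not formed until the definitions have
    to be met: [sat Q J], [height_ge J Q n] and [reg J Q d] describe the ring (R/J)_Q by subsets of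
    R, and [reg_ess] translates at the end. All minimal primes of T meet A in 0, so the lengths m_i
    cannot be read off from the minimal primes of A. They are planted one step higher: a prime Q_i
    extended from A has A/(Q_i /\ A) of the same dimension as T/Q_i, and its contraction has height
    one because Q_i has. The inequality m_i > 1 leaves room for Q_i strictly below M. Catenarity of
    T is needed both for dim (T/Q_i) = m_i - 1 and for the length of a lifted chain; Noether
    normalization reduces it to showing that a contracted prime has height at most one.
    Characteristic zero lifts the residue field by Hensel's lemma, keeps derivatives of minimal
    polynomials nonzero and makes derivations preserve minimal primes. *)

Lemma seteqI T (A B : set T) : A `<=` B -> B `<=` A -> A = B.
Proof. by move=> h1 h2; apply/predeqP => x; split; [exact: h1 | exact: h2]. Qed.

Section Ideals.
Variable R : comNzRingType.
Implicit Types (I J P Q C : set R) (x y a b : R) (s t : seq R).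

Definition isid I :=
  [/\ I 0, (forall x y, I x -> I y -> I (x + y)) & (forall a x, I x -> I (a * x))].

Definition isprime P :=
  [/\ isid P, ~ P 1 & forall x y, P (x * y) -> P x \/ P y].

Definition zid : set R := fun x => x = 0.

Lemma isid0 I : isid I -> I 0. Proof. by case. Qed.
Lemma isidD I x y : isid I -> I x -> I y -> I (x + y).
Proof. by case=> _ h _; apply: h. Qed.
Lemma isidM I a x : isid I -> I x -> I (a * x).
Proof. by case=> _ _; apply. Qed.
Lemma isidMr I a x : isid I -> I x -> I (x * a).
Proof. by rewrite mulrC; apply: isidM. Qed.
Lemma isidN I x : isid I -> I x -> I (- x).
Proof. by move=> h hx; rewrite -mulN1r; apply: isidM. Qed.
Lemma isidB I x y : isid I -> I x -> I y -> I (x - y).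
Proof. by move=> h hx hy; apply: isidD => //; apply: isidN. Qed.
Lemma isidBr I x y : isid I -> I (x - y) -> I y -> I x.
Proof. by move=> h h1 h2; rewrite -(subrK y x); apply: isidD. Qed.
Lemma isidBl I x y : isid I -> I (x - y) -> I x -> I y.
Proof. by move=> h h1 h2; rewrite -(subKr x y); apply: isidB. Qed.
Lemma isid_sum I (T : Type) (r : seq T) (p : pred T) (F : T -> R) :
  isid I -> (forall i, p i -> I (F i)) -> I (\sum_(i <- r | p i) F i).
Proof.
by move=> h hF; apply: big_ind => //; [exact: isid0 | move=> *; exact: isidD].
Qed.
Lemma isid1 I x : isid I -> I 1 -> I x.
Proof. by move=> h h1; rewrite -(mulr1 x); apply: isidM. Qed.

Lemma zid_id : isid zid.
Proof. by split=> // [x y -> ->|a x ->]; rewrite /zid ?addr0 ?mulr0. Qed.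
Lemma setT_id : isid setT. Proof. by split. Qed.
Lemma zid_sub I : isid I -> zid `<=` I.
Proof. by move=> h x ->; exact: isid0. Qed.
Lemma setI_id I J : isid I -> isid J -> isid (I `&` J).
Proof.
move=> hI hJ; split; first by split; exact: isid0.
- by move=> x y [? ?] [? ?]; split; exact: isidD.
- by move=> a x [? ?]; split; exact: isidM.
Qed.

Lemma prime_id P : isprime P -> isid P. Proof. by case. Qed.
Lemma prime1 P : isprime P -> ~ P 1. Proof. by case. Qed.
Lemma primeM P x y : isprime P -> P (x * y) -> P x \/ P y.
Proof. by case=> _ _; apply. Qed.
Lemma primeMl P u x : isprime P -> ~ P u -> P (u * x) -> P x.
Proof. by move=> hP hu /(primeM hP)[]. Qed.
Lemma primeNM P x y : isprime P -> ~ P x -> ~ P y -> ~ P (x * y).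
Proof. by move=> hP hx hy /(primeM hP)[]. Qed.
Lemma primeX P x n : isprime P -> P (x ^+ n) -> P x.
Proof.
move=> hP; elim: n => [|n IH]; first by rewrite expr0 => /(prime1 hP).
by rewrite exprS => /(primeM hP)[].
Qed.
Lemma primeNX P x n : isprime P -> ~ P x -> ~ P (x ^+ n).
Proof. by move=> hP hx /(primeX hP). Qed.
Hint Resolve prime_id zid_id setT_id setI_id : isdb.
Hint Extern 0 (isid _) => solve [auto 6 with isdb nocore] : core.

(* The combinations of s with coefficients in C, modulo J; [C] is a prime ideal in Nakayama's lemma,
   a subring in the construction of A, and the whole ring in [spn J s], the ideal J + (s). *)
Fixpoint gen C J s x : Prop :=
  if s is a :: s' then exists2 r, C r & gen C J s' (x - r * a) else J x.

Notation spn := (gen setT).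

Lemma gen_id C J s : isid C -> isid J -> isid (gen C J s).
Proof.
move=> hC hJ; elim: s => [|a s IH] //=; split.
- by exists 0; [exact: isid0 | rewrite mul0r subr0; exact: isid0 IH].
- move=> x y [r hr hx] [r' hr' hy]; exists (r + r'); first exact: isidD.
  by rewrite (_ : _ - _ = (x - r * a) + (y - r' * a)); [exact: isidD | ring].
- move=> b x [r hr hx]; exists (b * r); first exact: isidM.
  by rewrite (_ : _ - _ = b * (x - r * a)); [exact: isidM | ring].
Qed.

Hint Resolve gen_id : isdb.

Lemma gen_base C J s : isid C -> J `<=` gen C J s.
Proof.
move=> hC; elim: s => [|a s IH] //= x hx; exists 0; first exact: isid0.
by rewrite mul0r subr0; exact: IH.
Qed.

Lemma gen_memc C J s a r : isid C -> isid J -> a \in s -> C r -> gen C J s (r * a).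
Proof.
move=> hC hJ; elim: s => //= b s IH; rewrite inE => /predU1P[->|h] hr.
  by exists r => //; rewrite subrr; apply: isid0; exact: gen_id.
by exists 0; [exact: isid0 | rewrite mul0r subr0; exact: IH].
Qed.

Lemma spn_mem J s a : isid J -> a \in s -> spn J s a.
Proof. by move=> hJ h; rewrite -(mul1r a); apply: gen_memc. Qed.

Lemma gen_min I C J s : isid I -> J `<=` I ->
  (forall a r, a \in s -> C r -> I (r * a)) -> gen C J s `<=` I.
Proof.
move=> hI hJ; elim: s => [|a s IH] //= hs x [r hr hx].
apply: (isidBr hI (y := r * a)).
  by apply: IH hx => b q hb; apply: hs; rewrite inE hb orbT.
by apply: hs; rewrite // inE eqxx.
Qed.

Lemma spn_min I J s : isid I -> J `<=` I -> (forall a, a \in s -> I a) ->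
  spn J s `<=` I.
Proof. by move=> hI hJ hs; apply: gen_min => // a r ha _; apply: isidM => //; exact: hs. Qed.

Lemma gen_mono C C' J J' s : C `<=` C' -> J `<=` J' -> gen C J s `<=` gen C' J' s.
Proof.
move=> hC hJ; elim: s => [|a s IH] //= x [r hr hx].
by exists r; [exact: hC | exact: IH].
Qed.

Lemma gen_cat C J s t : gen C J (s ++ t) = gen C (gen C J t) s.
Proof. by elim: s => //= a s ->. Qed.

Lemma spn_sub J s t : isid J -> {subset s <= t} -> spn J s `<=` spn J t.
Proof.
move=> hJ h; apply: spn_min; [exact: gen_id | exact: gen_base |].
by move=> a /h; apply: spn_mem.
Qed.

Lemma gen_sumP C J s x : isid C -> gen C J s x <->
  exists2 c : nat -> R, (forall i, C (c i)) & J (x - \sum_(i < size s) c i * s`_i).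
Proof.
move=> hC; elim: s x => [|a s IH] x /=.
  by split=> [h|[c _]]; [exists (fun=> 0); [move=> _; exact: isid0|] |];
    rewrite big_ord0 subr0.
split.
  move=> [r hr /IH[c hc hx]]; exists (fun n => if n is k.+1 then c k else r).
    by case.
  by rewrite big_ord_recl /= opprD addrA.
move=> [c hc]; rewrite big_ord_recl /= opprD addrA => hx.
exists (c 0%N) => //; apply/IH; exists (fun n => c n.+1) => //.
Qed.

Definition noeth := forall I, isid I -> exists s, I = spn zid s.

(* The contraction to R of the extension of I to R_Q. *)
Definition sat Q I : set R := fun x => exists2 u, ~ Q u & I (u * x).

Lemma sat_id Q I : isprime Q -> isid I -> isid (sat Q I).
Proof.
move=> hQ hI; split.
- by exists 1; [exact: prime1 | rewrite mulr0; exact: isid0].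
- move=> x y [u hu hx] [v hv hy]; exists (u * v); first exact: primeNM.
  rewrite (_ : _ * _ = v * (u * x) + u * (v * y)); last by ring.
  by apply: isidD => //; exact: isidM.
- by move=> a x [u hu hx]; exists u => //; rewrite mulrCA; exact: isidM.
Qed.

Hint Resolve sat_id : isdb.

Lemma sat_sub Q I : isprime Q -> I `<=` sat Q I.
Proof. by move=> hQ x hx; exists 1; [exact: prime1 | rewrite mul1r]. Qed.

Lemma sat_mono Q I J : I `<=` J -> sat Q I `<=` sat Q J.
Proof. by move=> h x [u hu hx]; exists u => //; exact: h. Qed.

Lemma sat_sat Q I : isprime Q -> sat Q (sat Q I) `<=` sat Q I.
Proof.
move=> hQ x [u hu [v hv hx]]; exists (v * u); first exact: primeNM.
by rewrite -mulrA.
Qed.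

Lemma sat_in Q I : isprime Q -> I `<=` Q -> sat Q I `<=` Q.
Proof. by move=> hQ h x [u hu /h]; apply: primeMl. Qed.

Lemma sat_prime Q P : isprime Q -> isprime P -> P `<=` Q -> sat Q P `<=` P.
Proof. by move=> hQ hP h x [u hu]; apply: primeMl => // /h. Qed.

End Ideals.
Notation spn := (gen setT).
#[export] Hint Resolve prime_id zid_id setT_id setI_id gen_id sat_id : isdb.
#[export] Hint Extern 0 (isid _) => solve [auto 6 with isdb nocore] : core.

(** * Chain conditions, minimal primes, prime avoidance, powers of ideals *)

Section Noetherian.
Variable R : comNzRingType.
Implicit Types (I J P Q C : set R) (x y a b : R) (s t : seq R).

Lemma noeth_acc (c : nat -> set R) : noeth R -> (forall n, isid (c n)) ->
  (forall n, c n `<=` c n.+1) -> exists n, forall m, c m `<=` c n.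
Proof.
move=> hR hid hinc.
have mono m n : (m <= n)%N -> c m `<=` c n.
  by move=> /subnK <-; elim: (n - m)%N => // k IH x /IH /hinc.
pose U : set R := fun x => exists n, c n x.
have hU : isid U.
  split; first by exists 0%N; exact: isid0.
  - move=> x y [n hx] [m hy]; exists (maxn n m).
    by apply: isidD => //; [apply: mono hx | apply: mono hy]; rewrite ?leq_maxl ?leq_maxr.
  - by move=> a x [n hx]; exists n; exact: isidM.
have [s Us] := hR _ hU.
have hs : forall a, a \in s -> U a by move=> a ha; rewrite Us; exact: spn_mem.
have [n hn] : exists n, forall a, a \in s -> c n a.
  elim: s hs {Us} => [|a s IH] h; first by exists 0%N.
  have [//|n hn] := IH; first by move=> b hb; apply: h; rewrite inE hb orbT.
  have [|m hm] := h a; first by rewrite inE eqxx.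
  exists (maxn n m) => b; rewrite inE => /predU1P[->|hb].
    by apply: mono hm; rewrite leq_maxr.
  by apply: mono (hn _ hb); rewrite leq_maxl.
exists n => m x hx; have : U x by exists m.
by rewrite Us; apply: spn_min => //; exact: zid_sub.
Qed.

(** Without a maximal member, dependent choice would give a strictly increasing sequence of
    ideals. *)
Lemma noeth_max (F : set (set R)) I0 : noeth R -> F I0 ->
  (forall I, F I -> isid I) ->
  exists2 I, F I & forall J, F J -> I `<=` J -> J `<=` I.
Proof.
move=> hR hI0 hF; apply: contrapT => hno.
have step (I : {I | F I}) : exists J : {J | F J},
    sval I `<=` sval J /\ ~ (sval J `<=` sval I).
  apply: contrapT => h; apply: hno; exists (sval I); first exact: (svalP I).
  move=> J hJ hIJ; apply: contrapT => h'; apply: h.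
  by exists (exist _ J hJ).
have [g hg] := choice step.
pose c n := iter n g (exist _ I0 hI0).
have [n hn] := @noeth_acc (fun n => sval (c n)) hR (fun n => hF _ (svalP (c n)))
   (fun n => (hg (c n)).1).
by have [_] := hg (c n); apply; exact: (hn n.+1).
Qed.

Lemma noeth_ind (P : set R -> Prop) : noeth R ->
  (forall I, isid I -> (forall J, isid J -> I `<=` J -> ~ (J `<=` I) -> P J) -> P I) ->
  forall I, isid I -> P I.
Proof.
move=> hR h I hI; apply: contrapT => hP.
have [|J [hJ hPJ] hmax] := @noeth_max (fun I => isid I /\ ~ P I) I hR (conj hI hP).
  by move=> K [hK *]; exact: hK.
apply/hPJ/h => // K hK hJK hKJ; apply: contrapT => hPK; apply: hKJ.
by apply: hmax.
Qed.

(** An ideal maximal among those that contain [I] and miss [D] is prime. Later statements on the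
    existence of powers or denominators are proved by contradiction with a suitable [D]. *)
Lemma prime_avoid_mult I (D : set R) : noeth R -> isid I -> D 1 ->
  (forall x y, D x -> D y -> D (x * y)) -> (forall x, D x -> ~ I x) ->
  exists2 P, isprime P & I `<=` P /\ forall x, D x -> ~ P x.
Proof.
move=> hR hI hD1 hDM hDI.
have [||J [hJ hIJ hDJ] hmax] := @noeth_max
   (fun J => [/\ isid J, I `<=` J & forall x, D x -> ~ J x]) I hR.
- by split.
- by move=> K [hK *]; exact: hK.
exists J => //; split => //; first exact: hDJ.
move=> x y hxy; apply: contrapT => /not_orP[hx hy].
have key z : ~ J z -> exists2 d, D d & spn J [:: z] d.
  move=> hz; apply: contrapT => hno; apply: hz.
  apply: (hmax (spn J [:: z])); last by apply: spn_mem; rewrite ?inE.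
    split; first exact: gen_id.
    - by move=> w /hIJ; exact: gen_base.
    - by move=> w hw hw'; apply: hno; exists w.
  exact: gen_base.
have [d hd [r _ /= hr]] := key x hx; have [e he [q _ /= hq]] := key y hy.
apply: (hDJ (d * e)); first exact: hDM.
apply: (isidBr hJ (y := r * q * (x * y))); last exact: isidM.
rewrite (_ : _ - _ = (d - r * x) * e + (r * x) * (e - q * y)); last by ring.
by apply: isidD => //; [exact: isidMr | exact: isidM].
Qed.

Lemma prime_over I : noeth R -> isid I -> ~ I 1 -> exists2 P, isprime P & I `<=` P.
Proof.
move=> hR hI h1; have [//|x y -> ->|x ->|P hP [h _]] := @prime_avoid_mult I [set 1] hR hI.
- by rewrite mulr1.
- by [].
- by exists P.
Qed.

Definition minimal_over J Q := [/\ isprime Q, J `<=` Q &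
  forall P, isprime P -> J `<=` P -> P `<=` Q -> Q `<=` P].

(** Noetherian induction: if x y lies in [I], every prime over [I] contains x or y, so the lists for
    I + (x) and I + (y) together serve for [I]. *)
Lemma primes_list I : noeth R -> isid I ->
  exists2 ps : list (set R), (forall p, List.In p ps -> isprime p /\ I `<=` p) &
    forall P, isprime P -> I `<=` P -> exists2 p, List.In p ps & p `<=` P.
Proof.
move=> hR; move: I; apply: noeth_ind => // I hI IH.
have [hp|hnp] := pselect (isprime I).
  exists [:: I] => [p [<-|//]|P hP hIP]; first by split.
  by exists I => //; left.
have [h1|h1] := pselect (I 1).
  by exists [::] => // P hP /(_ _ h1) /(prime1 hP).
have [x [y [hxy hx hy]]] : exists x y, [/\ I (x * y), ~ I x & ~ I y].
  apply: contrapT => hno; apply: hnp; split => // x y hxy.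
  by apply: contrapT => /not_orP[hx hy]; apply: hno; exists x, y.
have big z : ~ I z -> ~ (spn I [:: z] `<=` I).
  by move=> hz /(_ z) h; apply/hz/h/spn_mem; rewrite ?inE.
have [ps hps hps'] := IH _ (gen_id [:: x] (setT_id R) hI) (@gen_base _ _ I _ (setT_id R)) (big x hx).
have [qs hqs hqs'] := IH _ (gen_id [:: y] (setT_id R) hI) (@gen_base _ _ I _ (setT_id R)) (big y hy).
exists (app ps qs).
  move=> p /List.in_app_iff[/hps|/hqs] [hp h]; split=> // z hz; apply: h.
    exact: gen_base.
  exact: gen_base.
move=> P hP hIP; have hz z : P z -> spn I [:: z] `<=` P.
  by move=> hz; apply: spn_min => // a; rewrite inE => /eqP->.
have [hPx|hPy] : P x \/ P y by apply: (primeM hP); exact: hIP.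
  have [p hp hpP] := hps' P hP (hz x hPx); exists p => //.
  by apply/List.in_app_iff; left.
have [p hp hpP] := hqs' P hP (hz y hPy); exists p => //.
by apply/List.in_app_iff; right.
Qed.

Lemma list_min (ps : list (set R)) p : List.In p ps ->
  exists2 q, List.In q ps & q `<=` p /\ forall r, List.In r ps -> r `<=` q -> q `<=` r.
Proof.
elim: ps p => [|a ps IH] p //=.
have key : forall q, List.In q ps -> (forall r, List.In r ps -> r `<=` q -> q `<=` r) ->
    exists2 q', a = q' \/ List.In q' ps &
      q' `<=` q /\ forall r, a = r \/ List.In r ps -> r `<=` q' -> q' `<=` r.
  move=> q hq hmin; have [haq|haq] := pselect (a `<=` q).
    exists a; [by left | split => // r [<- //|hr] hra].
    by move=> x /haq; apply: hmin => // y /hra /haq.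
  exists q; [by right | split=> // r [<- /haq //|]]; exact: hmin.
case=> [<-|/IH [q hq [hqp hmin]]].
  have [[r hr hra]|hno] := pselect (exists2 r, List.In r ps & r `<=` a).
    have [q hq [hqr hmin]] := IH r hr; have [q' hq' [h1 h2]] := key q hq hmin.
    by exists q' => //; split=> // x /h1 /hqr /hra.
  exists a; [by left | split=> // r [<- //|hr hra]].
  by case: hno; exists r.
have [q' hq' [h1 h2]] := key q hq hmin.
by exists q' => //; split=> // x /h1 /hqp.
Qed.

Lemma minprimes I : noeth R -> isid I ->
  exists2 ps : list (set R), (forall p, List.In p ps -> minimal_over I p) &
    forall P, isprime P -> I `<=` P -> exists2 p, List.In p ps & p `<=` P.
Proof.
move=> hR hI; have [ps hps hps'] := primes_list hR hI.
pose ok p := `[< minimal_over I p >].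
exists (List.filter ok ps) => [p /List.filter_In[_ /asboolP]//|P hP hIP].
have [p hp hpP] := hps' P hP hIP.
have [q hq [hqp hmin]] := list_min hp.
exists q; last by move=> x /hqp /hpP.
apply/List.filter_In; split=> //; apply/asboolP; have [hq1 hq2] := hps _ hq.
split=> // p' hp' hIp' hp'q; have [r hr hrp] := hps' p' hp' hIp'.
by move=> x hx; apply/hrp; apply: (hmin r hr) => // y /hrp /hp'q.
Qed.

Lemma minprime_exists I P : noeth R -> isid I -> isprime P -> I `<=` P ->
  exists2 p, minimal_over I p & p `<=` P.
Proof.
move=> hR hI hP hIP; have [ps h1 h2] := minprimes hR hI.
by have [p /h1 hp hpP] := h2 P hP hIP; exists p.
Qed.

Lemma avoid_witness (ps : list (set R)) J p : isid J -> isprime p ->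
  (forall q, List.In q ps -> isid q /\ ~ (q `<=` p)) -> ~ (J `<=` p) ->
  exists2 w, ~ p w & J w /\ forall q, List.In q ps -> q w.
Proof.
move=> hJ hp; elim: ps => [|q ps IH] hps hJp.
  have [w] : exists w, ~ (J w -> p w) by apply/existsNP.
  by move=> /not_implyP[h1 h2]; exists w.
have [|//|w hw [hJw hwq]] := IH; first by move=> r hr; apply: hps; right.
have [hq /existsNP[v /not_implyP[hv hpv]]] := hps q (or_introl erefl).
exists (w * v); first exact: primeNM.
split; first exact: isidMr.
move=> r /= [<-|hr]; first exact: isidM.
by apply: isidMr; [exact: (hps r (or_intror hr)).1 | exact: hwq].
Qed.

Lemma coset_avoid (ps : list (set R)) J x : isid J ->
  (forall p, List.In p ps -> isprime p /\ ~ (p x /\ J `<=` p)) ->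
  exists2 y, J y & forall p, List.In p ps -> ~ p (x + y).
Proof.
move=> hJ; have [n] := ubnP (size ps); elim: n ps => // n IH [|p ps] /= hn hps.
  by exists 0; [exact: isid0 |].
have [[q hq hqp]|hno] := pselect (exists2 q, List.In q ps & q `<=` p).
  have [l1 [l2 e]] := List.in_split _ _ hq; subst ps.
  have [||y hy h] := IH (p :: app l1 l2).
  - by move: hn; rewrite /= !size_cat /=; lia.
  - move=> r /= [hr|hr]; apply: hps; [by left | right].
    by apply/List.in_app_iff; case/List.in_app_iff: hr => ?; [left | right; right].
  exists y => // r [<-|]; first by apply: h; left.
  case/List.in_app_iff => [hr|[<-|hr]].
  - by apply: h; right; apply/List.in_app_iff; left.
  - by move=> /hqp; apply: h; left.
  - by apply: h; right; apply/List.in_app_iff; right.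
have [||y hy h] := IH ps; first by move: hn => /=; lia.
  by move=> r hr; apply: hps; right.
have [hpy|hpy] := pselect (p (x + y)); last first.
  by exists y => // r [<- //|/h].
have [hp hpx] := hps p (or_introl erefl).
have hJp : ~ (J `<=` p).
  move=> hJp; apply: hpx; split=> //.
  by rewrite -(addrK y x); apply: isidB => //; exact: hJp.
have [|w hw [hJw hwq]] := avoid_witness hJ hp _ hJp (ps := ps).
  move=> q hq; split; first exact: prime_id (hps q (or_intror hq)).1.
  by move=> hqp; apply: hno; exists q.
exists (y + w); first exact: isidD.
move=> r [<-|hr]; rewrite addrA => h'.
  by apply: hw; rewrite -(addKr (x + y) w) addrC; apply: isidB.
have hri : isid r := prime_id (hps r (or_intror hr)).1.
by apply: (h r hr); rewrite -(addrK w (x + y)); apply: isidB => //; exact: hwq.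
Qed.

Lemma avoid (ps : list (set R)) J : isid J ->
  (forall p, List.In p ps -> isprime p /\ ~ (J `<=` p)) ->
  exists2 y, J y & forall p, List.In p ps -> ~ p y.
Proof.
move=> hJ hps; have [|y hy h] := @coset_avoid ps J 0 hJ.
  by move=> p /hps[hp h]; split=> // -[_].
by exists y => // p /h; rewrite add0r.
Qed.

Lemma ideal_gen_id (E : set R) : isid (ideal_gen E).
Proof.
split.
- by exists 0%N, (fun=> 0), (fun=> 0); split; [case | rewrite big_ord0].
- move=> x y [k [c [e [he ->]]]] [l [d [f [hf ->]]]].
  exists (k + l)%N,
    (fun i => match split i with inl j => c j | inr j => d j end),
    (fun i => match split i with inl j => e j | inr j => f j end).
  split; first by move=> i; case: (split i).
  rewrite big_split_ord /=; congr (_ + _); apply: eq_bigr => i _.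
    by rewrite (unsplitK (inl i)).
  by rewrite (unsplitK (inr i)).
- move=> a x [k [c [e [he ->]]]]; exists k, (fun i => a * c i), e; split=> //.
  by rewrite mulr_sumr; apply: eq_bigr => i _; rewrite mulrA.
Qed.

Lemma ideal_gen_sub (E : set R) : E `<=` ideal_gen E.
Proof.
move=> x hx; exists 1%N, (fun=> 1), (fun=> x); split=> //.
by rewrite big_ord_recl big_ord0 mul1r addr0.
Qed.

Lemma ideal_gen_min (E I : set R) : isid I -> E `<=` I -> ideal_gen E `<=` I.
Proof.
move=> hI hE x [k [c [e [he ->]]]]; apply: isid_sum => // i _.
by apply: isidM => //; exact: hE.
Qed.

Lemma ideal_gen_spn s : ideal_gen [set` s] = spn (@zid R) s.
Proof.
apply: seteqI; first by apply: ideal_gen_min => // a ha; exact: spn_mem.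
apply: spn_min; first exact: ideal_gen_id; first exact: zid_sub (ideal_gen_id _).
by move=> a ha; exact: ideal_gen_sub.
Qed.

Definition pw I n := ideal_pow I n.

Lemma pw_id I n : isid (pw I n).
Proof. by case: n => [|n]; [exact: setT_id | exact: ideal_gen_id]. Qed.
Hint Resolve pw_id ideal_gen_id : isdb.

Lemma pwS I n x y : I x -> pw I n y -> pw I n.+1 (x * y).
Proof. by move=> hx hy; apply: ideal_gen_sub; exists x, y. Qed.

Lemma pwS_min I n J : isid J -> (forall x y, I x -> pw I n y -> J (x * y)) ->
  pw I n.+1 `<=` J.
Proof. by move=> hJ h; apply: ideal_gen_min => // z [x [y [hx hy ->]]]; exact: h. Qed.

Lemma pw_subS I n : pw I n.+1 `<=` pw I n.
Proof. by apply: pwS_min => // x y _ hy; exact: isidM. Qed.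

Lemma pw_sub I m n : (m <= n)%N -> pw I n `<=` pw I m.
Proof.
by move=> /subnK <-; elim: (n - m)%N => // k IH x hx; apply/IH/pw_subS.
Qed.

Lemma pwM I m n x y : pw I m x -> pw I n y -> pw I (m + n) (x * y).
Proof.
elim: m x => [|m IH] x hx hy; first by rewrite add0n; exact: isidM.
pose J : set R := fun x => pw I (m + n).+1 (x * y).
have hJ : isid J.
  split; rewrite /J; first by rewrite mul0r; exact: isid0.
  - by move=> a b ha hb; rewrite mulrDl; exact: isidD.
  - by move=> a b hb; rewrite -mulrA; exact: isidM.
apply: (pwS_min hJ _ hx) => a b ha hb; rewrite /J -mulrA.
by apply: pwS => //; exact: IH.
Qed.

Lemma pw1 I : isid I -> pw I 1 = I.
Proof.
move=> hI; apply: seteqI; first by apply: pwS_min => // x y hx _; exact: isidMr.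
by move=> x hx; rewrite -(mulr1 x); exact: pwS.
Qed.

Lemma pw_in I n : isid I -> pw I n.+1 `<=` I.
Proof. by move=> hI; apply: pwS_min => // x y hx _; exact: isidMr. Qed.

Lemma pwX I n x : I x -> pw I n (x ^+ n).
Proof. by move=> hx; elim: n => // n IH; rewrite exprS; exact: pwS. Qed.

Lemma pw_prime P I n : isprime P -> pw I n `<=` P -> I `<=` P.
Proof. by move=> hP h x hx; apply: (@primeX _ P x n) => //; apply/h/pwX. Qed.

End Noetherian.
#[export] Hint Resolve pw_id ideal_gen_id : isdb.

(** * Krull's height theorem *)

Section Height.
Variable R : comNzRingType.
Implicit Types (I J P Q C : set R) (x y a b : R) (s t : seq R).

Lemma colon_id J (s : R) : isid J -> isid [set a | J (a * s)].
Proof.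
move=> hJ; split => /=; first by rewrite mul0r; exact: isid0.
- by move=> x y hx hy; rewrite mulrDl; exact: isidD.
- by move=> a x hx; rewrite -mulrA; exact: isidM.
Qed.
Hint Resolve colon_id : isdb.

(* By elimination of one generator at a time. *)
Lemma nakayama Q J s : isprime Q -> isid J ->
  (forall a, a \in s -> exists2 u, ~ Q u & gen Q J s (u * a)) ->
  forall a, a \in s -> sat Q J a.
Proof.
move=> hQ hJ; elim: s => // a s IH h.
have [u hu [r hr hua]] := h a (mem_head _ _).
have hw : ~ Q (u - r) by move=> h'; apply: hu; apply: isidBr h' hr.
have hwa : gen Q J s ((u - r) * a) by rewrite mulrBl.
have hs : forall b, b \in s -> sat Q J b.
  apply: IH => b hb; have [|v hv [q hq hvb]] := h b; first by rewrite inE hb orbT.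
  exists ((u - r) * v); first exact: primeNM.
  rewrite (_ : _ * _ = (u - r) * (v * b - q * a) + q * ((u - r) * a)); last by ring.
  by apply: isidD => //; apply: isidM.
move=> b; rewrite inE => /predU1P[->|]; last exact: hs.
have : sat Q J ((u - r) * a).
  by apply: gen_min hwa => //; [exact: sat_sub | move=> c q hc _; apply: isidM => //; exact: hs].
by case=> v hv hva; exists (v * (u - r)); [exact: primeNM | rewrite -mulrA].
Qed.

Lemma nakayama_ideal Q J s : isprime Q -> isid J ->
  (forall a, a \in s -> exists2 u, ~ Q u & gen Q J s (u * a)) ->
  spn J s `<=` sat Q J.
Proof. by move=> hQ hJ h; apply: spn_min => //; [exact: sat_sub | exact: nakayama]. Qed.

(* The descending chain condition in the local ring (R/J)_Q, which is Artinian because Q is minimal over J. *)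
Lemma sat_dcc Q : noeth R -> isprime Q -> forall J, isid J -> sat Q J `<=` J ->
  (forall P, isprime P -> J `<=` P -> P `<=` Q -> Q `<=` P) ->
  forall c : nat -> set R, (forall n, isid (c n)) -> (forall n, sat Q (c n) `<=` c n) ->
  (forall n, J `<=` c n) -> (forall n, c n.+1 `<=` c n) ->
  exists n, forall m, (n <= m)%N -> c n `<=` c m.
Proof.
move=> hR hQ; apply: noeth_ind => // J hJ IH hsat hmin c hc hcs hJc hdec.
have mono m n : (m <= n)%N -> c n `<=` c m.
  by move=> /subnK <-; elim: (n - m)%N => // k IHk x /hdec /IHk.
have [h1|h1] := pselect (J 1).
  by exists 0%N => m _ x _; apply/hJc; exact: isid1.
(* The annihilator of [s] modulo [J] is maximal among annihilators, hence prime, and minimality of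
   [Q] makes it contain [Q]: [s] generates a simple submodule of (R/J)_Q. *)
have [s hs hQs] : exists2 s, ~ J s & forall q, Q q -> J (q * s).
  have [||K [s hs hK] hmaxK] := @noeth_max R
    (fun K => exists2 s, ~ J s & K = [set a | J (a * s)]) [set a | J (a * 1)] hR.
  - by exists 1.
  - by move=> K [s _ ->]; auto.
  have hKE a : K a = J (a * s) by rewrite hK.
  exists s => //.
  have hKid : isid K by rewrite hK; auto.
  have hKp : isprime K.
    split=> //; first by rewrite hKE mul1r.
    move=> x y hxy; apply: contrapT => /not_orP[hx hy].
    have hx' : ~ J (x * s) by rewrite -hKE.
    apply: hy; apply: (hmaxK [set a | J (a * (x * s))]); first by exists (x * s).
      by move=> a; rewrite hKE /= => ha; rewrite mulrCA; exact: isidM.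
    by move: hxy; rewrite hKE /= mulrA [y * x]mulrC.
  have : Q `<=` K.
    apply: hmin => //.
      by move=> a ha; rewrite hKE; exact: isidMr.
    move=> u; rewrite hKE => hu; apply: contrapT => hQu; apply: hs; apply: hsat.
    by exists u.
  by move=> h q /h; rewrite hKE.
pose J' := sat Q (spn J [:: s]).
have hJ'J : J `<=` J'.
  by move=> x hx; apply: sat_sub => //; exact: gen_base.
have hs' : J' s by apply: sat_sub => //; apply: spn_mem => //; rewrite inE.
have [//||||||||n1 hn1] := IH J' _ hJ'J _ _ _ (fun n => sat Q (spn (c n) [:: s])).
- by rewrite /J'; auto.
- by move=> h; apply/hs/h.
- exact: sat_sat.
- by move=> P hP h; apply: hmin => // x /hJ'J /h.
- by auto.
- by move=> n; exact: sat_sat.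
- by move=> n; apply/sat_mono/gen_mono.
- by move=> n; apply/sat_mono/gen_mono.
(* Modulo [s] the chain is stationary by induction, so at [Q] an element of [c n] differs from one
   of [c m] by r * s. Either [s] lies in every term, or [r] lies in [Q] and r * s in [J]. *)
have [hall|hno] := pselect (forall n, c n s).
  exists n1 => m hm x hx.
  have /(hn1 m hm)[u hu [r _ /= hr]] : sat Q (spn (c n1) [:: s]) x.
    by apply: sat_sub => //; exact: gen_base.
  apply: hcs; exists u => //; apply: (isidBr (hc m) hr); exact: isidM.
have [n2 hn2] : exists n, ~ c n s by apply/existsNP.
exists (maxn n1 n2) => m hm x hx.
have hmn1 : (n1 <= m)%N by lia.
have /(hn1 m hmn1)[u hu [r _ /= hr]] : sat Q (spn (c n1) [:: s]) x.
  apply: sat_sub => //; apply: gen_base => //; apply: mono hx; exact: leq_maxl.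
have hrs : c (maxn n1 n2) (r * s).
  apply: (@isidBl _ _ (u * x)) => //; last exact: isidM.
  exact: mono hr.
have hQr : Q r.
  apply: contrapT => hQr; apply: hn2; apply: (mono _ (maxn n1 n2)); first exact: leq_maxr.
  by apply: hcs; exists r.
apply: hcs; exists u => //; apply: (isidBr (hc m) hr); apply: hJc; exact: hQs.
Qed.

(* Krull's principal ideal theorem in R/p0, through the symbolic powers of p. *)
Lemma krull_pit p0 p Q x : noeth R -> isprime p0 -> isprime p ->
  minimal_over (spn p0 [:: x]) Q -> p0 `<=` p -> p `<=` Q -> ~ (Q `<=` p) -> p `<=` p0.
Proof.
move=> hR hp0 hp [hQ hxQ hmin] hp0p hpQ hQp.
have hxp : ~ p x.
  move=> hx; apply: hQp; apply: hmin => //; apply: spn_min => // a.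
  by rewrite inE => /eqP->.
(* The n-th symbolic power of p/p0. *)
pose sp n := sat p (ideal_gen (p0 `|` pw p n)).
have spid n : isid (sp n) by rewrite /sp; auto.
have spp n : sat p (sp n) `<=` sp n by exact: sat_sat.
have spQ n : sat Q (sp n) `<=` sp n.
  by move=> z [u hu hz]; apply: spp; exists u => // /hpQ.
have p0sp n : p0 `<=` sp n.
  by move=> z hz; apply: sat_sub => //; apply: ideal_gen_sub; left.
have pwsp n : pw p n `<=` sp n.
  by move=> z hz; apply: sat_sub => //; apply: ideal_gen_sub; right.
have spdec n : sp n.+1 `<=` sp n.
  apply: sat_mono; apply: ideal_gen_min; first exact: ideal_gen_id.
  by move=> z [hz|hz]; apply: ideal_gen_sub; [left | right; exact: pw_subS].
pose J := sat Q (spn p0 [:: x]).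
have [|||||||n hn] := @sat_dcc Q hR hQ J _ _ _ (fun n => sat Q (spn (sp n) [:: x])).
- by rewrite /J; auto.
- exact: sat_sat.
- move=> P hP hJP hPQ; apply: hmin => // z hz; apply: hJP; exact: sat_sub.
- by auto.
- by move=> n; exact: sat_sat.
- by move=> n; apply/sat_mono/gen_mono.
- by move=> n; apply: sat_mono; apply: gen_mono.
(* The chain [sp n] + (x) is stationary at [Q]. As [x] is not in [p], the coefficient of [x] falls
   again into [sp n], and Nakayama's lemma at [Q] removes the term in [x]. *)
have hsub : sp n `<=` sp n.+1.
  have [s hs] := hR _ (spid n).
  have -> : sp n `<=` sp n.+1 <-> spn (@zid R) s `<=` sp n.+1 by rewrite -hs.
  have hgen : forall a, a \in s -> sat Q (sp n.+1) a.
    apply: nakayama => // a ha.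
    have hna : sp n a by rewrite hs; exact: spn_mem.
    have /(hn n.+1 (leqnSn n))[u hu [c _ /= hc]] : sat Q (spn (sp n) [:: x]) a.
      by apply: sat_sub => //; exact: gen_base.
    exists u => //; have hcn : sp n c.
      apply: spp; exists x => //; rewrite mulrC.
      apply: (@isidBl _ _ (u * a)) => //; last exact: isidM.
      exact: spdec.
    rewrite -(subrK (c * x) (u * a)); apply: isidD => //; first exact: gen_base.
    have : gen Q (@zid R) s (c * x).
      move: hcn; rewrite {1}hs => hcn.
      have : gen setT (@zid R) s `<=` [set c | gen Q (@zid R) s (c * x)].
        apply: spn_min => /=.
        - by auto.
        - by move=> z -> /=; rewrite mul0r; exact: isid0.
        - move=> z hz /=; rewrite mulrC; apply: gen_memc => //.
          by apply: hxQ; apply: spn_mem => //; rewrite inE.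
      exact.
    by apply: gen_mono => //; exact: zid_sub.
  apply: spn_min => //; first exact: zid_sub.
  by move=> a /hgen /spQ.
(* Now p^n is contained in p0 + p^(n+1) at [p], so Nakayama's lemma at [p] puts p^n into [p0]. *)
have [t ht] := hR _ (pw_id p n).
have htgen : forall a, a \in t -> sat p p0 a.
  apply: nakayama => // a ha.
  have /pwsp /hsub [u hu hua] : pw p n a by rewrite ht; exact: spn_mem.
  exists u => //; apply: ideal_gen_min hua => // z [hz|hz]; first exact: gen_base.
  apply: pwS_min hz => // y w hy; rewrite ht => hw.
  have : gen setT (@zid R) t `<=` [set w | gen p p0 t (y * w)].
    apply: spn_min => /=.
    - split => /=; first by rewrite mulr0; exact: isid0.
      + by move=> b c hb hc; rewrite mulrDr; exact: isidD.
      + by move=> b c hc; rewrite mulrCA; exact: isidM.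
    - by move=> b -> /=; rewrite mulr0; exact: isid0.
    - by move=> b hb /=; exact: gen_memc.
  exact.
apply: (@pw_prime _ p0 p n hp0); rewrite ht; apply: spn_min => //; first exact: zid_sub.
by move=> a /htgen; exact: sat_prime.
Qed.

(* Q/J has height at least n in R/J. *)
Fixpoint height_ge J Q n : Prop :=
  if n is k.+1 then isprime Q /\ exists P, [/\ height_ge J P k, P `<=` Q & ~ (Q `<=` P)]
  else isprime Q /\ J `<=` Q.

Lemma height_ge_prime J Q n : height_ge J Q n -> isprime Q.
Proof. by case: n => [|n] []. Qed.

Lemma height_ge_sub J Q n : height_ge J Q n -> J `<=` Q.
Proof.
elim: n Q => [|n IH] Q /= [_]; first by [].
by move=> [P [/IH hJP hPQ _]] x /hJP /hPQ.
Qed.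

Lemma height_ge0 J Q n : height_ge J Q n -> height_ge J Q 0.
Proof. by move=> h; split; [exact: height_ge_prime h | exact: height_ge_sub h]. Qed.

Lemma height_ge_mono J J' Q n : J' `<=` J -> height_ge J Q n -> height_ge J' Q n.
Proof.
move=> h; elim: n Q => [|n IH] Q /= [hQ hs]; split=> //; first by move=> x /h /hs.
by have [P [/IH ? ? ?]] := hs; exists P.
Qed.

Lemma height_ge_leS J Q n : height_ge J Q n.+1 -> height_ge J Q n.
Proof.
elim: n Q => [|n IH] Q h; first exact: height_ge0 h.
have [hQ [P [/IH hP hPQ hQP]]] := h; split=> //; by exists P.
Qed.

Lemma height_ge_le J Q m n : (m <= n)%N -> height_ge J Q n -> height_ge J Q m.
Proof. by move=> /subnK <-; elim: (n - m)%N => // k IH /height_ge_leS /IH. Qed.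

Lemma height_ge_up J P Q n : height_ge J P n -> isprime Q -> P `<=` Q -> height_ge J Q n.
Proof.
case: n => [|n] /= [hP h] hQ hPQ; split=> //; first by move=> x /h /hPQ.
have [p [hp hpP hPp]] := h; exists p; split=> //; first by move=> x /hpP /hPQ.
by move=> hQp; apply: hPp => x /hPQ /hQp.
Qed.

Lemma height_ge_trans J P Q m n : height_ge J P m -> height_ge P Q n -> height_ge J Q (m + n).
Proof.
move=> hm; elim: n Q => [|n IH] Q /= [hQ h]; first by rewrite addn0; exact: height_ge_up hm hQ h.
rewrite addnS; split=> //; have [p [hp h1 h2]] := h; exists p; split=> //; exact: IH.
Qed.

(** The lowest prime of the given chain is not known in advance, so a smaller prime is asked for
    under every candidate. *)
Lemma height_ge_bot J J' Q n :
  (forall P, isprime P -> J' `<=` P -> P `<=` Q ->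
     exists p, [/\ isprime p, J `<=` p, p `<=` P & ~ (P `<=` p)]) ->
  height_ge J' Q n -> height_ge J Q n.+1.
Proof.
move=> h hn.
have [P [hP hJ'P hPQ hPn]] : exists P, [/\ isprime P, J' `<=` P, P `<=` Q & height_ge P Q n].
  elim: n Q h hn => [|n IH] Q h /= [hQ hs].
    by exists Q; split=> //; split.
  have [P [hP hPQ hQP]] := hs.
  have [|p [hp h1 h2 h3]] := IH P _ hP.
    by move=> p hp h1 h2; apply: h => // x /h2 /hPQ.
  exists p; split=> //; first by move=> x /h2 /hPQ.
  by split=> //; exists P.
have [p [hp h1 h2 h3]] := h P hP hJ'P hPQ.
have : height_ge J P 1 by split=> //; exists p; split.
by move=> h4; have := height_ge_trans h4 hPn; rewrite add1n.
Qed.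

Lemma minover_hge J Q n : minimal_over J Q -> height_ge J Q n.+1 -> False.
Proof.
move=> [hQ hJQ hmin] [_ [P [hP hPQ]]]; apply.
by apply: hmin => //; [exact: height_ge_prime hP | exact: height_ge_sub hP].
Qed.

Lemma minover_hgeF J Q : isprime Q -> J `<=` Q -> ~ height_ge J Q 1 -> minimal_over J Q.
Proof.
move=> hQ hJQ h; split=> // P hP hJP hPQ; apply: contrapT => hQP; apply: h.
by split=> //; exists P.
Qed.

Lemma krull_height s J Q n : noeth R -> isid J -> minimal_over (spn J s) Q ->
  height_ge J Q n -> (n <= size s)%N.
Proof.
move=> hR; have [k] := ubnP (size s).
elim: k s J Q n => // k IH s J Q [|n] // hk hJ hQmin hQn.
have [hQ hsQ hmin] := hQmin.
case: s hk hQmin hsQ hmin => [|g0 s0] hk hQmin hsQ hmin.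
  by case: (minover_hge hQmin hQn).
set s := g0 :: s0 in hk hQmin hsQ hmin.
have [_ [P0 [hP0 hP0Q hQP0]]] := hQn.
(* A maximal choice of [P] strictly inside [Q] leaves no prime strictly between [P] and [Q]. *)
have [||P [hPn hPQ hQP hP0P] hPmax] := @noeth_max R
  (fun P => [/\ height_ge J P n, P `<=` Q, ~ (Q `<=` P) & P0 `<=` P]) P0 hR.
- by split.
- by move=> I [/height_ge_prime /prime_id].
have hP := height_ge_prime hPn; have hJP := height_ge_sub hPn.
have hnobet p : isprime p -> P `<=` p -> p `<=` Q -> Q `<=` p \/ p `<=` P.
  move=> hp hPp hpQ; apply: contrapT => /not_orP[h1 h2]; apply: h2; apply: hPmax => //.
  split=> //; first exact: height_ge_up hPn hp hPp.
  by move=> x /hP0P /hPp.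
have [g hgs hgP] : exists2 g, g \in s & ~ P g.
  apply: contrapT => hno; apply: hQP; apply: hmin => //.
  apply: spn_min => // a ha; apply: contrapT => haP; apply: hno; by exists a.
have hgQ a : a \in s -> Q a by move=> ha; apply: hsQ; exact: spn_mem.
have hQg : minimal_over (spn P [:: g]) Q.
  split=> //.
    by apply: spn_min => // a; rewrite inE => /eqP->; exact: hgQ.
  move=> p hp hPgp hpQ.
  have hPp : P `<=` p by move=> x hx; apply: hPgp; exact: gen_base.
  have [//|hpP] := hnobet p hp hPp hpQ.
  by case: hgP; apply: hpP; apply: hPgp; apply: spn_mem => //; rewrite inE.
(* Modulo P and g every other generator is nilpotent at Q. *)
have hpow a : a \in s -> exists a', P a' /\ forall p, isprime p -> p `<=` Q ->
    p a' -> p g -> p a.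
  move=> ha; apply: contrapT => hno.
  have [||||p hp [hPgp hDp]] := @prime_avoid_mult R (spn P [:: g])
    [set x | exists u m, ~ Q u /\ x = u * a ^+ m] hR.
  - by auto.
  - by exists 1, 0%N; rewrite expr0 mulr1; split=> //; exact: prime1.
  - move=> _ _ [u [m [hu ->]]] [v [l [hv ->]]]; exists (u * v), (m + l)%N.
    by split; [exact: primeNM | rewrite exprD; ring].
  - move=> _ [u [m [hu ->]]] [r _ /= hr]; apply: hno.
    exists (u * a ^+ m - r * g); split=> // p hp hpQ h1 h2.
    have : p (u * a ^+ m).
      by apply: (isidBr (prime_id hp) h1); apply: isidM.
    by move=> /(primeMl hp (fun h => hu (hpQ _ h))); exact: primeX.
  have hpQ : p `<=` Q.
    move=> x hx; apply: contrapT => hxQ; apply: (hDp x) => //.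
    by exists x, 0%N; rewrite expr0 mulr1.
  have hQp : Q `<=` p by case: hQg => _ _; apply.
  apply: (hDp a); last by apply: hQp; exact: hgQ.
  by exists 1, 1%N; rewrite mul1r expr1; split=> //; exact: prime1.
have [f hf] : exists f : R -> R, forall a, a \in s -> P (f a) /\
    forall p, isprime p -> p `<=` Q -> p (f a) -> p g -> p a.
  have /choice[f hf] : forall a, exists b, a \in s -> P b /\
    forall p, isprime p -> p `<=` Q -> p b -> p g -> p a.
    move=> a.
    case: (boolP (a \in s)) => [/hpow[a' h]|_]; first by exists a'.
    by exists 0.
  by exists f.
pose t := map f (rem g s).
have htsz : size s = (size t).+1.
  by rewrite size_map size_rem // prednK //; case: (s) hgs.
have htP a : a \in t -> P a.
  by move=> /mapP[b hb ->]; apply: (hf b _).1; exact: mem_rem hb.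
(* Otherwise some p strictly inside [P] is minimal over J + (t), and [Q] is minimal over p + (g),
   against the principal ideal theorem. The induction then applies to [P], with one generator
   less. *)
have hPmin : minimal_over (spn J t) P.
  have hid : isid (spn J t) by auto.
  have htJP : spn J t `<=` P by apply: spn_min.
  have [p hp hpP] := minprime_exists hR hid hP htJP.
  have [hpp htp hpmin] := hp.
  suff hPp : P `<=` p.
    by have -> : P = p by exact: seteqI.
  have [//|hPp] := pselect (P `<=` p).
  have : P `<=` p.
    apply: (@krull_pit p P Q g) => //; split=> //.
      apply: spn_min => // [x /hpP /hPQ //|a]; rewrite inE => /eqP->; exact: hgQ.
    move=> q hq hpq hqQ; apply: hmin => //.
    have hqg : q g by apply: hpq; apply: spn_mem => //; rewrite inE.
    have hpq' : p `<=` q by move=> x hx; apply: hpq; exact: gen_base.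
    apply: spn_min => //.
      by move=> x hx; apply: hpq'; apply: htp; exact: gen_base.
    move=> a ha; have [->//|hag] := eqVneq a g.
    apply: (hf a ha).2 => //; apply: hpq'; apply: htp; apply: spn_mem => //.
    apply: map_f; move: ha; rewrite (perm_mem (perm_to_rem hgs)) inE.
    by case/predU1P => // e; rewrite e eqxx in hag.
  by [].
rewrite htsz ltnS; apply: (IH t J P n) => //.
by move: hk; rewrite htsz ltnS.
Qed.

(** Parameters come from prime avoidance: an element of [Q] outside the minimal primes of [J] that
    do not contain [Q] lowers the height. *)
Lemma params h J Q : noeth R -> isid J -> isprime Q -> J `<=` Q -> ~ height_ge J Q h.+1 ->
  exists s, [/\ (size s <= h)%N, forall a, a \in s -> Q a & minimal_over (spn J s) Q].
Proof.
move=> hR; elim: h J => [|h IH] J hJ hQ hJQ hno.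
  by exists [::]; split=> //; exact: minover_hgeF.
have [ps hps hps'] := minprimes hR hJ.
pose ok p := `[< ~ (Q `<=` p) >].
have [||x hxQ hx] := @avoid R (List.filter ok ps) Q; first by auto.
  by move=> p /List.filter_In[/hps[hp _ _] /asboolP hQp].
have hxJQ : spn J [:: x] `<=` Q by apply: spn_min => // a; rewrite inE => /eqP->.
have [||//||s [hs hsQ hmin]] := IH (spn J [:: x]); [by auto | by [] | | ].
  move=> hc; apply: hno; apply: (height_ge_bot _ hc) => P hP hxP hPQ.
  have [p hp hpP] : exists2 p, List.In p ps & p `<=` P.
    by apply: hps' => // y hy; apply: hxP; exact: gen_base.
  have [hpp hJp hpmin] := hps p hp.
  have [hQp|hQp] := pselect (Q `<=` p).
    have hQP : P = Q by apply: seteqI => // y /hQp /hpP.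
    have hpQ : p = Q by apply: seteqI => //; rewrite -hQP.
    move: hc; case=> _ [P1 [hP1 h1 h2]]; case: h2; rewrite -hpQ.
    apply: hpmin; [exact: height_ge_prime hP1 | | by rewrite hpQ].
    by move=> y hy; apply: (height_ge_sub hP1); exact: gen_base.
  exists p; split=> // hPp; apply: (hx p).
    by apply/List.filter_In; split=> //; exact/asboolP.
  by apply: hPp; apply: hxP; apply: spn_mem => //; rewrite inE.
exists (rcons s x); split; first by rewrite size_rcons.
  by move=> a; rewrite mem_rcons inE => /predU1P[->|] //; exact: hsQ.
by rewrite -cats1 gen_cat.
Qed.

End Height.

(** * Regularity at a prime *)

Section Regular.
Variable R : comNzRingType.
Implicit Types (I J P Q C : set R) (x y a b : R) (s t : seq R).

(* (R/J)_Q is a regular local ring of dimension d. *)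
Definition reg J Q d := height_ge J Q d /\
  exists s, [/\ size s = d, forall a, a \in s -> Q a & Q `<=` sat Q (spn J s)].

Lemma gens_minover J Q s : isprime Q -> J `<=` Q -> (forall a, a \in s -> Q a) ->
  Q `<=` sat Q (spn J s) -> minimal_over (spn J s) Q.
Proof.
move=> hQ hJ hs h; split=> //; first exact: spn_min.
move=> P hP hJP hPQ x /h[u hu hx]; apply: (primeMl hP) (hJP _ hx).
by move=> /hPQ.
Qed.

Lemma gens_height J Q s n : noeth R -> isid J -> (forall a, a \in s -> Q a) ->
  Q `<=` sat Q (spn J s) -> height_ge J Q n -> (n <= size s)%N.
Proof.
move=> hR hJ hs h hn; apply: (krull_height hR hJ _ hn); apply: gens_minover => //.
- exact: height_ge_prime hn.
- exact: height_ge_sub hn.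
Qed.

Lemma reg_prime J Q d : reg J Q d -> isprime Q.
Proof. by case=> /height_ge_prime. Qed.
Lemma reg_sub J Q d : reg J Q d -> J `<=` Q.
Proof. by case=> /height_ge_sub. Qed.

Lemma reg_le J Q d n : noeth R -> isid J -> reg J Q d -> height_ge J Q n -> (n <= d)%N.
Proof. by move=> hR hJ [_ [s [<- hs h]]]; apply: gens_height. Qed.

(** If the height modulo [x] were smaller, fewer than [d] parameters together with [x] would cut out
    [Q], against Krull's height theorem. *)
Lemma height_ge_drop J Q d x : noeth R -> isid J -> height_ge J Q d.+1 -> Q x ->
  height_ge (spn J [:: x]) Q d.
Proof.
move=> hR hJ hd hx; have hQ := height_ge_prime hd; have hJQ := height_ge_sub hd.
have hxQ : spn J [:: x] `<=` Q by apply: spn_min => // a; rewrite inE => /eqP->.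
apply: contrapT => hno; case: d hd hno => [|d] hd hno; first by apply: hno; split.
have [||//||s [hs hsQ]] := @params R d (spn J [:: x]) Q hR; try by auto.
rewrite -gen_cat => hmin; have := krull_height hR hJ _ hd => /(_ (s ++ [:: x])).
by rewrite size_cat /= => /(_ hmin); lia.
Qed.

Lemma gen_mulC Q s q i : isid Q -> Q q -> spn (@zid R) s i -> gen Q (@zid R) s (q * i).
Proof.
move=> hQ hq; apply: (@spn_min _ [set i | gen Q (@zid R) s (q * i)]) => /=.
- split => /=; first by rewrite mulr0; exact: isid0.
  + by move=> b c hb hc; rewrite mulrDr; exact: isidD.
  + by move=> b c hc; rewrite mulrCA; exact: isidM.
- by move=> b -> /=; rewrite mulr0; exact: isid0.
- by move=> b hb /=; exact: gen_memc.
Qed.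

Definition prods Q I : set R := [set z | exists q i, [/\ Q q, I i & z = q * i]].

Lemma nakayama_sub Q J I : noeth R -> isprime Q -> isid J -> isid I ->
  I `<=` sat Q (ideal_gen (J `|` prods Q I)) -> I `<=` sat Q J.
Proof.
move=> hR hQ hJ hI h; have [s hs] := hR _ hI.
have {}hs' : I `<=` spn J s by rewrite hs; apply: gen_mono => //; exact: zid_sub.
move=> w /hs'; apply: nakayama_ideal => // a ha.
have [|u hu hua] := h a; first by rewrite hs; exact: spn_mem.
exists u => //; apply: ideal_gen_min hua => //.
move=> z [hz|[q [i [hq hi ->]]]]; first exact: gen_base.
have : gen Q (@zid R) s (q * i) by apply: gen_mulC => //; rewrite -hs.
by apply: gen_mono => //; exact: zid_sub.
Qed.

Lemma isid_quot Q J : noeth R -> isprime Q -> isid J ->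
  Q `<=` sat Q J -> J `<=` Q -> sat Q J = Q.
Proof.
move=> hR hQ hJ h1 h2; apply: seteqI => //; exact: sat_in.
Qed.

(** A regular local ring is a domain: divide by a member [x] of a regular system of parameters that
    avoids the minimal primes. The quotient is a domain by induction, and a minimal prime inside (x)
    vanishes by Nakayama's lemma. *)
Lemma reg_domain d J Q : noeth R -> isid J -> reg J Q d -> isprime (sat Q J).
Proof.
move=> hR; elim: d J => [|d IH] J hJ hreg.
  have [[hQ hJQ] [s [/size0nil-> _ h]]] := hreg.
  by rewrite (isid_quot hR hQ).
have hQ := reg_prime hreg; have hJQ := reg_sub hreg.
have [hd [s0 [hs0 hsQ hgen]]] := hreg.
case: s0 hs0 hsQ hgen => [//|a s] [hs] hsQ hgen.
have [ps hps hps'] := minprimes hR hJ.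
pose C := spn (ideal_gen (prods Q Q)) s.
have hCid : isid C by rewrite /C; auto.
have hnQ p : List.In p ps -> Q `<=` p -> False.
  move=> hp hQp; have [hpp hJp hpmin] := hps p hp.
  apply: (@minover_hge _ J Q d) => //; split=> // P hP hJP hPQ x hx.
  by apply: hpmin => //; [move=> y /hPQ /hQp | exact: hQp].
(* Changing [a] by Q^2 and by the other generators keeps a generating system of [Q], by Nakayama's
   lemma, and leaves enough freedom to avoid all minimal primes. *)
have [|y hy hxy] := @coset_avoid R ps C a hCid.
  move=> p hp; split; first by case: (hps p hp).
  move=> [hpa hCp]; apply: (hnQ p hp); have [hpp hJp _] := hps p hp.
  have hpQQ x : Q x -> p x.
    move=> hx; have : p (x * x).
      apply: hCp; apply: gen_base => //; apply: ideal_gen_sub; by exists x, x.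
    by move=> /(primeM hpp)[].
  exact: hpQQ.
set x := a + y in hxy.
have hQs b : b \in s -> Q b by move=> hb; apply: hsQ; rewrite inE hb orbT.
have hQx : Q x.
  apply: isidD => //; first by apply: hsQ; exact: mem_head.
  apply: (spn_min _ _ hQs hy) => //; apply: ideal_gen_min => // z [q [i [hq hi ->]]].
  exact: isidM.
have hgen' : Q `<=` sat Q (spn (spn J [:: x]) s).
  apply: nakayama_sub => //; set K := ideal_gen _.
  have hK : isid K by exact: ideal_gen_id.
  have hsub : spn (spn J [:: x]) s `<=` K by move=> z hz; apply: ideal_gen_sub; left.
  move=> z /hgen[u hu huz]; exists u => //; apply: spn_min huz => //.
    by move=> w hw; apply: hsub; apply: gen_base => //; exact: gen_base.
  move=> b; rewrite inE => /predU1P[->|hb]; last by apply: hsub; exact: spn_mem.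
  have -> : a = x - y by rewrite /x addrK.
  apply: isidB => //; first by apply: hsub; apply: gen_base => //; apply: spn_mem => //; rewrite inE.
  apply: (spn_min _ _ _ hy) => //.
    by apply: ideal_gen_min => // w hw; apply: ideal_gen_sub; right.
  by move=> w hw; apply: hsub; exact: spn_mem.
have hregx : reg (spn J [:: x]) Q d.
  split; first by apply: height_ge_drop.
  by exists s.
have hpr := IH _ (gen_id _ (setT_id R) hJ) hregx.
have hxQ : spn J [:: x] `<=` Q by exact: reg_sub hregx.
have [p hp hpP] : exists2 p, List.In p ps & p `<=` sat Q (spn J [:: x]).
  by apply: hps' => // z hz; apply: sat_sub => //; exact: gen_base.
have [hpp hJp _] := hps p hp.
have hpQ : p `<=` Q by move=> z /hpP; apply: sat_in.
(* The minimal prime [p] lies in J + (x) at [Q] and does not contain [x], so that p = x p there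
   modulo [J]. *)
suff h : p `<=` sat Q J.
  suff -> : sat Q J = p by [].
  apply: seteqI => // z [u hu /hJp]; apply: (primeMl hpp) => /hpQ //.
apply: nakayama_sub => // z hz; have [u hu [r _ /= hr]] := hpP z hz.
exists u => //; rewrite -(subrK (r * x) (u * z)).
have hrx : p (r * x).
  by apply: (@isidBl _ _ (u * z)); [auto | exact: hJp | exact: isidM].
apply: isidD; [exact: ideal_gen_id | by apply: ideal_gen_sub; left|].
apply: ideal_gen_sub; right; exists x, r; split=> //; last by rewrite mulrC.
by case/(primeM hpp): hrx => // /(hxy p hp).
Qed.

End Regular.

(** * Residue fields, and primes as sets or as records *)

Section FieldOf.
Variables (F : comNzRingType) (h : forall x : F, x != 0 -> exists y, y * x = 1).

(** The proof of invertibility is a parameter of the alias, so that the field structure can be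
    attached to it canonically. *)
Definition field_of of (forall x : F, x != 0 -> exists y, y * x = 1) : Type := F.
Local Notation K := (field_of h).
HB.instance Definition _ := GRing.ComNzRing.on K.

Definition field_inv (x : K) : K :=
  if pselect (exists y : K, y * x = 1) is left e then projT1 (cid e) else 0.

Lemma field_mulVf (x : K) : x != 0 -> field_inv x * x = 1.
Proof.
by move=> /h hx; rewrite /field_inv; case: pselect => // e; case: (cid e).
Qed.

Lemma field_inv0 : field_inv 0 = 0.
Proof.
rewrite /field_inv; case: pselect => // e; exfalso; case: e => y /eqP.
by rewrite mulr0 eq_sym oner_eq0.
Qed.

HB.instance Definition _ := GRing.ComNzRing_isField.Build K field_mulVf field_inv0.

Lemma exists_field : exists (L : fieldType) (f : {rmorphism F -> L}), bijective f.
Proof.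
exists K, (idfun : {rmorphism F -> F}); exact: (inv_bij (fun x : F => erefl x)).
Qed.
End FieldOf.

Section PrimeSets.
Variable R : comNzRingType.

Definition pset (Q : set R) of isprime Q : R -> bool := fun x => `[< Q x >].

Section Inst.
Variables (Q : set R) (hQ : isprime Q).

Lemma pset_idealr : idealr_closed (pset hQ).
Proof.
have hi := prime_id hQ; split.
- by apply/asboolP; exact: isid0.
- by apply/negP => /asboolP; exact: prime1.
- move=> a x y /asboolP hx /asboolP hy; apply/asboolP.
  by apply: isidD => //; exact: isidM.
Qed.
HB.instance Definition _ := isIdealr.Build R (pset hQ) pset_idealr.

Lemma pset_prime : prime_idealr_closed (pset hQ).
Proof.
move=> x y /asboolP /(primeM hQ) h; apply/orP.
by case: h => h; [left | right]; apply/asboolP.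
Qed.
HB.instance Definition _ := isPrimeIdealrClosed.Build R (pset hQ) pset_prime.

Lemma prime_set_idealr : exists P : prime_idealr R, forall x, x \in P <-> Q x.
Proof. by exists (pset hQ : prime_idealr R) => x; split => /asboolP. Qed.
End Inst.

Lemma idealr_isid (I : idealr R) : isid [set x | x \in I].
Proof.
split=> /=; first exact: idealr0.
- by move=> x y hx hy; exact: rpredD.
- by move=> a x hx; exact: idealMr.
Qed.

Lemma prime_idealr_isprime (P : prime_idealr R) : isprime [set x | x \in P].
Proof.
split=> /=; first exact: idealr_isid; first by rewrite idealr1.
by move=> x y; rewrite prime_idealrM => /orP.
Qed.

Definition residue_proj (P : prime_idealr R) :
    {rmorphism localization P -> residue_field P} :=
  \pi_{ideal_quot (loc_max P : idealr (localization P))}.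

Lemma residue_projP (P : prime_idealr R) z z' :
  residue_proj P z = residue_proj P z' <-> z - z' \in (loc_max P : idealr (localization P)).
Proof. by rewrite Quotient.idealrBE; split => [->|/eqP]. Qed.

Lemma residue_map_eq0 (P : prime_idealr R) x : residue_map P x = 0 <-> x \in P.
Proof.
rewrite -(rmorph0 (residue_proj P)) (_ : residue_map P x = residue_proj P (loc_map P x)) //.
rewrite residue_projP subr0; split.
  move=> /asboolP[a [s [hs [aP /loc_mkP[u uP]]]]].
  rewrite mulr1 mulrBr => /subr0_eq e.
  have : u * (x * s) \in P by rewrite e idealMr.
  by rewrite !prime_idealrM (negPf uP) (negPf hs) orbF.
by move=> hx; apply/asboolP; exists x, 1, (primeN1 P).
Qed.

Lemma residue_frac_inv (P : prime_idealr R) s (hs : s \notin P) a :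
  residue_map P s * residue_proj P (loc_mk a hs) = residue_map P a.
Proof.
rewrite -[residue_map P s]/(residue_proj P (loc_map P s)).
rewrite -[residue_map P a]/(residue_proj P (loc_map P a)) -rmorphM; congr (residue_proj P _).
change (loc_mul (loc_map P s) (loc_mk a hs) = loc_map P a).
by rewrite /loc_map loc_mulE; apply: loc_mk_eq; ring.
Qed.

Lemma residue_frac (P : prime_idealr R) (l : residue_field P) :
  exists b u, u \notin P /\ residue_map P u * l = residue_map P b.
Proof.
have [z ->] : exists z, l = residue_proj P z by exists (repr l); exact: esym (reprK l).
have [a [s [hs ->]]] := loc_mkW z; exists a, s; split=> //; exact: residue_frac_inv.
Qed.

Lemma residue_field_exists (P : prime_idealr R) : exists (L : fieldType) (f : {rmorphism residue_field P -> L}), bijective f.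
Proof.
have inv1 u (hu : u \notin P) : residue_map P u * residue_proj P (loc_mk 1 hu) = 1.
  by rewrite residue_frac_inv rmorph1.
have hinv (x : residue_field P) : x != 0 -> exists y, y * x = 1.
  have [b [u [hu e]]] := residue_frac x => hx.
  have hb : b \notin P.
    apply/negP => /residue_map_eq0 hb; move/eqP: hx; apply.
    by rewrite -(mul1r x) -(inv1 u hu) mulrAC e hb mul0r.
  exists (residue_proj P (loc_mk 1 hb) * residue_map P u).
  by rewrite -mulrA e mulrC inv1.
by have [L [f bf]] := exists_field hinv; exists L, f.
Qed.

(** All that is used later of the residue field of [Q]: a morphism with kernel [Q] such that every
    element of the target is a fraction of values. *)
Lemma residue_exists (Q : set R) : isprime Q ->
  exists (L : fieldType) (pi : {rmorphism R -> L}),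
    (forall x, Q x <-> pi x = 0) /\
    (forall l, exists b u, ~ Q u /\ l = pi b / pi u).
Proof.
move=> hQ; have [P hP] := prime_set_idealr hQ; have [L [f bf]] := residue_field_exists P.
have finj := bij_inj bf.
exists L, (f \o residue_map P); split.
  move=> x; rewrite -hP -residue_map_eq0 /=; split=> [->|h]; first by rewrite rmorph0.
  by apply: finj; rewrite h rmorph0.
move=> l; case: bf => g fg gf; have [b [u [hu e]]] := residue_frac (g l).
exists b, u; split; first by rewrite -hP; exact/negP.
have hu0 : f (residue_map P u) != 0.
  apply/eqP => h; move/negP: hu; apply; apply/residue_map_eq0.
  by apply: finj; rewrite h rmorph0.
have e2 : f (residue_map P b) = f (residue_map P u) * l by rewrite -e rmorphM /= gf.
by rewrite /= in hu0 e2 *; rewrite e2 mulrAC divff ?mul1r.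
Qed.

End PrimeSets.

(** * Linear forms on cotangent spaces *)

Section Dual.
Variable R : comNzRingType.
Implicit Types (I J P Q C : set R) (x y a b : R) (s t : seq R).
Variables (Q : set R) (L : fieldType) (pi : {rmorphism R -> L}).
Hypotheses (hR : noeth R) (hQ : isprime Q) (Qpi : forall x, Q x <-> pi x = 0).

(* L plays the role of the residue field of Q, and lam that of a linear form on the cotangent space of R_Q. *)
Definition functional (lam : R -> L) :=
  (forall x y, Q x -> Q y -> lam (x + y) = lam x + lam y) /\
  (forall a x, Q x -> lam (a * x) = pi a * lam x).

Lemma functional0 lam : functional lam -> lam 0 = 0.
Proof.
case=> _ h; have := h 0 0; rewrite mul0r rmorph0 mul0r; apply.
exact: isid0 (prime_id hQ).
Qed.

Lemma functional_sum lam n (c x : 'I_n -> R) : functional lam ->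
  (forall i, Q (x i)) -> lam (\sum_i c i * x i) = \sum_i pi (c i) * lam (x i).
Proof.
move=> hl; have [hD hM] := hl; elim: n c x => [|n IH] c x hx.
  by rewrite !big_ord0 functional0.
rewrite !big_ord_recl hD ?hM ?IH //; first by apply: isidM.
by apply: isid_sum => // i _; apply: isidM.
Qed.

Lemma functional_prods lam : functional lam ->
  forall J, (J `<=` Q) -> (forall x, J x -> lam x = 0) ->
  forall x, sat Q (ideal_gen (J `|` prods Q Q)) x -> Q x -> lam x = 0.
Proof.
move=> [hD hM] J hJQ hJ x [u hu [k [c [e [he hx]]]]] hQx.
have heQ i : Q (e i) /\ lam (e i) = 0.
  case: (he i) => [h|[q [i' [hq hi ->]]]]; first by split; [exact: hJQ | exact: hJ].
  by split; [exact: isidM | rewrite hM // (Qpi q).1 // mul0r].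
have : pi u * lam x = 0.
  rewrite -hM // hx functional_sum //; last by move=> i; case: (heQ i).
  by rewrite big1 // => i _; rewrite (heQ i).2 mulr0.
move=> /eqP; rewrite mulf_eq0 => /orP[/eqP /Qpi //|/eqP //].
Qed.

(** Since [s] is as short as possible, the coefficients of an element of [Q] on [s] are unique
    modulo [Q], after division by the denominator; they are the dual forms. *)
Lemma dual_functionals J s : isid J -> J `<=` Q -> (forall a, a \in s -> Q a) ->
  Q `<=` sat Q (spn J s) ->
  (forall s', (forall a, a \in s' -> Q a) -> Q `<=` sat Q (spn J s') ->
     (size s <= size s')%N) ->
  exists lam : 'I_(size s) -> R -> L,
    [/\ forall i, functional (lam i), forall i x, J x -> lam i x = 0 &
        forall i j : 'I_(size s), lam i s`_j = (i == j)%:R].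
Proof.
move=> hJ hJQ hs hgen hmin.
(* If c k were outside [Q], the relation would make the k-th generator redundant at [Q]. *)
have indep (c : nat -> R) : J (\sum_(i < size s) c i * s`_i) ->
    forall k : 'I_(size s), Q (c k).
  move=> hc k; apply: contrapT => hck.
  pose s' := take k s ++ drop k.+1 s.
  have hss' : s = take k s ++ s`_k :: drop k.+1 s by rewrite -drop_nth // cat_take_drop.
  have hsub a : a \in s' -> a \in s.
    by rewrite mem_cat => /orP[/mem_take|/mem_drop].
  have hmem (i : 'I_(size s)) : i != k -> s`_i \in s'.
    rewrite mem_cat -val_eqE neq_ltn => /orP[h|h]; apply/orP; [left|right].
      by rewrite -(nth_take 0 h); apply: mem_nth; rewrite size_take ltn_ord.
    have -> : s`_i = (drop k.+1 s)`_(i - k.+1) by rewrite nth_drop subnKC.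
    by apply: mem_nth; rewrite size_drop (ltn_sub2r (leq_ltn_trans h (ltn_ord i)) (ltn_ord i)).
  have : (size s <= size s')%N.
    apply: hmin; first by move=> a /hsub /hs.
    move=> x /hgen h; apply: sat_sat => //; apply: sat_mono h.
    apply: spn_min => //; first by move=> z hz; apply: sat_sub => //; exact: gen_base.
    move=> a; rewrite {1}hss' mem_cat inE => /or3P[h|/eqP->|h].
    - by apply: sat_sub => //; apply: spn_mem => //; rewrite mem_cat h.
    - exists (c k) => //.
      have -> : c k * s`_k = \sum_(i < size s) c i * s`_i - \sum_(i < size s | i != k) c i * s`_i.
        by rewrite (bigD1 k) //= addrK.
      apply: isidB => //; first exact: gen_base.
      by apply: isid_sum => // i hi; apply: isidM => //; apply: spn_mem => //; exact: hmem.
    - by apply: sat_sub => //; apply: spn_mem => //; rewrite mem_cat h orbT.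
  have e := congr1 size hss'; rewrite !size_cat /= addnS -size_cat -/s' in e.
  by rewrite {1}e ltnn.
have /choice[f hf] : forall x, exists uc : R * (nat -> R), Q x ->
    ~ Q uc.1 /\ J (uc.1 * x - \sum_(i < size s) uc.2 i * s`_i).
  move=> x; have [hx|hx] := pselect (Q x); last by exists (0, fun=> 0).
  have [u hu /gen_sumP[//|c _ hc]] := hgen x hx.
  by exists (u, c).
pose lam (i : 'I_(size s)) x := pi ((f x).2 i) / pi (f x).1.
have nz u : ~ Q u -> pi u != 0 by move=> hu; apply/eqP => /Qpi.
have key x u (c : nat -> R) : Q x -> ~ Q u -> J (u * x - \sum_(i < size s) c i * s`_i) ->
    forall i, lam i x = pi (c i) / pi u.
  move=> hx hu hc i; have [hu' hc'] := hf x hx; rewrite /lam.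
  set u' := (f x).1 in hu' hc' *; set c' := (f x).2 in hc' *.
  apply/eqP; rewrite eqr_div ?nz // -!rmorphM -subr_eq0 -rmorphB; apply/eqP/Qpi.
  apply: (indep (fun i => c' i * u - c i * u')).
  have -> : \sum_(i0 < size s) (c' i0 * u - c i0 * u') * s`_i0 =
     u' * (u * x - \sum_(i < size s) c i * s`_i)
     - u * (u' * x - \sum_(i < size s) c' i * s`_i).
    transitivity (u * (\sum_(i < size s) c' i * s`_i) - u' * (\sum_(i < size s) c i * s`_i)).
      by rewrite !mulr_sumr -sumrB; apply: eq_bigr => j _; ring.
    by ring.
  by apply: isidB => //; apply: isidM.
exists lam; split.
- move=> i; split.
    move=> x y hx hy; have [hu hc] := hf x hx; have [hv hd] := hf y hy.
    rewrite (key (x + y) ((f x).1 * (f y).1)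
       (fun i => (f y).1 * (f x).2 i + (f x).1 * (f y).2 i)) //.
    - rewrite /lam addf_div ?nz // rmorphD !rmorphM; congr (_ / _); ring.
    - by apply: isidD.
    - exact: primeNM.
    rewrite (_ : _ - _ = (f y).1 * ((f x).1 * x - \sum_(i < size s) (f x).2 i * s`_i)
      + (f x).1 * ((f y).1 * y - \sum_(i < size s) (f y).2 i * s`_i)).
      by apply: isidD => //; apply: isidM.
    rewrite !mulrBr !mulr_sumr addrACA -opprD -big_split /=; congr (_ - _); first by ring.
    by apply: eq_bigr => j _; ring.
  move=> a x hx; have [hu hc] := hf x hx.
  rewrite (key (a * x) (f x).1 (fun i => a * (f x).2 i)) //.
  - by rewrite /lam rmorphM mulrA.
  - by apply: isidM.
  rewrite (_ : _ - _ = a * ((f x).1 * x - \sum_(i < size s) (f x).2 i * s`_i)).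
    exact: isidM.
  rewrite mulrBr mulr_sumr mulrCA; congr (_ - _).
  by apply: eq_bigr => j _; ring.
- move=> i x hx; rewrite (key x 1 (fun=> 0)) ?rmorph0 ?mul0r //; first exact: hJQ.
    exact: prime1.
  by rewrite mul1r big1 ?subr0 // => j _; rewrite mul0r.
- move=> i j; have hj : Q s`_j by apply: hs; exact: mem_nth.
  rewrite (key s`_j 1 (fun k => (k == j :> nat)%:R)) //.
  + by rewrite rmorph1 divr1 rmorph_nat.
  + exact: prime1.
  rewrite mul1r (bigD1 j) //= eqxx mul1r big1 ?addr0 ?subrr; first exact: isid0.
  by move=> k /negbTE hk; rewrite val_eqE hk mul0r.
Qed.

Lemma reg_dual J d : isid J -> reg J Q d ->
  exists (s : d.-tuple R) (lam : 'I_d -> R -> L),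
    [/\ forall a, a \in s -> Q a, Q `<=` sat Q (spn J s),
        forall i, functional (lam i), forall i x, J x -> lam i x = 0 &
        forall i j : 'I_d, lam i s`_j = (i == j)%:R].
Proof.
move=> hJ hreg; have [hd [s [hs hsQ hgen]]] := hreg.
have [|lam [h1 h2 h3]] := dual_functionals hJ (reg_sub hreg) hsQ hgen.
  by move=> s' hs' hg'; rewrite hs; apply: (gens_height hR hJ hs' hg' hd).
subst d; exists (in_tuple s), lam; split=> //.
Qed.

Lemma min_gens J : isid J -> J `<=` Q ->
  exists (n : nat) (s : n.-tuple R) (lam : 'I_n -> R -> L),
    [/\ forall a, a \in s -> Q a, Q `<=` sat Q (spn J s),
        forall i, functional (lam i), forall i x, J x -> lam i x = 0 &
        forall i j : 'I_n, lam i s`_j = (i == j)%:R].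
Proof.
move=> hJ hJQ.
pose ok n := `[< exists s, [/\ size s = n, forall a, a \in s -> Q a & Q `<=` sat Q (spn J s)] >].
have hex : exists n, ok n.
  have [s hs] := hR (prime_id hQ); exists (size s); apply/asboolP; exists s; split=> //.
    by move=> a ha; rewrite hs; exact: spn_mem.
  move=> x; rewrite {1}hs => hx; apply: sat_sub => //; apply: gen_mono hx => //.
  exact: zid_sub.
case: (ex_minnP hex) => n /asboolP[s [hs hsQ hg]] hmin.
have [|lam [h1 h2 h3]] := dual_functionals hJ hJQ hsQ hg.
  by move=> s' hs' hg'; rewrite hs; apply: hmin; apply/asboolP; exists s'.
by subst n; exists (size s), (in_tuple s), lam; split.
Qed.

End Dual.

Section QuotGens.
Variable R : comNzRingType.
Implicit Types (I J P : set R) (x y a b : R) (s t : seq R).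
Variables (Q : set R) (L : fieldType) (pi : {rmorphism R -> L}).
Hypotheses (hR : noeth R) (hQ : isprime Q) (Qpi : forall x, Q x <-> pi x = 0).
Hypothesis (Lfrac : forall l, exists b u, ~ Q u /\ l = pi b / pi u).

Lemma pi_neq0 u : ~ Q u -> pi u != 0.
Proof. by move=> hu; apply/eqP => /Qpi. Qed.

Lemma common_denom n (al : 'I_n -> L) :
  exists u (a : 'I_n -> R), ~ Q u /\ forall i, pi u * al i = pi (a i).
Proof.
elim: n al => [|n IH] al.
  by exists 1, (fun=> 0); split; [exact: prime1 | case].
have [u [a [hu ha]]] := IH (fun i => al (lift ord0 i)).
have [b [v [hv e]]] := Lfrac (al ord0).
exists (u * v), (fun i => if unlift ord0 i is Some j then v * a j else u * b).
split; first exact: primeNM.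
move=> i; case: unliftP => [j ->|->]; first by rewrite !rmorphM -ha; ring.
by rewrite e !rmorphM -mulrA [pi v * _]mulrC divfK // pi_neq0.
Qed.

(** In a regular local ring, an ideal with regular quotient is generated by part of a regular system
    of parameters. The elements [w] are those of [J'] whose images form a maximal independent family
    in the cotangent space. *)
Lemma reg_quot_gens J J' D e : isid J -> isid J' -> J `<=` J' ->
  reg J Q D -> reg J' Q e ->
  exists w : seq R, [/\ forall a, a \in w -> J' a, (size w + e <= D)%N & J' `<=` sat Q (spn J w)].
Proof.
move=> hJ hJ' hJJ' hD he.
have [G [La [hGQ hG hLa hLaJ hLaG]]] := reg_dual hR hQ Qpi hJ hD.
have [c [la [hcQ hc hla hlaJ hlac]]] := reg_dual hR hQ Qpi hJ' he.
have fsum := @functional_sum R Q L pi hQ.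
have hJQ := reg_sub hD; have hJ'Q := reg_sub he.
(* The forms [La] separate the elements of Q/(J + Q^2), up to localization at [Q]. *)
have vker x : Q x -> (forall k, La k x = 0) -> sat Q (ideal_gen (J `|` prods Q Q)) x.
  move=> hx hk; have [u hu /gen_sumP[//|a _ ha]] := hG x hx; exists u => //.
  have hGi (i : 'I_(size G)) : Q G`_i by apply/hGQ/mem_nth.
  have e0 : u * x = (u * x - \sum_(i < size G) a i * G`_i) + \sum_(i < size G) a i * G`_i.
    by rewrite subrK.
  have haQ (k : 'I_D) : Q (a k).
    apply/Qpi.
    have : La k (u * x) = 0 by rewrite (hLa k).2 // hk mulr0.
    have hS : Q (\sum_(i < size G) a i * G`_i) by apply: isid_sum => // i _; apply: isidM.
    have -> : La k (u * x) = La k (\sum_(i < size G) a i * G`_i).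
      have hd := hJQ _ ha.
      by rewrite [in LHS]e0 (hLa k).1 // hLaJ // add0r.
    have hsz : size G = D := size_tuple G.
    rewrite (fsum _ _ _ _ (hLa k)) //.
    rewrite (eq_bigr (fun i : 'I_(size G) => pi (a i) * (k == i :> nat)%:R)); last first.
      by move=> i _; have := hLaG k (cast_ord hsz i) => /= ->.
    rewrite (bigD1 (cast_ord (esym hsz) k)) //= eqxx mulr1 big1 ?addr0 // => i hi.
    suff -> : (k == i :> nat) = false by rewrite mulr0.
    by apply: contraNF hi => /eqP e1; apply/eqP/val_inj; rewrite /= e1.
  rewrite e0; apply: isidD; [exact: ideal_gen_id | by apply: ideal_gen_sub; left |].
  apply: isid_sum => [|i _]; first exact: ideal_gen_id.
  apply: ideal_gen_sub; right; exists (a i), G`_i; split=> //.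
  by have := haQ (cast_ord (size_tuple G) i).
pose mat n (w : seq R) : 'M[L]_(n, D) := \matrix_(i, k) La k w`_i.
pose ok n := `[< exists w : n.-tuple R, (forall a, a \in w -> J' a) /\ row_free (mat n w) >].
have hex : exists n, ok n.
  exists 0%N; apply/asboolP; exists [tuple]; split=> //.
  by apply: inj_row_free => z _; exact: thinmx0.
have hbd n : ok n -> (n <= D)%N.
  by move=> /asboolP[w [_ /eqP <-]]; exact: rank_leq_col.
case: (ex_maxnP hex hbd) => n /asboolP[w [hwJ' hfree]] hmax.
have hwi (i : 'I_n) : J' w`_i by apply: hwJ'; apply: mem_nth; rewrite size_tuple.
have hspan x : J' x -> exists be : 'rV[L]_n, forall k, La k x = \sum_i be 0 i * La k w`_i.
  move=> hx; apply: contrapT => hno.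
  suff : ok n.+1 by move=> /hmax; rewrite ltnn.
  apply/asboolP; exists [tuple of x :: w]; split.
    by move=> a; rewrite inE => /predU1P[->|/hwJ'].
  apply: inj_row_free => z hz.
  have hz' k : z 0 ord0 * La k x + \sum_i z 0 (lift ord0 i) * La k w`_i = 0.
    have := congr1 (fun A : 'rV[L]_D => A 0 k) hz; rewrite !mxE big_ord_recl => e1.
    rewrite -[RHS]e1 {e1} !mxE /=; congr (_ + _).
    by apply: eq_bigr => i _; rewrite !mxE.
  have z0 : z 0 ord0 = 0.
    apply: contrapT => /eqP z0; apply: hno.
    exists (\row_i (- (z 0 ord0)^-1 * z 0 (lift ord0 i))) => k.
    apply: (mulfI z0); rewrite mulr_sumr; apply/eqP; rewrite -subr_eq0 -sumrN; apply/eqP.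
    have e1 := hz' k; rewrite -[RHS]e1; congr (_ + _); apply: eq_bigr => i _; rewrite !mxE.
    by rewrite !mulNr mulrN opprK !mulrA divff // mul1r.
  have zr : (\row_i z 0 (lift ord0 i)) *m mat n w = 0.
    apply/rowP => k; rewrite !mxE -[RHS](hz' k) z0 mul0r add0r.
    by apply: eq_bigr => i _; rewrite !mxE.
  have /rowP zr' : (\row_i z 0 (lift ord0 i)) = 0.
    by apply: (row_free_inj hfree); rewrite zr mul0mx.
  apply/rowP => i; rewrite mxE; case: (unliftP ord0 i) => [j ->|->] //.
  by have := zr' j; rewrite !mxE.
have hwQ (i : 'I_n) : Q w`_i by exact: hJ'Q.
pose Js := spn (spn J w) c.
have hK : isid (ideal_gen (Js `|` prods Q Q)) by exact: ideal_gen_id.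
have hJ'K : J' `<=` sat Q (ideal_gen (Js `|` prods Q Q)).
  move=> x hx; have [be hbe] := hspan x hx; have hxQ := hJ'Q x hx.
  have [u [a [hu ha]]] := common_denom (fun i => be 0 i).
  have hz : sat Q (ideal_gen (J `|` prods Q Q)) (u * x - \sum_i a i * w`_i).
    apply: vker; first by apply: isidB => //; [exact: isidM | apply: isid_sum => // i _; apply: isidM].
    move=> k.
    have hs : Q (\sum_i a i * w`_i) by apply: isid_sum => // i _; apply: isidM.
    rewrite -mulN1r (hLa k).1; [|exact: isidM|exact: isidM].
    rewrite (hLa k).2 // (hLa k).2 // (fsum _ _ _ _ (hLa k)) // hbe.
    rewrite rmorphN1 mulN1r mulr_sumr -sumrB big1 // => i _.
    by rewrite mulrA ha subrr.
  apply: sat_sat => //; exists u => //.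
  rewrite -(subrK (\sum_i a i * w`_i) (u * x)); apply: isidD => //.
    apply: sat_mono hz; apply: ideal_gen_min => // z [hz|hz]; apply: ideal_gen_sub; [left|by right].
    by apply: gen_base => //; exact: gen_base.
  apply: isid_sum => // i _; apply: isidM => //; apply: sat_sub => //; apply: ideal_gen_sub; left.
  by apply: gen_base => //; apply: spn_mem => //; apply: mem_nth; rewrite size_tuple.
have hgen : Q `<=` sat Q Js.
  apply: nakayama_sub => //; first by rewrite /Js; auto.
  move=> z /hc hz; apply: sat_sat => //; apply: sat_mono hz; apply: spn_min => //.
  move=> a ha; apply: sat_sub => //; apply: ideal_gen_sub; left; apply: spn_mem => //; by auto.
have hwsub : spn J w `<=` J' by apply: spn_min.
(* J + (w) already has a regular quotient of dimension [e] at [Q], hence a domain. A further proper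
   quotient would have smaller dimension, so [J'] is J + (w) at [Q]. *)
have hregw : reg (spn J w) Q e.
  split; first by apply: height_ge_mono he.1.
  by exists c; split=> //; exact: size_tuple.
have hpr := reg_domain hR (gen_id w (setT_id R) hJ) hregw.
exists w; split=> //; last first.
  apply: contrapT => hno.
  have : height_ge (spn J w) Q e.+1.
    apply: height_ge_bot he.1 => P hP hJ'P hPQ; exists (sat Q (spn J w)); split=> //.
    - by move=> x hx; exact: sat_sub.
    - by move=> x [u hu hx]; apply: (primeMl hP) (hJ'P _ (hwsub _ hx)) => /hPQ.
    - by move=> h; apply: hno => x /hJ'P /h.
  by move=> /(reg_le hR _ hregw) => /(_ (gen_id w (setT_id R) hJ)); rewrite ltnn.
rewrite size_tuple.
(* The images of [w] and of the parameters [c] modulo [J'] are jointly independent in a space of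
   dimension [D]. *)
have : row_free (col_mx (mat n w) (mat e c)); last by move=> /eqP <-; exact: rank_leq_col.
apply: inj_row_free => z hz.
have hz' k : \sum_i z 0 (lshift e i) * La k w`_i + \sum_j z 0 (rshift n j) * La k c`_j = 0.
  move: hz; rewrite -{1}[z]hsubmxK mul_row_col => /matrixP /(_ 0 k); rewrite !mxE => e1.
  by rewrite -[RHS]e1; congr (_ + _); apply: eq_bigr => i _; rewrite !mxE.
have [u [a [hu ha]]] := common_denom (fun i => z 0 i).
have hci (j : 'I_e) : Q c`_j by apply: hcQ; apply: mem_nth; rewrite size_tuple.
pose A := \sum_i a (lshift e i) * w`_i; pose B := \sum_j a (rshift n j) * c`_j.
have hA : Q A by apply: isid_sum => // i _; apply: isidM.
have hB : Q B by apply: isid_sum => // i _; apply: isidM.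
have hAB : sat Q (ideal_gen (J' `|` prods Q Q)) (A + B).
  have : sat Q (ideal_gen (J `|` prods Q Q)) (A + B).
    apply: vker => [|k]; first exact: isidD.
    rewrite (hLa k).1 // !(fsum _ _ _ _ (hLa k)) // -[RHS](mulr0 (pi u)) -[in RHS](hz' k) mulrDr !mulr_sumr.
    by congr (_ + _); apply: eq_bigr => i _; rewrite mulrA ha.
  apply: sat_mono; apply: ideal_gen_min; first exact: ideal_gen_id.
  by move=> x [hx|hx]; apply: ideal_gen_sub; [left; exact: hJJ' | right].
have zr j : z 0 (rshift n j) = 0.
  have : la j (A + B) = 0.
    exact: (functional_prods hQ Qpi (hla j) hJ'Q (hlaJ j) hAB (isidD (prime_id hQ) hA hB)).
  rewrite (hla j).1 // !(fsum _ _ _ _ (hla j)) // big1 ?add0r; last first.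
    by move=> i _; rewrite hlaJ ?mulr0.
  rewrite (bigD1 j) //= hlac eqxx mulr1 big1 ?addr0; last first.
    by move=> i hi; rewrite hlac eq_sym (negbTE hi) mulr0.
  by rewrite -ha => /eqP; rewrite mulf_eq0 (negbTE (pi_neq0 hu)) /= => /eqP.
have zl : lsubmx z = 0.
  apply: (row_free_inj hfree); rewrite mul0mx; apply/rowP => k; rewrite !mxE; have e1 := hz' k.
  rewrite [X in _ + X]big1 ?addr0 in e1; last by move=> j _; rewrite zr mul0r.
  by rewrite -[RHS]e1; apply: eq_bigr => i _; rewrite !mxE.
apply/rowP => i; rewrite mxE -(splitK i); case: (split i) => j /=; last exact: zr.
by have /rowP/(_ j) := zl; rewrite !mxE.
Qed.

End QuotGens.

(** * Flat morphisms *)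

Section HeightExtras.
Variable R : comNzRingType.
Implicit Types (I J P Q : set R).

Lemma height_ge_base J Q n : height_ge J Q n -> exists d, [/\ isprime d, J `<=` d, d `<=` Q & height_ge d Q n].
Proof.
elim: n Q => [|n IH] Q /= [hQ hs]; first by exists Q; split=> //; split.
have [P [hP hPQ hQP]] := hs; have [d [hd h1 h2 h3]] := IH P hP.
exists d; split=> //; first by move=> x /h2 /hPQ.
by split=> //; exists P.
Qed.

Lemma height_ge_max J Q b : height_ge J Q 0 -> ~ height_ge J Q b.+1 ->
  exists2 h, height_ge J Q h & ~ height_ge J Q h.+1.
Proof.
elim: b => [|b IH] h0 hb; first by exists 0%N.
by have [h|h] := pselect (height_ge J Q b.+1); [exists b.+1 | exact: IH].
Qed.

Lemma sat_common Q I n (x : 'I_n -> R) : isprime Q -> isid I ->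
  (forall i, sat Q I (x i)) -> exists2 u, ~ Q u & forall i, I (u * x i).
Proof.
move=> hQ hI; elim: n x => [|n IH] x hx; first by exists 1; [exact: prime1 | case].
have [u hu h] := IH (fun i => x (lift ord0 i)) (fun i => hx _).
have [v hv h0] := hx ord0; exists (u * v); first exact: primeNM.
move=> i; case: (unliftP ord0 i) => [j ->|->]; last by rewrite -mulrA; exact: isidM.
by rewrite mulrAC; exact: isidMr.
Qed.

End HeightExtras.

Section Flat.
Variables (A T : comNzRingType) (phi : {rmorphism A -> T}).
Implicit Types (J P : set A) (Q : set T).

(* Flatness of T over A by the equational criterion. *)
Definition flat := forall (I : finType) (a : I -> A) (t : I -> T),
  \sum_i phi (a i) * t i = 0 ->
  exists l (al : I -> 'I_l -> A) (z : 'I_l -> T),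
    (forall i, t i = \sum_j phi (al i j) * z j) /\ (forall j, \sum_i a i * al i j = 0).

Definition ext J : set T := ideal_gen (phi @` J).
Definition contr Q : set A := [set x | Q (phi x)].

Definition faithfully_flat := flat /\ forall J, isid J -> ext J 1 -> J 1.

Lemma ext_id J : isid (ext J). Proof. exact: ideal_gen_id. Qed.
Hint Resolve ext_id : isdb.

Lemma ext_in J x : J x -> ext J (phi x).
Proof. by move=> h; apply: ideal_gen_sub; exists x. Qed.

Lemma ext_min J Q : isid Q -> (forall x, J x -> Q (phi x)) -> ext J `<=` Q.
Proof. by move=> hQ h; apply: ideal_gen_min => // _ [x hx <-]; exact: h. Qed.

Lemma contr_id Q : isid Q -> isid (contr Q).
Proof.
move=> hQ; split; rewrite /contr /=; first by rewrite rmorph0; exact: isid0.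
- by move=> x y hx hy; rewrite rmorphD; exact: isidD.
- by move=> a x hx; rewrite rmorphM; exact: isidM.
Qed.
Hint Resolve contr_id : isdb.

Lemma contr_prime Q : isprime Q -> isprime (contr Q).
Proof.
move=> hQ; split; [by auto | by rewrite /contr /= rmorph1; exact: prime1|].
by move=> x y; rewrite /contr /= rmorphM => /(primeM hQ).
Qed.

Lemma ext_spn J s x : isid J -> spn J s x -> spn (ext J) (map phi s) (phi x).
Proof.
move=> hJ; apply: (@spn_min _ [set x | spn (ext J) (map phi s) (phi x)]) => /=.
- apply: (contr_id (Q := spn (ext J) (map phi s))); by auto.
- by move=> y hy /=; apply: gen_base => //; exact: ext_in.
- by move=> a ha; apply: spn_mem; [auto | exact: map_f].
Qed.

(** The members of [ext J] are moved into the relation as additional terms; their coefficients lie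
    in [J] and disappear modulo [J]. *)
Lemma flat_mod (I : finType) (a : I -> A) (t : I -> T) J : flat -> isid J ->
  ext J (\sum_i phi (a i) * t i) ->
  exists l (al : I -> 'I_l -> A) (z : 'I_l -> T),
    (forall i, t i = \sum_j phi (al i j) * z j) /\ (forall j, J (\sum_i a i * al i j)).
Proof.
move=> hf hJ [k [c [e [he hx]]]].
have /choice[b hb] : forall i, exists b, J b /\ phi b = e i.
  by move=> i; have [b hb hbe] := he i; exists b.
pose a' (i : I + 'I_k) := match i with inl i => a i | inr j => b j end.
pose t' (i : I + 'I_k) := match i with inl i => t i | inr j => - c j end.
have [|l [al [z [h1 h2]]]] := hf _ a' t'.
  rewrite big_sumType /= hx -big_split big1 //= => j _; rewrite (hb j).2; ring.
exists l, (fun i j => al (inl i) j), z; split=> [i|j]; first exact: (h1 (inl i)).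
have := h2 j; rewrite big_sumType /= => /eqP; rewrite addr_eq0 => /eqP ->.
apply: isidN => //; apply: isid_sum => // i _; apply: isidMr => //.
exact: (hb i).1.
Qed.

Lemma flat_mod1 s u J : flat -> isid J -> ext J (phi s * u) ->
  ext [set x | J (x * s)] u.
Proof.
move=> hf hJ h; have [|l [al [z [h1 h2]]]] := @flat_mod 'I_1 (fun=> s) (fun=> u) J hf hJ.
  by rewrite big_ord1.
rewrite (h1 ord0); apply: isid_sum => // j _; apply: isidMr => //.
by apply: ext_in => /=; have := h2 j; rewrite big_ord1 mulrC.
Qed.

Lemma colon_prime P s : isprime P -> ~ P s -> [set x | P (x * s)] `<=` P.
Proof. by move=> hP hs x /= /(primeM hP)[]. Qed.

Lemma ext_mono J J' : J `<=` J' -> ext J `<=` ext J'.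
Proof. by move=> h; apply: ext_min => // x /h; exact: ext_in. Qed.

Lemma prime_over_disjoint P Q : noeth T -> isprime P -> isprime Q ->
  (forall s u, ~ P s -> ~ Q u -> ~ ext P (phi s * u)) ->
  exists2 Q', isprime Q' & Q' `<=` Q /\ contr Q' = P.
Proof.
move=> hT hP hQ h.
have [||||Q' hQ' [h1 h2]] := @prime_avoid_mult T (ext P)
  [set x | exists s u, [/\ ~ P s, ~ Q u & x = phi s * u]] hT.
- by auto.
- by exists 1, 1; rewrite rmorph1 mulr1; split=> //; exact: prime1.
- move=> _ _ [s [u [hs hu ->]]] [s' [u' [hs' hu' ->]]]; exists (s * s'), (u * u').
  by split; [exact: primeNM | exact: primeNM | rewrite rmorphM; ring].
- by move=> _ [s [u [hs hu ->]]]; exact: h.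
exists Q' => //; split.
  move=> x hx; apply: contrapT => hxQ; apply: (h2 x) => //; exists 1, x.
  by rewrite rmorph1 mul1r; split=> //; exact: prime1.
apply: seteqI => x hx; last by apply: h1; exact: ext_in.
apply: contrapT => hxP; apply: (h2 (phi x)) => //; exists x, 1.
by rewrite mulr1; split=> //; exact: prime1.
Qed.

(** If s is outside [P] and phi s * u lies in PT, flatness puts u into (P : s)T = PT, which is
    inside [Q]. Hence some prime inside [Q] contains PT and no such phi s. *)
Lemma going_down P Q : noeth T -> flat -> isprime P -> isprime Q -> P `<=` contr Q ->
  exists2 Q', isprime Q' & Q' `<=` Q /\ contr Q' = P.
Proof.
move=> hT hf hP hQ hPQ; apply: prime_over_disjoint => // s u hs hu h; apply: hu.
have : ext P u.
  by apply: ext_mono (flat_mod1 hf _ h); [exact: colon_prime | exact: prime_id].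
by apply: ext_min => // x /hPQ.
Qed.

Lemma lying_over_flat P : noeth T -> faithfully_flat -> isprime P ->
  exists2 Q, isprime Q & contr Q = P.
Proof.
move=> hT [hf h1] hP.
have [Q0 hQ0 hPQ0] : exists2 Q0, isprime Q0 & ext P `<=` Q0.
  by apply: prime_over => // h; apply: (prime1 hP); apply: h1 => //; exact: prime_id.
have [|Q hQ [_ h]] := going_down hT hf hP hQ0; last by exists Q.
by move=> x hx; apply: hPQ0; exact: ext_in.
Qed.

Lemma height_ge_lift J P Q n : noeth T -> flat -> height_ge J P n -> isprime Q -> contr Q = P ->
  height_ge (ext J) Q n.
Proof.
move=> hT hf; elim: n P Q => [|n IH] P Q /= [hP hs] hQ hc; split=> //.
  by apply: ext_min => // x /hs; rewrite -hc.
have [P1 [hP1 hP1P hPP1]] := hs.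
have [|Q1 hQ1 [hQ1Q hc1]] := going_down hT hf (height_ge_prime hP1) hQ.
  by rewrite hc.
exists Q1; split=> //; first exact: IH hP1 _ _.
by move=> hQQ1; apply: hPP1; rewrite -hc -hc1 => x /hQQ1.
Qed.

(** Chains of the base are lifted by going down and continued in the fibre; parameters of the base
    and of the fibre together generate [Q]. *)
Lemma reg_ascent J P Q h e : noeth T -> flat -> isid J -> isprime Q -> contr Q = P ->
  reg J P h -> reg (ext P) Q e -> reg (ext J) Q (h + e).
Proof.
move=> hT hf hJ hQ hc [hh [s [hs hsP hgs]]] [he [t [ht htQ hgt]]].
have hP := height_ge_prime hh; have hPid := prime_id hP.
have hcE x : Q (phi x) = P x by rewrite -hc.
split.
  have [d [hd h1 h2 h3]] := height_ge_base he.
  have hcd : contr d = P.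
    apply: seteqI => x hx; first by rewrite -hc; exact: h2.
    by apply: h1; exact: ext_in.
  exact: height_ge_trans (height_ge_lift hT hf hh hd hcd) h3.
exists (map phi s ++ t); split; first by rewrite size_cat size_map hs ht.
  move=> a; rewrite mem_cat => /orP[/mapP[x /hsP hx ->]|/htQ //].
  by rewrite hcE.
move=> z /hgt hz; apply: sat_sat => //; apply: sat_mono hz.
apply: spn_min => //.
  apply: ext_min => // x /hgs[u hu hux]; exists (phi u); first by rewrite hcE.
  have /(ext_spn hJ) : spn J s (u * x) by [].
  rewrite rmorphM; apply: spn_sub => // a ha; by rewrite mem_cat ha.
move=> a ha; apply: sat_sub => //; apply: spn_mem => //; by rewrite mem_cat ha orbT.
Qed.

(** Let [mu] be the number of minimal generators of [P] modulo [J] and [h] the height. The extension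
    of [P] needs at most D - e <= h generators at [Q], because the total space and the fibre are
    regular. By flatness minimal generators of [P] stay minimal in T, so mu <= h. *)
Lemma reg_descent J P Q D e : noeth A -> noeth T -> flat -> isid J -> isprime P ->
  J `<=` P -> contr Q = P ->
  reg (ext J) Q D -> reg (ext P) Q e -> exists h, reg J P h.
Proof.
move=> hA hT hf hJ hP hJP hc hD he; have hQ := reg_prime hD; have hPid := prime_id hP.
have hcE x : Q (phi x) = P x by rewrite -hc.
have hextPQ : ext P `<=` Q by exact: reg_sub he.
have [LP [piP [hpiP hfracP]]] := residue_exists hP.
have [mu [s [lam [hsP hgs hlam hlamJ hlams]]]] := min_gens hA hP hpiP hJ hJP.
have hsz : size s = mu := size_tuple s.
have hbd : ~ height_ge J P mu.+1.
  by move=> /(gens_height hA hJ hsP hgs); rewrite hsz ltnn.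
have [h hh hh1] := height_ge_max (conj hP hJP) hbd.
have [b [hb hbP hbmin]] := params hA hJ hP hJP hh1.
have [heh [c [hce hcQ hgc]]] := he.
(* Parameters for [P] and generators of [Q] in the fibre together cut out [Q]. *)
have hDh : (D <= h + e)%N.
  have hmin : minimal_over (spn (ext J) (map phi b ++ c)) Q.
    split=> //.
      apply: spn_min => //; first exact: reg_sub hD.
      move=> a; rewrite mem_cat => /orP[/mapP[x /hbP hx ->]|/hcQ //].
      by rewrite hcE.
    move=> q hq hqs hqQ.
    have hcq : P `<=` contr q.
      case: hbmin => _ _; apply; first exact: contr_prime.
        apply: spn_min; first by auto.
          move=> x hx; apply: hqs; apply: gen_base => //; exact: ext_in.
        move=> a ha; apply: hqs; apply: spn_mem => //; by rewrite mem_cat map_f.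
      by rewrite -hc => x /hqQ.
    move=> z /hgc[u hu hz]; apply: (primeMl hq (x := z) (u := u)); first by move=> /hqQ.
    apply: spn_min hz => //; first by apply: ext_min.
    by move=> a ha; apply: hqs; apply: spn_mem => //; rewrite mem_cat ha orbT.
  have := krull_height hT (ext_id J) hmin hD.1.
  by move=> h0; apply: leq_trans h0 _; rewrite size_cat size_map hce leq_add2r.
have [L [pi [hpi hfrac]]] := residue_exists hQ.
have [w [hw hwe hgw]] := reg_quot_gens hT hQ hpi hfrac (ext_id J) (ext_id P) (ext_mono hJP) hD he.
(* Flatness expresses a relation over T by relations over A, whose coefficients the dual forms [lam]
   show to lie in [P]. *)
have hindep (x : 'I_mu -> T) : ext J (\sum_k x k * phi s`_k) -> forall k, Q (x k).
  move=> hx; have [|l [al [z [h1 h2]]]] := @flat_mod 'I_mu (fun k => s`_k) x J hf hJ.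
    by rewrite (eq_bigr (fun k => x k * phi s`_k)) // => k _; rewrite mulrC.
  move=> k; apply: hextPQ; rewrite h1; apply: isid_sum => // j _; apply: isidMr => //.
  apply: ext_in; apply/hpiP.
  have : lam k (\sum_(i < mu) s`_i * al i j) = 0 by exact: hlamJ.
  rewrite (eq_bigr (fun i : 'I_mu => al i j * s`_i)); last by move=> i _; rewrite mulrC.
  rewrite (@functional_sum _ _ _ piP hP _ _ _ _ (hlam k)); last first.
    by move=> i; apply: hsP; apply: mem_nth; rewrite hsz.
  rewrite (bigD1 k) //= hlams eqxx mulr1 big1 ?addr0 // => i hi.
  by rewrite hlams eq_sym (negbTE hi) mulr0.
(* Expressing [s] by [w] and [w] by [s] gives matrices whose product is, modulo [Q], the nonzero
   scalar u * v; its rank [mu] is at most the length of [w]. *)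
have hmuw : (mu <= size w)%N.
  have [||u hu hus] := @sat_common T Q (spn (ext J) w) mu (fun i => phi s`_i) hQ.
  - by auto.
  - by move=> i; apply: hgw; apply: ext_in; apply: hsP; apply: mem_nth; rewrite hsz.
  have [||v hv hvs] := @sat_common T Q (spn (ext J) (map phi s)) (size w) (fun i => w`_i) hQ.
  - by auto.
  - move=> i; have : ext P w`_i by apply: hw; exact: mem_nth.
    apply: ext_min => // x /hgs[r hr hx].
    exists (phi r); first by rewrite hcE.
    by rewrite -rmorphM; exact: ext_spn.
  have /choice[m hm] : forall i : 'I_mu, exists m : nat -> T,
      ext J (u * phi s`_i - \sum_(j < size w) m j * w`_j).
    by move=> i; have /gen_sumP[//|m _ hm] := hus i; exists m.
  have /choice[n hn] : forall j : 'I_(size w), exists n : nat -> T,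
      ext J (v * w`_j - \sum_(k < mu) n k * phi s`_k).
    move=> j; have /gen_sumP[//|n _] := hvs j; rewrite size_map hsz => hn; exists n.
    rewrite (eq_bigr (fun k : 'I_mu => n k * (map phi s)`_k)) // => k _.
    by rewrite (nth_map 0) // hsz.
  pose M : 'M[L]_(mu, size w) := \matrix_(i, j) pi (m i j).
  pose N : 'M[L]_(size w, mu) := \matrix_(j, k) pi (n j k).
  have hMN : M *m N = (pi (u * v))%:M.
    apply/matrixP => i k; rewrite !mxE.
    have /(_ k)/hpi : forall k : 'I_mu, Q ((u * v) * (i == k)%:R - \sum_(j < size w) m i j * n j k).
      apply: hindep.
      have -> : \sum_(k < mu) ((u * v) * (i == k)%:R - \sum_(j < size w) m i j * n j k) * phi s`_k
        = v * (u * phi s`_i - \sum_(j < size w) m i j * w`_j) +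
          \sum_(j < size w) m i j * (v * w`_j - \sum_(k < mu) n j k * phi s`_k).
        have e1 : \sum_(k < mu) (u * v * (i == k)%:R) * phi s`_k = u * v * phi s`_i.
          rewrite (bigD1 i) //= eqxx mulr1 big1 ?addr0 // => k' hk'.
          by rewrite eq_sym (negbTE hk') mulr0 mul0r.
        have e2 : \sum_(k < mu) (\sum_(j < size w) m i j * n j k) * phi s`_k =
            \sum_(j < size w) m i j * \sum_(k < mu) n j k * phi s`_k.
          rewrite (eq_bigr (fun k : 'I_mu => \sum_(j < size w) m i j * (n j k * phi s`_k))).
            by rewrite exchange_big; apply: eq_bigr => j _; rewrite mulr_sumr.
          by move=> k' _; rewrite mulr_suml; apply: eq_bigr => j _; rewrite mulrA.
        rewrite (eq_bigr (fun k : 'I_mu => (u * v * (i == k)%:R) * phi s`_k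
           - (\sum_(j < size w) m i j * n j k) * phi s`_k)); last by move=> k' _; rewrite mulrBl.
        rewrite sumrB e1 e2.
        rewrite [X in _ = _ + X](eq_bigr (fun j : 'I_(size w) => v * (m i j * w`_j)
           - m i j * \sum_(k < mu) n j k * phi s`_k)); last by move=> j _; ring.
        by rewrite sumrB -mulr_sumr; ring.
      apply: isidD; [by auto | by apply: isidM|].
      by apply: isid_sum => // j _; apply: isidM.
    rewrite rmorphB mulr_natr rmorphMn rmorph_sum => /eqP; rewrite subr_eq0 => /eqP.
    move=> ->; apply: eq_bigr => j _; by rewrite !mxE rmorphM.
  have : \rank (M *m N) = mu.
    rewrite hMN -scalemx1 mxrank_scale_nz ?mxrank1 //.
    by apply/eqP => /hpi; exact: primeNM.
  by move=> <-; apply: leq_trans (mxrankM_maxl _ _) (rank_leq_col _).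
have hhmu : (h <= mu)%N by have := gens_height hA hJ hsP hgs hh; rewrite hsz.
exists h; split=> //; exists s; split=> //; rewrite hsz; lia.
Qed.

(** One equation at a time: the solution of the others is substituted into the first one, which
    becomes a relation between the new unknowns [z]. *)
Lemma flat_sys m (I : finType) (M : 'I_m -> I -> A) (t : I -> T) : flat ->
  (forall e, \sum_i phi (M e i) * t i = 0) ->
  exists l (al : I -> 'I_l -> A) (z : 'I_l -> T),
    (forall i, t i = \sum_j phi (al i j) * z j) /\
    (forall e j, \sum_i M e i * al i j = 0).
Proof.
move=> hf; elim: m M => [|m IH] M h.
  have [|l [al [z [h1 h2]]]] := hf I (fun=> 0) t.
    by rewrite big1 // => i _; rewrite rmorph0 mul0r.
  by exists l, al, z; split=> //; case.
have [l [al [z [h1 h2]]]] := IH (fun e => M (lift ord0 e)) (fun e => h _).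
have [|k [be [w [h3 h4]]]] := hf _ (fun j : 'I_l => \sum_i M ord0 i * al i j) z.
  rewrite -[RHS](h ord0).
  rewrite (eq_bigr (fun j => \sum_i phi (M ord0 i) * (phi (al i j) * z j))).
    by rewrite exchange_big; apply: eq_bigr => i _; rewrite h1 mulr_sumr.
  by move=> j _; rewrite rmorph_sum mulr_suml; apply: eq_bigr => i _; rewrite rmorphM mulrA.
exists k, (fun i q => \sum_j al i j * be j q), w; split.
  move=> i; rewrite h1 (eq_bigr (fun j => \sum_q phi (al i j) * (phi (be j q) * w q))).
    rewrite exchange_big; apply: eq_bigr => q _.
    by rewrite rmorph_sum mulr_suml; apply: eq_bigr => j _; rewrite rmorphM mulrA.
  by move=> j _; rewrite h3 mulr_sumr.
move=> e q; have -> : \sum_i M e i * (\sum_j al i j * be j q) =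
    \sum_j (\sum_i M e i * al i j) * be j q.
  rewrite (eq_bigr (fun i => \sum_j M e i * (al i j * be j q))).
    rewrite exchange_big; apply: eq_bigr => j _.
    by rewrite mulr_suml; apply: eq_bigr => i _; rewrite mulrA.
  by move=> i _; rewrite mulr_sumr.
case: (unliftP ord0 e) => [e' ->|->]; last exact: h4.
by rewrite big1 // => j _; rewrite h2 mul0r.
Qed.

(** A solution over T is a homogeneous solution with last coordinate 1. By flatness this coordinate
    is a combination of last coordinates of solutions over A; the ideal they generate extends to the
    unit ideal, hence contains 1. *)
Lemma ffl_sys m (I : finType) (M : 'I_m -> I -> A) (b : 'I_m -> A) (t : I -> T) : faithfully_flat ->
  (forall e, \sum_i phi (M e i) * t i = phi (b e)) ->
  exists y : I -> A, forall e, \sum_i M e i * y i = b e.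
Proof.
move=> [hf hff] h.
pose M' e (i : I + 'I_1) := match i with inl i => M e i | inr _ => - b e end.
pose t' (i : I + 'I_1) := match i with inl i => t i | inr _ => 1 end.
have [|l [al [z [h1 h2]]]] := @flat_sys m _ M' t' hf.
  by move=> e; rewrite big_sumType /= big_ord1 h rmorphN mulr1 subrr.
pose J : set A := [set r | exists y : 'I_l -> A, r = \sum_j al (inr ord0) j * y j].
have hJ : isid J.
  split.
  - by exists (fun=> 0); rewrite big1 // => j _; rewrite mulr0.
  - move=> _ _ [y ->] [y' ->]; exists (fun j => y j + y' j).
    by rewrite -big_split; apply: eq_bigr => j _; rewrite mulrDr.
  - move=> a _ [y ->]; exists (fun j => a * y j); rewrite mulr_sumr.
    by apply: eq_bigr => j _; rewrite mulrCA.
have [|y hy] := hff J hJ.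
  rewrite -[1]/(t' (inr ord0)) h1; apply: isid_sum; first exact: ext_id.
  move=> j _; apply: isidMr; first exact: ext_id.
  apply: ext_in; exists (fun k => (k == j)%:R).
  rewrite (bigD1 j) //= eqxx mulr1 big1 ?addr0 // => k /negbTE->; by rewrite mulr0.
exists (fun i => \sum_j al (inl i) j * y j) => e.
rewrite -[RHS]mulr1 hy mulr_sumr.
rewrite (eq_bigr (fun i => \sum_j M e i * (al (inl i) j * y j))); last first.
  by move=> i _; rewrite mulr_sumr.
rewrite exchange_big; apply: eq_bigr => j _.
have := h2 e j; rewrite big_sumType /= big_ord1 mulNr => /subr0_eq.
by rewrite mulrA => <-; rewrite mulr_suml; apply: eq_bigr => i _; rewrite mulrA.
Qed.

End Flat.
#[export] Hint Resolve ext_id contr_id : isdb.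

(** * Integral extensions *)

Section Integral.
Variables (R T : comNzRingType) (eps : {rmorphism R -> T}).
Implicit Types (P Q : set T) (q : set R) (t : seq T).

(** T/P is generated by [t] as a module over R. *)
Definition finmod (P : set T) t :=
  forall x, exists c : nat -> R, P (x - \sum_(i < size t) eps (c i) * t`_i).

(** Determinant trick: multiplication by the adjugate shows that [\det r] kills every member of [t]
    modulo [P], and 1 is a combination of them. *)
Lemma det_kill P t n (r : 'M[R]_n) (c : 'I_n -> R) : size t = n -> isid P ->
  P (1 - \sum_i eps (c i) * t`_i) -> (forall i, P (\sum_j eps (r i j) * t`_j)) ->
  P (eps (\det r)).
Proof.
move=> ht hP h1 hr.
have hk (k : 'I_n) : P (eps (\det r) * t`_k).
  have -> : eps (\det r) * t`_k = \sum_i eps ((\adj r) k i) * (\sum_j eps (r i j) * t`_j).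
    rewrite (eq_bigr (fun i => \sum_j eps ((\adj r) k i * r i j) * t`_j)); last first.
      by move=> i _; rewrite mulr_sumr; apply: eq_bigr => j _; rewrite rmorphM mulrA.
    rewrite exchange_big (bigD1 k) //= [X in _ + X]big1 ?addr0 => [|j hj].
      rewrite -mulr_suml -rmorph_sum; congr (eps _ * _).
      have := mul_adj_mx r => /matrixP/(_ k k); rewrite !mxE eqxx mulr1n => <-.
      by [].
    rewrite -mulr_suml -rmorph_sum.
    have := mul_adj_mx r => /matrixP/(_ k j); rewrite !mxE eq_sym (negbTE hj) mulr0n => ->.
    by rewrite rmorph0 mul0r.
  by apply: isid_sum => // i _; apply: isidM.
have -> : eps (\det r) = eps (\det r) * (1 - \sum_i eps (c i) * t`_i) +
    \sum_i eps (c i) * (eps (\det r) * t`_i).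
  rewrite mulrBr mulr1 mulr_sumr.
  rewrite [X in _ = _ + X](eq_bigr (fun i : 'I_n => eps (\det r) * (eps (c i) * t`_i))).
    by rewrite subrK.
  by move=> i _; rewrite mulrCA.
apply: isidD => //; first exact: isidM.
by apply: isid_sum => // i _; apply: isidM.
Qed.

End Integral.

(** Cayley-Hamilton: the determinant trick is applied over {poly R}, with 'X acting as [x]. *)
Lemma integral (R T : comNzRingType) (eps : {rmorphism R -> T}) (P : set T) t x :
  isid P -> finmod eps P t ->
  exists n (c : nat -> R), P (x ^+ n + \sum_(i < n) eps (c i) * x ^+ i).
Proof.
move=> hP hf; set n := size t.
have /choice[r hr] : forall i : 'I_n, exists r : nat -> R,
    P (x * t`_i - \sum_(j < n) eps (r j) * t`_j) by move=> i; exact: hf.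
pose A : 'M[R]_n := \matrix_(i, j) r i j.
have [c hc] := hf 1.
have hcomm : commr_rmorph eps x by move=> a; exact: mulrC.
pose ev : {rmorphism {poly R} -> T} := horner_morph hcomm.
have evX : ev 'X = x by exact: horner_morphX.
have evC a : ev a%:P = eps a by exact: horner_morphC.
have hdet : P (ev (char_poly A)).
  apply: (@det_kill _ _ ev P t n _ (fun i => (c i)%:P)) => //.
    by rewrite (eq_bigr (fun i : 'I_n => eps (c i) * t`_i)) // => i _; rewrite evC.
  move=> i; suff -> : \sum_j ev (char_poly_mx A i j) * t`_j =
     x * t`_i - \sum_(j < n) eps (r i j) * t`_j by [].
  rewrite (eq_bigr (fun j : 'I_n => x *+ (i == j) * t`_j - eps (r i j) * t`_j)).
    rewrite sumrB; congr (_ - _); rewrite (bigD1 i) //= eqxx mulr1n big1 ?addr0 // => j hj.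
    by rewrite eq_sym (negbTE hj) mulr0n mul0r.
  by move=> j _; rewrite !mxE rmorphB evC rmorphMn /= evX mulrBl.
exists n, (fun i => (char_poly A)`_i).
move: hdet; rewrite /ev /= /horner_morph horner_coef size_map_poly_id0; last first.
  by rewrite (monicP (char_poly_monic A)) rmorph1 oner_eq0.
rewrite size_char_poly big_ord_recr /= !coef_map addrC.
move=> h; have e1 : eps (char_poly A)`_n = 1.
  by have := monicP (char_poly_monic A); rewrite lead_coefE size_char_poly => ->; exact: rmorph1.
suff <- : eps (char_poly A)`_n * x ^+ n + \sum_(i < n) (map_poly eps (char_poly A))`_i * x ^+ i
  = x ^+ n + \sum_(i < n) eps (char_poly A)`_i * x ^+ i by exact: h.
by rewrite e1 mul1r; congr (_ + _); apply: eq_bigr => i _; rewrite coef_map.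
Qed.

Section Integral2.
Variables (R T : comNzRingType) (eps : {rmorphism R -> T}).
Variables (P : set T) (t : seq T).
Hypotheses (hT : noeth T) (hP : isid P) (hf : finmod eps P t).

(** Take an integral equation, modulo [p], of an x in [p'] outside [p]. Its constant term lies in
    the contraction of [p'], hence of [p], and x can be cancelled until the degree is zero. *)
Lemma incomparable p p' : isprime p -> isprime p' -> P `<=` p -> p `<=` p' ->
  contr eps p' `<=` contr eps p -> p' `<=` p.
Proof.
move=> hp hp' hPp hpp' hc x hx; apply: contrapT => hxp.
have [n [c /hPp]] := integral x hP hf.
elim: n c => [|n IH] c; first by rewrite big_ord0 addr0 expr0; exact: prime1.
rewrite big_ord_recl expr0 mulr1 => h.
have hpi := prime_id hp; have hpi' := prime_id hp'.
have e0 : x ^+ n.+1 + \sum_(i < n) eps (c (lift ord0 i)) * x ^+ lift ord0 i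
   = x * (x ^+ n + \sum_(i < n) eps (c i.+1) * x ^+ i).
  rewrite mulrDr exprS; congr (_ + _); rewrite mulr_sumr; apply: eq_bigr => i _.
  by rewrite lift0 exprS mulrCA.
have e : x ^+ n.+1 + (eps (c ord0) + \sum_(i < n) eps (c (lift ord0 i)) * x ^+ lift ord0 i)
   = eps (c 0%N) + x * (x ^+ n + \sum_(i < n) eps (c i.+1) * x ^+ i).
  by rewrite -e0 addrCA.
rewrite e in h.
have hc0 : p (eps (c 0%N)).
  apply: hc; rewrite /contr /=.
  rewrite -[X in p' X](addrK (x * (x ^+ n + \sum_(i < n) eps (c i.+1) * x ^+ i))).
  by apply: isidB => //; [exact: hpp' | exact: isidMr].
apply: (IH (fun i => c i.+1)); apply: (primeMl hp hxp).
by rewrite -[X in p X](addKr (eps (c 0%N))) addrC; apply: isidB.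
Qed.

Lemma lying_over_fin p q : isprime p -> P `<=` p -> isprime q -> contr eps p `<=` q ->
  exists2 p', isprime p' & p `<=` p' /\ contr eps p' = q.
Proof.
move=> hp hPp hq hpq; have hpi := prime_id hp; have hqi := prime_id hq.
pose I : set T := ideal_gen (p `|` ext eps q).
have hI : isid I by exact: ideal_gen_id.
have hpI : p `<=` I by move=> x hx; apply: ideal_gen_sub; left.
have hqI x : q x -> I (eps x) by move=> hx; apply: ideal_gen_sub; right; exact: ext_in.
set n := size t.
(* The elements of T whose coefficients on [t] modulo [p] can be chosen in [q]; they include p +
   qT. *)
pose W : set T := [set x | exists c : nat -> R, (forall i, q (c i)) /\
   p (x - \sum_(i < n) eps (c i) * t`_i)].
have hWD x y : W x -> W y -> W (x + y).
  move=> [c [hc hx]] [d [hd hy]]; exists (fun i => c i + d i); split.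
    by move=> i; exact: isidD.
  rewrite (_ : _ - _ = (x - \sum_(i < n) eps (c i) * t`_i) + (y - \sum_(i < n) eps (d i) * t`_i)).
    exact: isidD.
  rewrite addrACA -opprD -big_split; congr (_ - _); apply: eq_bigr => i _.
  by rewrite rmorphD mulrDl.
have hWp x : p x -> W x.
  move=> hx; exists (fun=> 0); split=> [_|]; first exact: isid0.
  by rewrite big1 ?subr0 // => i _; rewrite rmorph0 mul0r.
have hWq a y : q a -> W (eps a * y).
  move=> ha; have [c /hPp hc] := hf y; exists (fun i => a * c i); split.
    by move=> i; exact: isidMr.
  rewrite (_ : _ - _ = eps a * (y - \sum_(i < n) eps (c i) * t`_i)); first exact: isidM.
  rewrite mulrBr mulr_sumr; congr (_ - _); apply: eq_bigr => i _.
  by rewrite rmorphM mulrA.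
have hWI : I `<=` W.
  move=> x [k [c [e [he ->]]]]; apply: big_ind => //; first by apply: hWp; exact: isid0.
  move=> i _; case: (he i) => [hpe|[k' [c' [e' [he' ->]]]]].
    by apply: hWp; exact: isidM.
  rewrite mulr_sumr; apply: big_ind => //; first by apply: hWp; exact: isid0.
  by move=> j _; have [a ha <-] := he' j; rewrite mulrA mulrC; exact: hWq.
have [|||p' hp' [h1 h2]] := @prime_avoid_mult T I (eps @` [set s | ~ q s]) hT hI.
- by exists 1; [exact: prime1 | rewrite rmorph1].
- move=> _ _ [s hs <-] [s' hs' <-]; exists (s * s'); [exact: primeNM | by rewrite rmorphM].
(* If eps s were in p + qT, the matrix of s minus coefficients in [q] would have its determinant in
   [q]; modulo [q] that determinant is a power of s. *)
- move=> _ [s hs <-] hsI.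
  have /choice[r hr] : forall i : 'I_n, exists r : nat -> R, (forall j, q (r j)) /\
      p (eps s * t`_i - \sum_(j < n) eps (r j) * t`_j).
    by move=> i; apply: hWI; apply: isidMr.
  pose A : 'M[R]_n := \matrix_(i, j) (s *+ (i == j) - r i j).
  have [c /hPp hc] := hf 1.
  have : p (eps (\det A)).
    apply: (@det_kill _ _ eps p t n A (fun i => c i)) => // i.
    rewrite (eq_bigr (fun j : 'I_n => eps s *+ (i == j) * t`_j - eps (r i j) * t`_j)).
      rewrite sumrB (bigD1 i) //= eqxx mulr1n big1 ?addr0; first by case: (hr i).
      by move=> j hj; rewrite eq_sym (negbTE hj) mulr0n mul0r.
    by move=> j _; rewrite !mxE rmorphB rmorphMn mulrBl.
  move=> /hpq; have [L [pi [hpiq _]]] := residue_exists hq => /hpiq.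
  rewrite -det_map_mx; have -> : map_mx pi A = (pi s)%:M.
    apply/matrixP => i j; rewrite !mxE rmorphB rmorphMn.
    by rewrite (_ : pi (r i j) = 0) ?subr0 //; apply/hpiq; case: (hr i).
  by rewrite det_scalar => /eqP; rewrite expf_eq0 => /andP[_ /eqP /hpiq].
exists p' => //; split; first by move=> x /hpI /h1.
apply: seteqI => x hx; last by apply: h1; exact: hqI.
by apply: contrapT => hxq; apply: (h2 (eps x)) => //; exists x.
Qed.

Lemma height_ge_contr p p' n : P `<=` p -> height_ge p p' n -> height_ge (contr eps p) (contr eps p') n.
Proof.
move=> hPp; elim: n p' => [|n IH] p' /= [hp' hs].
  by split; [exact: contr_prime | move=> x /hs].
have [p1 [h1 h2 h3]] := hs; split; first exact: contr_prime.
exists (contr eps p1); split; [exact: IH | by move=> x /h2 |].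
move=> h; apply: h3; apply: incomparable h => //; first exact: height_ge_prime h1.
by move=> x /hPp; exact: height_ge_sub h1 x.
Qed.

Lemma height_ge_up_fin p q n : isprime p -> P `<=` p -> height_ge (contr eps p) q n ->
  exists2 p', height_ge p p' n & contr eps p' = q.
Proof.
move=> hp hPp; elim: n q => [|n IH] q /= [hq hs].
  have [p' hp' [h1 h2]] := lying_over_fin hp hPp hq hs; by exists p'.
have [q1 [h1 h2 h3]] := hs; have [p1 hp1 hc1] := IH q1 h1.
have hPp1 : P `<=` p1 by move=> x /hPp; exact: height_ge_sub hp1 x.
have [|p' hp' [h4 h5]] := lying_over_fin (height_ge_prime hp1) hPp1 hq; first by rewrite hc1.
exists p' => //; split=> //; exists p1; split=> // h; apply: h3.
by rewrite -hc1 -h5 => x /h.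
Qed.

End Integral2.

Lemma noeth_spn (R : comNzRingType) (I : set R) (F : seq R) :
  isid I -> (forall f, f \in F -> I f) -> I `<=` spn (@zid R) F -> I = spn (@zid R) F.
Proof. by move=> hI hF h; apply: seteqI => //; apply: spn_min => //; exact: zid_sub. Qed.

(** * Polynomials and power series *)

Section HilbertPoly.
Variable R : comNzRingType.

(** Hilbert's argument: [L k] collects the coefficients in degree k of members of the ideal of
    degree at most k. Beyond the stationary index [k0], multiples by powers of 'X of the generators
    for [L k0] suffice. *)
Lemma noeth_poly : noeth R -> noeth {poly R}.
Proof.
move=> hR I hI.
pose L k : set R := [set c | exists p : {poly R}, [/\ I p, (size p <= k.+1)%N & p`_k = c]].
have hL k : isid (L k).
  split.
  - by exists 0; split; [exact: isid0 | rewrite size_poly0 | rewrite coef0].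
  - move=> _ _ [p [hp hsp <-]] [q [hq hsq <-]]; exists (p + q); split.
    + exact: isidD.
    + by apply: leq_trans (size_polyD _ _) _; rewrite geq_max hsp.
    + by rewrite coefD.
  - move=> a _ [p [hp hsp <-]]; exists (a%:P * p); split.
    + exact: isidM.
    + by rewrite mul_polyC; apply: leq_trans (size_scale_leq _ _) hsp.
    + by rewrite coefCM.
have hLS k : L k `<=` L k.+1.
  move=> _ [p [hp hsp <-]]; exists (p * 'X); split.
  - exact: isidMr.
  - have [->|p0] := eqVneq p 0; first by rewrite mul0r size_poly0.
    by rewrite size_mulX.
  - by rewrite coefMX.
have [k0 hk0] := noeth_acc hR hL hLS.
have /choice[c hc] : forall k, exists c, L k = spn (@zid R) c by move=> k; exact: hR.
have /choice[g hg] : forall kc : nat * R, exists p : {poly R}, L kc.1 kc.2 ->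
    [/\ I p, (size p <= kc.1.+1)%N & p`_(kc.1) = kc.2].
  by move=> [k x]; have [[p hp]|h] := pselect (L k x); [exists p | exists 0].
pose G k := [seq g (k, x) | x <- c k].
have hcL k x : x \in c k -> L k x by rewrite hc; exact: spn_mem.
have hG k x : L k x -> exists p : {poly R}, [/\ spn (@zid _) (G k) p, (size p <= k.+1)%N & p`_k = x].
  rewrite {1}hc.
  apply: (@spn_min _ [set x | exists p : {poly R}, [/\ spn (@zid _) (G k) p, (size p <= k.+1)%N & p`_k = x]]).
  - split.
    + by exists 0; split; [exact: isid0 | rewrite size_poly0 | rewrite coef0].
    + move=> _ _ [p [hp hsp <-]] [q [hq hsq <-]]; exists (p + q); split.
      * exact: isidD.
      * by apply: leq_trans (size_polyD _ _) _; rewrite geq_max hsp.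
      * by rewrite coefD.
    + move=> a _ [p [hp hsp <-]]; exists (a%:P * p); split.
      * exact: isidM.
      * by rewrite mul_polyC; apply: leq_trans (size_scale_leq _ _) hsp.
      * by rewrite coefCM.
  - by move=> _ ->; exists 0; split; [exact: isid0 | rewrite size_poly0 | rewrite coef0].
  - move=> a ha; have [h1 h2 h3] := hg (k, a) (hcL k a ha).
    by exists (g (k, a)); split=> //; apply: spn_mem => //; exact: (map_f (fun x => g (k, x))).
have hGI k f : f \in G k -> I f.
  by move=> /mapP[x hx ->]; case: (hg (k, x) (hcL k x hx)).
pose F := flatten [seq G k | k <- iota 0 k0.+1].
have hGF k : (k <= k0)%N -> {subset G k <= F}.
  move=> hk f hf; apply/flattenP; exists (G k) => //.
  by apply: map_f; rewrite mem_iota.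
exists F; apply: noeth_spn => //.
  by move=> f /flattenP[s /mapP[k _ ->]]; exact: hGI.
move=> p hp; move: (leqnn (size p)); move: {2}(size p) => n.
elim: n p hp => [|n IH] p hp hsp.
  by move: hsp; rewrite size_poly_leq0 => /eqP->; exact: isid0.
pose k := minn n k0.
have [q [hq hsq hqn]] : exists q : {poly R}, [/\ spn (@zid _) (G k) q, (size q <= k.+1)%N & q`_k = p`_n].
  apply: hG; rewrite /k; have hLn : L n p`_n by exists p.
  by case: (leqP n k0) => h; [exact: hLn | exact: hk0 hLn].
have hqF : spn (@zid _) F q by apply: spn_sub hq => //; apply: hGF; exact: geq_minr.
have hqI : I q by apply: spn_min hq => //; [exact: zid_sub | exact: hGI].
rewrite -(subrK ('X^(n - k) * q) p); apply: isidD => //; last exact: isidM.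
apply: IH; first by apply: isidB => //; exact: isidM.
have hkn : (k <= n)%N by exact: geq_minl.
have hs : (size (p - 'X^(n - k) * q)%R <= n.+1)%N.
  apply: leq_trans (size_polyD _ _) _; rewrite geq_max hsp size_polyN.
  apply: leq_trans (size_polyMleq _ _) _; rewrite size_polyXn addSn /=.
  by have := leq_add (leqnn (n - k)) hsq; rewrite addnS subnK.
apply/leq_sizeP => j; rewrite leq_eqVlt => /predU1P[<-|hj]; last first.
  by move/leq_sizeP: hs; apply.
rewrite coefB mulrC coefMXn ltnNge leq_subr /= subKn // hqn subrr //.
Qed.

End HilbertPoly.

Section FormalSeries.
Variable R : comNzRingType.

Definition fps : Type := nat -> R.
HB.instance Definition _ := gen_eqMixin fps.
HB.instance Definition _ := gen_choiceMixin fps.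

Implicit Types f g h : fps.

Definition fps_C (a : R) : fps := fun n => if n is 0%N then a else 0.
Definition fps_add f g : fps := fun n => f n + g n.
Definition fps_opp f : fps := fun n => - f n.
Definition fps_mul f g : fps := fun n => \sum_(i < n.+1) f i * g (n - i)%N.

Lemma fps_addA : associative fps_add.
Proof. by move=> f g h; apply: funext => n; rewrite /fps_add addrA. Qed.
Lemma fps_addC : commutative fps_add.
Proof. by move=> f g; apply: funext => n; rewrite /fps_add addrC. Qed.
Lemma fps_add0 : left_id (fps_C 0) fps_add.
Proof. by move=> f; apply: funext => -[|n]; rewrite /fps_add add0r. Qed.
Lemma fps_addN : left_inverse (fps_C 0) fps_opp fps_add.
Proof. by move=> f; apply: funext => -[|n]; rewrite /fps_add addNr. Qed.

HB.instance Definition _ := GRing.isZmodule.Build fps fps_addA fps_addC fps_add0 fps_addN.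

(** Truncation to a polynomial, through which commutativity and associativity of the product are
    inherited from {poly R}. *)
Definition fps_tr n f : {poly R} := \poly_(i < n.+1) f i.
Lemma fps_mul_tr n f g k : (k <= n)%N ->
  fps_mul f g k = (fps_tr n f * fps_tr n g)`_k.
Proof.
move=> hk; rewrite coefM; apply: eq_bigr => i _; rewrite !coef_poly.
by rewrite (leq_trans (ltn_ord i) _) ?ltnS // (leq_trans (leq_subr _ _) hk).
Qed.

Lemma fps_mulC : commutative fps_mul.
Proof. by move=> f g; apply: funext => n; rewrite !(fps_mul_tr _ _ (leqnn n)) mulrC. Qed.

Lemma fps_mulA : associative fps_mul.
Proof.
move=> f g h; apply: funext => n.
have -> : fps_mul (fps_mul f g) h n = (fps_tr n f * fps_tr n g * fps_tr n h)`_n.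
  rewrite [RHS]coefM; apply: eq_bigr => i _; rewrite (@fps_mul_tr n) -1?ltnS //.
  by rewrite [in RHS]coef_poly ltnS leq_subr.
rewrite -mulrA [RHS]coefM; apply: eq_bigr => i _; rewrite (@fps_mul_tr n) ?leq_subr //.
by rewrite [in RHS]coef_poly ltn_ord.
Qed.

Lemma fps_mulCl a f n : fps_mul (fps_C a) f n = a * f n.
Proof.
rewrite /fps_mul big_ord_recl /= subn0 big1 ?addr0 // => i _.
by rewrite mul0r.
Qed.

Lemma fps_mul1 : left_id (fps_C 1) fps_mul.
Proof. by move=> f; apply: funext => n; rewrite fps_mulCl mul1r. Qed.

Lemma fps_mulD : left_distributive fps_mul fps_add.
Proof.
move=> f g h; apply: funext => n; rewrite /fps_add /fps_mul -big_split.
by apply: eq_bigr => i _; rewrite mulrDl.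
Qed.

Lemma fps_one_neq0 : fps_C 1 != fps_C 0.
Proof. by apply/eqP => /(congr1 (fun f : fps => f 0%N)) /eqP; rewrite oner_eq0. Qed.

HB.instance Definition _ := GRing.Zmodule_isComNzRing.Build fps
  fps_mulA fps_mulC fps_mul1 fps_mulD fps_one_neq0.

Lemma fpsD f g n : (f + g) n = f n + g n. Proof. by []. Qed.
Lemma fpsB f g n : (f - g) n = f n - g n. Proof. by []. Qed.
Lemma fpsM f g n : (f * g) n = \sum_(i < n.+1) f i * g (n - i)%N. Proof. by []. Qed.
Lemma fps0 n : (0 : fps) n = 0. Proof. by case: n. Qed.
Lemma fps_sum (I : Type) (r : seq I) (P : pred I) (F : I -> fps) n :
  (\sum_(i <- r | P i) F i) n = \sum_(i <- r | P i) F i n.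
Proof. by apply: (big_morph (fun f : fps => f n)) => //; exact: fps0. Qed.

Lemma fps_C_zmod : zmod_morphism fps_C.
Proof. by move=> a b; apply: funext => -[|n]; rewrite fpsB /= ?subr0. Qed.
Lemma fpsCM a f n : (fps_C a * f) n = a * f n.
Proof. exact: fps_mulCl. Qed.
Lemma fps_C_monoid : monoid_morphism fps_C.
Proof. by split=> // a b; apply: funext => -[|n]; rewrite fpsCM //= mulr0. Qed.
HB.instance Definition _ := GRing.isZmodMorphism.Build R fps fps_C fps_C_zmod.
HB.instance Definition _ := GRing.isMonoidMorphism.Build R fps fps_C fps_C_monoid.

Definition fps_0 f : R := f 0%N.
Lemma fps_0_zmod : zmod_morphism fps_0. Proof. by []. Qed.
Lemma fps_0_monoid : monoid_morphism fps_0.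
Proof. by split=> // f g; rewrite /fps_0 fpsM big_ord_recl big_ord0 addr0. Qed.
HB.instance Definition _ := GRing.isZmodMorphism.Build fps R fps_0 fps_0_zmod.
HB.instance Definition _ := GRing.isMonoidMorphism.Build fps R fps_0 fps_0_monoid.

Definition fps_X : fps := fun n => (n == 1%N)%:R.
Lemma fpsXM f n : (fps_X * f) n = if n is k.+1 then f k else 0.
Proof.
rewrite fpsM; case: n => [|n]; first by rewrite big_ord_recl big_ord0 mul0r addr0.
rewrite big_ord_recl mul0r add0r big_ord_recl mul1r /= subn1 /= big1 ?addr0 // => i _.
by rewrite mul0r.
Qed.

Lemma fpsXnM k f n : (fps_X ^+ k * f) n = if (n < k)%N then 0 else f (n - k)%N.
Proof.
elim: k n => [|k IH] n; first by rewrite expr0 mul1r subn0.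
by rewrite exprS -mulrA fpsXM; case: n => [|n] //; rewrite IH ltnS subSS.
Qed.

Lemma fps_shift f : f = fps_C (f 0%N) + fps_X * (fun n => f n.+1 : R).
Proof.
apply: funext => n; rewrite fpsD fpsXM; case: n => [|n] /=; first by rewrite addr0.
by rewrite add0r.
Qed.

Lemma fps1S n : (1 : fps) n.+1 = 0. Proof. by []. Qed.

Definition fps_trunc m f : fps := fun n => if (n < m)%N then f n else 0.
Lemma fps_truncS m f : fps_trunc m.+1 f = fps_trunc m f + fps_C (f m) * fps_X ^+ m.
Proof.
apply: funext => n; rewrite fpsD fpsCM -[fps_X ^+ m]mulr1 fpsXnM /fps_trunc ltnS.
case: (ltngtP n m) => h /=; first by rewrite mulr0 addr0.
  by rewrite -(subnSK h) fps1S add0r mulr0.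
by rewrite h subnn /= add0r mulr1.
Qed.

Lemma fps_decomp m f : exists g, f = fps_trunc m f + fps_X ^+ m * g.
Proof.
exists (fun n => f (n + m)%N); apply: funext => n; rewrite fpsD fpsXnM /fps_trunc.
by case: ltnP => h; [rewrite addr0 | rewrite add0r subnK].
Qed.

(** Hilbert's argument with lowest coefficients: [L k] collects the coefficients in degree k of
    members of order at least k. *)
Lemma noeth_fps : noeth R -> noeth fps.
Proof.
move=> hR I hI.
pose ok k f := I f /\ forall i, (i < k)%N -> f i = 0.
pose L k : set R := [set c | exists2 f, ok k f & f k = c].
have okD k f g : ok k f -> ok k g -> ok k (f + g).
  move=> [h1 h2] [h3 h4]; split; first exact: isidD.
  by move=> i hi; rewrite fpsD h2 ?h4 ?addr0.
have okC k a f : ok k f -> ok k (fps_C a * f).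
  move=> [h1 h2]; split; first exact: isidM.
  by move=> i hi; rewrite fpsCM h2 ?mulr0.
have ok0 k : ok k 0 by split; [exact: isid0 | move=> i _; exact: fps0].
have okX k m f : ok k f -> ok (m + k)%N (fps_X ^+ m * f).
  move=> [h1 h2]; split; first exact: isidM.
  move=> i hi; rewrite fpsXnM; case: ltnP => // him; apply: h2; lia.
have hL k : isid (L k).
  split; first by exists 0; [exact: ok0 | exact: fps0].
  - by move=> _ _ [f hf <-] [g hg <-]; exists (f + g); [exact: okD | ].
  - by move=> a _ [f hf <-]; exists (fps_C a * f); [exact: okC | rewrite fpsCM].
have hLS k : L k `<=` L k.+1.
  move=> _ [f hf <-]; exists (fps_X ^+ 1 * f); first exact: (okX k 1%N).
  by rewrite fpsXnM /= subn1.
have [k0 hk0] := noeth_acc hR hL hLS.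
have /choice[c hc] : forall k, exists c, L k = spn (@zid R) c by move=> k; exact: hR.
have /choice[g hg] : forall kc : nat * R, exists f, L kc.1 kc.2 -> ok kc.1 f /\ f kc.1 = kc.2.
  by move=> [k x]; have [[p hp hp']|h] := pselect (L k x); [exists p | exists 0].
pose G k := [seq g (k, x) | x <- c k].
have hcL k x : x \in c k -> L k x by rewrite hc; exact: spn_mem.
have hGnth k j : (j < size (c k))%N -> (G k)`_j = g (k, (c k)`_j).
  by move=> hj; rewrite (nth_map 0).
have hG k x : L k x -> exists a : nat -> R,
    let p := \sum_(j < size (c k)) fps_C (a j) * (G k)`_j in ok k p /\ p k = x.
  rewrite {1}hc => /gen_sumP[//|a _ ha]; exists a => /=.
  have hj (j : 'I_(size (c k))) : ok k (G k)`_j /\ (G k)`_j k = (c k)`_j.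
    by rewrite hGnth //; apply: (hg (k, _)); apply: hcL; exact: mem_nth.
  split; first by elim/big_ind: _ => // [|j _]; [exact: okD | apply: okC; case: (hj j)].
  rewrite fps_sum; move: ha => /subr0_eq->.
  by apply: eq_bigr => j _; rewrite fpsCM (hj j).2.
have hGI k f : f \in G k -> I f.
  by move=> /mapP[x hx ->]; case: (hg (k, x) (hcL k x hx)) => -[].
have hGs k a : spn (@zid fps) (G k) (\sum_(j < size (c k)) fps_C (a j) * (G k)`_j).
  apply: isid_sum => // j _; apply: isidM => //; apply: spn_mem => //; apply: mem_nth.
  by rewrite size_map.
pose F := flatten [seq G k | k <- iota 0 k0.+1].
have hGF k : (k <= k0)%N -> {subset G k <= F}.
  move=> hk f hf; apply/flattenP; exists (G k) => //.
  by apply: map_f; rewrite mem_iota.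
(* From order [k0] on, the corrections do not terminate, but each generator receives one new
   coefficient per degree, and these form the power series [A j]. *)
have hlast f : ok k0 f -> spn (@zid fps) (G k0) f.
  move=> hf; pose r := size (c k0).
  have /choice[a ha] : forall mf : nat * fps, exists a : nat -> R, ok (k0 + mf.1)%N mf.2 ->
      ok (k0 + mf.1).+1 (mf.2 - \sum_(j < r) fps_C (a j) * fps_X ^+ mf.1 * (G k0)`_j).
    move=> [m h]; have [hh|hh] := pselect (ok (k0 + m)%N h); last by exists (fun=> 0).
    have hLm : L (k0 + m)%N (h (k0 + m)%N) by exists h.
    have [a /= [ha1 ha2]] := hG k0 _ (hk0 _ _ hLm); exists a => _ /=.
    have -> : \sum_(j < r) fps_C (a j) * fps_X ^+ m * (G k0)`_j =
       fps_X ^+ m * \sum_(j < r) fps_C (a j) * (G k0)`_j.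
      by rewrite mulr_sumr; apply: eq_bigr => j _; rewrite mulrCA mulrA.
    have [hI1 hz1] := hh; have [hI2 hz2] := okX _ m _ ha1; split.
      by apply: isidB.
    move=> i; rewrite ltnS leq_eqVlt fpsB => /predU1P[->|hi].
      by rewrite fpsXnM ltnNge leq_addl /= addnK ha2 subrr.
    by rewrite hz1 // hz2 1?addnC // subrr.
  pose fix fm m := if m is m'.+1 then
    fm m' - \sum_(j < r) fps_C (a (m', fm m') j) * fps_X ^+ m' * (G k0)`_j else f.
  have hfm m : ok (k0 + m)%N (fm m).
    elim: m => [|m IH]; first by rewrite addn0.
    by rewrite addnS; exact: (ha (m, fm m)).
  pose A j : fps := fun m => a (m, fm m) j.
  have hfmE m : fm m = f - \sum_(j < r) fps_trunc m (A j) * (G k0)`_j.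
    elim: m => [|m IH] /=.
      rewrite big1 ?subr0 // => j _; rewrite (_ : fps_trunc 0 _ = 0) ?mul0r //.
      by apply: funext => n; rewrite fps0.
    rewrite [X in X - _]IH -addrA -opprD -big_split; congr (_ - _); apply: eq_bigr => j _.
    by rewrite fps_truncS mulrDl.
  suff -> : f = \sum_(j < r) A j * (G k0)`_j.
    apply: isid_sum => // j _; apply: isidM => //; apply: spn_mem => //; apply: mem_nth.
    by rewrite size_map.
  apply: funext => n; have [_ /(_ n)] := hfm n.+1.
  rewrite hfmE fpsB => /(_ _)/subr0_eq -> //; last by rewrite addnS ltnS leq_addl.
  rewrite !fps_sum; apply: eq_bigr => j _; rewrite !fpsM; apply: eq_bigr => i _.
  by rewrite /fps_trunc ltn_ord.
exists F; apply: noeth_spn => //.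
  by move=> f /flattenP[s /mapP[k _ ->]]; exact: hGI.
suff key d f : (d <= k0)%N -> ok (k0 - d)%N f -> spn (@zid fps) F f.
  by move=> f hf; apply: (key k0) => //; rewrite subnn; split.
elim: d f => [|d IH] f hd hf.
  by apply: spn_sub (hlast f _) => //; [exact: hGF | rewrite subn0 in hf].
set k := (k0 - d.+1)%N in hf *.
have [|a /= [[hI1 hz1] hk1]] := hG k (f k); first by exists f.
set p := (\sum_(j < _) _) in hI1 hz1 hk1.
have hkd : (k0 - d)%N = k.+1 by rewrite /k subnSK.
rewrite -(subrK p f); apply: isidD => //.
  apply: IH; first exact: ltnW.
  rewrite hkd; have [hI0 hz0] := hf; split; first exact: isidB.
  move=> i; rewrite ltnS leq_eqVlt fpsB => /predU1P[->|hi]; first by rewrite hk1 subrr.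
  by rewrite hz0 // hz1 // subrr.
by apply: spn_sub (hGs k a) => //; apply: hGF; exact: leq_subr.
Qed.

End FormalSeries.

(** * Artin-Rees and Krull's intersection theorem *)

Section Vectors.
Variable (R : comNzRingType).

Section Module.
Variable (M : lmodType R).
Definition submod (V : set M) :=
  [/\ V 0, (forall x y, V x -> V y -> V (x + y)) & (forall a x, V x -> V (a *: x))].

Lemma submod_sum (V : set M) (I : Type) (r : seq I) (p : pred I) (F : I -> M) :
  submod V -> (forall i, p i -> V (F i)) -> V (\sum_(i <- r | p i) F i).
Proof. by move=> [h0 hD _] hF; apply: big_ind. Qed.

Lemma submodN (V : set M) x : submod V -> V x -> V (- x).
Proof. by move=> [_ _ h] hx; rewrite -scaleN1r; exact: h. Qed.
Lemma submodB (V : set M) x y : submod V -> V x -> V y -> V (x - y).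
Proof. by move=> hV hx hy; have [_ h _] := hV; apply: h => //; exact: submodN. Qed.

Definition prodV (I : set R) (V : set M) : set M := fun x =>
  exists (J : finType) (c : J -> R) (w : J -> M),
    [/\ forall i, I (c i), forall i, V (w i) & x = \sum_i c i *: w i].
End Module.

(** Induction on the rank: generators of the ideal of first coordinates, and generators of the part
    with first coordinate zero. *)
Lemma noeth_vec n (V : set 'rV[R]_n) : noeth R -> submod V ->
  exists s : seq 'rV[R]_n, (forall x, x \in s -> V x) /\
    forall x, V x -> exists c : nat -> R, x = \sum_(i < size s) c i *: s`_i.
Proof.
move=> hR; elim: n V => [|n IH] V hV; have [h0 hD hZ] := hV.
  exists [::]; split=> // x _; exists (fun=> 0); rewrite big_ord0; exact: thinmx0.
pose I : set R := [set a | exists2 x, V x & x 0 ord0 = a].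
have hI : isid I.
  split; first by exists 0; rewrite ?mxE.
  - by move=> _ _ [x hx <-] [y hy <-]; exists (x + y); [exact: hD | rewrite mxE].
  - by move=> a _ [x hx <-]; exists (a *: x); [exact: hZ | rewrite mxE].
have [s hs] := hR _ hI.
have /choice[f hf] : forall a, exists x, I a -> V x /\ x 0 ord0 = a.
  by move=> a; have [[x hx e]|h] := pselect (I a); [exists x | exists 0].
pose lft (y : 'rV[R]_n) : 'rV[R]_n.+1 := \row_i oapp (y 0) 0 (unlift ord0 i).
have lft0 : lft 0 = 0 by apply/rowP => i; rewrite !mxE; case: (unlift _ _) => //= j; rewrite mxE.
have lftD y z : lft (y + z) = lft y + lft z.
  by apply/rowP => i; rewrite !mxE; case: (unlift _ _) => [j|] /=; rewrite ?mxE ?addr0.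
have lftZ a y : lft (a *: y) = a *: lft y.
  by apply/rowP => i; rewrite !mxE; case: (unlift _ _) => [j|] /=; rewrite ?mxE ?mulr0.
have [|s' [hs' hgen]] := IH [set y | V (lft y)].
  split => /=; first by rewrite lft0.
  - by move=> x y hx hy; rewrite lftD; exact: hD.
  - by move=> a x hx; rewrite lftZ; exact: hZ.
exists (map f s ++ map lft s'); split.
  move=> x; rewrite mem_cat => /orP[/mapP[a ha ->]|/mapP[y hy ->]]; last exact: hs'.
  by case: (hf a) => //; rewrite hs; exact: spn_mem.
move=> x hx; have : I (x 0 ord0) by exists x.
rewrite hs => /gen_sumP[//|c _ /subr0_eq hc].
have hfs i : (i < size s)%N -> V (f s`_i) /\ (f s`_i) 0 ord0 = s`_i.
  by move=> hi; apply: hf; rewrite hs; apply: spn_mem => //; exact: mem_nth.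
set y := x - \sum_(i < size s) c i *: f s`_i.
have hy : V y.
  apply: submodB => //; apply: submod_sum => // i _; apply: (hZ).
  by case: (hfs i).
have ey : y = lft (\row_i y 0 (lift ord0 i)).
  apply/rowP => i; rewrite [RHS]mxE; case: unliftP => [j ->|->] /=; first by rewrite mxE.
  rewrite /y 2!mxE summxE hc; apply/eqP; rewrite subr_eq0; apply/eqP.
  by apply: eq_bigr => k _; rewrite mxE; case: (hfs k) => // _ ->.
have [d hd] : exists d : nat -> R, \row_i y 0 (lift ord0 i) = \sum_(i < size s') d i *: s'`_i.
  by apply: hgen; rewrite /= -ey.
exists (fun i => if (i < size s)%N then c i else d (i - size s)%N).
have -> : x = \sum_(i < size s) c i *: f s`_i + y by rewrite /y addrC subrK.
rewrite size_cat !size_map big_split_ord /=; congr (_ + _).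
  apply: eq_bigr => i _; rewrite ltn_ord nth_cat size_map ltn_ord (nth_map 0) //.
rewrite ey hd.
have -> : lft (\sum_(i < size s') d i *: s'`_i) = \sum_(i < size s') d i *: lft s'`_i.
  apply: (big_ind2 (fun a b => lft a = b)) => //.
    by move=> a b a' b' <- <-; exact: lftD.
apply: eq_bigr => i _; rewrite ltnNge leq_addr /= addKn nth_cat size_map ltnNge leq_addr /= addKn.
by rewrite (nth_map 0).
Qed.
End Vectors.

(** The Rees algebra of [I] appears as the image of [psi]; only the iterated polynomial ring [W]
    above it has to be Noetherian. *)
Lemma rees_ring (A : comNzRingType) (I : set A) (s : seq A) : noeth A -> isid I ->
  (forall a, a \in s -> I a) ->
  exists (W : comNzRingType) (psi : {rmorphism W -> {poly A}}),
    [/\ noeth W, forall w i, pw I i (psi w)`_i, forall a, exists w, psi w = a%:P &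
        forall a, a \in s -> exists w, psi w = a%:P * 'X].
Proof.
move=> hA hI; elim: s => [|a s IH] hs.
  exists A, (@polyC A : {rmorphism A -> {poly A}}); split=> //.
  - by move=> w i; rewrite coefC; case: i => [|i] //=; exact: isid0.
  - by move=> a; exists a.
have [|W [psi [hW h1 h2 h3]]] := IH; first by move=> b hb; apply: hs; rewrite inE hb orbT.
have hcomm : commr_rmorph psi (a%:P * 'X) by move=> b; exact: mulrC.
pose ev : {rmorphism {poly W} -> {poly A}} := horner_morph hcomm.
have evX : ev 'X = a%:P * 'X by exact: horner_morphX.
have evC b : ev b%:P = psi b by exact: horner_morphC.
exists {poly W}, ev; split.
- exact: noeth_poly.
- apply: (poly_ind (K := fun w => forall i, pw I i (ev w)`_i)) => [i|p c IHp i].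
    by rewrite rmorph0 coef0; exact: isid0.
  have -> : ev (p * 'X + c%:P) = a%:P * (ev p * 'X) + psi c.
    by rewrite rmorphD rmorphM evC evX mulrCA.
  rewrite coefD coefCM coefMX; apply: isidD => //.
  case: i => [//|i] /=.
  apply: pwS => //; apply: hs; exact: mem_head.
- by move=> b; have [w hw] := h2 b; exists w%:P; rewrite evC.
- move=> b; rewrite inE => /predU1P[->|/h3[w hw]]; last by exists w%:P; rewrite evC.
  by exists 'X.
Qed.

(** The weak form, which is enough for Krull's theorem and for flatness: what [V] has in common with
    a high power of [I] lies in I V. *)
Lemma artin_rees (A : comNzRingType) n (I : set A) (V : set 'rV[A]_n) :
  noeth A -> isid I -> submod V ->
  exists D, forall v, V v -> (forall i, pw I D (v 0 i)) -> prodV I V v.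
Proof.
move=> hA hI hV; have [h0 hD hZ] := hV; have [s hs] := hA _ hI.
have [|W [psi [hW h1 h2 h3]]] := @rees_ring A I s hA hI.
  by move=> a ha; rewrite hs; exact: spn_mem.
have him k v : pw I k v -> exists w, psi w = v%:P * 'X^k.
  elim: k v => [|k IH] v; first by move=> _; rewrite expr0 mulr1; exact: h2.
  pose J : set A := [set v | exists w, psi w = v%:P * 'X^(k.+1)].
  have hJ : isid J.
    split; first by exists 0; rewrite rmorph0 mul0r.
    - by move=> x y [w hw] [w' hw']; exists (w + w'); rewrite rmorphD hw hw' polyCD mulrDl.
    - move=> a x [w hw]; have [u hu] := h2 a; exists (u * w).
      by rewrite rmorphM hw hu polyCM mulrA.
  apply: (pwS_min hJ) => x y hx hy.
  have [w hw] := IH y hy.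
  suff [u hu] : exists u, psi u = x%:P * 'X.
    by exists (u * w); rewrite rmorphM hw hu polyCM exprS mulrACA.
  move: hx; rewrite hs; apply: (@spn_min _ [set x | exists u, psi u = x%:P * 'X]) => //=.
  - split; first by exists 0; rewrite rmorph0 mul0r.
    + by move=> a b [u hu] [u' hu']; exists (u + u'); rewrite rmorphD hu hu' polyCD mulrDl.
    + move=> a b [u hu]; have [u' hu'] := h2 a; exists (u' * u).
      by rewrite rmorphM hu hu' polyCM mulrA.
  - by move=> _ ->; exists 0; rewrite rmorph0 mul0r.
pose rw (F : 'rV[W]_n) k : 'rV[A]_n := \row_j (psi (F 0 j))`_k.
pose VV : set 'rV[W]_n := [set F | forall k, V (rw F k)].
have rwZ (G : W) (F : 'rV[W]_n) k :
    rw (G *: F) k = \sum_(a < k.+1) (psi G)`_a *: rw F (k - a)%N.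
  apply/rowP => j; rewrite !mxE rmorphM coefM summxE.
  by apply: eq_bigr => a _; rewrite !mxE.
have rwD F G k : rw (F + G) k = rw F k + rw G k.
  by apply/rowP => j; rewrite !mxE rmorphD coefD.
have rw0 k : rw 0 k = 0 by apply/rowP => j; rewrite !mxE rmorph0 coef0.
have hVV : submod VV.
  split; rewrite /VV /=.
  - by move=> k; rewrite rw0.
  - by move=> x y hx hy k; rewrite rwD; exact: hD.
  - by move=> a x hx k; rewrite rwZ; apply: submod_sum => // i _; exact: hZ.
have [Fs [hFs hgen]] := noeth_vec hW hVV.
pose fent (F : 'rV[W]_n) (l : 'I_n) : {poly A} := psi (F 0 l).
pose sz (j : nat) l := size (fent Fs`_j l).
(* [D] is beyond the degree of every entry of every generator. In degree [D] the constant
   coefficients of the multipliers therefore contribute nothing, and the others lie in [I]. *)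
pose D := (\sum_(j < size Fs) \sum_(l < n) sz j l)%N.
have hDbig j l : (j < size Fs)%N -> (fent Fs`_j l)`_D = 0.
  move=> hj; apply: nth_default; rewrite /D (bigD1 (Ordinal hj)) //= (bigD1 l) //=.
  by rewrite -addnA leq_addr.
exists D => v hv hvD.
have /choice[F hF] : forall l, exists w, psi w = (v 0 l)%:P * 'X^D by move=> l; exact: him.
have hrwF k : rw (\row_l F l) k = v *+ (k == D).
  apply/rowP => l; rewrite !mxE hF coefCM coefXn mulr_natr.
  by case: eqP => _; rewrite ?mulr1n ?mulr0n // mxE.
have [c hc] : exists c : nat -> W, \row_l F l = \sum_(j < size Fs) c j *: Fs`_j.
  by apply: hgen => k; rewrite hrwF; case: eqP => _.
have rw_sum (J : Type) (r : seq J) (P : pred J) (E : J -> 'rV[W]_n) k :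
    rw (\sum_(j <- r | P j) E j) k = \sum_(j <- r | P j) rw (E j) k.
  by apply: (big_morph (rw ^~ k)) => // x y; rewrite rwD.
have : v = \sum_(j < size Fs) \sum_(a < D) (psi (c j))`_a.+1 *: rw Fs`_j (D - a.+1)%N.
  have := hrwF D; rewrite eqxx mulr1n => <-; rewrite hc rw_sum; apply: eq_bigr => j _.
  rewrite rwZ big_ord_recl /= subn0 (_ : rw _ D = 0) ?scaler0 ?add0r //.
  by apply/rowP => l; rewrite !mxE hDbig.
move=> ->; rewrite pair_big /=.
exists (('I_(size Fs) * 'I_D)%type : finType),
  (fun p : 'I_(size Fs) * 'I_D => (psi (c p.1))`_p.2.+1),
  (fun p : 'I_(size Fs) * 'I_D => rw Fs`_p.1 (D - p.2.+1)%N); split=> //.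
- move=> p; exact: (pw_in hI (h1 _ _)).
- by move=> p; apply: hFs; exact: mem_nth.
Qed.

Section Complete.
Variables (T : comNzRingType) (M : set T).

(** Completeness is stated by convergence of series, the form in which limits are taken below. *)
Definition complete := (forall x, (forall n, pw M n x) -> x = 0) /\
  forall a : nat -> T, (forall k, pw M k (a k)) ->
    exists s, forall n, pw M n (s - \sum_(k < n) a k).

Definition complete_local := [/\ noeth T, isid M, forall x, ~ M x -> exists y, y * x = 1, ~ M 1 & complete].

(** The inverse is the sum of the geometric series. *)
Lemma complete_unit m : isid M -> complete -> M m -> exists y, y * (1 - m) = 1.
Proof.
move=> hM [hsep hc] hm; have [|s hs] := hc (fun k => m ^+ k); first by move=> k; exact: pwX.
exists s; apply/eqP; rewrite -subr_eq0; apply/eqP/hsep => n.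
have -> : s * (1 - m) - 1 = (s - \sum_(k < n) m ^+ k) * (1 - m) - m ^+ n.
  have e : (\sum_(k < n) m ^+ k) * (1 - m) = 1 - m ^+ n.
    by rewrite -[LHS]opprK -mulrN opprB mulrC -subrX1 opprB.
  by rewrite mulrBl e; ring.
by apply: isidB => //; [exact: isidMr | exact: pwX].
Qed.

Lemma complete_units : isid M -> complete ->
  (forall x, ~ M x -> exists y, M (1 - y * x)) -> forall x, ~ M x -> exists y, y * x = 1.
Proof.
move=> hM hc h x /h[y hy]; have [z hz] := complete_unit hM hc hy.
by exists (z * y); rewrite -mulrA -hz; congr (_ * _); ring.
Qed.

Hypothesis hcl : complete_local.

Lemma complete_local_prime : isprime M.
Proof.
have [_ hM hu h1 _] := hcl; split=> // x y hxy; apply: contrapT => /not_orP[/hu[a ha] /hu[b hb]].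
apply: h1; rewrite -[1]mulr1 -{1}ha -hb (_ : _ * _ = a * b * (x * y)); last by ring.
exact: isidM.
Qed.

Lemma complete_local_proper I : isid I -> ~ I 1 -> I `<=` M.
Proof.
have [_ hM hu h1 _] := hcl; move=> hI hI1 x hx; apply: contrapT => /hu[y hy].
by apply: hI1; rewrite -hy; exact: isidM.
Qed.

Lemma complete_local_prime_sub P : isprime P -> P `<=` M.
Proof. by move=> hP; apply: complete_local_proper; [auto | exact: prime1]. Qed.

Lemma complete_local_1m m : M m -> exists y, y * (1 - m) = 1.
Proof. have [_ hM _ _ hc] := hcl; exact: complete_unit. Qed.

(** Submodules are closed. Artin-Rees applied to V + T t gives t - v in M (V + T t) for an
    approximation v, hence (1 - m) t in [V] with m in [M], and 1 - m is a unit. *)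
Lemma krull_vec n (V : set 'rV[T]_n) t : submod V ->
  (forall k, exists2 v, V v & forall i, pw M k ((t - v) 0 i)) -> V t.
Proof.
have [hT hM _ _ _] := hcl; move=> hV h; have [h0 hD hZ] := hV.
pose V' : set 'rV[T]_n := [set x | exists r, V (x - r *: t)].
have hV' : submod V'.
  split; rewrite /V' /=; first by exists 0; rewrite scale0r subr0.
  - move=> x y [r hr] [q hq]; exists (r + q).
    by rewrite scalerDl opprD addrACA; exact: hD.
  - by move=> a x [r hr]; exists (a * r); rewrite -scalerA -scalerBr; exact: hZ.
have [D hD'] := artin_rees hT hM hV'.
have [v hv hvD] := h D.
have [|//|m [c [w [hc hw e]]]] := hD' (t - v).
  by exists 1; rewrite scale1r addrAC subrr add0r; exact: submodN.
have /choice[r hr] := hw.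
have hm : M (\sum_i c i * r i) by apply: isid_sum => // i _; exact: isidMr.
have [y hy] := complete_local_1m hm.
have et : t = v + \sum_i c i *: w i by rewrite -e addrC subrK.
rewrite -[t]scale1r -hy -scalerA; apply: hZ.
rewrite scalerBl scale1r {1}et scaler_suml -addrA -sumrB; apply: hD => //.
apply: submod_sum => // i _.
have [_ _ hZ'] := hV; by rewrite -scalerA -scalerBr; apply: hZ'; exact: hr.
Qed.

Lemma krull_ideal J x : isid J ->
  (forall k, exists2 y, J y & pw M k (x - y)) -> J x.
Proof.
move=> hJ h.
have := @krull_vec 1 [set v | J (v 0 ord0)] (const_mx x); rewrite /= mxE; apply.
  split=> /=; first by rewrite mxE; exact: isid0.
  - by move=> u v hu hv; rewrite mxE; exact: isidD.
  - by move=> a u hu; rewrite mxE; exact: isidM.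
by move=> k; have [y hy hk] := h k; exists (const_mx y) => [|i]; rewrite /= !mxE.
Qed.

End Complete.

Definition isder (R : comNzRingType) (d : R -> R) :=
  (forall x y, d (x + y) = d x + d y) /\ (forall x y, d (x * y) = x * d y + y * d x).

Lemma noeth_field (K : fieldType) : noeth K.
Proof.
move=> I hI; have [[x hx x0]|h] := pselect (exists2 x, I x & x != 0).
  have hI1 : I 1 by rewrite -(mulVf x0); exact: isidM.
  exists [:: 1]; apply: noeth_spn => //; first by move=> f; rewrite inE => /eqP->.
  by move=> y _; rewrite -(mulr1 y); apply: isidM => //; apply: spn_mem => //; rewrite inE.
exists [::]; apply: noeth_spn => // x hx /=.
by apply: contrapT => x0; apply: h; exists x => //; exact/eqP.
Qed.

Lemma cont_uniq (T : comNzRingType) (M : set T) (hc : complete M) x y :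
  (forall n, pw M n (x - y)) -> x = y.
Proof. by case: hc => h _ /h /subr0_eq. Qed.

Lemma coprime_reg_surj (R S : comNzRingType) (eps : {rmorphism R -> S}) (P Q : set S) n :
  (forall y, exists x, eps x = y) -> height_ge P Q n -> height_ge (contr eps P) (contr eps Q) n.
Proof.
move=> hs; elim: n Q => [|n IH] Q /= [hQ h].
  by split; [exact: contr_prime | move=> x /h].
have [P1 [h1 h2 h3]] := h; split; first exact: contr_prime.
exists (contr eps P1); split; [exact: IH | by move=> x /h2|].
by move=> h4; apply: h3 => y; have [x <-] := hs y; exact: h4.
Qed.

(** * Power series over complete local rings *)

Section FpsLocal.
Variables (R : comNzRingType) (M : set R).
Hypothesis (hM : isid M).
Local Notation F := (fps R).
Definition fpsI : set F := [set f | M (f 0%N)].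

Lemma fpsI_spn x : M = spn (@zid R) x -> fpsI = spn (@zid F) (fps_X R :: map (@fps_C R) x).
Proof.
move=> hx; have hI : isid (spn (@zid F) (fps_X R :: map (@fps_C R) x)).
  exact: (gen_id _ (setT_id _) (@zid_id _)).
apply: seteqI => f.
  rewrite /fpsI /= => hf; rewrite [f]fps_shift; apply: (isidD hI).
  - move: hf; rewrite hx.
    apply: (@spn_min _ [set a | spn (@zid F) (fps_X R :: map (@fps_C R) x) (fps_C a)]).
    + exact: (@contr_id _ _ (@fps_C R) _ hI).
    + by move=> _ -> /=; rewrite rmorph0; exact: isid0 hI.
    + move=> a ha /=; apply: (@spn_mem F _ (_ :: _)) => //.
      by rewrite inE map_f ?orbT.
  - rewrite mulrC; apply: (isidM _ hI).
    by apply: (@spn_mem F _ (_ :: _)) => //; rewrite inE eqxx.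
move: f; apply: (@spn_min _ fpsI _ (_ :: _)).
- exact: (@contr_id _ _ (@fps_0 R) M hM).
- by move=> _ ->; rewrite /fpsI /= fps0; exact: isid0.
- move=> f; rewrite inE => /predU1P[->|/mapP[a ha ->]]; rewrite /fpsI /=; first exact: isid0.
  by rewrite hx; exact: spn_mem.
Qed.

Lemma fpsI_id : isid fpsI.
Proof. exact: (@contr_id _ _ (@fps_0 R) M hM). Qed.

Lemma pw_fpsI n (f : F) : pw fpsI n f <-> forall i, pw M (n - i) (f i).
Proof.
split.
  elim: n f => [|n IH] f.
    by move=> _ i; rewrite sub0n.
  move: f; apply: pwS_min.
    split; first by move=> i; rewrite fps0; exact: isid0.
    - by move=> x y hx hy i; rewrite fpsD; exact: isidD.
    - move=> a x hx i; rewrite fpsM; apply: isid_sum => // j _; apply: isidM => //.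
      by apply: pw_sub (hx _); lia.
  move=> x y hx /IH hy i; rewrite fpsM; apply: isid_sum => // j _.
  case: j => -[|j] hj /=.
    case: (leqP i n) => hin; last by rewrite (_ : (n.+1 - i)%N = 0%N); [ | lia].
    rewrite subn0 subSn //; exact: pwS.
  by apply: isidM => //; apply: pw_sub (hy _); lia.
move=> h; have [g ->] := fps_decomp n f.
have hX k : pw fpsI k (fps_X R ^+ k).
  by apply: pwX; rewrite /fpsI /=; exact: isid0.
apply: isidD => //; last by apply: isidMr.
have hk k : (k <= n)%N -> pw fpsI n (fps_trunc k f).
  elim: k => [|k IH] hk.
    by rewrite (_ : fps_trunc 0 f = 0); [exact: isid0 | apply: funext => i; rewrite fps0].
  rewrite fps_truncS; apply: isidD => //; first by apply: IH; exact: ltnW.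
  rewrite -(subnK (ltnW hk)); apply: pwM => //.
  have := h k; elim: (n - k)%N (f k) => // m IHm a.
  apply: (pwS_min (I := M) (J := [set a | pw fpsI m.+1 (fps_C a)])).
    exact: (@contr_id _ _ (@fps_C R) (pw fpsI m.+1) (pw_id _ _)).
  move=> x y hx hy /=; rewrite rmorphM; apply: pwS; first by [].
  exact: IHm.
exact: hk.
Qed.

Lemma fps_complete : complete M -> complete fpsI.
Proof.
move=> [hsep hc]; split.
  move=> f hf; apply: funext => i; rewrite fps0; apply: hsep => n.
  by have /pw_fpsI/(_ i) := hf (n + i)%N; rewrite addnK.
move=> a ha.
have ha' k i : pw M (k - i) (a k i) by have /pw_fpsI := ha k.
have /choice[s hs] : forall i, exists s, forall n, pw M n (s - \sum_(k < n) a (k + i)%N i).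
  by move=> i; apply: (hc (fun k => a (k + i)%N i)) => k; have := ha' (k + i)%N i; rewrite addnK.
exists (fun i => s i + \sum_(0 <= k < i) a k i) => n; apply/pw_fpsI => i.
rewrite fpsB fps_sum; case: (leqP n i) => hin.
  by rewrite (_ : (n - i)%N = 0%N); [ | lia].
have -> : \sum_(k < n) a k i = \sum_(0 <= k < i) a k i + \sum_(k < n - i) a (k + i)%N i.
  rewrite -(big_mkord xpredT (fun k => a k i)) (@big_cat_nat _ _ _ i) ?(ltnW hin) //=.
  by congr (_ + _); rewrite -{1}(add0n i) big_addn big_mkord.
rewrite (_ : _ - _ = s i - \sum_(k < n - i) a (k + i)%N i); last by ring.
exact: hs.
Qed.

End FpsLocal.

(** The coefficients of the second factor vanish one after the other, by comparison with the lowest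
    nonzero coefficient of the first. *)
Lemma fps_dom (R : comNzRingType) : isprime (@zid R) -> isprime (@zid (fps R)).
Proof.
move=> hR; split; first exact: zid_id; first by move=> /eqP; rewrite oner_eq0.
move=> f g hfg; apply: contrapT => /not_orP[hf hg]; apply: hg.
have [i0 hi0] : exists i, f i != 0.
  apply: contrapT => h; apply: hf; apply: funext => i; rewrite fps0.
  by apply/eqP/negP => /negP h'; apply: h; exists i.
case: (ex_minnP (ex_intro (fun i => f i != 0) i0 hi0)) => i hi hmin.
apply: funext => j; rewrite fps0; have [n] := ubnP j; elim: n j => // n IH j hj.
have : (f * g) (i + j)%N = 0 by rewrite hfg fps0.
rewrite fpsM (bigD1 (inord i)) //= inordK; last by rewrite ltnS leq_addr.
rewrite addKn big1 ?addr0.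
  by move=> /(primeM hR)[h|//]; move/eqP: hi.
move=> k hk; case: (ltngtP k i) => h.
- have -> : f k = 0; last by rewrite mul0r.
  by apply/eqP/negP => /negP /hmin; rewrite leqNgt h.
- by rewrite (IH (i + j - k)%N) ?mulr0 //; have := ltn_ord k; lia.
- by case/negP: hk; apply/eqP/val_inj; rewrite /= inordK ?ltnS ?leq_addr.
Qed.

Section FpsEval.
Variables (S T : comNzRingType) (eps : {rmorphism S -> T}) (M : set T) (z : T).
Hypotheses (hM : isid M) (hc : complete M) (hz : M z).

Lemma fps_lim_ex (f : fps S) : exists s, forall n, pw M n (s - \sum_(k < n) eps (f k) * z ^+ k).
Proof. case: hc => _ h; apply: (h (fun k => eps (f k) * z ^+ k)) => k.
by apply: isidM => //; exact: pwX. Qed.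

Definition fps_ev (f : fps S) : T := projT1 (cid (fps_lim_ex f)).
Lemma fps_evP f n : pw M n (fps_ev f - \sum_(k < n) eps (f k) * z ^+ k).
Proof. by rewrite /fps_ev; case: (cid _). Qed.

Lemma fps_ev_eq (f : fps S) s : (forall n, pw M n (s - \sum_(k < n) eps (f k) * z ^+ k)) -> fps_ev f = s.
Proof.
move=> h; apply: (cont_uniq hc) => n.
rewrite (_ : _ - _ = (fps_ev f - \sum_(k < n) eps (f k) * z ^+ k) - (s - \sum_(k < n) eps (f k) * z ^+ k)).
  by apply: isidB => //; exact: fps_evP.
ring.
Qed.

Lemma fps_ev_zmod : zmod_morphism fps_ev.
Proof.
move=> f g; apply: fps_ev_eq => n.
rewrite (_ : _ - _ = (fps_ev f - \sum_(k < n) eps (f k) * z ^+ k) - (fps_ev g - \sum_(k < n) eps (g k) * z ^+ k)).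
  by apply: isidB => //; exact: fps_evP.
rewrite (eq_bigr (fun k : 'I_n => eps (f k) * z ^+ k - eps (g k) * z ^+ k)).
  by rewrite sumrB; ring.
by move=> k _; rewrite fpsB rmorphB mulrBl.
Qed.

Lemma fps_evC a : fps_ev (fps_C a) = eps a.
Proof.
apply: fps_ev_eq => -[|n] //; rewrite big_ord_recl /= expr0 mulr1 big1 ?addr0 ?subrr.
  exact: isid0.
by move=> i _; rewrite rmorph0 mul0r.
Qed.

Lemma fps_evX : fps_ev (fps_X S) = z.
Proof.
have e1 : pw M 1 z by rewrite pw1.
apply: fps_ev_eq => -[|[|n]] //.
  rewrite big_ord_recl big_ord0 /= /fps_X /= rmorph0 mul0r addr0 subr0.
  exact: e1.
rewrite !big_ord_recl /= /fps_X /= rmorph0 mul0r add0r rmorph1 mul1r expr1 big1 ?addr0 ?subrr.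
  exact: isid0.
by move=> i _; rewrite ?rmorph0 mul0r.
Qed.

Lemma fps_ev_monoid : monoid_morphism fps_ev.
Proof.
split; first by rewrite -(rmorph1 (@fps_C S)) fps_evC rmorph1.
move=> f g; apply: fps_ev_eq => n.
have hcomm : commr_rmorph eps z by move=> a; exact: mulrC.
pose e : {rmorphism {poly S} -> T} := horner_morph hcomm.
have eX : e 'X = z by exact: horner_morphX.
have eC a : e a%:P = eps a by exact: horner_morphC.
have ep (h : nat -> S) : e (\poly_(k < n) h k) = \sum_(k < n) eps (h k) * z ^+ k.
  rewrite poly_def rmorph_sum; apply: eq_bigr => k _.
  by rewrite -mul_polyC rmorphM rmorphXn eC eX.
rewrite -!ep; set p := \poly_(k < n) f k; set q := \poly_(k < n) g k.
(* Truncating the product and multiplying the truncations differ by a multiple of 'X^n, which is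
   evaluated into M^n. *)
have hpq : p * q = \poly_(k < n) (f * g) k + drop_poly n (p * q) * 'X^n.
  rewrite -[LHS](poly_take_drop n); congr (_ + _); apply/polyP => i.
  rewrite coef_take_poly coef_poly; case: ltnP => // hi.
  rewrite coefM fpsM; apply: eq_bigr => j _; rewrite !coef_poly.
  by rewrite !(leq_ltn_trans _ hi) ?leq_subr // -ltnS.
have -> : e (\poly_(k < n) (f * g) k) = e p * e q - e (drop_poly n (p * q)) * z ^+ n.
  by rewrite -eX -rmorphXn -!rmorphM -rmorphB {1}hpq addrK.
rewrite (_ : _ - _ = (fps_ev f - e p) * fps_ev g + e p * (fps_ev g - e q)
   + e (drop_poly n (p * q)) * z ^+ n); last by ring.
apply: isidD => //; first apply: isidD => //.
- by rewrite ep; apply: isidMr => //; exact: fps_evP.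
- by rewrite ep [e q]ep; apply: isidM => //; exact: fps_evP.
- by apply: isidM => //; exact: pwX.
Qed.

HB.instance Definition _ := GRing.isZmodMorphism.Build (fps S) T fps_ev fps_ev_zmod.
HB.instance Definition _ := GRing.isMonoidMorphism.Build (fps S) T fps_ev fps_ev_monoid.

Lemma fps_ev_exists : exists e : {rmorphism fps S -> T},
  (forall a, e (fps_C a) = eps a) /\ e (fps_X S) = z.
Proof. by exists fps_ev; split; [exact: fps_evC | exact: fps_evX]. Qed.
End FpsEval.

Section FpsDer.
Variable R : comNzRingType.
Definition fps_der (f : fps R) : fps R := fun n => f n.+1 *+ n.+1.

Lemma fps_der_isder : isder fps_der.
Proof.
split=> f g; apply: funext => n; first by rewrite /fps_der !fpsD mulrnDl.
rewrite /fps_der fpsD !fpsM.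
pose p := fps_tr n.+1 f; pose q := fps_tr n.+1 g.
have h (f' g' : fps R) k : (k <= n.+1)%N -> \sum_(i < k.+1) f' i * g' (k - i)%N =
   (fps_tr n.+1 f' * fps_tr n.+1 g')`_k by exact: fps_mul_tr.
rewrite (h f g n.+1 (leqnn _)) -/p -/q -coef_deriv derivM coefD addrC.
have hc (a b : fps R) : \sum_(i < n.+1) a i * fps_der b (n - i)%N =
   (fps_tr n.+1 a * (fps_tr n.+1 b)^`())`_n.
  rewrite coefM; apply: eq_bigr => i _; rewrite coef_deriv !coef_poly /fps_der.
  rewrite !ltnS (ltnW (ltn_ord i)) ?leq_subr //.
by rewrite -(hc f g) [_^`() * _]mulrC -(hc g f).
Qed.

Lemma fps_der_map (d : R -> R) : isder d -> isder (fun f : fps R => (fun n => d (f n)) : fps R).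
Proof.
move=> [hD hM]; split=> f g; apply: funext => n; first by rewrite !fpsD hD.
have d0 : d 0 = 0 by apply: (addrI (d 0)); rewrite -hD !addr0.
rewrite (mulrC g) fpsD !fpsM (big_morph d hD d0) -big_split.
by apply: eq_bigr => i _; rewrite hM [d _ * _]mulrC.
Qed.
End FpsDer.

Lemma isder0 (R : comNzRingType) (d : R -> R) : isder d -> d 0 = 0.
Proof. by move=> [hD _]; apply: (addrI (d 0)); rewrite -hD !addr0. Qed.

Lemma isder1 (R : comNzRingType) (d : R -> R) : isder d -> d 1 = 0.
Proof.
by move=> [_ hM]; apply: (addrI (d 1)); rewrite -{3}(mulr1 1) hM !mul1r addr0 => //;
  rewrite -{3}(mulr1 1) hM !mul1r.
Qed.

(* The properties that are used of the power series ring R = K[[X]]. *)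
Record is_ps (K : fieldType) (R : comNzRingType) (C : {rmorphism K -> R}) (X : seq R) : Prop := IsPs {
  ps_cloc : complete_local (spn (@zid R) X);
  ps_dec : forall f, exists c, spn (@zid R) X (f - C c);
  ps_dom : isprime (@zid R);
  ps_hge : height_ge (@zid R) (spn (@zid R) X) (size X);
  ps_hd : forall x0 X', X = x0 :: X' ->
    isprime (spn (@zid R) [:: x0]) /\ height_ge (spn (@zid R) [:: x0]) (spn (@zid R) X) (size X');
  ps_eval : forall (T : comNzRingType) (MT : set T) (tau : {rmorphism K -> T}) z, isid MT -> complete MT ->
    size z = size X -> (forall x, x \in z -> MT x) ->
    exists eps : {rmorphism R -> T}, (forall c, eps (C c) = tau c) /\ map eps X = z;
  ps_der : forall i, (i < size X)%N -> exists D, [/\ isder D, forall c, D (C c) = 0 &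
    forall j, (j < size X)%N -> D X`_j = (i == j)%:R] }.

Lemma fps_X_contr (R : comNzRingType) : contr (@fps_0 R) (@zid R) = spn (@zid (fps R)) [:: fps_X R].
Proof.
apply: seteqI => f.
  rewrite /contr /= /zid /fps_0 => hf; rewrite [f]fps_shift hf rmorph0 add0r mulrC.
  have hI : isid (spn (@zid (fps R)) [:: fps_X R]) by apply: gen_id; [exact: setT_id|exact: zid_id].
  exists (fun n => f n.+1) => //; exact: subrr.
move: f; apply: spn_min; first by apply: contr_id; exact: zid_id.
  by move=> _ ->; rewrite /contr /= rmorph0.
by move=> a; rewrite inE => /eqP->.
Qed.

Lemma is_ps0 (K : fieldType) : is_ps (idfun : {rmorphism K -> K}) [::].
Proof.
have hz : isprime (@zid K).
  split; [exact: zid_id | by move=> /eqP; rewrite oner_eq0 |].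
  by move=> x y /eqP; rewrite mulf_eq0 => /orP[]/eqP; [left|right].
split => //=.
- split; [exact: noeth_field | exact: zid_id | | by move=> /eqP; rewrite oner_eq0 |].
    by move=> x /eqP x0; exists x^-1; rewrite mulVf.
  split; first by move=> x /(_ 1%N); rewrite pw1; [| exact: zid_id].
  move=> a ha; exists (a 0%N) => -[|n] //.
  have h0 : pw (@zid K) n.+1 0 by exact: isid0 (pw_id _ _).
  rewrite big_ord_recl /= big1 ?addr0 ?subrr //.
  move=> i _; have := ha (bump 0 i); rewrite /bump /= add1n => h; exact: (pw_in (@zid_id K) h).
- by move=> f; exists f; rewrite /zid subrr.
- by split.
- move=> T MT tau z _ _ /eqP; rewrite size_eq0 => /eqP-> _.
  by exists tau.
Qed.

Lemma is_psS (K : fieldType) (R : comNzRingType) (C : {rmorphism K -> R}) X : is_ps C X ->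
  is_ps (@fps_C R \o C : {rmorphism K -> fps R}) (fps_X R :: map (@fps_C R) X).
Proof.
case=> hcl hdec hdom hhge hhd hev hder.
have [hn hM hu h1 hc] := hcl.
have e : spn (@zid (fps R)) (fps_X R :: map (@fps_C R) X) = fpsI (spn (@zid R) X).
  by rewrite (fpsI_spn hM erefl).
have hsurj : forall y, exists x, @fps_0 R x = y by move=> y; exists (fps_C y).
have hI : isid (fpsI (spn (@zid R) X)) by exact: fpsI_id.
have hz0 := fps_dom hdom.
have hpr : isprime (spn (@zid (fps R)) [:: fps_X R]).
  by rewrite -fps_X_contr; exact: contr_prime.
have hh : height_ge (spn (@zid (fps R)) [:: fps_X R]) (fpsI (spn (@zid R) X)) (size X).
  rewrite -fps_X_contr; exact: (coprime_reg_surj hsurj hhge).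
have hfc := fps_complete hM hc.
split.
- rewrite e; split=> //; first exact: noeth_fps.
  + apply: complete_units => // f hf.
    have [y hy] := hu _ hf; exists (fps_C y).
    rewrite /fpsI /= fpsB fpsCM hy /= subrr; exact: isid0.
- move=> f; have [c hc'] := hdec (f 0%N); exists c; rewrite e /fpsI /= fpsB; exact: hc'.
- exact: hz0.
- rewrite e /= size_map; apply: height_ge_bot hh => P hP hXP _.
  exists (@zid _); split => //; first exact: zid_sub (prime_id hP).
  move=> h; have : (fps_X R) 1%N = 0.
    have -> : fps_X R = 0 by apply: h; apply: hXP; apply: spn_mem; [exact: zid_id | rewrite inE].
    by rewrite fps0.
  by move=> /eqP; rewrite /fps_X /= oner_eq0.
- move=> x0 X' [<- <-]; split => //; rewrite e size_map; exact: hh.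
- move=> T MT tau z hMT hcT; case: z => [|z0 z] //= [hs] hz; rewrite size_map in hs.
  have [eps [he1 he2]] := hev T MT tau z hMT hcT hs (fun x hx => hz x (mem_behead (s := z0 :: z) hx)).
  have [eps' [he3 he4]] := fps_ev_exists eps hMT hcT (hz z0 (mem_head _ _)).
  exists eps'; split; first by move=> c; rewrite he3.
  rewrite he4 -he2; congr (_ :: _); rewrite -map_comp; apply: eq_map => a /=; exact: he3.
- move=> [|i] /=; rewrite size_map => hi.
    exists (@fps_der R); split; first exact: fps_der_isder.
      by move=> c; apply: funext => n; rewrite /fps_der /= mul0rn fps0.
    move=> [|j] /= hj.
      transitivity (1 : fps R) => //; apply: funext => -[|n] //.
      by rewrite fps1S /fps_der /fps_X /= mul0rn.
    rewrite (nth_map 0); last by rewrite -ltnS.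
    by transitivity (0 : fps R) => //; apply: funext => n; rewrite fps0 /fps_der /= mul0rn.
  have [D [hD hDC hDX]] := hder i hi.
  exists (fun f : fps R => (fun n => D (f n)) : fps R); split; first exact: fps_der_map.
    move=> c; apply: funext => -[|n] /=; rewrite ?hDC ?(isder0 hD) //.
  move=> [|j] /= hj.
    transitivity (0 : fps R) => //; by apply: funext => -[|[|n]]; rewrite /fps_X /= ?fps0 ?(isder0 hD) ?(isder1 hD).
  rewrite (nth_map 0); last by rewrite -ltnS.
  apply: funext => -[|n] /=.
    rewrite hDX; last by rewrite -ltnS.
    by rewrite eqSS; case: (i == j); rewrite //= ?fps0.
  rewrite (isder0 hD) eqSS; case: (i == j); rewrite ?fps0 ?fps1S //.
Qed.

Lemma ps_exists (K : fieldType) N : exists (R : comNzRingType) (C : {rmorphism K -> R}) X,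
  size X = N /\ is_ps C X.
Proof.
elim: N => [|N [R [C [X [hX h]]]]].
  by exists K, idfun, [::]; split; last exact: is_ps0.
exists (fps R), (@fps_C R \o C), (fps_X R :: map (@fps_C R) X); split; last exact: is_psS.
by rewrite /= size_map hX.
Qed.

(** Turns functions obtained by choice, such as limits and fractions, into morphisms. *)
Lemma rmorph_exists (A B : comPzRingType) (f : A -> B) : (forall x y, f (x + y) = f x + f y) ->
  (forall x y, f (x * y) = f x * f y) -> f 1 = 1 -> exists g : {rmorphism A -> B}, forall x, g x = f x.
Proof.
move=> hD hM h1.
have f0 : f 0 = 0 by apply: (addrI (f 0)); rewrite -hD !addr0.
have hB : zmod_morphism f.
  by move=> x y; apply: (addIr (f y)); rewrite -hD !subrK.
have hm : monoid_morphism f by split.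
pose g1 := GRing.isZmodMorphism.Build A B f hB.
pose g2 := GRing.isMonoidMorphism.Build A B f hm.
pose g : {rmorphism A -> B} := HB.pack f g1 g2.
by exists g.
Qed.

(** * Coefficient fields and Noether normalization *)

Section Hensel.
Variables (T : comNzRingType) (M : set T).
Hypothesis hcl : complete_local M.
Let hM : isid M. Proof. by case: hcl. Qed.
Let hu x : ~ M x -> exists y, y * x = 1. Proof. by case: hcl => _ _ h _ _; exact: h. Qed.
Let hc : complete M. Proof. by case: hcl. Qed.

Lemma taylor2 (p : {poly T}) x h : exists r, p.[x + h] = p.[x] + p^`().[x] * h + h ^+ 2 * r.
Proof.
elim/poly_ind: p => [|p c [r IH]]; first by exists 0; rewrite deriv0 !horner0; ring.
exists (r * (x + h) + p^`().[x]).
rewrite derivD derivC addr0 derivM derivX mulr1 !hornerE IH; ring.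
Qed.

Lemma horner_congr (p : {poly T}) x y : M (x - y) -> M (p.[x] - p.[y]).
Proof.
move=> h; have [r] := taylor2 p y (x - y); rewrite subrKC => ->.
set a := p.[y]; set b := p^`().[y]; rewrite (_ : _ - a = (b + (x - y) * r) * (x - y)); last by ring.
exact: isidM.
Qed.

(** Newton iteration with the inverse [u] of the derivative at [t] kept fixed: each step gains one
    power of [M], which is enough for convergence. *)
Lemma hensel (p : {poly T}) t : M p.[t] -> ~ M p^`().[t] -> exists2 t', M (t' - t) & p.[t'] = 0.
Proof.
move=> hp hp'; have [u hu'] := hu hp'.
pose f x := x - u * p.[x]; pose s k := iter k f t.
have hs k : M (s k - t) /\ pw M k.+1 p.[s k].
  elim: k => [|k [h1 h2]]; first by split; [rewrite subrr; exact: isid0 | rewrite -(pw1 hM) in hp].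
  have h3 : M p.[s k] := pw_in hM h2.
  rewrite (_ : s k.+1 = s k - u * p.[s k]) //; split.
    by rewrite addrAC; apply: isidB => //; exact: isidM.
  have [r ->] := taylor2 p (s k) (- (u * p.[s k])).
  rewrite (_ : _ + _ = (1 - u * p^`().[s k]) * p.[s k] + (u ^+ 2 * r * p.[s k]) * p.[s k]); last by ring.
  have h4 : M (1 - u * p^`().[s k]).
    have -> : 1 - u * p^`().[s k] = - (u * (p^`().[s k] - p^`().[t])) by rewrite -hu'; ring.
    by apply: isidN => //; apply: isidM => //; exact: horner_congr.
  by apply: isidD; [exact: pw_id | apply: pwS | apply: pwS => //; exact: isidM].
case: (hc) => _ h; have [k|a ha] := h (fun k => - (u * p.[s k])).
  apply: isidN; first exact: pw_id.
  by apply: isidM; [exact: pw_id | apply: pw_subS; case: (hs k)].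
have es n : s n = t + \sum_(k < n) - (u * p.[s k]).
  elim: n => [|n IH]; first by rewrite big_ord0 addr0.
  by rewrite big_ord_recr /= addrA -IH.
have hn n : pw M n (t + a - s n) by rewrite es opprD addrACA subrr add0r.
exists (t + a).
  have := hn 1%N; rewrite pw1 // => h1.
  by rewrite -(subrK (s 1%N) (t + a)) -addrA; apply: isidD => //; case: (hs 1%N).
apply: (cont_uniq hc) => n; rewrite subr0.
have [r] := taylor2 p (s n) (t + a - s n); rewrite subrKC => ->.
apply: isidD; [exact: pw_id | apply: isidD; [exact: pw_id | |] |].
- by apply: pw_subS; case: (hs n).
- by apply: isidM => //; exact: pw_id.
- by rewrite expr2 -mulrA; apply: isidMr => //; exact: pw_id.
Qed.

Definition subr_closed (F : set T) := [/\ F 1, forall x y, F x -> F y -> F (x - y) & forall x y, F x -> F y -> F (x * y)].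

Lemma subring0 F : subr_closed F -> F 0.
Proof. by case=> h1 hB _; rewrite -(subrr 1); exact: hB. Qed.
Lemma subringD F x y : subr_closed F -> F x -> F y -> F (x + y).
Proof. by move=> h hx hy; case: (h) => h1 hB _; rewrite -(opprK y) -[- y]add0r; apply: (hB) => //; apply: (hB) => //; exact: subring0. Qed.
Lemma subring_sum F (J : Type) (r : seq J) (P : pred J) (G : J -> T) : subr_closed F -> (forall i, P i -> F (G i)) -> F (\sum_(i <- r | P i) G i).
Proof. move=> h hG; elim/big_rec: _ => [|i x Pi hx]; [exact: subring0 | by apply: subringD => //; exact: hG]. Qed.

Definition pover (F : set T) (p : {poly T}) := forall i, F p`_i.

Hypothesis hchar : forall n, ~ M n.+1%:R.

(** A subring meeting [M] only in 0. That a maximal one contains the inverses of its nonzero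
    elements is [cfield_inv]. *)
Definition cfield (F : set T) := subr_closed F /\ forall x, F x -> M x -> x = 0.

Lemma cfield_max : exists F, cfield F /\ forall G, cfield G -> F `<=` G -> G `<=` F.
Proof.
(* Zorn's lemma for unions also asks about the empty chain, whose union is empty. *)
pose P F := F = set0 \/ cfield F.
have [|F [hF hmax]] := @Zorn_bigcup T P.
  move=> S hS htot; have [[G hG hGc]|h] := pselect (exists2 G, S G & cfield G); last first.
    left; apply: seteqI => x // -[G hG hx].
    by case: (hS _ hG) => hG'; [rewrite hG' in hx | case: h; exists G].
  right; have hc2 x y : (\bigcup_(X in S) X) x -> (\bigcup_(X in S) X) y -> exists G, [/\ S G, cfield G, G x & G y].
    move=> [X hX hx] [Y hY hy]; case: (htot _ _ hX hY) => h.
      have hy' := hy; exists Y; split => //; [by case: (hS _ hY) => // e; rewrite e in hy | exact: h].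
    exists X; split => //; [by case: (hS _ hX) => // e; rewrite e in hx | exact: h].
  split; last first.
    by move=> x [X hX hx] hMx; case: (hS _ hX) => [e|[_ h]]; [rewrite e in hx | exact: h].
  split; first by exists G => //; case: hGc => -[].
    move=> x y hx hy; have [X [hX [[_ h _] _] hx' hy']] := hc2 x y hx hy; exists X => //; exact: h.
  move=> x y hx hy; have [X [hX [[_ _ h] _] hx' hy']] := hc2 x y hx hy; exists X => //; exact: h.
have hmax' G : cfield G -> F `<=` G -> G `<=` F.
  move=> hG hFG x hx; apply: contrapT => hx'; apply: (hmax G); [|by right].
  by split=> // h; apply: hx'; exact: h.
case: hF => // hF; last by exists F.
exfalso; apply: (hmax [set x | exists z : int, x = z%:~R]); last right.
  by split; rewrite hF // => /(_ 1); apply; exists 1.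
split; first split.
- by exists 1.
- by move=> _ _ [z ->] [w ->]; exists (z - w); rewrite rmorphB.
- by move=> _ _ [z ->] [w ->]; exists (z * w); rewrite rmorphM.
move=> _ [z ->]; case: z => -[|n] // h.
  by case: (hchar (n:=n)); move: h; rewrite -pmulrn.
by case: (hchar (n:=0)); rewrite NegzE mulrNz in h; have := isidN hM h; rewrite opprK -pmulrn.
case: (hchar (n:=n.+1)); rewrite NegzE mulrNz in h; have := isidN hM h; by rewrite opprK -pmulrn.
Qed.

Variable F : set T.
Hypotheses (hF : cfield F) (hFmax : forall G, cfield G -> F `<=` G -> G `<=` F).
Let hFr : subr_closed F. Proof. by case: hF. Qed.

(** The elements z with b z in [F] for some nonzero b of [F] again form a subring meeting [M] only
    in 0, so maximality puts them into [F]. *)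
Lemma cfield_inv x : F x -> x <> 0 -> exists2 y, F y & y * x = 1.
Proof.
move=> hx x0; have [|y hy] := hu (x:=x); first by move=> h; apply: x0; case: hF => _; apply.
exists y => //; apply: (hFmax (G := [set z | exists2 b, F b /\ b <> 0 & F (b * z)])).
- have hne a b : F a -> a <> 0 -> F b -> b <> 0 -> a * b <> 0.
    move=> ha a0 hb b0 ab.
    have [|c hc'] := hu (x:=a); first by move=> h; apply: a0; case: hF => _; apply.
    by apply: b0; rewrite -(mul1r b) -hc' -mulrA ab mulr0.
  case: (hFr) => h1 hB hMM; split; first split.
  + by exists 1; rewrite ?mulr1 //; split=> //; move=> /eqP; rewrite oner_eq0.
  + move=> z w [a [ha a0] haz] [b [hb b0] hbw]; exists (a * b); first by split; [exact: hMM | exact: hne].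
    rewrite (_ : _ * _ = b * (a * z) - a * (b * w)); last by ring.
    by apply: hB; exact: hMM.
  + move=> z w [a [ha a0] haz] [b [hb b0] hbw]; exists (a * b); first by split; [exact: hMM | exact: hne].
    rewrite (_ : _ * _ = (a * z) * (b * w)); last by ring.
    exact: hMM.
  + move=> z [b [hb b0] hbz] hz; have hbz0 : b * z = 0 by case: hF => _; apply => //; exact: isidM.
    have [|c hc'] := hu (x:=b); first by move=> h; apply: b0; case: hF => _; apply.
    by rewrite -(mul1r z) -hc' -mulrA hbz0 mulr0.
- move=> z hz; case: (hFr) => h1 _ _; exists 1; rewrite ?mul1r //; split=> //; move=> /eqP; rewrite oner_eq0 //.
- by exists x => //; rewrite mulrC hy; case: hFr.
Qed.

Lemma cfield_adjoin t : (forall q, pover F q -> M q.[t] -> q.[t] = 0) -> F t.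
Proof.
move=> ht; apply: (hFmax (G := [set z | exists2 q, pover F q & z = q.[t]])).
- split; last by move=> _ [q hq ->]; exact: ht.
  case: (hFr) => h1 hB hMM; split.
  + by exists 1; rewrite ?hornerC // => -[|i]; rewrite coef1 //=; exact: subring0.
  + by move=> _ _ [p hp ->] [q hq ->]; exists (p - q); rewrite ?hornerE // => i; rewrite coefB; exact: hB.
  + move=> _ _ [p hp ->] [q hq ->]; exists (p * q); rewrite ?hornerE // => i; rewrite coefM.
    by apply: subring_sum => // j _; exact: hMM.
- move=> z hz; exists z%:P; rewrite ?hornerC // => -[|i]; rewrite coefC //=; exact: subring0.
- exists 'X; rewrite ?hornerX // => i; rewrite coefX; case: eqP => _; last exact: subring0.
  by case: hFr.
Qed.

(** If [t] is transcendental over [F] modulo [M], adjoining it is allowed as it stands. Otherwise a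
    polynomial over [F] of least degree vanishing at [t] modulo [M] has a simple root there, in
    characteristic zero; Hensel's lemma replaces [t] by a true root, which may be adjoined. *)
Lemma cfield_dec t : exists2 f, F f & M (t - f).
Proof.
suff [t' h1 h2] : exists2 t', M (t' - t) & (forall q, pover F q -> M q.[t'] -> q.[t'] = 0).
  exists t'; first exact: cfield_adjoin.
  by rewrite -opprB; exact: isidN.
have [hex|hno] := pselect (exists n p, [/\ pover F p, p != 0, M p.[t] & size p = n]); last first.
  exists t; first by rewrite subrr; exact: isid0.
  move=> q hq hqM; have -> : q = 0; last by rewrite horner0.
  by apply/eqP/negP => /negP q0; apply: hno; exists (size q), q.
have hex' : exists n, `[< exists p, [/\ pover F p, p != 0, M p.[t] & size p = n] >].
  by case: hex => n h; exists n; apply/asboolP.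
case: (ex_minnP hex') => n /asboolP[p0 [hp0 p00 hp0M sp0]] hmin.
have hmin' q : pover F q -> (size q < n)%N -> M q.[t] -> q = 0.
  move=> hq sq hqM; apply/eqP/negP => /negP q0.
  suff : (n <= size q)%N by rewrite leqNgt sq.
  by apply: hmin; apply/asboolP; exists q.
case: (hFr) => h1 hB hMM.
have [y hy hyl] : exists2 y, F y & y * lead_coef p0 = 1.
  by apply: cfield_inv; [exact: hp0 | apply/eqP; rewrite lead_coef_eq0].
pose p := y *: p0.
have hp : pover F p by move=> i; rewrite coefZ; exact: hMM.
have hpM : M p.[t] by rewrite hornerZ; exact: isidM.
have p_n1 : p`_n.-1 = 1 by rewrite coefZ -sp0.
have sp : size p = n.
  apply/eqP; rewrite eqn_leq -{1}sp0 size_scale_leq /= leqNgt; apply/negP => h.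
  have : p = 0 by exact: hmin'.
  by move=> e; move: p_n1; rewrite e coef0 => /eqP; rewrite eq_sym oner_eq0.
have n0 : (0 < n)%N by rewrite -sp0 lt0n size_poly_eq0.
have n1 : (1 < n)%N.
  rewrite ltnNge; apply/negP => hn; have hn1 : n = 1%N by apply/eqP; rewrite eqn_leq hn.
  have /eqP := sp; rewrite hn1 => /size_poly1P[c c0 ec].
  move: p_n1 hpM; rewrite hn1 ec coefC hornerC /= => ->; by case: hcl.
have hp' : ~ M p^`().[t].
  move=> h; have hd : p^`() = 0.
    apply: hmin' => //; first by move=> i; rewrite coef_deriv -mulr_natr; apply: hMM => //;
      elim: i.+1 => [|k IH]; [exact: subring0 | rewrite -natr1; exact: subringD].
    by rewrite -sp lt_size_deriv // -size_poly_gt0 sp.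
  have /polyP/(_ n.-2) := hd; rewrite coef_deriv coef0 prednK; last by lia.
  rewrite p_n1 => e; case: (hchar (n:=n.-2)); rewrite prednK; last by lia.
  rewrite e; exact: isid0.
have [t' ht' hpt'] := hensel hpM hp'.
exists t' => // q; have [k] := ubnP (size q); elim: k q => // k IH q hk hq hqM.
case: (ltnP (size q) n) => hqn.
  rewrite (hmin' q) ?horner0 //.
  have := isidB hM hqM (horner_congr q ht'); by rewrite opprB subrKC.
pose q1 := q - (lead_coef q *: 'X^(size q - n)) * p.
have e1 : q1.[t'] = q.[t'] by rewrite /q1 hornerD hornerN hornerM hpt' mulr0 subr0.
rewrite -e1; apply: IH; last by rewrite e1.
  apply: leq_trans (_ : size q <= k)%N => //.
  rewrite -(prednK (_ : 0 < size q)%N); last by lia.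
  apply/leq_sizeP => j hj.
  rewrite /q1 coefB -scalerAl coefZ coefXnM ifF; last by lia.
  case: (ltngtP j (size q).-1) hj => // [hj _|-> _].
    have hqj : (size q <= j)%N by case: (size q) hj.
    rewrite [q`_j]nth_default //.
    rewrite [p`_ _]nth_default; last by rewrite [X in (X <= _)%N]sp; lia.
    by rewrite mulr0 subrr.
  rewrite (_ : ((size q).-1 - _)%N = n.-1); last by lia.
  by rewrite p_n1 mulr1 subrr.
move=> i; rewrite /q1 coefB -scalerAl coefZ coefXnM; apply: hB => //; apply: hMM; first exact: hq.
by case: ifP => _; [exact: subring0 | exact: hp].
Qed.
End Hensel.

Lemma coef_field (T : comNzRingType) (M : set T) : complete_local M -> (forall n, ~ M n.+1%:R) ->
  exists (L : fieldType) (pi : {rmorphism T -> L}) (sg : {rmorphism L -> T}),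
    (forall x, M x <-> pi x = 0) /\ forall l, pi (sg l) = l.
Proof.
move=> hcl hch; have hMp := complete_local_prime hcl; have [_ hM hu _ _] := hcl.
have [L [pi [hpi hL]]] := residue_exists hMp.
have [F [hF hFmax]] := cfield_max hcl hch.
have [hFr hF0] := hF; have [h1 hB hMM] := hFr.
have hsj l : exists2 f, F f & pi f = l.
  have [b [u [hu' ->]]] := hL l; have [v hv] := hu _ hu'.
  have [f hf] := cfield_dec hcl hch hF hFmax (b * v).
  rewrite hpi rmorphB rmorphM => /subr0_eq e; exists f => //; rewrite -e; congr (_ * _).
  apply: (mulIf (pi_neq0 hpi hu')); rewrite mulVf ?(pi_neq0 hpi) // -rmorphM hv rmorph1 //.
have hinj f g : F f -> F g -> pi f = pi g -> f = g.
  move=> hf hg e; apply: subr0_eq; apply: hF0; first exact: hB.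
  by rewrite hpi rmorphB e subrr.
have /choice[sg hsg] : forall l, exists f, F f /\ pi f = l by move=> l; have [f] := hsj l; exists f.
have hsF l : F (sg l) by case: (hsg l).
have hsp l : pi (sg l) = l by case: (hsg l).
have [|||g hg] := @rmorph_exists L T sg.
- by move=> x y; apply: hinj; rewrite ?rmorphD ?hsp //; exact: subringD.
- by move=> x y; apply: hinj; rewrite ?rmorphM ?hsp //; exact: hMM.
- by apply: hinj; rewrite ?rmorph1 ?hsp.
by exists L, pi, g; split=> // l; rewrite hg hsp.
Qed.

Lemma pw_addP (T : comNzRingType) (M : set T) k l :
  pw M (k + l) `<=` ideal_gen (fun z => exists x y, [/\ pw M k x, pw M l y & z = x * y]).
Proof.
elim: k => [|k IHk]; first by move=> x hx; apply: ideal_gen_sub; exists 1, x; rewrite mul1r.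
rewrite addSn; apply: pwS_min; first exact: ideal_gen_id.
move=> x y hx /IHk; move: y; apply: ideal_gen_min.
  split; first by rewrite mulr0; exact: isid0 (ideal_gen_id _).
    by move=> u v hu hv; rewrite mulrDr; exact: isidD (ideal_gen_id _) _ _.
  by move=> c u hu; rewrite mulrCA; exact: isidM (ideal_gen_id _) _.
move=> _ [u [v [hu hv ->]]]; apply: ideal_gen_sub; exists (x * u), v; split => //; last by rewrite mulrA.
exact: pwS.
Qed.

(** Noetherian induction: if a b lies in [I] and neither factor does, powers of [M] contained in I +
    (a) and in I + (b) multiply into [I]. *)
Lemma primary_pow (T : comNzRingType) (M J : set T) : noeth T -> isprime M -> isid J ->
  (forall P, isprime P -> J `<=` P -> M `<=` P) -> exists k, pw M k `<=` J.
Proof.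
move=> hT hM hJ; move: J hJ; apply: noeth_ind => // I hI IH hall.
have [h1|h1] := pselect (I 1); first by exists 0%N => x _; exact: isid1.
have [hp|hnp] := pselect (isprime I).
  by exists 1%N; rewrite pw1; [exact: hall | exact: prime_id].
have [a [b [hab ha hb]]] : exists a b, [/\ I (a * b), ~ I a & ~ I b].
  apply: contrapT => h; apply: hnp; split => // a b hab; apply: contrapT => /not_orP[ha hb].
  by apply: h; exists a, b.
have key c : ~ I c -> exists k, pw M k `<=` spn I [:: c].
  move=> hc; apply: IH; first exact: gen_id.
  - exact: gen_base.
  - by move=> h; apply: hc; apply: h; apply: spn_mem => //; rewrite inE.
  - by move=> P hP hIP; apply: hall => // x hx; apply: hIP; exact: gen_base.
have [k hk] := key a ha; have [l hl] := key b hb.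
exists (k + l)%N.
have hmul x y : spn I [:: a] x -> spn I [:: b] y -> I (x * y).
  move=> [r _ /= hr] [r' _ /= hr'].
  rewrite (_ : x * y = y * (x - r * a) + (r * a) * (y - r' * b) + r * r' * (a * b)); last by ring.
  by apply: isidD; [| apply: isidD |] => //; exact: isidM.
move=> x /pw_addP; move: x; apply: ideal_gen_min => // _ [x [y [hx hy ->]]].
by apply: hmul; [exact: hk | exact: hl].
Qed.

Lemma minover_pow (T : comNzRingType) (M J : set T) : complete_local M -> isid J -> minimal_over J M -> exists k, pw M k `<=` J.
Proof.
move=> hcl hJ [hM hJM hmin]; apply: primary_pow => //; first by case: hcl.
by move=> P hP hJP; apply: hmin => //; exact: (complete_local_prime_sub hcl).
Qed.

Section Fin.
Variables (K : fieldType) (T : comNzRingType) (M : set T) (sg : {rmorphism K -> T}).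
Hypotheses (hcl : complete_local M) (hdec : forall x, exists c, M (x - sg c)).
Let hM : isid M. Proof. by case: hcl. Qed.

(** Each power of [M] modulo the next is spanned over the coefficient field by generators of that
    power. *)
Lemma kspan J k : isid J -> pw M k `<=` J ->
  exists t : seq T, forall x, exists c : nat -> K, J (x - \sum_(i < size t) sg (c i) * t`_i).
Proof.
move=> hJ hk; suff [t ht] : exists t : seq T, forall x, exists c : nat -> K, pw M k (x - \sum_(i < size t) sg (c i) * t`_i).
  by exists t => x; have [c hc] := ht x; exists c; exact: hk.
have [hT _ _ _ _] := hcl; elim: k {hk} => [|k [t IH]]; first by exists [::] => x; exists (fun=> 0).
have [g hg] := hT _ (pw_id M k).
have hpk := pw_id M k.+1.
exists (t ++ g) => x; have [c hc] := IH x.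
move: hc; rewrite hg => /gen_sumP[|r _]; first exact: setT_id.
rewrite /zid => /subr0_eq e.
have /choice[d hd] : forall j, exists d, M (r j - sg d) by move=> j; exact: hdec.
exists (fun i => if (i < size t)%N then c i else d (i - size t)%N).
rewrite size_cat big_split_ord /= opprD addrA.
under eq_bigr => i _ do rewrite ltn_ord nth_cat ltn_ord.
rewrite e -sumrB; apply: isid_sum => // i _.
rewrite ltnNge leq_addr /= nth_cat ltnNge leq_addr /= addKn -mulrBl.
by apply: pwS => //; rewrite hg; apply: spn_mem; [exact: zid_id | exact: mem_nth].
Qed.

Variables (R : comNzRingType) (C : {rmorphism K -> R}) (X : seq R) (eps : {rmorphism R -> T}).
Hypotheses (hps : is_ps C X) (heC : forall c, eps (C c) = sg c) (heX : forall x, x \in X -> M (eps x)).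
Let I := spn (@zid R) X.
Let hI : isid I. Proof. by apply: gen_id; [exact: setT_id | exact: zid_id]. Qed.

Lemma eps_pw n x : pw I n x -> pw M n (eps x).
Proof.
elim: n x => // n IH x; apply: (pwS_min (J := contr eps (pw M n.+1))).
  exact: contr_id (pw_id _ _).
move=> y z hy hz; rewrite /contr /= rmorphM; apply: pwS; last exact: IH.
move: y hy; apply: (spn_min (I := contr eps M)); first exact: contr_id.
  by move=> _ ->; rewrite /contr /= rmorph0; exact: isid0.
by move=> a; exact: heX.
Qed.

(** Generators over the coefficient field modulo P and the variables generate T/P over the power
    series ring, by successive approximation. *)
Lemma fin_ps P t : isid P ->
  (forall x, exists c : nat -> K, spn P (map eps X) (x - \sum_(i < size t) sg (c i) * t`_i)) -> finmod eps P t.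
Proof.
move=> hP ht; have [hT _ _ _ hcT] := hcl; have [[_ _ _ _ [hsepR hcR]] _ _ _ _ _ _] := hps.
pose E n := ext eps (pw I n).
have hE n : isid (E n) by exact: ext_id.
have hEM n : E n `<=` pw M n by apply: ext_min; [exact: pw_id | exact: eps_pw].
(* One step: an element of I^n T is a combination of [t] with coefficients in I^n, up to [P] and a
   remainder in I^(n+1) T. *)
pose st n y (d : nat -> R) y' := [/\ forall i : nat, pw I n (d i), E n.+1 y' & P (y - \sum_(i < size t) eps (d i) * t`_i - y')].
have hst n y : E n y -> exists d y', st n y d y'.
  move: y; apply: (ext_min (Q := [set y | exists (d : nat -> R) y', st n y d y'])); first split.
  - exists (fun=> 0), 0; split; [by move=> i; exact: isid0 (pw_id _ _) | exact: isid0 |].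
    by rewrite big1 ?subrr ?subr0 => [|i _]; [exact: isid0 | rewrite rmorph0 mul0r].
  - move=> x y [d [x' [h1 h2 h3]]] [e [y' [h4 h5 h6]]]; exists (fun i => d i + e i), (x' + y'); split.
    + by move=> i; exact: isidD (pw_id _ _) _ _.
    + exact: isidD.
    + rewrite (eq_bigr (fun i : 'I_(size t) => eps (d i) * t`_i + eps (e i) * t`_i)); last by move=> i _; rewrite rmorphD mulrDl.
      rewrite big_split /=; have := isidD hP h3 h6; congr P; ring.
  - move=> a y [d [y' [h1 h2 h3]]].
    have /choice[m hm] : forall i, exists m : nat -> R, exists2 z, E 1%N z & P (a * t`_i - \sum_(j < size t) eps (m j) * t`_j - z).
      move=> i; have [c] := ht (a * t`_i).
      move=> /gen_sumP[|r _]; first exact: setT_id.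
      rewrite size_map => hr; exists (fun j => C (c j)), (\sum_(i0 < size X) r i0 * [seq eps i | i <- X]`_i0).
        apply: isid_sum => // j _; apply: isidM => //; rewrite (nth_map 0) //.
        apply: ext_in; rewrite pw1 //; apply: spn_mem; [exact: zid_id | exact: mem_nth].
      by under [X in _ - X - _]eq_bigr => j _ do rewrite heC.
    have /choice[z hz] : forall i, exists z, E 1%N z /\ P (a * t`_i - \sum_(j < size t) eps (m i j) * t`_j - z).
      by move=> i; have [z h h'] := hm i; exists z.
    exists (fun j => \sum_(i < size t) d i * m i j), (a * y' + \sum_(i < size t) eps (d i) * z i); split.
    + move=> j; apply: isid_sum; first exact: pw_id.
      by move=> i _; apply: isidMr; [exact: pw_id | exact: h1].
    + apply: isidD => //; first exact: isidM.
      apply: isid_sum => // i _; have [hzi _] := hz i.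
      move: (z i) hzi; apply: (ext_min (Q := [set w | E n.+1 (eps (d i) * w)])).
        split=> [|u v hu hv|b u hu] /=; first by rewrite mulr0; exact: isid0.
          by rewrite mulrDr; exact: isidD.
        by rewrite mulrCA; exact: isidM.
      move=> w hw /=; rewrite -rmorphM; apply: ext_in; rewrite mulrC; apply: pwS => //.
      by rewrite pw1 in hw.
    + have -> : \sum_(j < size t) eps (\sum_(i < size t) d i * m i j) * t`_j =
         \sum_(i < size t) eps (d i) * \sum_(j < size t) eps (m i j) * t`_j.
        under [RHS]eq_bigr => i _ do rewrite mulr_sumr.
        rewrite exchange_big; apply: eq_bigr => j _; rewrite rmorph_sum mulr_suml.
        by apply: eq_bigr => i _; rewrite rmorphM mulrA.
      have h4 : P (\sum_(i < size t) eps (d i) * (a * t`_i - \sum_(j < size t) eps (m i j) * t`_j - z i)).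
        by apply: isid_sum => // i _; apply: isidM => //; case: (hz i).
      have h5 := isidD hP (isidM a hP h3) h4; move: h5; congr P.
      under [X in _ + X]eq_bigr => i _ do rewrite !mulrBr.
      rewrite !sumrB !mulrBr [a * \sum_(_ < _) _]mulr_sumr.
      under [X in _ - X - _ + _]eq_bigr => i _ do rewrite mulrCA.
      by ring.
  - move=> x hx.
    have [c] := ht 1; move=> /gen_sumP[|r _]; first exact: setT_id.
    rewrite size_map => hr.
    exists (fun j => x * C (c j)), (\sum_(i0 < size X) r i0 * ([seq eps i | i <- X]`_i0 * eps x)); split.
    + by move=> i; apply: isidMr => //; exact: pw_id.
    + apply: isid_sum => // j _; apply: isidM => //; rewrite (nth_map 0) // -rmorphM.
      apply: ext_in; apply: pwS => //; apply: spn_mem; [exact: zid_id | exact: mem_nth].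
    + have := isidMr (eps x) hP hr; congr P.
      rewrite mulrBl mulrBl mul1r !mulr_suml; congr (_ - _ - _).
        by apply: eq_bigr => j _; rewrite rmorphM heC; ring.
      by apply: eq_bigr => j _; ring.
(* Each state carries its order n and the proof of membership in [E n], so that the step can be
   iterated by a chosen function. *)
have hst' (w : {n & {y | E n y}}) : exists dy : (nat -> R) * T, st (projT1 w) (proj1_sig (projT2 w)) dy.1 dy.2.
  by case: w => n [y hy] /=; have [d [y' h]] := hst n y hy; exists (d, y').
have [g hg] := choice hst'.
have hgE w : E (projT1 w).+1 (g w).2 by case: (hg w).
move=> x.
have hE0 : E 0%N x by rewrite -(mulr1 x) -(rmorph1 eps); apply: isidM => //; exact: ext_in.
pose W0 : {n & {y | E n y}} := existT _ 0%N (exist _ x hE0).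
pose nxt (w : {n & {y | E n y}}) : {n & {y | E n y}} := existT _ (projT1 w).+1 (exist _ (g w).2 (hgE w)).
pose w k := iter k nxt W0.
have hw k : projT1 (w k) = k by elim: k => //= k ->.
pose d k := (g (w k)).1; pose y k := proj1_sig (projT2 (w k)).
have hd k i : pw I k (d k i) by have [h _ _] := hg (w k); have := h i; rewrite hw.
have hy k : pw M k (y k) by apply: hEM; rewrite -{1}(hw k); exact: (proj2_sig (projT2 (w k))).
have hyS k : P (y k - \sum_(i < size t) eps (d k i) * t`_i - y k.+1) by have [_ _ h] := hg (w k).
have /choice[s hs] : forall i, exists s, forall n, pw I n (s - \sum_(k < n) d k i).
  by move=> i; apply: (hcR (fun k => d k i)) => k; exact: hd.
(* The coefficients converge in R. Their limits represent x modulo [P] and every power of [M], hence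
   modulo [P]. *)
exists s; apply: (krull_ideal hcl) => // n.
have hn : P (x - \sum_(i < size t) eps (\sum_(k < n) d k i) * t`_i - y n).
  elim: n => [|n IH].
    rewrite big1 ?subr0 ?subrr; first exact: isid0.
    by move=> i _; rewrite big_ord0 rmorph0 mul0r.
  rewrite (_ : _ - _ - _ = (x - \sum_(i < size t) eps (\sum_(k < n) d k i) * t`_i - y n)
     + (y n - \sum_(i < size t) eps (d n i) * t`_i - y n.+1)); first exact: isidD.
  rewrite (eq_bigr (fun i : 'I_(size t) => eps (\sum_(k < n) d k i) * t`_i + eps (d n i) * t`_i)).
    by rewrite big_split /=; ring.
  by move=> i _; rewrite big_ord_recr /= rmorphD mulrDl.
exists (x - \sum_(i < size t) eps (\sum_(k < n) d k i) * t`_i - y n); first exact: hn.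
rewrite (_ : _ - _ = y n - \sum_(i < size t) eps (s i - \sum_(k < n) d k i) * t`_i).
  apply: (isidB (pw_id _ _)) => //.
  apply: isid_sum; first exact: pw_id.
  by move=> i _; apply: isidMr; [exact: pw_id | exact: eps_pw].
rewrite [X in _ = _ - X](eq_bigr (fun i : 'I_(size t) => eps (s i) * t`_i - eps (\sum_(k < n) d k i) * t`_i)).
  by rewrite sumrB; ring.
by move=> i _; rewrite rmorphB mulrBl.
Qed.

Lemma ps_surj : M = spn (@zid T) (map eps X) -> forall y, exists x, eps x = y.
Proof.
move=> h; have hf := @fin_ps (@zid T) [:: 1] (@zid_id T); have {}hf : finmod eps (@zid T) [:: 1].
  apply: hf => x; have [c' hc] := hdec x; exists (fun=> c'); by rewrite big_ord_recl big_ord0 addr0 mulr1 -h.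
move=> y; have [c] := hf y; rewrite big_ord_recl big_ord0 addr0 mulr1 => /subr0_eq->.
by exists (c 0%N).
Qed.

Lemma ps_min : minimal_over (spn (@zid R) X) (spn (@zid R) X).
Proof.
have [hc _ _ _ _ _ _] := hps.
by split => //; exact: (complete_local_prime hc).
Qed.

Lemma ps_dim n : height_ge (@zid R) (spn (@zid R) X) n -> (n <= size X)%N.
Proof.
have [[hn _ _ _ _] _ _ _ _ _ _] := hps.
exact: (krull_height hn (@zid_id R) ps_min).
Qed.

(** The contraction has height at least zero plus the length of the contracted chain above it; if it
    were not zero, the zero ideal below it would give a chain longer than the number of
    variables. *)
Lemma ps_ker P t : isprime P -> finmod eps P t -> height_ge P M (size X) -> contr eps P = @zid R.
Proof.
move=> hP hf hh; have [hT _ _ _ _] := hcl; have [hc _ hdom _ _ _ _] := hps.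
have h1 := @height_ge_contr _ _ eps P t (prime_id hP) hf P M (size X) (fun x hx => hx) hh.
have hcP := @contr_prime _ _ eps _ hP.
apply: seteqI; last by move=> _ ->; exact: isid0 (prime_id hcP).
apply: contrapT => hne.
suff : height_ge (@zid R) (spn (@zid R) X) (size X).+1 by move=> /ps_dim; rewrite ltnn.
apply: height_ge_up (complete_local_prime hc) (complete_local_prime_sub hc (height_ge_prime h1)).
apply: height_ge_bot h1 => Q hQ hPQ _; exists (@zid R); split => //; first exact: zid_sub (prime_id hQ).
by move=> h; apply: hne => x hx; apply: h; apply: hPQ.
Qed.
End Fin.

(** The hypotheses make [z] a system of parameters of T/P: M^k lies in P + (z) for some k, so that
    T/P is finite over K[[z]], and a comparison of dimensions gives injectivity. *)
Lemma noether_norm (K : fieldType) (T : comNzRingType) (M : set T) (sg : {rmorphism K -> T}) P z :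
  complete_local M -> (forall x, exists c, M (x - sg c)) -> isprime P -> (forall a, a \in z -> M a) ->
  minimal_over (spn P z) M -> height_ge P M (size z) ->
  exists (R : comNzRingType) (C : {rmorphism K -> R}) (X : seq R) (eps : {rmorphism R -> T}) (t : seq T),
  [/\ is_ps C X, map eps X = z, (forall c, eps (C c) = sg c), finmod eps P t & contr eps P = @zid R].
Proof.
move=> hcl hdec hP hz hmin hh; have [hT hM _ _ hc] := hcl.
have [R [C [X [hX hps]]]] := ps_exists K (size z).
have [eps [heC heX]] := ps_eval hps sg hM hc (esym hX) hz.
have hJ : isid (spn P z) by apply: gen_id; [exact: setT_id | exact: prime_id].
have [k hk] := minover_pow hcl hJ hmin.
have [t ht] := kspan hcl hdec hJ hk.
have heM x : x \in X -> M (eps x) by move=> hx; apply: hz; rewrite -heX map_f.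
exists R, C, X, eps, t.
have hf : finmod eps P t.
  by apply: (fin_ps hcl hps heC heM (prime_id hP)) => x; rewrite heX; exact: ht.
split=> //; apply: (ps_ker hcl hps hP hf); by rewrite hX.
Qed.

Lemma pw_pw (A : comNzRingType) (N : set A) k D : pw N (k * D) `<=` pw (pw N k) D.
Proof.
elim: D => [|D IH]; first by [].
rewrite mulnS => x /pw_addP; move: x; apply: ideal_gen_min; first exact: pw_id.
by move=> _ [x [y [hx hy ->]]]; apply: pwS => //; exact: IH.
Qed.

(** * Flatness of completions and polynomial extensions *)

Section CompletionFlat.
Variables (A T : comNzRingType) (phi : {rmorphism A -> T}) (N : set A) (M : set T).
Hypotheses (hA : noeth A) (hN : isid N) (hcl : complete_local M).
Hypotheses (hNM : forall k x, pw N k x <-> pw M k (phi x)) (hd : forall k t, exists a, pw M k (t - phi a)).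

(** A value of the linear form [a] that is small enough is also the value at a vector with
    coordinates in N^k; this makes approximate syzygies exact. *)
Lemma artin_rees_gens n (a : 'I_n -> A) k : exists D, forall b : 'I_n -> A, pw N D (\sum_i a i * b i) ->
  exists e : 'I_n -> A, (forall i, pw N k (e i)) /\ \sum_i a i * b i = \sum_i a i * e i.
Proof.
pose V : set 'rV[A]_1 := [set v | exists b : 'I_n -> A, v 0 0 = \sum_i a i * b i].
have hV : submod V.
  split=> [|x y [b hb] [c hc]|r x [b hb]].
  - by exists (fun=> 0); rewrite mxE big1 // => i _; rewrite mulr0.
  - exists (fun i => b i + c i); rewrite mxE hb hc -big_split /=.
    by apply: eq_bigr => i _; rewrite mulrDr.
  - exists (fun i => r * b i); rewrite mxE hb mulr_sumr.
    by apply: eq_bigr => i _; rewrite mulrCA.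
have [D hD] := artin_rees hA (pw_id N k) hV.
exists (k * D)%N => b hb.
have [||J [c [w [hc hw e]]]] := hD (\row__ \sum_i a i * b i).
- by exists b; rewrite mxE.
- by move=> i; rewrite mxE; exact: pw_pw.
have /choice[f hf] : forall j, exists f : 'I_n -> A, w j 0 0 = \sum_i a i * f i by move=> j; exact: hw.
exists (fun i => \sum_j c j * f j i); split.
  by move=> i; apply: isid_sum; [exact: pw_id | move=> j _; apply: isidMr; [exact: pw_id | exact: hc]].
have /matrixP/(_ 0 0) := e; rewrite mxE summxE => ->.
under [RHS]eq_bigr => i _ do rewrite mulr_sumr.
rewrite exchange_big; apply: eq_bigr => j _; rewrite mxE hf mulr_sumr.
by apply: eq_bigr => i _; rewrite mulrCA.
Qed.

(** The vectors that satisfy the equational criterion for [a] form a submodule [W], which is closed.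
    A solution over T is approximated over A, and the approximation is corrected to an exact syzygy
    over A. *)
Lemma completion_flat : flat phi.
Proof.
move=> I a t hat; have [hT hM _ _ _] := hcl.
pose n := #|I|.
pose W : set 'rV[T]_n := [set w | exists l (al : 'I_n -> 'I_l -> A) (z : 'I_l -> T),
  (forall i, w 0 i = \sum_j phi (al i j) * z j) /\ forall j, \sum_i a (enum_val i) * al i j = 0].
have hW : submod W.
  split.
  - by exists 0%N, (fun _ _ => 0), (fun=> 0); split=> [i|[]//]; rewrite mxE big_ord0.
  - move=> x y [l [al [z [h1 h2]]]] [l' [al' [z' [h3 h4]]]].
    exists (l + l')%N, (fun i j => match split j with inl j => al i j | inr j => al' i j end),
      (fun j => match split j with inl j => z j | inr j => z' j end); split.
      move=> i; rewrite mxE h1 h3 big_split_ord /=; congr (_ + _); apply: eq_bigr => j _.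
        by rewrite (unsplitK (inl j)).
      by rewrite (unsplitK (inr j)).
    by move=> j; case: (split j).
  - move=> c x [l [al [z [h1 h2]]]]; exists l, al, (fun j => c * z j); split => // i.
    by rewrite mxE h1 mulr_sumr; apply: eq_bigr => j _; rewrite mulrCA.
have : W (\row_i t (enum_val i)).
  apply: (krull_vec hcl) => // k.
  have [D hD] := artin_rees_gens (fun i : 'I_n => a (enum_val i)) k.
  have /choice[b hb] : forall i : 'I_n, exists b, pw M (D + k) (t (enum_val i) - phi b) by move=> i; exact: hd.
  have [|e [he1 he2]] := hD b.
    apply/hNM; rewrite rmorph_sum.
    have -> : \sum_i phi (a (enum_val i) * b i) = - \sum_(i < n) phi (a (enum_val i)) * (t (enum_val i) - phi (b i)).
      under [X in - X]eq_bigr => i _ do rewrite mulrBr.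
      rewrite sumrB opprB.
      have -> : \sum_(i < n) phi (a (enum_val i)) * t (enum_val i) = 0.
        by transitivity (\sum_i phi (a i) * t i) => //; rewrite [RHS](reindex _ (onW_bij _ (enum_val_bij I))).
      by rewrite subr0; apply: eq_bigr => i _; rewrite rmorphM.
    apply: isidN; first exact: pw_id.
    apply: isid_sum; first exact: pw_id.
    move=> i _; apply: isidM; first exact: pw_id.
    by apply: pw_sub (hb i); exact: leq_addr.
  exists (\row_i phi (b i - e i)).
    exists 1%N, (fun i _ => b i - e i), (fun=> 1); split.
      by move=> i; rewrite mxE big_ord1 mulr1.
    move=> _; under eq_bigr => i _ do rewrite mulrBr.
    by rewrite sumrB he2 subrr.
  move=> i; rewrite !mxE rmorphB opprB addrA addrAC.
  apply: isidD; first exact: pw_id.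
    by apply: pw_sub (hb i); exact: leq_addl.
  by apply/hNM.
move=> [l [al [z [h1 h2]]]]; exists l, (fun i => al (enum_rank i)), z; split.
  by move=> i; rewrite -h1 mxE enum_rankK.
move=> j; rewrite -[RHS](h2 j) [LHS](reindex _ (onW_bij _ (enum_val_bij I))).
by apply: eq_bigr => i _; rewrite enum_valK.
Qed.

Lemma completion_ffl : (forall J, isid J -> ~ J 1 -> J `<=` N) -> faithfully_flat phi.
Proof.
move=> hloc; split; first exact: completion_flat.
have [hT hM _ h1 _] := hcl.
move=> J hJ hext; apply: contrapT => /(hloc _ hJ) hJN; apply: h1.
apply: (ext_min hM _ hext) => x /hJN; rewrite -(pw1 hN) => /hNM.
by rewrite pw1.
Qed.
End CompletionFlat.

Section FlatPoly.
(** The coefficient, in degree e of a sum of products a i * t i, of the unknown coefficient of t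
    (p.1) in degree p.2: it turns polynomial relations into linear systems. *)
Definition pconv (A : comNzRingType) (I : finType) D (a : I -> {poly A}) e (p : I * 'I_D) : A :=
  if (p.2 <= e)%N then (a p.1)`_(e - p.2) else 0.

Lemma pconvE (A : comNzRingType) (I : finType) D (a : I -> {poly A}) (h : I * 'I_D -> nat -> A) e :
  (\sum_i a i * \sum_(d < D) (h (i, d) 0%N)%:P * 'X^d)`_e = \sum_p pconv a e p * h p 0%N.
Proof.
transitivity (\sum_i \sum_d pconv a e (i, d) * h (i, d) 0%N); last first.
  by rewrite pair_bigA; apply: eq_bigr => -[].
rewrite coef_sum; apply: eq_bigr => i _; rewrite mulr_sumr coef_sum; apply: eq_bigr => d _.
rewrite /pconv /= mulrCA coefCM coefMXn mulrC ltnNge; by case: leqP => // _; rewrite mul0r.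
Qed.

Lemma pconv0 (A : comNzRingType) (I : finType) D (a : I -> {poly A}) E e (p : I * 'I_D) :
  (forall i, size (a i) <= E)%N -> (E + D <= e)%N -> pconv a e p = 0.
Proof.
move=> hE he; rewrite /pconv; case: ifP => // _; apply: nth_default.
apply: leq_trans (hE _) _; have := ltn_ord p.2; lia.
Qed.

Lemma poly_expand (A : comNzRingType) (p : {poly A}) D : (size p <= D)%N -> p = \sum_(d < D) (p`_d)%:P * 'X^d.
Proof.
move=> h; rewrite -{1}(coefK p) poly_def (big_ord_widen D (fun i => p`_i *: 'X^i) h) big_mkcond /=.
apply: eq_bigr => i _; case: ltnP => hi; first by rewrite mul_polyC.
by rewrite nth_default // polyC0 mul0r.
Qed.

Variables (A T : comNzRingType) (phi : {rmorphism A -> T}).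
Let pphi : {rmorphism {poly A} -> {poly T}} := map_poly phi.

Lemma pconv_map (I : finType) D (a : I -> {poly A}) e (p : I * 'I_D) :
  pconv (fun i => pphi (a i)) e p = phi (pconv a e p).
Proof. by rewrite /pconv; case: ifP => _; rewrite ?rmorph0 // coef_map. Qed.

Lemma size_bound (B : comNzRingType) (I : finType) (a : I -> {poly B}) : exists E, forall i, (size (a i) <= E)%N.
Proof. by exists (\max_i size (a i)) => i; exact: (leq_bigmax i). Qed.

Lemma flat_poly : flat phi -> flat pphi.
Proof.
move=> hf I a t hat; have [D hD] := size_bound t; have [E hE] := size_bound a.
have hexp i := poly_expand (hD i).
have [|l [al [z [h1 h2]]]] := @flat_sys _ _ phi (E + D) _ (fun e p => @pconv A I D a e p) (fun p => (t p.1)`_p.2) hf.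
  move=> e; have /polyP/(_ e) := hat; rewrite coef0.
  under eq_bigr => i _ do rewrite (hexp i).
  rewrite (@pconvE _ _ _ (fun i => pphi (a i)) (fun p _ => (t p.1)`_p.2)) => h; rewrite -[RHS]h.
  by apply: eq_bigr => p _; rewrite pconv_map.
exists l, (fun i j => \sum_(d < D) (al (i, d) j)%:P * 'X^d), (fun j => (z j)%:P); split.
  move=> i; rewrite {1}(hexp i).
  under [RHS]eq_bigr => j _ do rewrite rmorph_sum mulr_suml.
  rewrite exchange_big; apply: eq_bigr => d _; rewrite (h1 (i, d)) rmorph_sum mulr_suml.
  apply: eq_bigr => j _; have -> : pphi ((al (i, d) j)%:P * 'X^d) = (phi (al (i, d) j))%:P * 'X^d.
    by rewrite rmorphM /= map_polyC map_polyXn.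
  by rewrite /= polyCM mulrAC.
move=> j; apply/polyP => e; rewrite coef0 (pconvE a (fun p _ => al p j)).
case: (ltnP e (E + D)) => he; first exact: (h2 (Ordinal he) j).
by rewrite big1 // => p _; rewrite (pconv0 p hE he) mul0r.
Qed.

(** Comparing coefficients in 1 = \sum c i * e i gives a linear system over A that is solvable over
    T, hence over A. *)
Lemma ffl_poly : faithfully_flat phi -> faithfully_flat pphi.
Proof.
move=> hf; split; first by apply: flat_poly; case: hf.
move=> J hJ [k [c [e [he e1]]]].
have /choice[b hb] : forall i, exists b, J b /\ pphi b = e i by move=> i; have [b h1 h2] := he i; exists b.
have [D hD] := size_bound c; have [E hE] := size_bound b.
have hexp i := poly_expand (hD i).
(* The successor guarantees that the equation in degree 0, the only one with right-hand side 1,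
   belongs to the system. *)
have [|y hy] := @ffl_sys _ _ phi (E + D).+1 _ (fun e p => @pconv A _ D b e p)
    (fun e => (e == 0%N :> nat)%:R) (fun p => (c p.1)`_p.2) hf.
  move=> n; have /polyP/(_ n) := e1; rewrite coef1 rmorph_nat => ->.
  under [in RHS]eq_bigr => i _ do rewrite mulrC -(proj2 (hb i)) (hexp i).
  rewrite (@pconvE _ _ _ (fun i => pphi (b i)) (fun p _ => (c p.1)`_p.2)).
  by apply: eq_bigr => p _; rewrite pconv_map.
have -> : 1 = \sum_i b i * \sum_(d < D) (y (i, d))%:P * 'X^d.
  apply/polyP => n; rewrite (pconvE b (fun p _ => y p)) coef1.
  case: (ltnP n (E + D).+1) => hn; first by rewrite -(hy (Ordinal hn)).
  rewrite big1 ?(gtn_eqF (leq_trans _ hn)) // => p _.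
  by rewrite (pconv0 p hE (ltnW hn)) mul0r.
apply: isid_sum => // i _; apply: isidMr => //; by case: (hb i).
Qed.
End FlatPoly.

(** * Derivations and linear forms on cotangent spaces *)

Lemma isderZ (R : comNzRingType) (d : R -> R) a : isder d -> isder (fun x => a * d x).
Proof. by move=> [h1 h2]; split=> x y; rewrite ?h1 ?h2; ring. Qed.

Lemma isder_sum (R : comNzRingType) n (d : 'I_n -> R -> R) :
  (forall k, isder (d k)) -> isder (fun x => \sum_k d k x).
Proof.
move=> h; split=> x y.
  by rewrite -big_split; apply: eq_bigr => k _; case: (h k) => h1 _; rewrite h1.
rewrite !mulr_sumr -big_split; apply: eq_bigr => k _; case: (h k) => _ h2; rewrite h2 //.
Qed.

Lemma isder_deriv (R : comNzRingType) : isder (@deriv R).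
Proof. by split=> x y; [rewrite derivD | rewrite derivM addrC; congr (_ + _); rewrite mulrC]. Qed.

Lemma isder_map_poly (R : comNzRingType) (d : R -> R) : isder d -> isder (map_poly d).
Proof.
move=> hd; have d0 := isder0 hd; have [hD hM] := hd.
split=> p q; apply/polyP => i; first by rewrite coefD !coef_map_id0 // coefD hD.
rewrite coefD coef_map_id0 // [q * _]mulrC !coefM (big_morph d hD d0) -big_split.
by apply: eq_bigr => j _; rewrite !coef_map_id0 // hM [q`_ _ * _]mulrC.
Qed.

Lemma map_poly_derC (R : comNzRingType) (d : R -> R) c : isder d -> map_poly d c%:P = (d c)%:P.
Proof.
by move=> hd; apply/polyP => i; rewrite coef_map_id0 ?(isder0 hd) // !coefC; case: eqP => //; rewrite (isder0 hd).
Qed.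

Definition char0u (S : comNzRingType) := forall n, exists y : S, y * n.+1%:R = 1.

Lemma char0u_neq0 (S : comNzRingType) (L : fieldType) (pi : {rmorphism S -> L}) n : char0u S -> n.+1%:R != 0 :> L.
Proof.
move=> h; have [y hy] := h n; have : pi y * n.+1%:R = 1 by rewrite -(rmorph_nat pi) -rmorphM hy rmorph1.
by apply: contra_eq_neq => ->; rewrite mulr0 eq_sym oner_neq0.
Qed.

Lemma char0u_map (S R : comNzRingType) (phi : {rmorphism S -> R}) : char0u S -> char0u R.
Proof. by move=> h n; have [y hy] := h n; exists (phi y); rewrite -(rmorph_nat phi) -rmorphM hy rmorph1. Qed.

Lemma ker_prime (S : comNzRingType) (L : fieldType) (pi : {rmorphism S -> L}) : isprime [set x | pi x = 0].
Proof.
split; first by split=> [|x y hx hy|a x hx]; rewrite /= ?rmorph0 ?rmorphD ?rmorphM // hx ?hy ?addr0 ?mulr0.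
  by rewrite /= rmorph1 => /eqP; rewrite oner_eq0.
by move=> x y /= /eqP; rewrite rmorphM mulf_eq0 => /orP[]/eqP; [left|right].
Qed.

Section OneVar.
Variables (A : comNzRingType) (L : fieldType) (pi : {rmorphism {poly A} -> L}).
Hypothesis hch : forall n, n.+1%:R != 0 :> L.
Let Q : set {poly A} := [set p | pi p = 0].
Let hQ : isid Q.
Proof. exact: prime_id (ker_prime pi). Qed.

(** Division by [f] with the leading coefficient cleared: the degree of [g] drops, and terms with
    leading coefficient in the kernel are removed as multiples of constants of the kernel. *)
Lemma functional_vanish (phi : {poly A} -> L) f :
  functional Q pi phi -> (forall c : A, pi c%:P = 0 -> phi c%:P = 0) ->
  Q f -> phi f = 0 -> pi (lead_coef f)%:P != 0 ->
  (forall g, Q g -> pi (lead_coef g)%:P != 0 -> (size f <= size g)%N) -> forall g, Q g -> phi g = 0.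
Proof.
move=> hphi hc hf hpf hlf hmin g; have [n] := ubnP (size g); elim: n g => // n IH g hn hg.
have [->|g0] := eqVneq g 0; first exact: (functional0 (ker_prime pi) hphi).
have sg : (0 < size g)%N by rewrite size_poly_gt0.
have hlt (h : {poly A}) : (size h <= size g)%N -> h`_(size g).-1 = 0 -> (size h < n)%N.
  move=> h1 h2; apply: leq_trans (_ : size g <= n)%N => //.
  rewrite -(prednK sg) ltnS; apply/leq_sizeP => j; rewrite leq_eqVlt => /orP[/eqP<-//|hj].
  by apply: nth_default; apply: leq_trans h1 _; rewrite -(prednK sg).
have [D Z] := hphi.
have [hl|hl] := eqVneq (pi (lead_coef g)%:P) 0.
  pose h := g - 'X^((size g).-1) * (lead_coef g)%:P.
  have hhQ : Q ('X^((size g).-1) * (lead_coef g)%:P) by apply: isidM => //.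
  have hQh : Q h by apply: isidB.
  rewrite -(subrK ('X^((size g).-1) * (lead_coef g)%:P) g) -/h D // (Z _ _ hl) hc // mulr0 addr0.
  apply: IH hQh; apply: hlt.
    rewrite (leq_trans (size_polyD _ _)) // geq_max leqnn size_polyN mulrC mul_polyC.
    by rewrite (leq_trans (size_scale_leq _ _)) // size_polyXn prednK.
  by rewrite coefB mulrC coefCM coefXn eqxx mulr1 subrr.
have hfg := hmin _ hg hl.
have sf : (0 < size f)%N by rewrite size_poly_gt0; apply: contraNneq hlf => ->; rewrite lead_coef0 rmorph0.
pose m := (size g - size f)%N.
pose h := (lead_coef f)%:P * g - ((lead_coef g)%:P * 'X^m) * f.
have hQh : Q h by apply: isidB => //; apply: isidM.
have e : phi ((lead_coef f)%:P * g) = 0.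
  rewrite -(subrK (((lead_coef g)%:P * 'X^m) * f) (_ * g)) -/h D //; last exact: isidM.
  rewrite Z // hpf mulr0 addr0; apply: IH hQh; apply: hlt.
    rewrite (leq_trans (size_polyD _ _)) // geq_max size_polyN !mul_polyC size_scale_leq /=.
    rewrite -scalerAl (leq_trans (size_scale_leq _ _)) //.
    rewrite (leq_trans (size_polyMleq _ _)) // size_polyXn /m addSn /= subnK //.
  rewrite coefB -mulrA !coefCM coefXnM ifF; last by rewrite /m; lia.
  rewrite (_ : ((size g).-1 - m)%N = (size f).-1); last by rewrite /m; lia.
  by rewrite mulrC subrr.
by move: e; rewrite Z // => /eqP; rewrite mulf_eq0 (negPf hlf) => /eqP.
Qed.

Lemma one_var lam : functional Q pi lam -> (forall c : A, pi c%:P = 0 -> lam c%:P = 0) ->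
  exists v, forall p, pi p = 0 -> lam p = v * pi p^`().
Proof.
move=> hlam hc.
have hfun v : functional Q pi (fun p => lam p - v * pi p^`()).
  have [D Z] := hlam; split=> [x y hx hy|a x hx].
    by rewrite D // derivD rmorphD; ring.
  rewrite Z // derivM rmorphD !rmorphM (_ : pi x = 0) //; ring.
have hfc v c : pi c%:P = 0 -> lam c%:P - v * pi (c%:P)^`() = 0.
  by move=> h; rewrite hc // derivC rmorph0 mulr0 subr0.
have [hex|hno] := pselect (exists n f, [/\ Q f, pi (lead_coef f)%:P != 0 & size f = n]); last first.
  exists 0 => p hp; apply/eqP; rewrite -subr_eq0; apply/eqP.
  have [n] := ubnP (size p); elim: n p hp => // n IH p hp hn.
  have [->|p0] := eqVneq p 0; first exact: (functional0 (ker_prime pi) (hfun 0)).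
  have sp : (0 < size p)%N by rewrite size_poly_gt0.
  have hl : pi (lead_coef p)%:P = 0.
    by apply/eqP/negP => /negP h; apply: hno; exists (size p), p.
  pose h := p - 'X^((size p).-1) * (lead_coef p)%:P.
  have hhQ : Q ('X^((size p).-1) * (lead_coef p)%:P) by apply: isidM.
  have hQh : Q h by apply: isidB.
  have [D Z] := hfun 0.
  rewrite -(subrK ('X^((size p).-1) * (lead_coef p)%:P) p) -/h D // (Z _ _ hl) hfc // mulr0 addr0.
  apply: IH => //; apply: leq_trans (_ : size p <= n)%N => //.
  rewrite -(prednK sp) ltnS; apply/leq_sizeP => j; rewrite /h coefB mulrC coefCM coefXn => hj.
  case: ltngtP hj => // [hj _|<- _]; last by rewrite mulr1 subrr.
  by rewrite mulr0 subr0 nth_default // -(prednK sp).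
have hex' : exists n, `[< exists f, [/\ Q f, pi (lead_coef f)%:P != 0 & size f = n] >].
  by case: hex => n h; exists n; apply/asboolP.
case: (ex_minnP hex') => n /asboolP[f [hf hlf sf]] hmin'.
have hmin g : Q g -> pi (lead_coef g)%:P != 0 -> (size f <= size g)%N.
  by move=> hg hl; rewrite sf; apply: hmin'; apply/asboolP; exists g.
have sf1 : (1 < size f)%N.
  rewrite ltnNge; apply/negP => /size1_polyC ef; move: hlf.
  by rewrite ef lead_coefC -ef (_ : pi f = 0) ?eqxx.
(* In characteristic zero the derivative still has leading coefficient outside the kernel, so it
   cannot be a member of [Q] of smaller degree. *)
have hdf : pi f^`() != 0.
  apply/eqP => h.
  have ld : f^`()`_(size f).-2 = lead_coef f *+ (size f).-1.
    by rewrite coef_deriv /lead_coef; case: (size f) sf1 => [|[|k]].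
  have hpl : pi (lead_coef f *+ (size f).-1)%:P != 0.
    rewrite polyCMn rmorphMn -mulr_natr mulf_neq0 // -(prednK (_ : 0 < (size f).-1)%N); last by lia.
    exact: hch.
  have sd : size f^`() = (size f).-1.
    apply/eqP; rewrite eqn_leq -ltnS prednK ?lt_size_deriv -?size_poly_gt0 //; try by lia.
    rewrite -(prednK (_ : 0 < (size f).-1)%N); last by lia.
    rewrite ltnNge; apply/negP => /leq_sizeP/(_ _ (leqnn _)); rewrite ld => e.
    by move: hpl; rewrite e polyC0 rmorph0 eqxx.
  have := hmin _ (h : Q _); rewrite /lead_coef sd ld => /(_ hpl); lia.
exists (lam f / pi f^`()) => p hp; apply/eqP; rewrite -subr_eq0; apply/eqP.
apply: (functional_vanish (hfun (lam f / pi f^`())) _ hf) => //; first exact: hfc.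
by rewrite mulfVK ?subrr.
Qed.
End OneVar.

(* Every linear form on the cotangent space at a prime Q is induced by derivations of S, as for
   polynomial and power series rings over a field of characteristic zero. *)
Definition Jprop (S : comNzRingType) := forall (Q : set S) (L : fieldType) (pi : {rmorphism S -> L}) lam,
  (forall x, Q x <-> pi x = 0) -> functional Q pi lam ->
  exists n (c : 'I_n -> L) (D : 'I_n -> S -> S), (forall k, isder (D k)) /\
    forall x, Q x -> lam x = \sum_k c k * pi (D k x).

Lemma der_functional (S : comNzRingType) (L : fieldType) (pi : {rmorphism S -> L}) (Q : set S) n (c : 'I_n -> L) (D : 'I_n -> S -> S) lam :
  (forall x, Q x -> pi x = 0) -> functional Q pi lam -> (forall k, isder (D k)) ->
  functional Q pi (fun x => lam x - \sum_k c k * pi (D k x)).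
Proof.
move=> hQ [hD hZ] hder; split=> [x y hx hy|a x hx].
  rewrite hD // [RHS]addrACA -opprD -big_split; congr (_ - _).
  by apply: eq_bigr => k _ /=; have [h _] := hder k; rewrite h rmorphD mulrDr.
rewrite hZ // mulrBr mulr_sumr; congr (_ - _); apply: eq_bigr => k _.
by have [_ h] := hder k; rewrite h rmorphD !rmorphM (hQ _ hx) mul0r addr0 mulrCA.
Qed.

(** On constants the form is induced by derivations of S, which extend coefficientwise. What remains
    vanishes on constants and is a multiple of the derivative in the new variable. *)
Lemma Jprop_poly (S : comNzRingType) : char0u S -> Jprop S -> Jprop {poly S}.
Proof.
move=> hch hJ Q L pi lam hQ hlam.
have eQ : Q = [set p | pi p = 0] by apply: seteqI => x /hQ.
rewrite eQ in hlam *; have [hD hZ] := hlam.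
have hlc : functional [set x | (pi \o polyC) x = 0] (pi \o polyC) (lam \o polyC).
  split=> [x y hx hy|a x hx] /=; rewrite ?polyCD ?polyCM ?hD ?hZ //.
have [n [c [D [hder he]]]] := hJ _ L (pi \o polyC : {rmorphism S -> L}) _ (fun x => iff_refl _) hlc.
have hch' m : m.+1%:R != 0 :> L by apply: (char0u_neq0 (pi \o polyC : {rmorphism S -> L})).
have hder' k : isder (map_poly (D k)) by exact: isder_map_poly.
have [|v hv] := one_var hch' (der_functional c (fun x h => h) hlam hder').
  move=> a ha; rewrite -[lam a%:P]/((lam \o polyC) a) he //; apply/eqP; rewrite subr_eq0; apply/eqP.
  by apply: eq_bigr => k _; rewrite map_poly_derC.
exists (n + 1)%N, (fun k => match split k with inl j => c j | inr _ => v end),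
  (fun k => match split k with inl j => map_poly (D j) | inr _ => @deriv S end); split.
  by move=> k; case: (split k) => // _; exact: isder_deriv.
move=> x hx; rewrite big_split_ord big_ord1 /= (unsplitK (inr ord0)) -(hv x hx).
under eq_bigr => i _ do rewrite (unsplitK (inl i)).
by rewrite addrC subrK.
Qed.

Fixpoint polyn (A : comNzRingType) m : comNzRingType := if m is k.+1 then {poly (polyn A k)} else A.

Fixpoint polynC (A : comNzRingType) m : {rmorphism A -> polyn A m} :=
  if m is k.+1 return {rmorphism A -> polyn A m} then polyC \o polynC A k else idfun.

Fixpoint polynM (A B : comNzRingType) (phi : {rmorphism A -> B}) m : {rmorphism polyn A m -> polyn B m} :=
  if m is k.+1 return {rmorphism polyn A m -> polyn B m} then map_poly (polynM phi k) else phi.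

Fixpoint pd (A : comNzRingType) m (j : nat) : polyn A m -> polyn A m :=
  if m is k.+1 return polyn A m -> polyn A m then
    if j is l.+1 then map_poly (@pd A k l) else @deriv (polyn A k)
  else fun=> 0.

Fixpoint polynD (A : comNzRingType) (d : A -> A) m : polyn A m -> polyn A m :=
  if m is k.+1 return polyn A m -> polyn A m then map_poly (@polynD A d k) else d.

Lemma pd_der A m j : isder (@pd A m j).
Proof.
elim: m j => [|m IH] [|j] /=; try by split=> x y; rewrite ?addr0 ?mulr0 ?addr0.
  exact: isder_deriv.
exact: isder_map_poly.
Qed.

Lemma polynD_der (A : comNzRingType) (d : A -> A) m : isder d -> isder (@polynD A d m).
Proof. by move=> h; elim: m => //= m IH; exact: isder_map_poly. Qed.

Lemma polynD_C (A : comNzRingType) (d : A -> A) m a : isder d -> polynD d (polynC A m a) = polynC A m (d a).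
Proof. by move=> h; elim: m => //= m IH; rewrite map_poly_derC ?IH //; exact: polynD_der. Qed.

Lemma pd_C A m j a : @pd A m j (polynC A m a) = 0.
Proof.
elim: m j => [|m IH] [|j] //=; first exact: derivC.
by rewrite map_poly_derC ?IH ?polyC0 //; exact: pd_der.
Qed.

Lemma polynM_C A B phi m a : @polynM A B phi m (polynC A m a) = polynC B m (phi a).
Proof. by elim: m => //= m IH; rewrite map_polyC /= IH. Qed.

Lemma polynM_pd A B phi m j x : @polynM A B phi m (pd j x) = pd j (polynM phi m x).
Proof.
elim: m j x => [|m IH] [|j] x /=; rewrite ?rmorph0 //; first by rewrite deriv_map.
apply/polyP => i; rewrite !coef_map_id0 ?rmorph0 //; try exact: isder0 (pd_der _ _ _).
Qed.

Lemma polynM_surj (A B : comNzRingType) (phi : {rmorphism A -> B}) m : (forall y, exists x, phi x = y) -> forall y, exists x, @polynM A B phi m x = y.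
Proof.
move=> h; elim: m => //= m IH y.
have /choice[f hf] := IH; exists (\poly_(i < size y) f y`_i); apply/polyP => i.
rewrite coef_map coef_poly; case: ltnP => hi; first exact: hf.
by rewrite [RHS]nth_default //; exact: (rmorph0 (polynM phi m)).
Qed.

Lemma polyn_noeth A m : noeth A -> noeth (polyn A m).
Proof. by move=> h; elim: m => //= m; exact: noeth_poly. Qed.

Lemma polyn_Jprop A m : char0u A -> Jprop A -> Jprop (polyn A m).
Proof. by move=> hc h; elim: m => //= m; apply: Jprop_poly; exact: char0u_map (polynC A m) hc. Qed.

Lemma polyn_Jrel A m (L : fieldType) (pi : {rmorphism polyn A m -> L}) lam :
  (forall n, n.+1%:R != 0 :> L) -> functional [set x | pi x = 0] pi lam ->
  (forall a, pi (polynC A m a) = 0 -> lam (polynC A m a) = 0) ->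
  exists c : 'I_m -> L, forall x, pi x = 0 -> lam x = \sum_(j < m) c j * pi (pd j x).
Proof.
move=> hch; elim: m pi lam => [|m IH] pi lam hlam hc /=.
  by exists (fun=> 0) => x hx; rewrite big_ord0; exact: hc.
have [hD hZ] := hlam.
have [||c hc'] := IH (pi \o polyC) (lam \o polyC).
- split=> [x y hx hy|a x hx] /=; rewrite ?polyCD ?polyCM ?hD ?hZ //.
- by move=> a ha; exact: hc.
have hder' (k : 'I_m) : isder (map_poly (@pd A m k)) by exact: isder_map_poly (pd_der _ _ _).
have [|v hv] := one_var hch (der_functional c (fun x h => h) hlam hder').
  move=> a ha; rewrite -[lam a%:P]/((lam \o polyC) a) hc' //; apply/eqP; rewrite subr_eq0; apply/eqP.
  by apply: eq_bigr => k _; rewrite map_poly_derC //; exact: pd_der.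
exists (fun k => if unlift ord0 k is Some j then c j else v) => x hx.
rewrite big_ord_recl unlift_none -(hv x hx).
rewrite [X in _ + X](_ : _ = \sum_k c k * pi (map_poly (@pd A m k) x)); first exact/esym/subrK.
by apply: eq_bigr => i _; rewrite liftK.
Qed.

Definition is_lder (B : comNzRingType) (L : fieldType) (rho : B -> L) (d : B -> L) :=
  (forall x y, d (x + y) = d x + d y) /\ forall x y, d (x * y) = rho x * d y + rho y * d x.

Lemma lder0 (B : comNzRingType) (L : fieldType) (rho : B -> L) d : is_lder rho d -> d 0 = 0.
Proof. by move=> [hD _]; apply: (addrI (d 0)); rewrite -hD !addr0. Qed.

Lemma lder_sum (B : comNzRingType) (L : fieldType) (rho : B -> L) d (I : Type) (r : seq I) (P : pred I) (F : I -> B) :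
  is_lder rho d -> d (\sum_(i <- r | P i) F i) = \sum_(i <- r | P i) d (F i).
Proof. by move=> h; apply: (big_morph d (proj1 h) (lder0 h)). Qed.

Section Lder.
Variables (S : comNzRingType) (L : fieldType) (pi : {rmorphism S -> L}) (Q : set S) (lam : S -> L).
Hypotheses (hQ : forall x, Q x <-> pi x = 0) (hlam : functional Q pi lam) (hch : forall n, n.+1%:R != 0 :> L).

(** [one_var] yields the value that the extended derivation must take on 'X in order to agree with
    [lam] on the preimage of [Q]. *)
Lemma lder_ext (B : comNzRingType) (i : {rmorphism B -> S}) (d : B -> L) s :
  is_lder (pi \o i) d -> (forall b, Q (i b) -> d b = lam (i b)) ->
  exists (i' : {rmorphism {poly B} -> S}) (d' : {poly B} -> L),
  [/\ is_lder (pi \o i') d', forall b, Q (i' b) -> d' b = lam (i' b),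
      forall b, i' b%:P = i b, forall b, d' b%:P = d b & i' 'X = s].
Proof.
move=> hd hc; have [hD hM] := hd; have d0 := lder0 hd.
have hcomm : commr_rmorph i s by move=> a; exact: mulrC.
pose i' : {rmorphism {poly B} -> S} := horner_morph hcomm.
have iX : i' 'X = s by exact: horner_morphX.
have iC a : i' a%:P = i a by exact: horner_morphC.
pose rho : {rmorphism B -> L} := pi \o i.
have hrho p : (map_poly rho p).[pi s] = pi (i' p).
  by rewrite /i' /= /horner_morph /= -horner_map /= -map_poly_comp.
pose d1 p := (map_poly d p).[pi s].
have hd1 : is_lder (pi \o i') d1.
  split=> p q; rewrite /d1.
    rewrite -hornerD; congr (_.[_]); apply/polyP => k.
    by rewrite coefD !coef_map_id0 // coefD hD.
  rewrite /= -!hrho -!hornerM -hornerD; congr (_.[_]); apply/polyP => k.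
  rewrite coefD coef_map_id0 // [map_poly rho q * _]mulrC !coefM (big_morph d hD d0) -big_split.
  by apply: eq_bigr => j _; rewrite !coef_map_id0 ?rmorph0 // hM [_ * d p`_ _]mulrC.
have hd1C b : d1 b%:P = d b.
  rewrite /d1 (_ : map_poly d b%:P = (d b)%:P) ?hornerC //; apply/polyP => k.
  by rewrite coef_map_id0 // !coefC; case: eqP.
have [hD1 hM1] := hd1.
have hlam' : functional [set p | (pi \o i') p = 0] (pi \o i') (fun p => lam (i' p) - d1 p).
  have [lD lZ] := hlam; split=> [p q /hQ hp /hQ hq|p q].
    by rewrite rmorphD lD // hD1; ring.
  move=> hq; have hq' : Q (i' q) by apply/hQ.
  by rewrite rmorphM lZ // hM1 (_ : (pi \o i') q = 0) // mul0r addr0 mulrBr.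
have [|v hv] := one_var hch hlam'.
  by move=> c /hQ; rewrite iC => h; rewrite hd1C hc // subrr.
exists i', (fun p => d1 p + v * pi (i' p^`())); split=> //.
- split=> p q; first by rewrite hD1 derivD !rmorphD; ring.
  by rewrite hM1 derivM !rmorphD !rmorphM /=; ring.
- by move=> p /hQ hp; rewrite -(hv p hp) addrC subrK.
- by move=> b; rewrite hd1C derivC !rmorph0 mulr0 addr0.
Qed.

Variables (R : comNzRingType) (eps : {rmorphism R -> S}).

(** Derivations are extended along polynomial rings mapping to S, so no presentation of S is needed.
    The start is the zero derivation of R, compatible with [lam] because [Q] contracts to 0. *)
Lemma lder_adjoin (t : seq S) (hz : contr eps Q = @zid R) : exists (B : comNzRingType) (i : {rmorphism B -> S}) (d : B -> L)
  (j : R -> B), [/\ is_lder (pi \o i) d, forall b, Q (i b) -> d b = lam (i b),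
    forall r, i (j r) = eps r, forall r, d (j r) = 0 & forall x, x \in t -> exists b, i b = x].
Proof.
elim: t => [|s t [B [i [d [j [h1 h2 h3 h4 h5]]]]]].
  exists R, eps, (fun=> 0), id; split=> //; first by split=> x y; rewrite ?mulr0 addr0.
  move=> b hb; have -> : b = 0 by have : contr eps Q b by []; rewrite hz.
  have hQp : isprime Q by rewrite (_ : Q = [set x | pi x = 0]); [exact: ker_prime | apply: seteqI => x /hQ].
  by rewrite rmorph0 (functional0 hQp hlam).
have [i' [d' [g1 g2 g3 g4 g5]]] := lder_ext s h1 h2.
exists {poly B}, i', d', (fun r => (j r)%:P); split=> //.
- by move=> r; rewrite g3.
- by move=> r; rewrite g4.
- move=> x; rewrite inE => /predU1P[->|/h5[b hb]]; first by exists 'X.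
  by exists b%:P; rewrite g3.
Qed.

(** Every element of S is an image from the polynomial ring up to an element of [Q]; the derivation
    is applied to the former and [lam] to the latter, and compatibility makes this independent of
    the choice. *)
Lemma lder_fin t : finmod eps Q t -> contr eps Q = @zid R ->
  exists d : S -> L, [/\ is_lder pi d, forall x, Q x -> d x = lam x & forall r, d (eps r) = 0].
Proof.
move=> hf hz; have [B [i [d [j [h1 h2 h3 h4 h5]]]]] := lder_adjoin t hz.
have hQp : isprime Q by rewrite (_ : Q = [set x | pi x = 0]); [exact: ker_prime | apply: seteqI => x /hQ].
have hQi := prime_id hQp.
have [lD lZ] := hlam; have [hD hM] := h1.
have hdec s : exists b, Q (s - i b).
  have [c hc] := hf s.
  have /choice[g hg] : forall k : 'I_(size t), exists b, i b = t`_k by move=> k; apply: h5; exact: mem_nth.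
  exists (\sum_(k < size t) j (c k) * g k); rewrite rmorph_sum.
  by under eq_bigr => k _ do rewrite rmorphM h3 hg.
have /choice[b hb] := hdec.
have lN x : Q x -> lam (- x) = - lam x by move=> hx; rewrite -mulN1r lZ // rmorphN1 mulN1r.
pose e s := d (b s) + lam (s - i (b s)).
have he s b' : Q (s - i b') -> e s = d b' + lam (s - i b').
  move=> hs; rewrite /e.
  have hdN : d (- b') = - d b' by apply: (addrI (d b')); rewrite -hD !subrr (lder0 h1).
  have h6 : Q (i (b s - b')).
    by rewrite rmorphB (_ : _ - _ = (s - i b') - (s - i (b s))); [exact: isidB | ring].
  have := h2 _ h6; rewrite hD hdN => h7.
  rewrite -(subrK (lam (s - i b')) (lam (s - i (b s)))) addrA; congr (_ + _).
  have -> : lam (s - i (b s)) - lam (s - i b') = - lam (i (b s - b')).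
    rewrite -lN // -lN // -lD //; last exact: isidN.
    by congr (lam _); rewrite rmorphB; ring.
  by rewrite -h7; ring.
exists e; split.
- split=> x y.
    rewrite (he _ (b x + b y)) rmorphD opprD addrACA; last exact: isidD.
    by rewrite hD lD // addrACA.
  have e1 : x * y - i (b x * b y) = i (b x) * (y - i (b y)) + (y - i (b y) + i (b y)) * (x - i (b x)) by rewrite rmorphM; ring.
  have hq : Q (x * y - i (b x * b y)) by rewrite e1; apply: isidD => //; exact: isidM.
  rewrite (he _ _ hq) hM e1 lD ?lZ //; try exact: isidM.
  have ex z : pi z = pi (i (b z)).
    by apply/eqP; rewrite -subr_eq0 -rmorphB; apply/eqP/hQ.
  by rewrite subrK (ex x) (ex y) /e /=; ring.
- move=> x hx; rewrite (he _ 0) rmorph0 subr0 // (lder0 h1) add0r //.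
- move=> r; rewrite (he _ (j r)) h3 subrr; last exact: isid0.
  by rewrite h4 (functional0 hQp hlam) addr0.
Qed.
End Lder.

Section PsJ.
Variables (K : fieldType) (S : comNzRingType) (C : {rmorphism K -> S}) (X : seq S).
Hypotheses (hps : is_ps C X) (hch : char0u S).
Let M := spn (@zid S) X.
Let hcl : complete_local M. Proof. by case: hps. Qed.
Let hM : isid M. Proof. by case: hcl. Qed.
Let hdecC x : exists c, M (x - C c). Proof. by case: hps => _ h _ _ _ _ _; exact: h. Qed.

(** A subring with the constants and the variables is dense. *)
Lemma ps_dense Z : subr_closed Z -> (forall c, Z (C c)) -> (forall x, x \in X -> Z x) ->
  forall k y, pw M k y -> exists z, [/\ Z z, pw M k z & pw M k.+1 (y - z)].
Proof.
move=> hZ hC hX; have [z1 zB zM] := hZ; elim=> [|k IH] y.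
  by move=> _; have [c hc] := hdecC y; exists (C c); split=> //; rewrite pw1.
move: y; apply: pwS_min; first split.
- by exists 0; split; [exact: subring0 | exact: isid0 (pw_id _ _) | rewrite subr0; exact: isid0 (pw_id _ _)].
- move=> x y [u [u1 u2 u3]] [v [v1 v2 v3]]; exists (u + v); split; first exact: subringD.
    exact: isidD (pw_id _ _) _ _.
  by rewrite opprD addrACA; exact: isidD (pw_id _ _) _ _.
- move=> a x [u [u1 u2 u3]]; have [c hc] := hdecC a.
  exists (C c * u); split; [exact: zM | exact: isidM (pw_id _ _) _ |].
  rewrite (_ : _ - _ = a * (x - u) + (a - C c) * u); last by ring.
  by apply: isidD; [exact: pw_id | apply: isidM => //; exact: pw_id | exact: pwS].
move=> x y hx hy; have [v [v1 v2 v3]] := IH y hy.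
have [u [u1 u2 u3]] : exists u, [/\ Z u, M u & pw M 2 (x - u)].
  have /gen_sumP[|r _] := hx; first exact: setT_id.
  rewrite /zid => /subr0_eq e.
  have /choice[c hc] : forall i, exists c, M (r i - C c) by move=> i; exact: hdecC.
  have hXi (i : 'I_(size X)) : M X`_i by apply: spn_mem; [exact: zid_id | exact: mem_nth].
  exists (\sum_(i < size X) C (c i) * X`_i); split.
  - by apply: subring_sum => // i _; apply: zM => //; apply: hX; exact: mem_nth.
  - by apply: isid_sum => // i _; exact: isidM.
  - rewrite e -sumrB; apply: isid_sum; first exact: pw_id.
    by move=> i _; rewrite -mulrBl; apply: pwS => //; rewrite pw1.
exists (u * v); split; [exact: zM | exact: pwS |].
rewrite (_ : _ - _ = x * (y - v) + (x - u) * v); last by ring.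
apply: isidD; [exact: pw_id | exact: pwS |].
rewrite -add2n; exact: pwM.
Qed.

(** [lam] extends to an L-valued derivation trivial on a normalizing subring of S/Q. A derivation is
    determined by its values on the variables, so this one is a combination of the partial
    derivatives; the point is continuity, as L has no topology. *)
Lemma ps_Jprop : Jprop S.
Proof.
move=> Q L pi lam hQ hlam; have [hS _ hu h1 hc] := hcl.
have eQ : Q = [set x | pi x = 0] by apply: seteqI => x /hQ.
have hQp : isprime Q by rewrite eQ; exact: ker_prime.
have hQi := prime_id hQp.
have hQM : Q `<=` M := complete_local_prime_sub hcl hQp.
have hMp := complete_local_prime hcl.
have [h hh1 hh2] : exists2 h, height_ge Q M h & ~ height_ge Q M h.+1.
  apply: (height_ge_max (b := size X)); first by split.
  move=> h2; have := krull_height hS (@zid_id S) (ps_min hps) (height_ge_mono (zid_sub hQi) h2).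
  by rewrite ltnn.
have [y [hy1 hy2 hy3]] := params hS hQi hMp hQM hh2.
have hsy : size y = h.
  by apply/eqP; rewrite eqn_leq hy1 /=; exact: (krull_height hS hQi hy3 hh1).
rewrite -hsy in hh1.
have [R [C' [X' [eps [t [hps' heX heC hf hz]]]]]] := noether_norm hcl hdecC hQp hy2 hy3 hh1.
have hchL n : n.+1%:R != 0 :> L by exact: (char0u_neq0 pi n hch).
have [d [hd hdQ hdR]] := lder_fin hQ hlam hchL hf hz.
have [dD dM] := hd.
have /choice[D hD] : forall k : 'I_(size X), exists D, [/\ isder D, forall c, D (C c) = 0 &
    forall j, (j < size X)%N -> D X`_j = (k == j :> nat)%:R].
  by move=> k; case: hps => _ _ _ _ _ _ hder; exact: hder.
(* [d2] vanishes on constants and variables, hence on a dense subring. *)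
pose d2 f := d f - \sum_(k < size X) d X`_k * pi (D k f).
suff h0 : forall f, d2 f = 0.
  exists (size X), (fun k : 'I_(size X) => d X`_k), D; split; first by move=> k; case: (hD k).
  by move=> x hx; rewrite -hdQ //; apply: subr0_eq; exact: h0.
have hd2 : is_lder pi d2.
  split=> x y'.
    rewrite /d2 dD addrACA -opprD -big_split; congr (_ - _); apply: eq_bigr => k _.
    by have [[e1 _] _ _] := hD k; rewrite e1 rmorphD mulrDr.
  rewrite /d2 dM !mulrBr !mulr_sumr addrACA -opprD -big_split; congr (_ - _); apply: eq_bigr => k _.
  by have [[_ e1] _ _] := hD k; rewrite e1 rmorphD !rmorphM /=; ring.
have [d2D d2M] := hd2.
have d20 := lder0 hd2.
have d2N x : d2 (- x) = - d2 x by apply: (addrI (d2 x)); rewrite -d2D !subrr.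
have d21 : d2 1 = 0.
  by apply: (addrI (d2 1)); rewrite addr0 -{3}(mulr1 1) d2M rmorph1 !mul1r.
have hZ : subr_closed [set x | d2 x = 0].
  split=> [|x y' /= hx hy'|x y' /= hx hy'] //; first by rewrite d2D d2N hx hy' subr0.
  by rewrite d2M hx hy' !mulr0 addr0.
have hZC c : d2 (C c) = 0.
  rewrite /d2 -heC hdR sub0r heC big1 ?oppr0 // => k _.
  by have [_ e1 _] := hD k; rewrite e1 rmorph0 mulr0.
have hZX x : x \in X -> d2 x = 0.
  move=> /(nthP 0)[j hj <-]; rewrite /d2 (bigD1 (Ordinal hj)) //=.
  have [_ _ e1] := hD (Ordinal hj); rewrite e1 // eqxx rmorph1 mulr1 big1 ?addr0 ?subrr //.
  move=> k hk; have [_ _ e2] := hD k; rewrite e2 // (negPf (_ : k != j :> nat)) ?rmorph0 ?mulr0 //.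
have [q hq] := hS _ hQi.
(* The values of [d2] lie in a finitely generated submodule of L, so that Krull's theorem applies. *)
have [n [v hv]] : exists n (v : 'I_n -> L), forall f, exists r : 'I_n -> S, d2 f = \sum_j pi (r j) * v j.
  exists (size t + (size q + size X))%N, (fun j => match split j with inl i => d t`_i
     | inr i => match split i with inl i => lam q`_i | inr i => d X`_i end end) => f.
  have [c hc'] := hf f.
  have := hc'; rewrite hq => /gen_sumP[|r _]; first exact: setT_id.
  rewrite /zid => /subr0_eq e.
  have hqQ (i : 'I_(size q)) : Q q`_i by rewrite hq; apply: spn_mem; [exact: zid_id | exact: mem_nth].
  exists (fun j => match split j with inl i => eps (c i)
     | inr i => match split i with inl i => r i | inr i => - D i f end end).
  rewrite big_split_ord /=.
  under eq_bigr => i _ do rewrite (unsplitK (inl i)).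
  under [X in _ + X]eq_bigr => i _ do rewrite (unsplitK (inr i)).
  rewrite big_split_ord /=.
  under [X in _ + (X + _)]eq_bigr => i _ do rewrite (unsplitK (inl i)).
  under [X in _ + (_ + X)]eq_bigr => i _ do rewrite (unsplitK (inr i)) rmorphN mulNr mulrC.
  rewrite sumrN addrA /d2; congr (_ - _).
  rewrite -{1}(subrK (\sum_(i < size t) eps (c i) * t`_i) f) dD hdQ // addrC; congr (_ + _).
    by rewrite e (functional_sum hQp (fun i => r i) hlam hqQ).
  rewrite (lder_sum _ _ _ hd); apply: eq_bigr => i _.
  by rewrite dM hdR mulr0 addr0.
move=> f; have [r hr] := hv f.
pose V : set 'rV[S]_n := [set w | \sum_j pi (w 0 j) * v j = 0].
have hV : submod V.
  split=> [|x y' hx hy'|a x hx]; rewrite /V /=.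
  - by rewrite big1 // => j _; rewrite mxE rmorph0 mul0r.
  - under eq_bigr => j _ do rewrite mxE rmorphD mulrDl.
    by rewrite big_split /= hx hy' addr0.
  - under eq_bigr => j _ do rewrite mxE rmorphM -mulrA.
    by rewrite -mulr_sumr hx mulr0.
have : V (\row_j r j).
  apply: (krull_vec hcl hV) => k.
  have hdense : forall k f, exists z, d2 z = 0 /\ pw M k (f - z).
    elim=> [|k' IH] g; first by exists 0.
    have [z [hz1 hz2]] := IH g.
    have [z' [hz3 _ hz4]] := ps_dense hZ hZC hZX hz2.
    exists (z + z'); split; first by rewrite d2D hz1 hz3 addr0.
    by rewrite opprD addrA.
  have [z [hz1 hz2]] := hdense k.+1 f.
  (* A derivation lowers the order at most by one, here for vectors of coefficients on [v]. *)
  have hdk : forall k g, pw M k.+1 g -> exists w : 'I_n -> S, (forall j, pw M k (w j)) /\ d2 g = \sum_j pi (w j) * v j.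
    elim=> [|k' IH] g hg; first by have [w hw] := hv g; exists w.
    suff [//] : pw M k'.+2 g /\ exists w : 'I_n -> S, (forall j, pw M k'.+1 (w j)) /\ d2 g = \sum_j pi (w j) * v j.
    move: g hg; apply: pwS_min; first split.
    - split; first exact: isid0 (pw_id _ _).
      exists (fun=> 0); split; first by move=> j; exact: isid0 (pw_id _ _).
      by rewrite d20 big1 // => j _; rewrite rmorph0 mul0r.
    - move=> x y' [x1 [w [w1 w2]]] [y1 [w' [w3 w4]]]; split; first exact: isidD (pw_id _ _) _ _.
      exists (fun j => w j + w' j); split.
        by move=> j; exact: isidD (pw_id _ _) _ _.
      by rewrite d2D w2 w4 -big_split; apply: eq_bigr => j _; rewrite rmorphD mulrDl.
    - move=> a x [x1 [w [w1 w2]]]; split; first exact: isidM (pw_id _ _) _.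
      have [r' hr'] := hv a; exists (fun j => a * w j + x * r' j); split.
        move=> j; apply: isidD; [exact: pw_id | exact: isidM (pw_id _ _) _ |].
        by apply: isidMr; [exact: pw_id | exact: pw_subS].
      rewrite d2M w2 hr' !mulr_sumr -big_split; apply: eq_bigr => j _ /=.
      by rewrite rmorphD !rmorphM; ring.
    - move=> x y' hx hy; split; first exact: pwS.
      have [w [w1 w2]] := IH y' hy; have [r' hr'] := hv x.
      exists (fun j => x * w j + y' * r' j); split.
        move=> j; apply: isidD; [exact: pw_id | exact: pwS |].
        by apply: isidMr; [exact: pw_id | exact: hy].
      rewrite d2M w2 hr' !mulr_sumr -big_split; apply: eq_bigr => j _ /=.
      by rewrite rmorphD !rmorphM; ring.
  have [w [hw1 hw2]] := hdk _ _ hz2.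
  exists (\row_j (r j - w j)).
    rewrite /V /=; under eq_bigr => j _ do rewrite mxE rmorphB mulrBl.
    by rewrite sumrB -hr -hw2 d2D d2N hz1 subr0 subrr.
  by move=> j; rewrite !mxE opprB addrC subrK; exact: hw1.
by rewrite /V /=; under eq_bigr => j _ do rewrite mxE; rewrite -hr.
Qed.
End PsJ.

(** * The Jacobian criterion *)

Section Seidenberg.
Variable S : comNzRingType.
Hypotheses (hS : noeth S) (hch : char0u S).

Lemma isderX (d : S -> S) x n : isder d -> d (x ^+ n.+1) = (n.+1%:R * x ^+ n) * d x.
Proof.
move=> hd; have [_ hM] := hd; elim: n => [|n IH]; first by rewrite expr1 expr0 !mul1r.
by rewrite exprS hM IH -[n.+2%:R]natr1 exprS; ring.
Qed.

Lemma isderXM (d : S -> S) x n : isder d -> x * d (x ^+ n) = n%:R * x ^+ n * d x.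
Proof. by move=> hd; case: n => [|n]; rewrite ?(isder1 hd) ?mulr0 ?mul0r // isderX // exprS; ring. Qed.

(* Seidenberg: derivations preserve minimal primes in characteristic zero. *)
Lemma seidenberg (d : S -> S) I P : isder d -> isid I -> (forall x, I x -> I (d x)) -> minimal_over I P ->
  forall x, P x -> P (d x).
Proof.
move=> hd hI hdI [hP hIP hmin] a ha; have [hD hM] := hd.
pose I' := sat P I.
have hI' : isid I' by exact: sat_id.
have hdI' x : I' x -> I' (d x).
  move=> [u hu hux]; exists (u * u); first exact: primeNM.
  rewrite (_ : _ * _ = u * d (u * x) - d u * (u * x)); last by rewrite hM; ring.
  by apply: isidB => //; apply: isidM => //; exact: hdI.
have [n hn] : exists n, I' (a ^+ n).
  apply: contrapT => hno.
  have [|||P' hP' [h1 h2]] := @prime_avoid_mult S I [set z | exists u n, ~ P u /\ z = u * a ^+ n] hS hI.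
  - by exists 1, 0%N; rewrite mul1r; split=> //; exact: prime1.
  - move=> _ _ [u [k [hu ->]]] [v [l [hv ->]]]; exists (u * v), (k + l)%N; split; first exact: primeNM.
    by rewrite exprD; ring.
  - by move=> _ [u [k [hu ->]]] h; apply: hno; exists k, u.
  apply: (h2 a); first by exists 1, 1%N; rewrite mul1r; split=> //; exact: prime1.
  apply: (hmin P') => // x hx; apply: contrapT => hx'.
  by apply: (h2 x) => //; exists x, 0%N; rewrite mulr1.
have key : forall k m, I' (a ^+ k * d a ^+ m) -> exists l, I' (d a ^+ l).
  elim=> [|k IH] m hk; first by exists m; rewrite mul1r in hk.
  apply: (IH m.+2); have [y hy] := hch k.
  have e : d a * d (a ^+ k.+1 * d a ^+ m) =
      (m%:R * d (d a)) * (a ^+ k.+1 * d a ^+ m) + k.+1%:R * (a ^+ k * d a ^+ m.+2).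
    rewrite hM mulrDr mulrCA isderXM // isderX // !exprS; ring.
  rewrite (_ : _ * _ = y * (d a * d (a ^+ k.+1 * d a ^+ m) - (m%:R * d (d a)) * (a ^+ k.+1 * d a ^+ m))).
    by apply: isidM => //; apply: isidB => //; apply: isidM => //; exact: hdI'.
  by rewrite e addrAC subrr add0r mulrA hy mul1r.
have [|l hl] := key n 0%N; first by rewrite expr0 mulr1.
apply: (primeX (n := l)) => //; exact: (sat_in hP hIP hl).
Qed.

Lemma isder_spn (E : S -> S) J s : isder E -> isid J -> (forall x, J x -> spn J s (E x)) ->
  (forall a, a \in s -> spn J s (E a)) -> forall x, spn J s x -> spn J s (E x).
Proof.
move=> hE hJ hEJ hEs x hx; have hid : isid (spn J s) by exact: gen_id.
suff [//] : spn J s (E x) /\ spn J s x.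
have [hED hEM] := hE.
apply: (spn_min (I := [set x | spn J s (E x) /\ spn J s x])) hx.
- split=> [|y z [y1 y2] [z1 z2]|c y [y1 y2]] /=; first by rewrite (isder0 hE); split; exact: isid0.
    by rewrite hED; split; exact: isidD.
  by rewrite hEM; split; [apply: isidD => //; [exact: isidM | exact: isidMr] | exact: isidM].
- by move=> y hy; split; [exact: hEJ | exact: gen_base].
- by move=> a ha; split; [exact: hEs | exact: spn_mem].
Qed.

(** The k-th derivation preserves J + (s_0, ..., s_(k-1)), hence by Seidenberg's theorem every
    minimal prime of it. As it maps s_k to [w], which is outside [Q], such a prime inside [Q] cannot
    contain s_k, and the height grows with every generator. *)
Lemma der_chain (J Q : set S) s w : isid J -> isprime Q -> J `<=` Q -> (forall a, a \in s -> Q a) ->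
  Q `<=` sat Q (spn J s) -> ~ Q w ->
  (forall i, (i < size s)%N -> exists E : S -> S, [/\ isder E, forall x, J x -> J (E x) & forall j, (j < size s)%N -> E s`_j = (i == j)%:R * w]) ->
  height_ge J Q (size s).
Proof.
move=> hJ hQ hJQ hs hsat hw hE.
have hid k : isid (spn J (take k s)) by exact: gen_id.
suff key k P : (k <= size s)%N -> minimal_over (spn J (take k s)) P -> P `<=` Q -> height_ge J P k.
  apply: (key _ Q) => //; rewrite take_size; exact: gens_minover.
elim: k P => [|k IH] P hk hmin hPQ; have [hP hsP hmP] := hmin.
  by split=> // x hx; apply: hsP; exact: gen_base.
have hsub : spn J (take k s) `<=` P.
  move=> x hx; apply: hsP; apply: (spn_sub (s := take k s)) hx => // z.
  by rewrite (take_nth 0) // mem_rcons inE => ->; rewrite orbT.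
have [p hp hpP] := minprime_exists hS (hid k) hP hsub.
split=> //; exists p; split; [by apply: IH => //; [exact: ltnW | move=> x /hpP/hPQ] | by [] |].
move=> hPp; have [E [hE1 hE2 hE3]] := hE k hk.
have hsk : p s`_k.
  apply: hPp; apply: hsP; apply: spn_mem => //.
  by rewrite (take_nth 0) // mem_rcons inE eqxx.
have : p (E s`_k).
  apply: (seidenberg hE1 (hid k) _ hp) => //; apply: isder_spn => // [x /hE2 hx|a ha]; first exact: gen_base.
  have /(nthP 0)[j hj <-] := ha; rewrite size_takel in hj; last exact: ltnW.
  rewrite nth_take // hE3 ?(gtn_eqF hj) ?mul0r; [exact: isid0 | exact: ltn_trans hj hk].
by rewrite hE3 // eqxx mul1r => /hpP/hPQ.
Qed.
End Seidenberg.

Section Jacobian.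
Variable S : comNzRingType.
Hypotheses (hS : noeth S) (hch : char0u S) (hJS : Jprop S).
Variables (Q : set S) (L : fieldType) (pi : {rmorphism S -> L}).
Hypotheses (hQ : isprime Q) (Qpi : forall x, Q x <-> pi x = 0)
  (Lfrac : forall l, exists b u, ~ Q u /\ l = pi b / pi u).

Lemma Jprop_clear lam : functional Q pi lam ->
  exists D u, [/\ isder D, ~ Q u & forall x, Q x -> pi (D x) = pi u * lam x].
Proof.
move=> hlam; have [n [c [D [hD he]]]] := hJS Qpi hlam.
have [u [a [hu ha]]] := common_denom hQ Qpi Lfrac c.
exists (fun x => \sum_k a k * D k x), u; split=> //; first by apply: isder_sum => k; exact: isderZ.
move=> x hx; rewrite he // rmorph_sum mulr_sumr; apply: eq_bigr => k _.
by rewrite rmorphM -ha mulrA.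
Qed.

Lemma Jprop_clears n (lam : 'I_n -> S -> L) : (forall i, functional Q pi (lam i)) ->
  exists (D : 'I_n -> S -> S) (u : 'I_n -> S), forall i, [/\ isder (D i), ~ Q (u i) & forall x, Q x -> pi (D i x) = pi (u i) * lam i x].
Proof.
move=> h; have /choice[f hf] : forall i, exists Du : (S -> S) * S,
   [/\ isder Du.1, ~ Q Du.2 & forall x, Q x -> pi (Du.1 x) = pi Du.2 * lam i x].
  by move=> i; have [D [u hDu]] := Jprop_clear (h i); exists (D, u).
by exists (fun i => (f i).1), (fun i => (f i).2).
Qed.

(* The adjugate of the matrix of the derivations makes them exactly dual to the sequence, up to a factor outside Q. *)
Lemma adj_dual n (s : 'I_n -> S) (D : 'I_n -> S -> S) : (forall i, isder (D i)) ->
  exists E : 'I_n -> S -> S, (forall i, isder (E i)) /\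
    forall i j, E i (s j) = (i == j)%:R * \det (\matrix_(i, j) D i (s j)).
Proof.
move=> hD; set A := \matrix_(i, j) _.
exists (fun i x => \sum_k \adj A i k * D k x); split.
  by move=> i; apply: isder_sum => k; exact: isderZ.
move=> i j; have /matrixP/(_ i j) := mul_adj_mx A; rewrite !mxE => e.
rewrite mulrC mulr_natr -e; apply: eq_bigr => k _; by rewrite [A _ _]mxE.
Qed.

(** The given derivations, which have invertible minor on [f], are completed by derivations dual to
    minimal generators of Q modulo (f). After inversion by the adjugate, those dual to the
    generators kill [f], and [der_chain] gives the height. *)
Lemma jac_suff r (f : 'I_r -> S) (D : 'I_r -> S -> S) : (forall i, Q (f i)) -> (forall i, isder (D i)) ->
  ~ Q (\det (\matrix_(i, j) D i (f j))) -> exists n, reg (spn (@zid S) (codom f)) Q n.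
Proof.
move=> hf hD hdet; set J := spn _ _.
have hJ : isid J by apply: gen_id; [exact: setT_id | exact: zid_id].
have hQi := prime_id hQ.
have hJQ : J `<=` Q.
  by apply: spn_min => // [x ->|a /codomP[i ->]]; [exact: isid0 | exact: hf].
have [n [s [lam [hs hsat hlam hlamJ hdual]]]] := min_gens hS hQ Qpi hJ hJQ.
have [D' [u hD']] := Jprop_clears hlam.
pose g (i : 'I_(r + n)) := match split i with inl j => f j | inr j => s`_j end.
pose DD (i : 'I_(r + n)) := match split i with inl j => D j | inr j => D' j end.
have hDD i : isder (DD i) by rewrite /DD; case: (split i) => // j; case: (hD' j).
have [E [hE hEg]] := adj_dual g hDD; set w := \det _ in hEg.
(* Modulo [Q] the matrix is block triangular, because the dual forms vanish on [f]. *)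
have hw : ~ Q w.
  rewrite Qpi /w -det_map_mx => /eqP; apply/negP.
  have -> : map_mx pi (\matrix_(i, j) DD i (g j)) =
    block_mx (map_mx pi (\matrix_(i, j) D i (f j))) (\matrix_(i, j) pi (D i s`_j))
             0 (diag_mx (\row_i pi (u i))).
    apply/matrixP => i j; rewrite !mxE; case: (splitP i) => i' hi; rewrite !mxE;
      case: (splitP j) => j' hj; rewrite !mxE /DD /g.
    - have -> : i = lshift n i' by exact: val_inj. have -> : j = lshift n j' by exact: val_inj.
      by rewrite (unsplitK (inl i')) (unsplitK (inl j')).
    - have -> : i = lshift n i' by exact: val_inj. have -> : j = rshift r j' by exact: val_inj.
      by rewrite (unsplitK (inl i')) (unsplitK (inr j')).
    - have -> : i = rshift r i' by exact: val_inj. have -> : j = lshift n j' by exact: val_inj.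
      rewrite (unsplitK (inr i')) (unsplitK (inl j')).
      have [_ _ e] := hD' i'; rewrite e // hlamJ ?mulr0 //.
      by apply: spn_mem; [exact: zid_id | exact: codom_f].
    - have -> : i = rshift r i' by exact: val_inj. have -> : j = rshift r j' by exact: val_inj.
      rewrite (unsplitK (inr i')) (unsplitK (inr j')).
      have [_ _ e] := hD' i'; rewrite e ?hdual; last by apply: hs; apply: mem_nth; rewrite size_tuple.
      by case: eqP => [->|_]; rewrite ?mulr1 ?mulr1n ?mulr0 ?mulr0n.
  rewrite det_ublock det_map_mx det_diag mulf_neq0 //; first exact/eqP/(contra_not (proj2 (Qpi _)) hdet).
  apply/prodf_neq0 => i _; rewrite mxE; have [_ h _] := hD' i; exact: (pi_neq0 Qpi).
exists n; rewrite /reg; split; last by exists s; split=> //; rewrite size_tuple.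
suff : height_ge J Q (size s) by rewrite size_tuple.
apply: (der_chain hS hch hJ hQ hJQ hs hsat hw) => i; rewrite size_tuple => hi.
have gE k : g (lshift n k) = f k by rewrite /g (unsplitK (inl k)).
exists (E (rshift r (Ordinal hi))); split=> //.
  apply: (isder_spn (hE _) (@zid_id S)) => [x ->|].
    by rewrite (isder0 (hE _)); exact: isid0.
  by move=> a /codomP[k ->]; rewrite -gE hEg eq_rlshift mul0r; exact: isid0.
move=> j; rewrite ?size_tuple => hj; have -> : s`_j = g (rshift r (Ordinal hj)) by rewrite /g (unsplitK (inr _)).
by rewrite hEg eq_rshift.
Qed.

(** The criterion with no equations: S is regular at every prime. *)
Lemma jac_reg : exists n, reg (@zid S) Q n.
Proof.
have [|||n hn] := @jac_suff 0 (fun=> 0) (fun=> id); try by case.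
  by rewrite det_mx00; exact: prime1.
by exists n; move: hn; rewrite (_ : codom _ = [::]) //; apply/nilP; rewrite /nilp size_codom card_ord.
Qed.

(** Since S and S/J are regular at [Q], [J] is generated there by part [w] of a minimal generating
    system of [Q]; derivations inducing the dual forms have a diagonal matrix on [w] modulo [Q]. *)
Lemma jac_nec J e : isid J -> reg J Q e -> exists r (f : 'I_r -> S) (D : 'I_r -> S -> S),
  [/\ forall i, J (f i), forall i, isder (D i), ~ Q (\det (\matrix_(i, j) D i (f j))) &
      J `<=` sat Q (spn (@zid S) (codom f))].
Proof.
move=> hJ hreg; have [d hd] := jac_reg; have hQi := prime_id hQ.
have hJQ := reg_sub hreg; have [_ [s [hs1 hs2 hs3]]] := hreg.
have [w [hw1 hw2 hw3]] := reg_quot_gens hS hQ Qpi Lfrac (@zid_id S) hJ (zid_sub hJ) hd hreg.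
have hws a : a \in w ++ s -> Q a by rewrite mem_cat => /orP[/hw1/hJQ|/hs2].
have hsp : isid (spn (@zid S) (w ++ s)) by apply: gen_id; [exact: setT_id | exact: zid_id].
have hsat : Q `<=` sat Q (spn (@zid S) (w ++ s)).
  move=> x /hs3 hx; apply: (sat_sat hQ); move: x hx; apply: sat_mono.
  apply: spn_min; first exact: sat_id.
    move=> x /hw3; apply: sat_mono; apply: spn_sub; first exact: zid_id.
    by move=> z hz; rewrite mem_cat hz.
  move=> a ha; apply: sat_sub => //; apply: spn_mem; first exact: zid_id.
  by rewrite mem_cat ha orbT.
have [|lam [hl1 hl2 hl3]] := dual_functionals hQ Qpi (@zid_id S) (zid_sub hQi) hws hsat.
  move=> s' hs' hsat'; apply: leq_trans (_ : d <= _)%N; first by rewrite size_cat hs1.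
  by apply: (gens_height hS (@zid_id S) hs' hsat'); case: hd.
have [D [u hD]] := Jprop_clears hl1.
have hsz : (size w <= size (w ++ s))%N by rewrite size_cat leq_addr.
exists (size w), (fun i => w`_i), (fun i => D (widen_ord hsz i)); split.
- by move=> i; apply: hw1; exact: mem_nth.
- by move=> i; case: (hD (widen_ord hsz i)).
- rewrite Qpi -det_map_mx => /eqP; apply/negP.
  rewrite (_ : map_mx _ _ = diag_mx (\row_i pi (u (widen_ord hsz i)))).
    by rewrite det_diag; apply/prodf_neq0 => i _; rewrite mxE; have [_ h _] := hD (widen_ord hsz i); exact: (pi_neq0 Qpi).
  apply/matrixP => i j; rewrite !mxE; have [_ _ e'] := hD (widen_ord hsz i).
  have ej : w`_j = (w ++ s)`_(widen_ord hsz j) by rewrite nth_cat /= ltn_ord.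
  rewrite e' ?ej ?hl3; last by apply: hws; exact: mem_nth.
  rewrite (_ : (widen_ord hsz i == widen_ord hsz j) = (i == j)) //.
  by case: eqP => [->|_]; rewrite ?mulr1 ?mulr1n ?mulr0 ?mulr0n.
- move=> x /hw3; apply: sat_mono; apply: spn_sub; first exact: zid_id.
  by move=> z /(nthP 0)[i hi <-]; exact: (codom_f (fun i : 'I_(size w) => w`_i) (Ordinal hi)).
Qed.
End Jacobian.

Lemma reg_localeq (S : comNzRingType) (J J' Q : set S) n : reg J Q n -> J `<=` J' -> J' `<=` Q ->
  J' `<=` sat Q J -> reg J' Q n.
Proof.
move=> [h [s [h1 h2 h3]]] hJJ hJQ hsat; split.
  have [d [hd hJd hdQ hh]] := height_ge_base h; apply: height_ge_mono hh => x /hsat[u hu /hJd].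
  by apply: primeMl => // /hdQ.
exists s; split=> //; apply: subset_trans h3 _; apply: sat_mono; exact: gen_mono.
Qed.

(** The Jacobian minor times a common denominator, outside which [f] generates [J], defines the
    neighbourhood. *)
Lemma reg_open (S : comNzRingType) (J Q : set S) d : noeth S -> char0u S -> Jprop S -> isid J -> reg J Q d ->
  exists w, ~ Q w /\ forall Q', isprime Q' -> J `<=` Q' -> ~ Q' w -> exists n, reg J Q' n.
Proof.
move=> hS hch hJS hJ hreg; have hQ := reg_prime hreg.
have [L [pi [Qpi Lfrac]]] := residue_exists hQ.
have [r [f [D [hf hD hdet hsat]]]] := jac_nec hS hch hJS hQ Qpi Lfrac hJ hreg.
have hsp : isid (spn (@zid S) (codom f)) by apply: gen_id; [exact: setT_id | exact: zid_id].
have [q hq] := hS _ hJ.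
have [|u hu huq] := @sat_common S Q (spn (@zid S) (codom f)) (size q) (fun i => q`_i) hQ hsp.
  by move=> i; apply: hsat; rewrite hq; apply: spn_mem; [exact: zid_id | exact: mem_nth].
exists (u * \det (\matrix_(i, j) D i (f j))); split; first exact: primeNM.
move=> Q' hQ' hJQ' hw; have hQi' := prime_id hQ'.
have hu' : ~ Q' u by move=> h; apply: hw; exact: isidMr.
have hd' : ~ Q' (\det (\matrix_(i, j) D i (f j))) by move=> h; apply: hw; exact: isidM.
have [L' [pi' [Qpi' Lfrac']]] := residue_exists hQ'.
have [n hn] := jac_suff hS hch hJS hQ' Qpi' Lfrac' (fun i => hJQ' _ (hf i)) hD hd'.
exists n; apply: reg_localeq hn _ hJQ' _.
  by apply: spn_min => // [x ->|a /codomP[i ->]]; [exact: isid0 | exact: hf].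
move=> x; rewrite {1}hq; move: x; apply: spn_min; first exact: sat_id.
  by move=> x ->; exact: isid0 (sat_id hQ' hsp).
by move=> a /(nthP 0)[i hi <-]; exists u => //; exact: (huq (Ordinal hi)).
Qed.

(** * Catenarity of complete local rings *)

Section IndepSpan.
Variables (R T : comNzRingType) (eps : {rmorphism R -> T}) (P : set T).
Hypotheses (hRd : isprime (@zid R)) (hP : isprime P) (hz : contr eps P = @zid R).
Let hPi : isid P. Proof. exact: prime_id. Qed.

Definition rspan (w : seq T) x := exists a : nat -> R, P (x - \sum_(i < size w) eps (a i) * w`_i).

Lemma rspanD w x y : rspan w x -> rspan w y -> rspan w (x + y).
Proof.
move=> [a ha] [b hb]; exists (fun i => a i + b i).
rewrite (eq_bigr (fun i : 'I_(size w) => eps (a i) * w`_i + eps (b i) * w`_i)).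
  by rewrite big_split /= opprD addrACA; exact: isidD.
by move=> i _; rewrite rmorphD mulrDl.
Qed.

Lemma rspanZ w c x : rspan w x -> rspan w (eps c * x).
Proof.
move=> [a ha]; exists (fun i => c * a i).
rewrite (eq_bigr (fun i : 'I_(size w) => eps c * (eps (a i) * w`_i))).
  by rewrite -mulr_sumr -mulrBr; exact: isidM.
by move=> i _; rewrite rmorphM mulrA.
Qed.

Lemma rspanP w x y : P (x - y) -> rspan w y -> rspan w x.
Proof. by move=> h [a ha]; exists a; rewrite -(subrK y x) -addrA; exact: isidD. Qed.

Lemma rspan0 w : rspan w 0.
Proof. by exists (fun=> 0); rewrite big1 ?subrr => [|i _]; [exact: isid0 | rewrite rmorph0 mul0r]. Qed.

Lemma indep_span (t : seq T) : exists (w : seq T) h, [/\ h <> 0,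
  forall a : nat -> R, P (\sum_(i < size w) eps (a i) * w`_i) -> forall i, (i < size w)%N -> a i = 0 &
  forall x, x \in t -> rspan w (eps h * x)].
Proof.
elim: t => [|x t [w [h [h0 hw ht]]]].
  by exists [::], 1; split=> //; move=> /eqP; rewrite oner_eq0.
have [hi|hni] := pselect (forall a : nat -> R, P (\sum_(i < size w) eps (a i) * w`_i + eps (a (size w)) * x) ->
    forall i, (i < (size w).+1)%N -> a i = 0).
  have hmono y : rspan w y -> rspan (rcons w x) y.
    move=> [a ha]; exists (fun i => if (i < size w)%N then a i else 0).
    rewrite size_rcons big_ord_recr /= ltnn rmorph0 mul0r addr0.
    move: ha; congr (P (_ - _)); apply: eq_bigr => i _.
    by rewrite /= nth_rcons ltn_ord.
  exists (rcons w x), h; split=> //.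
    move=> a; rewrite size_rcons big_ord_recr /= nth_rcons ltnn eqxx => ha; apply: hi.
    by move: ha; congr (P (_ + _)); apply: eq_bigr => i _; rewrite /= nth_rcons ltn_ord.
  move=> y; rewrite inE => /predU1P[->|/ht/hmono//].
  apply: rspanZ; exists (fun i => (i == size w)%:R).
  rewrite size_rcons big_ord_recr /= nth_rcons ltnn eqxx rmorph1 mul1r big1 ?add0r ?subrr; first exact: isid0.
  by move=> i _; rewrite ltn_eqF // rmorph0 mul0r.
have [a [ha hna]] : exists a : nat -> R, P (\sum_(i < size w) eps (a i) * w`_i + eps (a (size w)) * x) /\ a (size w) <> 0.
  apply: contrapT => hno; apply: hni => a ha.
  have an : a (size w) = 0 by apply: contrapT => an; apply: hno; exists a.
  move=> i; rewrite ltnS leq_eqVlt => /orP[/eqP->//|hi].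
  by apply: hw hi; rewrite an rmorph0 mul0r addr0 in ha.
exists w, (h * a (size w)); split=> //.
  by move=> /(primeM hRd)[|].
move=> y; rewrite inE => /predU1P[->|/ht hy]; last first.
  by rewrite [h * _]mulrC rmorphM -mulrA; apply: rspanZ => //; exact: hy.
rewrite rmorphM -mulrA; apply: rspanZ; exists (fun i => - a i).
move: ha; rewrite addrC -sumrN; congr (P (_ + _)); apply: eq_bigr => i _.
by rewrite rmorphN mulNr opprK.
Qed.
End IndepSpan.

(** At [q] the element [g] is prime and does not divide [y], so each factor [g] on the right divides
    [a]. *)
Lemma prime_elt_cancel (R : comNzRingType) (q : set R) g k y a r : isprime (@zid R) -> isprime q ->
  isprime (sat q (spn (@zid R) [:: g])) -> g <> 0 -> ~ sat q (spn (@zid R) [:: g]) y -> y * a = g ^+ k * r ->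
  exists u c, ~ q u /\ u * a = g ^+ k * c.
Proof.
move=> hR hq hp g0 hy; elim: k a r => [|k IH] a r e.
  by exists 1, a; split; [exact: prime1 | rewrite expr0].
have hgp c : sat q (spn (@zid R) [:: g]) (g * c).
  by apply: sat_sub => //; exists c => //=; rewrite mulrC; exact: subrr.
have /(primeM hp)[//|[u hu /= [a' _ /subr0_eq ea]]] : sat q (spn (@zid R) [:: g]) (y * a).
  by rewrite e exprS -mulrA.
have [|u' [c [hu' e']]] := IH a' (u * r).
  apply: subr0_eq; have : @zid R (g * (y * a' - g ^+ k * (u * r))).
    rewrite /zid mulrBr (_ : g * (y * a') = y * (u * a)); last by rewrite ea; ring.
    by rewrite mulrCA e exprS; ring.
  by move=> /(primeM hR)[].
exists (u' * u), c; split; first exact: primeNM.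
by rewrite -mulrA ea mulrA e' exprS; ring.
Qed.

Section Catenary.
Variables (T : comNzRingType) (M P Q : set T).
Hypotheses (hcl : complete_local M) (hch : forall n, ~ M n.+1%:R) (hP : isprime P) (hQ : isprime Q) (hPQ : P `<=` Q).
Hypotheses (hnQP : ~ (Q `<=` P)) (hadj : forall p, isprime p -> P `<=` p -> p `<=` Q -> p `<=` P \/ Q `<=` p).
Let hT : noeth T. Proof. by case: hcl. Qed.

(* If q = contr eps Q had height 2, take a regular sequence g1, g2 of R_q and an element g of Q in no other
   prime over q: powers of g1 and g2 lie in g T + P at Q, whence eps h, with h <> 0, lies in (g ^+ j) T + P
   at Q for all j, against Krull's intersection theorem. *)
Lemma adj_height (R : comNzRingType) (eps : {rmorphism R -> T}) t : noeth R -> char0u R -> Jprop R -> isprime (@zid R) ->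
  finmod eps P t -> contr eps P = @zid R -> ~ height_ge (@zid R) (contr eps Q) 2.
Proof.
move=> hR hchR hJ hRd hf hz h2; have hPi := prime_id hP.
set q := contr eps Q in h2; have hq : isprime q := height_ge_prime h2.
have [L [pi [Qpi Lfrac]]] := residue_exists hq.
have [d hd] := jac_reg hR hchR hJ hq Qpi Lfrac.
have d2 := reg_le hR (@zid_id R) hd h2.
have [hh [s [hs1 hs2 hs3]]] := hd.
case: s hs1 hs2 hs3 => [|g1 [|g2 s]] /= hs1 hs2 hs3; try by rewrite -hs1 in d2.
pose I1 := spn (@zid R) [:: g1].
have hI1 : isid I1 by apply: gen_id; [exact: setT_id | exact: zid_id].
have hg1 : q g1 by apply: hs2; rewrite inE eqxx.
have hg2 : q g2 by apply: hs2; rewrite !inE eqxx orbT.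
have hI1q : I1 `<=` q.
  by apply: spn_min; [exact: prime_id | move=> x ->; exact: isid0 (prime_id hq) | move=> a; rewrite inE => /eqP->].
have hdrop : height_ge I1 q (size s).+1.
  by apply: height_ge_drop => //; rewrite hs1.
have hsub1 : spn (@zid R) [:: g1, g2 & s] `<=` spn I1 (g2 :: s).
  rewrite -gen_cat; apply: spn_sub; first exact: zid_id.
  by move=> z; rewrite mem_cat !inE => /or3P[] ->; rewrite ?orbT.
have hP1 : isprime (sat q I1).
  apply: (reg_domain (d := (size s).+1)) => //; split=> //; exists (g2 :: s); split=> //.
    by move=> a ha; apply: hs2; rewrite inE ha orbT.
  by apply: subset_trans hs3 _; exact: sat_mono.
have hng2 : ~ sat q I1 g2.
  move=> hg; suff : ((size s).+1 <= size s)%N by rewrite ltnn.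
  apply: (gens_height hR hI1 _ _ hdrop).
    by move=> a ha; apply: hs2; rewrite !inE ha !orbT.
  move=> x /hs3 hx; apply: sat_sat => //; move: x hx; apply: sat_mono.
  apply: subset_trans hsub1 _.
  have hid : isid (spn I1 s) by exact: gen_id.
  apply: spn_min; first exact: sat_id.
    by move=> x hx; apply: sat_sub => //; exact: gen_base.
  move=> a; rewrite inE => /predU1P[->|ha]; last by apply: sat_sub => //; exact: spn_mem.
  by apply: sat_mono hg; exact: gen_base.
have hg10 : g1 <> 0.
  move=> g10; suff : (d <= (size s).+1)%N by rewrite -hs1 ltnn.
  apply: (gens_height (s := g2 :: s) hR (@zid_id R) _ _ hh).
    by move=> a ha; apply: hs2; rewrite inE ha orbT.
  apply: subset_trans hs3 _; apply: sat_mono.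
  have hid : isid (spn (@zid R) (g2 :: s)) by apply: gen_id; [exact: setT_id | exact: zid_id].
  apply: (spn_min (s := [:: g1, g2 & s]) hid); first by move=> x ->; exact: isid0.
  by move=> a; rewrite inE => /predU1P[->|ha]; [rewrite g10; exact: isid0 | apply: spn_mem => //; exact: zid_id].
have heP x : P (eps x) -> x = 0.
  by move=> h; have : contr eps P x by []; rewrite hz.
pose Iq := ideal_gen (P `|` (eps @` q)).
have hIq : isid Iq by exact: ideal_gen_id.
have hIqP p : P `<=` p -> isprime p -> q `<=` contr eps p -> Iq `<=` p.
  move=> h3 hp h4; apply: ideal_gen_min; first exact: prime_id.
  by move=> x [/h3//|[y /h4 hy <-]].
have [ps hps1 hps2] := minprimes hT hIq.
have hover p : isprime p -> P `<=` p -> contr eps p = q -> List.In p ps.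
  move=> hp hPp hc; have [p' hp' hp'p] := hps2 p hp (hIqP p hPp hp (eq_ind_r (fun A : set R => q `<=` A) (fun x h => h) hc)).
  suff -> : p = p' by [].
  have [hp'1 hp'2 _] := hps1 _ hp'.
  apply: seteqI => //; apply: (incomparable hPi hf) => //.
    by move=> x hx; apply: hp'2; apply: ideal_gen_sub; left.
  rewrite hc => x hx; apply: hp'2; apply: ideal_gen_sub; right; by exists x.
(* By incomparability the primes over [P] with contraction [q] are among the finitely many minimal
   primes of [Iq], so prime avoidance applies to all of them except [Q]. *)
pose ps' := List.filter (fun p => `[< ~ (Q `<=` p) >]) (P :: ps).
have [|g hgQ hg] := @avoid T ps' Q (prime_id hQ).
  move=> p /List.filter_In[hp /asboolP hnp]; split=> //.
  by case: hp => [<-//|/hps1[]].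
have hgP : ~ P g.
  apply: hg; apply/List.filter_In; split; [by left | exact/asboolP].
have hgo p : isprime p -> P `<=` p -> contr eps p = q -> p g -> p = Q.
  move=> hp hPp hc hpg.
  have hQp : Q `<=` p.
    apply: contrapT => hn; apply: (hg p) => //.
    by apply/List.filter_In; split; [right; exact: hover | exact/asboolP].
  by apply: seteqI => //; apply: (incomparable hPi hf) => //; rewrite hc.
have hpow p1 : q p1 -> exists N v, ~ q v /\ spn P [:: g] (eps (v * p1 ^+ N)).
  move=> hp1; apply: contrapT => hno.
  have [||||p hp [hp2 hp3]] := @prime_avoid_mult T (spn P [:: g]) [set z | exists v N, ~ q v /\ z = eps (v * p1 ^+ N)] hT.
  - exact: gen_id.
  - by exists 1, 0%N; rewrite mulr1 rmorph1; split=> //; exact: prime1.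
  - move=> _ _ [v [k [hv ->]]] [v' [l [hv' ->]]]; exists (v * v'), (k + l)%N; split; first exact: primeNM.
    by rewrite -rmorphM exprD; congr (eps _); ring.
  - by move=> _ [v [k [hv ->]]] h; apply: hno; exists k, v.
  have hPp : P `<=` p by move=> x hx; apply: hp2; exact: gen_base.
  have hgp : p g by apply: hp2; apply: spn_mem => //; rewrite inE.
  have hcq : contr eps p `<=` q.
    move=> x hx; apply: contrapT => hnq; apply: (hp3 (eps x)) => //.
    by exists x, 0%N; rewrite mulr1.
  have [p' hp' [hpp' hc]] := lying_over_fin hT hf hp hPp hq hcq.
  have ep : p' = Q by apply: hgo => //; [move=> x /hPp/hpp' | exact: hpp'].
  have hpQ : p `<=` Q by rewrite -ep.
  case: (hadj hp hPp hpQ) => [h|h]; first exact/hgP/h.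
  apply: (hp3 (eps p1)); last exact: h.
  by exists 1, 1%N; rewrite mul1r; split=> //; exact: prime1.
have [N1 [v1 [hv1 [b1 _ /= hb1]]]] := hpow g1 hg1.
have [N2 [v2 [hv2 [b2 _ /= hb2]]]] := hpow g2 hg2.
have [w [h [h0 hw hht]]] := indep_span eps hRd hP t.
have hspan x : rspan eps P w (eps h * x).
  have [c hc] := hf x; apply: (rspanP hP (y := eps h * \sum_(i < size t) eps (c i) * t`_i)).
    by rewrite -mulrBr; exact: isidM.
  rewrite mulr_sumr; elim/big_rec: _ => [|i y _ hy]; first exact: rspan0.
  apply: rspanD => //; rewrite mulrCA; apply: rspanZ => //; apply: hht; exact: mem_nth.
have hcong x y j : P (x - y) -> P (x ^+ j - y ^+ j).
  by move=> hxy; rewrite subrXX; exact: isidMr.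
have main j : exists y, ~ Q y /\ exists c, P (y * eps h - g ^+ j * c).
  have [a ha] := hspan (b1 ^+ j); have [b hb] := hspan (b2 ^+ j).
  have e1 := hcong _ _ j hb1; have e2 := hcong _ _ j hb2.
  pose y1 := v1 ^+ j * g1 ^+ (N1 * j); pose y2 := v2 ^+ j * g2 ^+ (N2 * j).
  have ey1 : P (eps y1 - b1 ^+ j * g ^+ j).
    by rewrite /y1 exprM -!exprMn rmorphXn.
  have ey2 : P (eps y2 - b2 ^+ j * g ^+ j).
    by rewrite /y2 exprM -!exprMn rmorphXn.
  have hab i : (i < size w)%N -> y2 * a i = g1 ^+ (N1 * j) * (v1 ^+ j * b i).
    move=> hi; apply: subr0_eq.
    apply: (hw (fun i => y2 * a i - g1 ^+ (N1 * j) * (v1 ^+ j * b i)) _ i hi).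
    set sa := \sum_(i < size w) eps (a i) * w`_i in ha; set sb := \sum_(i < size w) eps (b i) * w`_i in hb.
    have -> : \sum_(i < size w) eps (y2 * a i - g1 ^+ (N1 * j) * (v1 ^+ j * b i)) * w`_i = eps y2 * sa - eps y1 * sb.
      rewrite /sa /sb !mulr_sumr -sumrB; apply: eq_bigr => k _.
      by rewrite rmorphB mulrBl !rmorphM; congr (_ - _); ring.
    rewrite (_ : _ - _ = eps y1 * (eps h * b2 ^+ j - sb) - eps y2 * (eps h * b1 ^+ j - sa)
       + eps h * (b1 ^+ j * (eps y2 - b2 ^+ j * g ^+ j) - b2 ^+ j * (eps y1 - b1 ^+ j * g ^+ j))); last by ring.
    by apply: isidD => //; [apply: isidB | apply: isidM => //; apply: isidB] => //; exact: isidM.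
  have hny2 : ~ sat q I1 y2.
    apply: primeNM => //; last exact: primeNX.
    move=> /(primeX hP1) hv; apply: hv2; exact: (sat_in hq hI1q hv).
  have /choice[uc huc] : forall i : 'I_(size w), exists uc : R * R, ~ q uc.1 /\ uc.1 * a i = g1 ^+ (N1 * j) * uc.2.
    move=> i; have [u [c [hu e]]] := prime_elt_cancel hRd hq hP1 hg10 hny2 (hab i (ltn_ord i)).
    by exists (u, c).
  have [||u hu hua] := @sat_common R q (spn (@zid R) [:: g1 ^+ (N1 * j)]) (size w) (fun i => a i) hq.
  - by apply: gen_id; [exact: setT_id | exact: zid_id].
  - move=> i; have [h3 h4] := huc i; exists (uc i).1 => //; exists (uc i).2 => //=.
    by rewrite h4 mulrC; exact: subrr.
  have /choice[c hc] : forall i : 'I_(size w), exists c, u * a i = c * g1 ^+ (N1 * j).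
    by move=> i; have [c _ /subr0_eq h3] := hua i; exists c.
  exists (eps (u * v1 ^+ j)); split; first by apply: (primeNM hq hu); exact: primeNX.
  exists (\sum_(i < size w) eps (c i) * w`_i).
  set sc := \sum_i _; set sa := \sum_(i < size w) eps (a i) * w`_i in ha.
  have ec : eps u * sa = eps (g1 ^+ (N1 * j)) * sc.
    rewrite /sa /sc !mulr_sumr; apply: eq_bigr => i _.
    by rewrite mulrA -rmorphM hc rmorphM; ring.
  have hgg : ~ P (eps (g1 ^+ (N1 * j))).
    by move=> /heP /(primeX hRd).
  apply: (primeMl hP hgg).
  rewrite (_ : _ * _ = eps u * eps h * (eps y1 - b1 ^+ j * g ^+ j) + g ^+ j * (eps u * (eps h * b1 ^+ j - sa))
     + g ^+ j * (eps u * sa - eps (g1 ^+ (N1 * j)) * sc)).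
    rewrite ec subrr mulr0 addr0; apply: isidD => //; first exact: isidM.
    by do 2 apply: isidM => //.
  by rewrite /y1 !rmorphM; ring.
pose V : set 'rV[T]_1 := [set v | exists a, P (v 0 0 - a * eps h)].
have hV : submod V.
  split=> [|x y [a ha] [b hb]|c x [a ha]].
  - by exists 0; rewrite mxE mul0r subrr; exact: isid0.
  - by exists (a + b); rewrite mxE mulrDl opprD addrACA; exact: isidD.
  - by exists (c * a); rewrite mxE -mulrA -mulrBr; exact: isidM.
pose Ig := spn (@zid T) [:: g].
have hIg : isid Ig by apply: gen_id; [exact: setT_id | exact: zid_id].
(* Artin-Rees for the ideal P + (eps h): for j = [D] the element g^D c lies in g times it.
   Cancelling eps h modulo [P] gives y in P + gT, inside [Q], a contradiction. *)
have [D hD] := artin_rees hT hIg hV.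
have [y [hy [c hc]]] := main D.
have [||J [k [v [hk hv e]]]] := hD (\row__ (g ^+ D * c)).
- by exists y; rewrite mxE -opprB; exact: isidN.
- move=> i; rewrite mxE; apply: isidMr; first exact: pw_id.
  by apply: pwX; apply: spn_mem; [exact: zid_id | rewrite inE].
have /choice[a ha] : forall i, exists a, P (v i 0 0 - a * eps h) by move=> i; exact: hv.
have /choice[l hl] : forall i, exists l, k i = l * g by move=> i; have [l _ /subr0_eq h3] := hk i; exists l.
have hyg : P (y - g * \sum_i l i * a i).
  apply: (primeMl hP (u := eps h)); first by move=> /heP.
  have /matrixP/(_ 0 0) := e; rewrite mxE summxE => e'.
  rewrite (_ : _ * _ = (y * eps h - g ^+ D * c) + \sum_i k i * (v i 0 0 - a i * eps h)).
    by apply: isidD => //; apply: isid_sum => // i _; exact: isidM.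
  under [in RHS]eq_bigr => i _ do rewrite mulrBr.
  rewrite sumrB e'; under [X in _ - X + (_ - _)]eq_bigr => i _ do rewrite mxE.
  rewrite addrA subrK mulrBr mulrC; congr (_ - _).
  rewrite !mulr_sumr; apply: eq_bigr => i _; rewrite hl; ring.
apply: hy; have := isidBr (prime_id hQ) (hPQ hyg) (isidMr _ (prime_id hQ) hgQ); exact.
Qed.

Lemma complete_local_dim_bound J : isid J -> exists b, forall n, height_ge J M n -> (n <= b)%N.
Proof.
move=> hJ; have [_ hM _ _ _] := hcl; have [a ha] := hT hM; exists (size a) => n hn.
apply: (krull_height hT (@zid_id T) _ (height_ge_mono (zid_sub hJ) hn)).
rewrite -ha; split; [exact: complete_local_prime hcl | by [] | by move=> p _ h1 _].
Qed.

(** T/P is normalized over power series with an element of [Q] as image of the first variable F. By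
    [adj_height] the contraction of [Q] has height at most one, so it is the prime (F); a chain of
    maximal length above (F) is lifted over [Q]. *)
Lemma catenary m : height_ge P M m.+1 -> height_ge Q M m.
Proof.
move=> hm; have hPi := prime_id hP; have hMp := complete_local_prime hcl.
have [b hb] := complete_local_dim_bound hPi.
have [|d hd1 hd2] := height_ge_max (b := b) (height_ge0 hm); first by move=> /hb; rewrite ltnn.
have hmd : (m < d)%N.
  by rewrite ltnNge; apply/negP => h; apply: hd2; apply: height_ge_le hm; rewrite ltnS.
case: d hd1 hd2 hmd => // d hd1 hd2 hmd; apply: (height_ge_le (n := d)) => //.
have [f hfQ hfP] : exists2 f, Q f & ~ P f.
  by apply: contrapT => hno; apply: hnQP => x hx; apply: contrapT => hn; apply: hno; exists x.
have hJ : isid (spn P [:: f]) by apply: gen_id; [exact: setT_id | exact: hPi].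
have hQM := complete_local_prime_sub hcl hQ.
have hJM : spn P [:: f] `<=` M.
  apply: spn_min; [exact: prime_id | by move=> x /hPQ/hQM | by move=> a; rewrite inE => /eqP->; exact: hQM].
have [|Y [hY1 hY2 hY3]] := params (h := d) hT hJ hMp hJM.
  move=> h; apply: hd2; apply: height_ge_bot h => p hp hJp _; exists P; split=> //.
    by move=> x hx; apply: hJp; exact: gen_base.
  by move=> hpP; apply/hfP/hpP/hJp; apply: spn_mem => //; rewrite inE.
have espn : spn (spn P [:: f]) Y = spn P (f :: Y).
  rewrite -gen_cat; apply: seteqI; apply: spn_sub => // z; rewrite mem_cat !inE //;
  by case/orP => ->; rewrite ?orbT.
rewrite espn in hY3.
have hsY : size Y = d.
  apply/eqP; rewrite eqn_leq hY1 /=.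
  by have := krull_height hT hPi hY3 hd1; rewrite ltnS.
have hz a : a \in f :: Y -> M a by rewrite inE => /predU1P[->|/hY2//]; exact: hQM.
have hd1' : height_ge P M (size (f :: Y)) by rewrite /= hsY.
have [L [pi [sg [hker hsg]]]] := coef_field hcl hch.
have hdec x : exists c, M (x - sg c).
  by exists (pi x); rewrite hker rmorphB hsg subrr.
have [R [C [X [eps [t [hps heX heC hf hker0]]]]]] := noether_norm hcl hdec hP hz hY3 hd1'.
have hcR : char0u R.
  apply: (char0u_map C) => n; exists (n.+1%:R^-1); rewrite mulVf //.
  by apply/eqP => h; apply: (hch (n := n)); rewrite hker rmorph_nat.
have [hclR _ hRd _ hhd _ _] := hps; have [hR _ _ _ _] := hclR.
case: X heX hps hclR hhd => [//|F X] heX hps hclR hhd.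
have [eF eY] : eps F = f /\ map eps X = Y by case: heX.
have [hFp hFh] := hhd F X erefl.
have hX : size X = d by rewrite -hsY -eY size_map.
have hnad := adj_height hR hcR (ps_Jprop hps hcR) hRd hf hker0.
have hqp : isprime (contr eps Q) := contr_prime eps hQ.
have hFq : spn (@zid R) [:: F] `<=` contr eps Q.
  apply: spn_min; [exact: prime_id | by move=> x ->; exact: isid0 (prime_id hqp)|].
  by move=> a; rewrite inE => /eqP->; rewrite /contr /= eF.
have eq : contr eps Q = spn (@zid R) [:: F].
  apply: seteqI => //; apply: contrapT => hno; apply: hnad; split=> //.
  exists (spn (@zid R) [:: F]); split=> //; split=> //; exists (@zid R); split; [by split | by move=> x ->; exact: isid0 (prime_id hFp) |].
  move=> h; apply: hfP; rewrite -eF.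
  have : contr eps P F by rewrite hker0; apply: h; apply: spn_mem; [exact: zid_id | rewrite inE].
  by [].
rewrite -eq hX in hFh.
have [p hp _] := height_ge_up_fin hT hf hQ hPQ hFh.
apply: (height_ge_up hp hMp); apply: (complete_local_prime_sub hcl); exact: height_ge_prime hp.
Qed.
End Catenary.

(** * Regularity under surjective morphisms *)

Section SurjReg.
Variables (S T : comNzRingType) (eps : {rmorphism S -> T}).
Hypothesis hs : forall y, exists x, eps x = y.

Lemma contr_sub (A B : set T) : contr eps A `<=` contr eps B -> A `<=` B.
Proof. by move=> h x hx; have [y ey] := hs x; rewrite -ey; apply: h; rewrite /contr /= ey. Qed.

Lemma surj_prime_img P : isprime P -> contr eps (@zid T) `<=` P -> exists2 P', isprime P' & contr eps P' = P.
Proof.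
move=> hP hk; have hPi := prime_id hP; pose P' : set T := [set y | exists2 x, P x & eps x = y].
have e : contr eps P' = P.
  apply: seteqI => x; last by exists x.
  move=> [y hy e]; apply: (isidBr hPi (y := y)) => //; apply: hk.
  by rewrite /contr /= /zid rmorphB e subrr.
exists P' => //; split.
- split=> [|_ _ [x hx <-] [y hy <-]|a _ [x hx <-]]; first by exists 0; [exact: isid0 | rewrite rmorph0].
    by exists (x + y); [exact: isidD | rewrite rmorphD].
  by have [b <-] := hs a; exists (b * x); [exact: isidM | rewrite rmorphM].
- move=> h; apply: (prime1 hP); rewrite -e /contr /= rmorph1 //.
- move=> x y; have [a <-] := hs x; have [b <-] := hs y => h.
  have : contr eps P' (a * b) by rewrite /contr /= rmorphM.
  by rewrite e => /(primeM hP)[h'|h']; [left; exists a | right; exists b].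
Qed.

Lemma height_ge_surj J Q n : isid J -> height_ge (contr eps J) (contr eps Q) n -> isprime Q -> height_ge J Q n.
Proof.
move=> hJ; elim: n Q => [|n IH] Q /=; first by move=> [_ h] hQ; split=> //; exact: contr_sub.
move=> [_ [p [h1 h2 h3]]] hQ; split=> //.
have hk : contr eps (@zid T) `<=` p.
  by move=> x hx; apply: (height_ge_sub h1); rewrite /contr /= (hx : eps x = 0); exact: isid0.
have [p' hp' e] := surj_prime_img (height_ge_prime h1) hk; rewrite -e in h1 h2 h3.
exists p'; split; [exact: IH | exact: contr_sub | by move=> h; apply: h3 => x; exact: h].
Qed.

Lemma spn_surj J s x : spn (contr eps J) s x <-> spn J (map eps s) (eps x).
Proof.
elim: s x => [|a s IH] x //=; split=> [[r _ /IH]|[r _]].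
  by rewrite rmorphB rmorphM => h; exists (eps r).
by have [r' <-] := hs r; rewrite -rmorphM -rmorphB => /IH h; exists r'.
Qed.

(** Brings the Jacobian criterion, proved for S, to bear on its quotient T. *)
Lemma reg_surj J Q n : isid J -> isprime Q -> reg (contr eps J) (contr eps Q) n <-> reg J Q n.
Proof.
move=> hJ hQ; split.
  move=> [h1 [s [h2 h3 h4]]]; split; first exact: height_ge_surj.
  exists (map eps s); split; [by rewrite size_map | by move=> _ /mapP[a /h3 ha ->] |].
  move=> y; have [x <-] := hs y => /h4[u hu /spn_surj]; rewrite rmorphM => h.
  by exists (eps u).
move=> [h1 [s [h2 h3 h4]]]; split; first exact: coprime_reg_surj.
have [s' es] : exists s', map eps s' = s.
  elim: s {h2 h3 h4} => [|a s [s' <-]]; first by exists [::].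
  by have [b <-] := hs a; exists (b :: s').
exists s'; split; [by rewrite -h2 -es size_map | by move=> a ha; apply: h3; rewrite -es map_f |].
move=> x /h4[v]; have [u <-] := hs v => hu; rewrite -rmorphM -es => /spn_surj h.
by exists u.
Qed.
End SurjReg.

(** Cohen's structure theorem in equal characteristic zero, reduced to what the Jacobian criterion
    asks of S. *)
Lemma complete_local_cover (T : comNzRingType) (M : set T) : complete_local M -> (forall n, ~ M n.+1%:R) ->
  exists (S : comNzRingType) (eps : {rmorphism S -> T}),
  [/\ noeth S, char0u S, Jprop S & forall y, exists x, eps x = y].
Proof.
move=> hcl hch; have [hT hM _ _ hc] := hcl.
have [L [pi [sg [hker hsg]]]] := coef_field hcl hch.
have hdec x : exists c, M (x - sg c).
  by exists (pi x); rewrite hker rmorphB hsg subrr.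
have [z hz] := hT _ hM.
have [S [C [X [hX hps]]]] := ps_exists L (size z).
have hzM x : x \in z -> M x by move=> hx; rewrite hz; apply: spn_mem => //; exact: zid_id.
have [eps [heC heX]] := ps_eval hps sg hM hc (esym hX) hzM.
have hcS : char0u S.
  apply: (char0u_map C) => n; exists (n.+1%:R^-1); rewrite mulVf //.
  by apply/eqP => h; apply: (hch n); rewrite hker rmorph_nat.
exists S, eps; split=> //; [by case: hps => -[] | exact: (ps_Jprop hps) |].
apply: (ps_surj hcl hdec hps heC); last by rewrite heX.
by move=> x hx; apply: hzM; rewrite -heX map_f.
Qed.

Lemma ext_polynC (S : comNzRingType) m (I : set S) (y : polyn S m.+1) :
  (forall k, ext (polynC S m) I y`_k) -> ext (polynC S m.+1) I y.
Proof.
move=> h; have hid : isid (ext (polynC S m.+1) I) by exact: ext_id.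
rewrite -(coefK y) poly_def; apply: isid_sum => // k _; rewrite -mul_polyC; apply: isidMr => //.
move: (h k); move: (y`_k); apply: (ext_min (Q := [set a : polyn S m | ext (polynC S m.+1) I a%:P])).
  exact: (contr_id (polyC : {rmorphism polyn S m -> polyn S m.+1}) hid).
by move=> a ha /=; exact: (ext_in (polynC S m.+1)).
Qed.

Lemma coef_ext_polynC (S : comNzRingType) m (I : set S) (y : polyn S m.+1) :
  ext (polynC S m.+1) I y -> forall k, ext (polynC S m) I y`_k.
Proof.
have hid : isid (ext (polynC S m) I) by exact: ext_id.
move: y; apply: (ext_min (Q := [set y : polyn S m.+1 | forall k, ext (polynC S m) I y`_k])).
  split=> [k|x y hx hy k|a x hx k] /=; first by rewrite coef0; exact: isid0.
    by rewrite coefD; exact: isidD.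
  by rewrite coefM; apply: isid_sum => // j _; exact: isidM.
move=> a ha k /=; rewrite coefC; case: eqP => _; last exact: isid0.
exact: ext_in.
Qed.

Lemma contr_polynM (S T : comNzRingType) (eps : {rmorphism S -> T}) m (I : set T) : isid I ->
  contr (polynM eps m) (ext (polynC T m) I) `<=` ext (polynC S m) (contr eps I).
Proof.
move=> hI; elim: m => [|m IH] x hx.
  by apply: ext_in; move: hx; apply: ext_min.
apply: ext_polynC => // k; apply: IH; have := coef_ext_polynC hx k.
by rewrite /contr /= coef_map.
Qed.

(** * Fibres of polynomial extensions *)

Section Fiber.
Variables (A T S : comNzRingType) (phi : {rmorphism A -> T}) (eps : {rmorphism S -> T}).
Hypotheses (hA : noeth A) (hAc : char0u A).
Hypotheses (hS : noeth S) (hSc : char0u S) (hSJ : Jprop S) (hsurj : forall y, exists x, eps x = y).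
Hypothesis hfib : forall q, isprime q -> exists n, reg (ext phi (contr phi q)) q n.

(** The Jacobian data of the fibre below, over [q0], are combined with partial derivatives in the
    new variables that are dual to generators of the contraction of [Q] modulo constants. The latter
    vanish on constants, so the combined matrix is block triangular. *)
Lemma fiber_reg m (Q : set (polyn T m)) : isprime Q ->
  exists n, reg (ext (polynM phi m) (contr (polynM phi m) Q)) Q n.
Proof.
move=> hQ; set F := polynM phi m; pose e := polynM eps m; set Pt := contr F Q.
have hes : forall y, exists x, e x = y by exact: polynM_surj.
have hPt : isprime Pt := contr_prime F hQ.
pose Q' := contr e Q; have hQ' : isprime Q' := contr_prime e hQ.
pose q0 := contr (polynC T m) Q; have hq0 : isprime q0 := contr_prime (polynC T m) hQ.
pose p := contr phi q0.
have FC a : F (polynC A m a) = polynC T m (phi a) by exact: polynM_C.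
have eC a : e (polynC S m a) = polynC T m (eps a) by exact: polynM_C.
have hpP a : p a <-> Pt (polynC A m a) by rewrite /Pt /contr /= FC.
have [n0 hn0] := hfib hq0; rewrite -/p in hn0.
have hextp := ext_id phi p.
have hJ0 := contr_id eps hextp.
have hq0' := contr_prime eps hq0.
have hr0 := proj2 (reg_surj hsurj n0 hextp hq0) hn0.
have [L0 [pi0 [Qpi0 Lfrac0]]] := residue_exists hq0'.
have [r [f [D [hf hD hdet hsat0]]]] := jac_nec hS hSc hSJ hq0' Qpi0 Lfrac0 hJ0 hr0.
have [L1 [pi1 [Qpi1 Lfrac1]]] := residue_exists hPt.
pose J := ext (polynC A m) p.
have hJ : isid J by exact: ext_id.
have hJP : J `<=` Pt by apply: ext_min; [exact: prime_id | by move=> a /hpP].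
have [s [Fs [lam [hs1 hs2 hlam hlamJ hdual]]]] := min_gens (@polyn_noeth A m hA) hPt Qpi1 hJ hJP.
have ePt : Pt = [set x | pi1 x = 0] by apply: seteqI => x /Qpi1.
have hch1 n : n.+1%:R != 0 :> L1 by exact: (char0u_neq0 pi1 n (char0u_map (polynC A m) hAc)).
(* A form that vanishes on the constants in the prime is a combination of partial derivatives alone,
   up to a denominator. *)
have /choice[E0 hE0] : forall i : 'I_s, exists bu : ('I_m -> polyn A m) * polyn A m, ~ Pt bu.2 /\
    forall x, Pt x -> pi1 (\sum_j bu.1 j * pd j x) = pi1 bu.2 * lam i x.
  move=> i; have hl := hlam i; rewrite {1}ePt in hl.
  have [|c hc] := polyn_Jrel hch1 hl.
    by move=> a ha; apply: hlamJ; apply: ext_in; apply/hpP; rewrite ePt.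
  have [u [b [hu hb]]] := common_denom hPt Qpi1 Lfrac1 c.
  exists (b, u); split=> // x hx; rewrite (hc x) ?mulr_sumr ?rmorph_sum /=; last exact/Qpi1.
  by apply: eq_bigr => j _; rewrite rmorphM -hb mulrA.
have /choice[l hl] := fun x => hes (F x).
pose E i x := \sum_(j < m) l ((E0 i).1 j) * pd j x.
have hE i : isder (E i) by apply: isder_sum => j; apply: isderZ; exact: pd_der.
have hEF i k : Q' (E i (l Fs`_k) - l (E0 i).2 * (i == k :> nat)%:R * (k < s)%N%:R) \/ ~~ (k < s)%N.
  case: (ltnP k s) => hk; [left | by right].
  rewrite mulr1 /Q' /contr /= rmorphB rmorphM rmorph_nat hl /E rmorph_sum.
  have -> : \sum_(j < m) e (l ((E0 i).1 j) * pd j (l Fs`_k)) = F (\sum_(j < m) (E0 i).1 j * pd j Fs`_k).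
    rewrite rmorph_sum; apply: eq_bigr => j _; rewrite !rmorphM hl.
    by rewrite (polynM_pd eps) (polynM_pd phi) -/e -/F hl.
  rewrite -(rmorph_nat F) -rmorphM -rmorphB; apply/Qpi1; rewrite rmorphB.
  have [_ e0] := hE0 i; rewrite e0; last by apply: hs1; apply: mem_nth; rewrite size_tuple.
  by rewrite (hdual i (Ordinal hk)) rmorphM rmorph_nat subrr.
have [L [pi [Qpi Lfrac]]] := residue_exists hQ'.
pose g (i : 'I_(r + s)) := match split i with inl j => polynC S m (f j) | inr j => l Fs`_j end.
pose DD (i : 'I_(r + s)) := match split i with inl j => @polynD S (D j) m | inr j => E j end.
have hDD i : isder (DD i) by rewrite /DD; case: (split i) => // j; exact: polynD_der.
have hFsP (k : 'I_s) : Pt Fs`_k by apply: hs1; apply: mem_nth; rewrite size_tuple.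
have hgJ i : contr e (ext F Pt) (g i).
  rewrite /g; case: (split i) => j; rewrite /contr /=; last by rewrite hl; exact: ext_in.
  rewrite eC; have := hf j; rewrite /contr /=; move: (eps (f j)).
  apply: (ext_min (Q := contr (polynC T m) (ext F Pt))); first by apply: contr_id; exact: ext_id.
  by move=> a /hpP ha; rewrite /contr /= -FC; exact: ext_in.
have hextQ : ext F Pt `<=` Q by apply: ext_min; [exact: prime_id | ].
have hgQ i : Q' (g i) by apply: hextQ; exact: hgJ.
have [|n hn] := jac_suff (@polyn_noeth S m hS) (char0u_map (polynC S m) hSc) (@polyn_Jprop S m hSc hSJ) hQ' Qpi Lfrac hgQ hDD.
  rewrite Qpi -det_map_mx => /eqP; apply/negP.
  have -> : map_mx pi (\matrix_(i, j) DD i (g j)) =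
    block_mx (map_mx (pi \o polynC S m) (\matrix_(i, j) D i (f j))) (\matrix_(i, j) pi (@polynD S (D i) m (l Fs`_j)))
             0 (diag_mx (\row_i pi (l (E0 i).2))).
    apply/matrixP => i j; rewrite !mxE; case: (splitP i) => i' hi; rewrite !mxE;
      case: (splitP j) => j' hj; rewrite !mxE /DD /g.
    - have -> : i = lshift s i' by exact: val_inj. have -> : j = lshift s j' by exact: val_inj.
      by rewrite (unsplitK (inl i')) (unsplitK (inl j')) polynD_C.
    - have -> : i = lshift s i' by exact: val_inj. have -> : j = rshift r j' by exact: val_inj.
      by rewrite (unsplitK (inl i')) (unsplitK (inr j')).
    - have -> : i = rshift r i' by exact: val_inj. have -> : j = lshift s j' by exact: val_inj.
      rewrite (unsplitK (inr i')) (unsplitK (inl j')) /E big1 ?rmorph0 // => k _.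
      by rewrite pd_C mulr0.
    - have -> : i = rshift r i' by exact: val_inj. have -> : j = rshift r j' by exact: val_inj.
      rewrite (unsplitK (inr i')) (unsplitK (inr j')).
      have [|] := hEF i' j'; last by rewrite ltn_ord.
      rewrite ltn_ord mulr1 => /Qpi; rewrite rmorphB rmorphM rmorph_nat => /subr0_eq->.
      by rewrite (_ : (i' == j' :> nat) = (i' == j')) // mulr_natr.
  rewrite det_ublock det_map_mx det_diag mulf_neq0 //.
    by apply/eqP => /Qpi h; apply: hdet; rewrite /contr /= /q0 /contr /= -eC.
  apply/prodf_neq0 => i _; rewrite mxE; apply: (pi_neq0 Qpi); have [h _] := hE0 i.
  by rewrite /Q' /contr /= hl => h'; apply: h.
exists n; have hidF := ext_id F Pt; apply/(reg_surj hes n hidF hQ).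
have hsp : isid (spn (@zid (polyn S m)) (codom g)) by apply: gen_id; [exact: setT_id | exact: zid_id].
have hsatid := sat_id hQ' hsp.
apply: reg_localeq hn _ _ _.
- apply: spn_min; [exact: contr_id | by move=> x ->; exact: isid0 (contr_id e hidF) |].
  by move=> a /codomP[i ->].
- by move=> x; exact: hextQ.
pose ET := ext (polynC T m) (ext phi p).
(* At [Q] the fibre ideal is generated by the constants from [p] and by [Fs]; the preimage of the
   former is generated by [f]. *)
have c1 : ext F Pt `<=` sat Q (spn ET (map F Fs)).
  have hE' : isid (spn ET (map F Fs)) by apply: gen_id; [exact: setT_id | exact: ext_id].
  apply: ext_min; first exact: sat_id.
  move=> a /hs2[u hu hua]; exists (F u); first exact: hu.
  have := ext_spn F hJ hua; rewrite rmorphM; apply: gen_mono => //.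
  apply: ext_min; first exact: ext_id.
  apply: (ext_min (Q := contr F ET)); first by apply: contr_id; exact: ext_id.
  by move=> b hb; rewrite /contr /= FC; apply: ext_in; exact: ext_in.
have c2 : contr e ET `<=` sat Q' (spn (@zid (polyn S m)) (codom g)).
  move=> x /(contr_polynM hextp); move: x; apply: ext_min => //.
  move=> a /hsat0[u hu hua]; exists (polynC S m u); first by rewrite /Q' /contr /= eC.
  rewrite -rmorphM; have := ext_spn (polynC S m) (@zid_id S) hua.
  apply: spn_min => // [x|x /mapP[y /codomP[i ->] ->]].
    by apply: ext_min => // z ->; rewrite rmorph0; exact: isid0.
  apply: spn_mem; first exact: zid_id.
  have -> : polynC S m (f i) = g (lshift s i) by rewrite /g (unsplitK (inl i)).
  exact: codom_f.
move=> x /c1[v]; have [v' <-] := hes v => hv; rewrite -rmorphM.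
have -> : map F Fs = map e (map l Fs) by rewrite -map_comp; apply: eq_map => y /=; rewrite hl.
move=> /(spn_surj hes) h; apply: (sat_sat hQ'); exists v' => //.
move: h; apply: spn_min => // a /mapP[y /(nthP 0)[i hi <-] ->].
rewrite size_tuple in hi; apply: sat_sub => //; apply: spn_mem; first exact: zid_id.
have -> : l Fs`_i = g (rshift r (Ordinal hi)) by rewrite /g (unsplitK (inr _)).
exact: codom_f.
Qed.
End Fiber.

(** * The countable domain *)

Section Baire.
Variables (T : comNzRingType) (M : set T).
Hypothesis hcl : complete_local M.
Let hT : noeth T. Proof. by case: hcl. Qed.
Let hM : isid M. Proof. by case: hcl. Qed.
Let hc : complete M. Proof. by case: hcl. Qed.

(* The element y is a Cauchy limit leaving the cosets d k + p k one at a time. *)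
Lemma baire (J : set T) (p : nat -> set T) (d : nat -> T) t : isid J ->
  (forall k, [/\ isprime (p k), ~ (M `<=` p k) & ~ (J `<=` p k)]) ->
  exists2 y, J y & forall k, ~ p k (t + y - d k).
Proof.
move=> hJ hp.
have step (k : nat) (s : T * nat) : exists s' : T * nat, [/\ J (s'.1 - s.1), pw M s.2 (s'.1 - s.1),
   (s.2 < s'.2)%N & forall z, pw M s'.2 z -> ~ p k (s'.1 + z - d k)].
  case: s => s N /=; have [hpk hMp hJp] := hp k; have hpi := prime_id hpk.
  have [y [y1 y2 y3]] : exists y, [/\ J y, pw M N y & ~ p k (s + y - d k)].
    have [h|h] := pselect (p k (s - d k)); last first.
      by exists 0; rewrite addr0; split=> //; [exact: isid0 | exact: isid0 (pw_id _ _)].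
    have [a ha1 ha2] : exists2 a, J a & ~ p k a.
      by apply: contrapT => hno; apply: hJp => x hx; apply: contrapT => hn; apply: hno; exists x.
    have [b hb1 hb2] : exists2 b, M b & ~ p k b.
      by apply: contrapT => hno; apply: hMp => x hx; apply: contrapT => hn; apply: hno; exists x.
    exists (a * b ^+ N); split; [exact: isidMr | apply: isidM; [exact: pw_id | exact: pwX] |].
    rewrite addrAC => h'; apply: (primeNM hpk ha2 (primeNX (n := N) hpk hb2)).
    have := isidB hpi h' h; congr (p k _); ring.
  have [N' hN'] : exists N', forall z, pw M N' z -> ~ p k (s + y + z - d k).
    apply: contrapT => hno; apply: y3; apply: (krull_ideal hcl) => // n.
    have [z hz1 hz2] : exists2 z, pw M n z & p k (s + y + z - d k).
      apply: contrapT => hno'; apply: hno; exists n => z hz hz'; apply: hno'; by exists z.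
    exists (s + y + z - d k) => //; rewrite (_ : _ - _ = - z); last by ring.
    by apply: isidN => //; exact: pw_id.
  exists (s + y, maxn N.+1 N') => /=; rewrite (_ : s + y - s = y); last by ring.
  split=> //; first by rewrite leq_max ltnSn.
  by move=> z hz; apply: hN'; apply: pw_sub hz; exact: leq_maxr.
have /choice[f hf] : forall ks : nat * (T * nat), exists s' : T * nat, [/\ J (s'.1 - ks.2.1), pw M ks.2.2 (s'.1 - ks.2.1),
   (ks.2.2 < s'.2)%N & forall z, pw M s'.2 z -> ~ p ks.1 (s'.1 + z - d ks.1)] by move=> [k s]; exact: step.
pose st := fix st k := if k is k'.+1 then f (k', st k') else (t, 0%N).
pose a k := (st k.+1).1 - (st k).1.
have hN k : (k <= (st k).2)%N by elim: k => //= k IH; have [_ _ h _] := hf (k, st k); exact: leq_ltn_trans IH h.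
have hNm k l : (k <= l)%N -> ((st k).2 <= (st l).2)%N.
  elim: l => [|l IH]; first by rewrite leqn0 => /eqP->.
  rewrite leq_eqVlt => /orP[/eqP->//|/IH h]; apply: leq_trans h _.
  by have [_ _ h _] := hf (l, st l); exact: ltnW.
have ha k : pw M (st k).2 (a k) by have [_ h _ _] := hf (k, st k).
have haJ k : J (a k) by have [h _ _ _] := hf (k, st k).
case: (hc) => _ hcc; have [k|y hy] := hcc a; first by apply: pw_sub (ha k).
have es n : (st n).1 = t + \sum_(k < n) a k.
  elim: n => [|n IH]; first by rewrite big_ord0 addr0.
  by rewrite big_ord_recr /= addrA -IH /a subrKC.
exists y.
  apply: (krull_ideal hcl) => // n; exists (\sum_(k < n) a k); last exact: hy.
  by apply: isid_sum => // k _.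
move=> k; have [_ _ _ h] := hf (k, st k).
have -> : t + y - d k = (st k.+1).1 + (t + y - (st k.+1).1) - d k by ring.
apply: h => /=; rewrite -[f _]/(st k.+1).
set n := (st k.+1).2.
have hkn : (k.+1 <= n)%N by exact: hN.
have -> : t + y - (st k.+1).1 = (y - \sum_(i < n) a i) + \sum_(k.+1 <= i < n) a i.
  rewrite es -(big_mkord xpredT a) -(big_mkord xpredT a) (@big_cat_nat _ _ _ k.+1 0 n) //=; ring.
apply: isidD; [exact: pw_id | exact: hy |].
rewrite big_nat_cond; apply: isid_sum; first exact: pw_id.
by move=> i /andP[/andP[h1 _] _]; apply: pw_sub (ha i); exact: hNm.
Qed.

(** Modulo [p] a root splits off by the factor theorem and the cofactor has smaller degree. *)
Lemma roots_finite (p : set T) (f : {poly T}) : isprime p -> (exists k, ~ p f`_k) ->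
  exists ds : seq T, forall u, p f.[u] -> exists2 d, d \in ds & p (u - d).
Proof.
move=> hp; have hpi := prime_id hp; have [n] := ubnP (size f); elim: n f => // n IH f hn [k hk].
have [[d hd]|hno] := pselect (exists d, p f.[d]); last by exists [::] => u hu; case: hno; exists u.
have /factor_theorem[q eq] : root (f - f.[d]%:P) d by rewrite /root !hornerE subrr.
have ef : f = q * ('X - d%:P) + f.[d]%:P by rewrite -eq subrK.
have hsz : (size q < n)%N.
  have [->|q0] := eqVneq q 0.
    rewrite size_poly0; case: n hn {IH} => //; rewrite ltnS leqn0 size_poly_eq0 => /eqP f0.
    by case: hk; rewrite f0 coef0; exact: isid0.
  have h1 : size (f - f.[d]%:P) = (size q).+1.
    by rewrite eq size_Mmonic ?monicXsubC // size_XsubC addn2.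
  have : ((size q).+1 <= size f)%N.
    rewrite -h1 (leq_trans (size_polyD _ _)) // geq_max leqnn size_polyN (leq_trans (size_polyC_leq1 _)) //.
    rewrite size_poly_gt0; apply: contra_not_neq hk => ->; rewrite coef0; exact: isid0.
  by move=> h2; apply: leq_trans h2 _.
have hq : exists k, ~ p q`_k.
  apply: contrapT => hno; apply: hk; rewrite ef coefD; apply: isidD => //.
    by rewrite coefM; apply: isid_sum => // i _; apply: isidMr => //; apply: contrapT => h; apply: hno; exists i.
  by rewrite coefC; case: eqP => _ //; exact: isid0.
have [ds hds] := IH q hsz hq; exists (d :: ds) => u hu.
have : p (q.[u] * (u - d)).
  by apply: (isidBr hpi (y := - f.[d])); [rewrite opprK; move: hu; rewrite {1}ef !hornerE | exact: isidN].
by case/(primeM hp) => [/hds[d' h1 h2]|h]; [exists d'; rewrite // inE h1 orbT | exists d; rewrite // inE eqxx].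
Qed.
End Baire.

Definition enumerable (T : Type) (A : set T) := exists e : nat -> T, forall x, A x -> exists n, e n = x.

Lemma enumerable_seq (T : Type) (f : seq nat -> T) (A : set T) : (forall x, A x -> exists s, f s = x) -> enumerable A.
Proof.
move=> h; exists (fun n => if @unpickle (seq nat) n is Some s then f s else f [::]) => x /h[s <-].
by exists (pickle s); rewrite pickleK.
Qed.

Lemma enumerable_bigcup (T : Type) (B : nat -> set T) : (forall k, enumerable (B k)) -> enumerable [set x | exists k, B k x].
Proof.
move=> /choice[e he]; apply: (enumerable_seq (f := fun s => e (nth 0%N s 0) (nth 0%N s 1))) => x [k /he[n hn]].
by exists [:: k; n].
Qed.

Section Construct.
Variables (T : comNzRingType) (M : set T) (mp : list (set T)).
Hypotheses (hcl : complete_local M) (hmp : forall p, List.In p mp -> isprime p /\ ~ (M `<=` p))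
  (hred : forall x, (forall p, List.In p mp -> p x) -> x = 0) (hch : forall n, ~ M n.+1%:R).
Let hT : noeth T. Proof. by case: hcl. Qed.
Let hM : isid M. Proof. by case: hcl. Qed.

Definition good (A : set T) := [/\ subr_closed A, enumerable A & forall p x, List.In p mp -> A x -> p x -> x = 0].
Definition offmin (J : set T) := isid J /\ forall p, List.In p mp -> ~ (J `<=` p).

Definition adjoin (A : set T) u : set T := [set z | exists2 q, pover A q & z = q.[u]].

Lemma adjoin_sub A u : subr_closed A -> A `<=` adjoin A u.
Proof. by move=> hA z hz; exists z%:P; rewrite ?hornerC // => -[|i]; rewrite coefC //=; exact: subring0. Qed.

Lemma adjoin_mem A u : subr_closed A -> adjoin A u u.
Proof.
move=> hA; exists 'X; rewrite ?hornerX // => i; rewrite coefX; case: eqP => _; last exact: subring0.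
by case: hA.
Qed.

Lemma adjoin_subring A u : subr_closed A -> subr_closed (adjoin A u).
Proof.
move=> hA; have [h1 hB hMM] := hA; split; first exact: adjoin_sub.
  by move=> _ _ [p hp ->] [q hq ->]; exists (p - q); rewrite ?hornerE // => i; rewrite coefB; exact: hB.
move=> _ _ [p hp ->] [q hq ->]; exists (p * q); rewrite ?hornerE // => i; rewrite coefM.
by apply: subring_sum => // j _; exact: hMM.
Qed.

Lemma pover_enum A (e : nat -> T) q : (forall x, A x -> exists n, e n = x) -> pover A q -> exists s : seq nat, q = Poly (map e s).
Proof.
move=> he hq; have /choice[g hg] : forall i, exists n, e n = q`_i by move=> i; apply/he.
exists (mkseq g (size q)); apply/polyP => i; rewrite coef_Poly -map_comp.
case: (ltnP i (size q)) => hi; first by rewrite (nth_map 0%N) ?size_iota // nth_iota //= hg.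
by rewrite !nth_default // size_map size_iota.
Qed.

Lemma adjoin_cnt A u : enumerable A -> enumerable (adjoin A u).
Proof.
move=> [e he]; apply: (enumerable_seq (f := fun s => (Poly (map e s)).[u])) => _ [q hq ->].
by have [s ->] := pover_enum he hq; exists s.
Qed.

Lemma good_adjoin A u : good A -> (forall p q, List.In p mp -> pover A q -> p q.[u] -> q.[u] = 0) -> good (adjoin A u).
Proof.
move=> [h1 h2 h3] h; split; [exact: adjoin_subring | exact: adjoin_cnt |].
by move=> p _ hp [q hq ->]; exact: h.
Qed.

(** A nonzero polynomial over [A] stays nonzero modulo each minimal prime and has finitely many
    roots there. There are countably many such polynomials, so [baire] provides an element of t + J
    that is none of these roots. *)
Lemma adjoin1 A J t : good A -> offmin J -> exists A' u, [/\ good A', A `<=` A', A' u & J (u - t)].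
Proof.
move=> hA [hJ hJp]; have [h1 h2 h3] := hA; have [e he] := h2.
have hrf (ps : set T * seq nat) : exists ds : seq T, List.In ps.1 mp -> (exists k, ~ ps.1 (Poly (map e ps.2))`_k) ->
    forall u, ps.1 (Poly (map e ps.2)).[u] -> exists2 d, d \in ds & ps.1 (u - d).
  have [hin|hno] := pselect (List.In ps.1 mp); last by exists [::].
  have [hk|hno] := pselect (exists k, ~ ps.1 (Poly (map e ps.2))`_k); last by exists [::].
  by have [ds hds] := roots_finite (proj1 (hmp hin)) hk; exists ds.
have {hrf}[rf hrf] := choice hrf.
case Emp: mp => [|p0 mp'].
  exists A, t; split=> //; last by rewrite subrr; exact: isid0.
  by rewrite (hred (x := t)); [exact: subring0 | rewrite Emp].
have hp0 : List.In p0 mp by rewrite Emp; left.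
(* A code lists the index of a minimal prime, the index of a root and the coefficients of a
   polynomial. An index out of range must still give a prime of [mp], whence the default [p0]. *)
pose pp (s : seq nat) := let p := List.nth (head 0%N s) mp p0 in p.
have hpp s : List.In (pp s) mp.
  rewrite /pp; case: (ltnP (head 0%N s) (List.length mp)) => hl.
    by apply: List.nth_In; apply/ltP.
  by rewrite List.nth_overflow //; apply/leP.
pose dec n := if @unpickle (seq nat) n is Some s then s else [::].
pose P k := pp (dec k).
pose D k := nth 0 (rf (P k, drop 2 (dec k))) (nth 0%N (dec k) 1).
have [k|y hy1 hy2] := @baire T M hcl J P D t hJ.
  by have [g1 g2] := hmp (hpp (dec k)); split => //; apply: hJp; exact: hpp.
exists (adjoin A (t + y)), (t + y); split; [| exact: adjoin_sub | exact: adjoin_mem | by rewrite addrAC subrr add0r].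
apply: good_adjoin => // p q hp hq hpq; have [s es] := pover_enum he hq.
suff -> : q = 0 by rewrite horner0.
apply/polyP => k; rewrite coef0; apply: (h3 p) => //; apply: contrapT => hk.
have hr : exists k, ~ p (Poly (map e s))`_k by exists k; rewrite -es.
have hu : p (Poly (map e s)).[t + y] by rewrite -es.
have [d hd1 hd2] := hrf (p, s) hp hr (t + y) hu.
have [i [hi hi']] := List.In_nth mp p p0 hp.
have [j hj hj'] := nthP 0 hd1.
apply: (hy2 (pickle [:: i, j & s])).
have ed : dec (pickle [:: i, j & s]) = [:: i, j & s] by rewrite /dec pickleK.
have eP : P (pickle [:: i, j & s]) = p by rewrite /P ed /pp /= hi'.
by rewrite /D eP ed /= drop0 hj'.
Qed.

Lemma regular_elt A x t : good A -> A x -> x <> 0 -> x * t = 0 -> t = 0.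
Proof.
move=> [_ _ h3] hx x0 e; apply: hred => p hp; have [hpp _] := hmp hp.
have : p (x * t) by rewrite e; exact: isid0 (prime_id hpp).
by case/(primeM hpp) => // h; case: x0; exact: (h3 p).
Qed.

(** If q.[t] lies in a minimal prime, so does its multiple by a power of [x], which is in [A] and
    hence zero; [x] is a nonzerodivisor. *)
Lemma adjoin2 A x t : good A -> A x -> x <> 0 -> A (x * t) -> exists A', [/\ good A', A `<=` A' & A' t].
Proof.
move=> hA hx x0 hxt; have [h1 h2 h3] := hA; have [_ _ hMM] := h1.
exists (adjoin A t); split; [| exact: adjoin_sub | exact: adjoin_mem].
apply: good_adjoin => // p q hp hq hpq.
have hX z n : A z -> A (z ^+ n).
  by move=> hz; elim: n => [|n IH]; [case: h1 | rewrite exprS; exact: hMM].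
have e n : (n <= size q)%N -> A (x ^+ n * \sum_(i < n) q`_i * t ^+ i).
  move=> _; rewrite mulr_sumr; apply: subring_sum => // i _.
  rewrite (_ : x ^+ n * (q`_i * t ^+ i) = q`_i * x ^+ (n - i) * (x * t) ^+ i).
    by apply: (hMM); [apply: (hMM); [exact: hq | exact: hX] | exact: hX].
  by rewrite exprMn -{1}(subnK (ltnW (ltn_ord i))) exprD; ring.
have {}e : A (x ^+ size q * q.[t]) by rewrite horner_coef; exact: e.
have e0 : x ^+ size q * q.[t] = 0.
  by apply: (h3 p) => //; apply: isidM => //; exact: prime_id (proj1 (hmp hp)).
case: (pselect (x ^+ size q = 0)) => xn0.
  case: x0; apply: hred => p' hp'; have [hpp _] := hmp hp'; apply: (primeX (n := size q)) => //.
  by rewrite xn0; exact: isid0 (prime_id hpp).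
apply: (regular_elt (x := x ^+ size q) hA) => //; exact: hX.
Qed.

Lemma gen_zero (A : set T) s : A 0 -> gen A (@zid T) s 0.
Proof. by move=> h0; elim: s => [|z s IH] //=; exists 0 => //; rewrite mul0r subr0. Qed.

(* After Heitmann: a relation with coefficients in T is moved into a larger subring,
   one coefficient at a time, by adding to it a multiple of another entry of s. *)
Lemma adjoin_rel A s c : good A -> (forall x, x \in s -> A x) -> A c -> spn (@zid T) s c ->
  exists A', [/\ good A', A `<=` A' & gen A' (@zid T) s c].
Proof.
elim: s A c => [|x s IH] A c hA hs hAc /=; first by exists A; split.
move=> [t _ ht]; have hx : A x by apply: hs; rewrite mem_head.
have hs' y : y \in s -> A y by move=> hy; apply: hs; rewrite inE hy orbT.
have [h1 _ _] := hA; have [h11 hB hMM] := h1.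
have [hall|hno] := pselect (forall z, z \in s -> z = 0).
  have e0 y : spn (@zid T) s y -> y = 0.
    by apply: (spn_min (I := @zid T)) => // [|z /hall]; exact: zid_id.
  have ec := subr0_eq (e0 _ ht).
  have [x0|x0] := pselect (x = 0).
    exists A; split=> //; exists 0; first exact: subring0.
    by rewrite mul0r subr0 ec x0 mulr0; apply: gen_zero; exact: subring0.
  have [|A' [g1 g2 g3]] := adjoin2 (x := x) (t := t) hA hx x0; first by rewrite mulrC -ec.
  exists A'; split=> //; exists t => //; rewrite ec subrr.
  by case: g1 => h _ _; apply: gen_zero; exact: subring0.
have [z hz z0] : exists2 z, z \in s & z <> 0.
  by apply: contrapT => hno'; apply: hno => z hz; apply: contrapT => z0; apply: hno'; exists z.
have hJ : offmin (spn (@zid T) [:: z]).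
  split; first by apply: gen_id; [exact: setT_id | exact: zid_id].
  move=> p hp hsub; apply: z0; have [_ _ h3] := hA; apply: (h3 p) => //; first exact: hs'.
  by apply: hsub; apply: spn_mem; [exact: zid_id | rewrite inE].
have [A1 [u [g1 g2 g3 [w _ /= hw]]]] := adjoin1 t hA hJ.
have hspn : isid (spn (@zid T) s) by apply: gen_id; [exact: setT_id | exact: zid_id].
have [h1' _ _] := g1; have [_ hB' hMM'] := h1'.
have [|||A' [g4 g5 g6]] := IH A1 (c - u * x) g1.
- by move=> y /hs'/g2.
- by apply: hB'; [exact: g2 | apply: hMM' => //; exact: g2].
- rewrite (_ : _ - _ = (c - t * x) - (x * w) * z).
    apply: isidB => //; apply: isidM => //; apply: spn_mem => //; exact: zid_id.
  by rewrite (subr0_eq (_ : u - (t + w * z) = 0)); [ring | rewrite -hw; ring].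
exists A'; split=> //; first by move=> y /g2/g5.
by exists u => //; exact: g5.
Qed.

Lemma good_union (B : nat -> set T) : (forall k, good (B k)) -> (forall k, B k `<=` B k.+1) ->
  good [set x | exists k, B k x].
Proof.
move=> hB hS; have hm k l : (k <= l)%N -> B k `<=` B l.
  elim: l => [|l IH]; first by rewrite leqn0 => /eqP->.
  by rewrite leq_eqVlt => /orP[/eqP->//|/IH h] x /h/hS.
split; last by move=> p x hp [k hk]; have [_ _ h3] := hB k; exact: (h3 p).
  split; first by exists 0%N; have [[]] := hB 0%N.
    move=> x y [k hk] [l hl]; exists (maxn k l); have [[_ h _] _ _] := hB (maxn k l).
    by apply: h; [apply: hm hk; exact: leq_maxl | apply: hm hl; exact: leq_maxr].
  move=> x y [k hk] [l hl]; exists (maxn k l); have [[_ _ h] _ _] := hB (maxn k l).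
  by apply: h; [apply: hm hk; exact: leq_maxl | apply: hm hl; exact: leq_maxr].
by apply: enumerable_bigcup => k; case: (hB k).
Qed.

Variable Req : seq T -> list (T * set T).
Hypothesis hReq : forall s gJ, List.In gJ (Req s) -> offmin gJ.2.

(** The two kinds of tasks: making a linear equation that is solvable in T solvable over the ring,
    and meeting the j-th coset requested by [s]. *)
Definition task (A : set T) (c : T) (s : seq T) (j : nat) (A' : set T) := (forall x, x \in s -> A x) ->
  (A c -> spn (@zid T) s c -> gen A' (@zid T) s c) /\
  (forall gJ, List.nth_error (Req s) j = Some gJ -> exists2 u, A' u & gJ.2 (u - gJ.1)).

Lemma task_solve A c s j : good A -> exists A', [/\ good A', A `<=` A' & task A c s j A'].
Proof.
move=> hA; have [hs|hns] := pselect (forall x, x \in s -> A x); last by exists A; split=> // h; case: hns.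
have [A1 [g1 g2 g3]] : exists A', [/\ good A', A `<=` A' & A c -> spn (@zid T) s c -> gen A' (@zid T) s c].
  have [h|h] := pselect (A c /\ spn (@zid T) s c); last by exists A; split=> // h1 h2; case: h.
  by have [A' [g1 g2 g3]] := adjoin_rel hA hs (proj1 h) (proj2 h); exists A'.
case E : (List.nth_error (Req s) j) => [gJ|]; last by exists A1; split=> // _; split=> //; rewrite E.
have hJ : offmin gJ.2 by apply: (hReq (s := s)); exact: List.nth_error_In E.
have [A2 [u [g4 g5 g6 g7]]] := adjoin1 gJ.1 g1 hJ.
exists A2; split=> //; first by move=> x /g2/g5.
move=> _; split; last by move=> gJ'; rewrite E => -[<-]; exists u.
by move=> h1 h2; apply: gen_mono (g3 h1 h2).
Qed.

Lemma gen_sub_mono (A A' : set T) s c : A `<=` A' -> gen A (@zid T) s c -> gen A' (@zid T) s c.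
Proof. by move=> h; exact: gen_mono. Qed.

Lemma close1 A : good A -> exists A', [/\ good A', A `<=` A' & forall c s j, A c -> task A c s j A'].
Proof.
move=> hA; have [hr [e he] _] := hA.
pose dec n := if @unpickle (nat * seq nat * nat)%type n is Some s then s else (0%N, [::], 0%N).
have /choice[f hf] : forall nB : nat * set T, exists B', good nB.2 -> [/\ good B', nB.2 `<=` B' &
    task nB.2 (e (dec nB.1).1.1) (map e (dec nB.1).1.2) (dec nB.1).2 B'].
  move=> [n B] /=; have [hB|hno] := pselect (good B); last by exists B.
  by have [B' h] := task_solve (e (dec n).1.1) (map e (dec n).1.2) (dec n).2 hB; exists B'.
pose B := fix B n := if n is k.+1 then f (k, B k) else A.
have hB n : good (B n) by elim: n => //= n IH; have [] := hf (n, B n) IH.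
have hBS n : B n `<=` B n.+1 by have [_ h _] := hf (n, B n) (hB n).
have hAB n : A `<=` B n by elim: n => // n IH x /IH/hBS.
exists [set x | exists n, B n x]; split; [exact: good_union | by move=> x hx; exists 0%N |].
move=> c s j hc hs; have [k ek] := he c hc.
have /choice[g hg] : forall i, exists n, (i < size s)%N -> e n = s`_i.
  move=> i; case: (ltnP i (size s)) => hi; last by exists 0%N.
  by have [n hn] := he _ (hs _ (mem_nth 0 hi)); exists n.
pose n := pickle (k, mkseq g (size s), j).
have es : map e (mkseq g (size s)) = s.
  apply: (@eq_from_nth _ 0); first by rewrite size_map size_mkseq.
  move=> i; rewrite size_map size_mkseq => hi; by rewrite (nth_map 0%N) ?size_mkseq // nth_mkseq // hg.
have [_ _] := hf (n, B n) (hB n); rewrite /= /dec pickleK /= es ek => h.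
have [|h1 h2] := h; first by move=> x /hs/hAB.
split; last by move=> gJ /h2[u hu hu']; exists u => //; exists n.+1.
by move=> h3 h4; apply: gen_sub_mono (h1 (hAB _ _ h3) h4) => x hx; exists n.+1.
Qed.

(* Req s lists cosets g + J that A has to meet as soon as it contains s. *)
Theorem construct : exists A, [/\ subr_closed A, enumerable A, forall p x, List.In p mp -> A x -> p x -> x = 0,
  forall s c, (forall x, x \in s -> A x) -> A c -> spn (@zid T) s c -> gen A (@zid T) s c &
  forall s gJ, (forall x, x \in s -> A x) -> List.In gJ (Req s) -> exists2 u, A u & gJ.2 (u - gJ.1)].
Proof.
have [A0 hA0] : exists A, good A.
  exists [set x | exists z : int, x = z%:~R]; split.
  - split; first by exists 1.
      by move=> _ _ [z ->] [w ->]; exists (z - w); rewrite rmorphB.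
    by move=> _ _ [z ->] [w ->]; exists (z * w); rewrite rmorphM.
  - exists (fun n => if @unpickle int n is Some z then z%:~R else 0) => _ [z ->].
    by exists (pickle z); rewrite pickleK.
  - move=> p _ hp [z ->] hz; have [hpp _] := hmp hp; have hpM := complete_local_prime_sub hcl hpp.
    case: z hz => [[|n]|n] // h; first by case: (hch (n := n)); apply: hpM; rewrite -pmulrn in h.
    case: (hch (n := n)); apply: hpM; rewrite NegzE mulrNz in h.
    by have := isidN (prime_id hpp) h; rewrite opprK -pmulrn.
have /choice[f hf] : forall B, exists B', good B -> [/\ good B', B `<=` B' & forall c s j, B c -> task B c s j B'].
  move=> B; have [hB|hno] := pselect (good B); last by exists B.
  by have [B' h] := close1 hB; exists B'.
(* One application of [close1] treats only tasks with data in the ring it starts from; countably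
   many applications treat those of the union. *)
pose B n := iter n f A0.
have hB n : good (B n) by elim: n => //= n IH; have [] := hf (B n) IH.
have hBS n : B n `<=` B n.+1 by have [_ h _] := hf (B n) (hB n).
have hm k l : (k <= l)%N -> B k `<=` B l.
  elim: l => [|l IH]; first by rewrite leqn0 => /eqP->.
  by rewrite leq_eqVlt => /orP[/eqP->//|/IH h] x /h/hBS.
have [h1 h2 h3] := good_union hB hBS.
have hfin (s : seq T) : (forall x, x \in s -> exists k, B k x) -> exists k, forall x, x \in s -> B k x.
  elim: s => [|x s IH] hs; first by exists 0%N.
  have [k hk] := hs x (mem_head _ _); have [|l hl] := IH; first by move=> y hy; apply: hs; rewrite inE hy orbT.
  exists (maxn k l) => y; rewrite inE => /predU1P[->|/hl h]; [apply: hm hk; exact: leq_maxl | apply: hm h; exact: leq_maxr].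
exists [set x | exists k, B k x]; split=> //.
  move=> s c hs hc hsp; have [|k hk] := hfin (c :: s).
    by move=> x; rewrite inE => /predU1P[->|/hs].
  have [_ _ h] := hf (B k) (hB k).
  have [|g _] := h c s 0%N (hk _ (mem_head _ _)); first by move=> x hx; apply: hk; rewrite inE hx orbT.
  apply: gen_sub_mono (g (hk _ (mem_head _ _)) hsp) => x hx; by exists k.+1.
move=> s gJ hs hin; have [k hk] := hfin s hs.
have [j hj] := List.In_nth_error _ _ hin.
have [_ _ h] := hf (B k) (hB k).
have h1B : B k 1 by have [[]] := hB k.
have [//|_ g] := h 1 s j h1B.
by have [u hu hu'] := g _ hj; exists u => //; exists k.+1.
Qed.
End Construct.

(** * Subrings of a complete local ring with that ring as completion *)

Section SubRing.
Variables (T : comNzRingType) (A : set T).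
Definition subring_of of subr_closed A : Type := {x : T | A x}.
Hypothesis hA : subr_closed A.
Local Notation R := (subring_of hA).
HB.instance Definition _ := gen_eqMixin R.
HB.instance Definition _ := gen_choiceMixin R.
Let hB x y : A x -> A y -> A (x - y). Proof. by case: hA => _ h _; exact: h. Qed.
Let hMM x y : A x -> A y -> A (x * y). Proof. by case: hA => _ _ h; exact: h. Qed.
Let h1 : A 1. Proof. by case: hA. Qed.
Let val_inj' (x y : R) : sval x = sval y -> x = y.
Proof. by case: x y => [x hx] [y hy] /= e; subst y; congr exist; exact: Prop_irrelevance. Qed.
Definition sr_zero : R := exist A 0 (subring0 hA).
Definition sr_one : R := exist A 1 h1.
Definition sr_add (x y : R) : R := exist A (sval x + sval y) (subringD hA (svalP x) (svalP y)).
Definition sr_opp (x : R) : R := exist A (0 - sval x) (hB (subring0 hA) (svalP x)).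
Definition sr_mul (x y : R) : R := exist A (sval x * sval y) (hMM (svalP x) (svalP y)).
Lemma sr_addA : associative sr_add. Proof. by move=> x y z; apply: val_inj'; rewrite /= addrA. Qed.
Lemma sr_addC : commutative sr_add. Proof. by move=> x y; apply: val_inj'; rewrite /= addrC. Qed.
Lemma sr_add0 : left_id sr_zero sr_add. Proof. by move=> x; apply: val_inj'; rewrite /= add0r. Qed.
Lemma sr_addN : left_inverse sr_zero sr_opp sr_add. Proof. by move=> x; apply: val_inj'; rewrite /= sub0r addNr. Qed.
HB.instance Definition _ := GRing.isZmodule.Build R sr_addA sr_addC sr_add0 sr_addN.
Lemma sr_mulA : associative sr_mul. Proof. by move=> x y z; apply: val_inj'; rewrite /= mulrA. Qed.
Lemma sr_mulC : commutative sr_mul. Proof. by move=> x y; apply: val_inj'; rewrite /= mulrC. Qed.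
Lemma sr_mul1 : left_id sr_one sr_mul. Proof. by move=> x; apply: val_inj'; rewrite /= mul1r. Qed.
Lemma sr_mulD : left_distributive sr_mul sr_add. Proof. by move=> x y z; apply: val_inj'; rewrite /= mulrDl. Qed.
Lemma sr_one_neq0 : sr_one != 0. Proof. by apply/eqP => /(congr1 sval) /= /eqP; rewrite oner_eq0. Qed.
HB.instance Definition _ := GRing.Zmodule_isComNzRing.Build R sr_mulA sr_mulC sr_mul1 sr_mulD sr_one_neq0.

Lemma subring_exists : exists (B : comNzRingType) (phi : {rmorphism B -> T}), injective phi /\ forall y, A y <-> exists x, phi x = y.
Proof.
have [phi hphi] : exists phi : {rmorphism R -> T}, forall x, phi x = sval x by apply: rmorph_exists.
exists R, phi; split; first by move=> x y; rewrite !hphi; exact: val_inj'.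
move=> y; split=> [hy|[x <-]]; last by rewrite hphi; exact: svalP.
by exists (exist A y hy); rewrite hphi.
Qed.
End SubRing.

Section Dense.
Variables (A T : comNzRingType) (phi : {rmorphism A -> T}) (M : set T).
Hypotheses (hcl : complete_local M) (hrel : forall s c, spn (@zid T) (map phi s) (phi c) -> spn (@zid A) s c).
Let N := contr phi M.
Let hT : noeth T. Proof. by case: hcl. Qed.
Let hM : isid M. Proof. by case: hcl. Qed.
Let hN : isid N. Proof. exact: contr_id. Qed.

Lemma ext_fin J x : ext phi J x -> exists s, (forall a, a \in s -> J a) /\ spn (@zid T) (map phi s) x.
Proof.
move=> [k [c [e [he ->]]]]; have /choice[j hj] : forall i, exists a, J a /\ phi a = e i.
  by move=> i; have [a h1 h2] := he i; exists a.
exists (codom j); split; first by move=> _ /codomP[i ->]; case: (hj i).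
have hid : isid (spn (@zid T) (map phi (codom j))) by apply: gen_id; [exact: setT_id | exact: zid_id].
apply: isid_sum => // i _; apply: isidM => //; apply: spn_mem; first exact: zid_id.
by have [_ <-] := hj i; rewrite map_f // codom_f.
Qed.

(** Closure under linear equations turns a membership in JT into one in [J]. *)
Lemma contr_ext J : isid J -> contr phi (ext phi J) = J.
Proof.
move=> hJ; apply: seteqI => x; last exact: ext_in.
by move=> /ext_fin[s [h1 h2]]; apply: (spn_min hJ (zid_sub hJ) h1); exact: hrel.
Qed.

(** Finitely many elements of [J] already generate JT, hence [J] by closure under linear
    equations. *)
Lemma dense_noeth : noeth A.
Proof.
move=> J hJ; have [t ht] := hT (ext_id phi J).
have [s [h1 h2]] : exists s, (forall a, a \in s -> J a) /\ forall x, x \in t -> spn (@zid T) (map phi s) x.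
  have : forall x, x \in t -> ext phi J x.
    by move=> x hx; rewrite ht; apply: spn_mem => //; exact: zid_id.
  elim: t {ht} => [|x t IH] hx; first by exists [::].
  have [s1 [h1 h2]] := ext_fin (hx x (mem_head _ _)).
  have [|s2 [h3 h4]] := IH; first by move=> y hy; apply: hx; rewrite inE hy orbT.
  exists (s1 ++ s2); split; first by move=> a; rewrite mem_cat => /orP[/h1|/h3].
  move=> y; rewrite inE => /predU1P[->|/h4 h]; [apply: spn_sub h2 | apply: spn_sub h]; try exact: zid_id.
    by move=> z; rewrite map_cat mem_cat => ->.
  by move=> z; rewrite map_cat mem_cat orbC => ->.
exists s; apply: noeth_spn => // x hx; apply: hrel.
have : ext phi J (phi x) by exact: ext_in.
have hid : isid (spn (@zid T) (map phi s)) by apply: gen_id; [exact: setT_id | exact: zid_id].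
by rewrite ht; apply: spn_min => // y ->; exact: isid0.
Qed.

(** The inverse in T solves a linear equation over A. *)
Lemma dense_unit x : ~ N x -> exists y, y * x = 1.
Proof.
move=> hx; have [_ _ hu _ _] := hcl; have [y hy] := hu _ hx.
have [|y' _ /= h] := @hrel [:: x] 1; first by exists y => //=; rewrite rmorph1 hy; exact: subrr.
by exists y'; symmetry; apply: subr0_eq.
Qed.

Lemma dense_local J : isid J -> ~ J 1 -> J `<=` N.
Proof.
move=> hJ h1 x hx; apply: contrapT => /dense_unit[y hy]; apply: h1; rewrite -hy; exact: isidM.
Qed.

Lemma ext_max g : M = spn (@zid T) (map phi g) -> M `<=` ext phi N.
Proof.
move=> hg; rewrite {1}hg; apply: spn_min; [exact: ext_id | exact: zid_sub (ext_id _ _) |].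
move=> _ /mapP[a ha ->]; apply: ext_in; rewrite /N /contr /= hg.
by apply: spn_mem; [exact: zid_id | exact: map_f].
Qed.

Lemma pw_ext k : M `<=` ext phi N -> pw M k `<=` ext phi (pw N k).
Proof.
move=> hMN; have hid k' : isid (ext phi (pw N k')) by exact: ext_id.
elim: k => [|k IH]; first by move=> x _; rewrite -(mulr1 x) -(rmorph1 phi); apply: isidM => //; exact: ext_in.
apply: pwS_min => // x y hx /IH hy.
move: x {hx}(hMN _ hx); apply: (ext_min (Q := [set x | ext phi (pw N k.+1) (x * y)])).
  split=> [|u v hu hv|a u hu] /=; first by rewrite mul0r; exact: isid0.
    by rewrite mulrDl; exact: isidD.
  by rewrite -mulrA; exact: isidM.
move=> a hNa /=.
move: y hy; apply: (ext_min (Q := [set y | ext phi (pw N k.+1) (phi a * y)])).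
  split=> [|u v hu hv|b u hu] /=; first by rewrite mulr0; exact: isid0.
    by rewrite mulrDr; exact: isidD.
  by rewrite mulrCA; exact: isidM.
by move=> b hb /=; rewrite -rmorphM; apply: ext_in; exact: pwS.
Qed.

Lemma ext_pw k : ext phi (pw N k) `<=` pw M k.
Proof.
apply: ext_min; first exact: pw_id.
elim: k => // k IH x; move: x; apply: (pwS_min (J := contr phi (pw M k.+1))); first exact: contr_id (pw_id _ _).
by move=> x y hx hy; rewrite /contr /= rmorphM; apply: pwS => //; exact: IH.
Qed.

Hypothesis hMN : M `<=` ext phi N.

Lemma dense_pw k x : pw N k x <-> pw M k (phi x).
Proof.
split=> h; first by apply: ext_pw; exact: ext_in.
by rewrite -(contr_ext (pw_id N k)); exact: pw_ext.
Qed.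

Hypothesis hres : forall t, exists a, M (t - phi a).

Lemma dense_approx k t : exists a, pw M k (t - phi a).
Proof.
elim: k t => [|k IH] t; first by exists 0.
have [a ha] := IH t.
suff [b hb] : exists b, pw M k.+1 (t - phi a - phi b) by exists (a + b); rewrite rmorphD opprD addrA.
suff [//] : pw M k (t - phi a) /\ exists b, pw M k.+1 (t - phi a - phi b).
have := pw_ext hMN ha; move: (t - phi a); apply: (ext_min (Q := [set z | pw M k z /\ exists b, pw M k.+1 (z - phi b)])).
  split.
  - split; first exact: isid0 (pw_id _ _).
    by exists 0; rewrite rmorph0 subr0; exact: isid0 (pw_id _ _).
  - move=> x y [x1 [b hb]] [y1 [c hc]]; split; first exact: isidD (pw_id _ _) _ _.
    by exists (b + c); rewrite rmorphD opprD addrACA; exact: isidD (pw_id _ _) _ _.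
  - move=> d x [x1 [b hb]]; split; first exact: isidM (pw_id _ _) _.
    have [d' hd'] := hres d; exists (d' * b); rewrite rmorphM.
    rewrite (_ : _ - _ = (d - phi d') * x + phi d' * (x - phi b)); last by ring.
    by apply: isidD; [exact: pw_id | exact: pwS | apply: isidM => //; exact: pw_id].
move=> b hb; split; first exact: (proj1 (dense_pw k b)).
by exists b; rewrite subrr; exact: isid0 (pw_id _ _).
Qed.

Lemma dense_ffl : faithfully_flat phi.
Proof.
apply: (completion_ffl dense_noeth hN hcl dense_pw dense_approx); exact: dense_local.
Qed.
End Dense.

(** At a minimal prime every element is nilpotent up to a factor outside the prime, hence zero
    there, as T is reduced. *)
Lemma reg_minimal (T : comNzRingType) (Q : set T) : noeth T -> (forall (x : T) n, x ^+ n = 0 -> x = 0) -> minimal_over (@zid T) Q ->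
  reg (@zid T) Q 0.
Proof.
move=> hT hred [hQ h0 hmin]; split; first by split.
exists [::]; split=> // x hx /=; apply: contrapT => hno.
have [|||P hP [h1 h2]] := @prime_avoid_mult T (@zid T) [set z | exists u n, ~ Q u /\ z = u * x ^+ n] hT (@zid_id T).
- by exists 1, 0%N; rewrite mulr1; split=> //; exact: prime1.
- move=> _ _ [u [k [hu ->]]] [v [l [hv ->]]]; exists (u * v), (k + l)%N; split; first exact: primeNM.
  by rewrite exprD; ring.
- move=> _ [u [k [hu ->]]] h; apply: hno; exists u => //.
  apply: (hred _ k.+1); rewrite (_ : _ ^+ _ = (u * x ^+ k) * (u ^+ k * x)); first by rewrite h mul0r.
  by rewrite exprMn !exprS; ring.
have hPQ : P `<=` Q by move=> y hy; apply: contrapT => hn; apply: (h2 y) => //; exists y, 0%N; rewrite mulr1.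
apply: (h2 x); last exact: (hmin P hP (fun y hy => h1 y hy) hPQ _ hx).
by exists 1, 1%N; rewrite mul1r; split=> //; exact: prime1.
Qed.

(* A is a countable domain with completion T and regular formal fibres. *)
Record dense_model (A T : comNzRingType) (phi : {rmorphism A -> T}) (M : set T) : Prop := DenseModel {
  dm_inj : injective phi;
  dm_dom : isprime (@zid A);
  dm_cnt : enumerable (@setT A);
  dm_rel : forall s c, spn (@zid T) (map phi s) (phi c) -> spn (@zid A) s c;
  dm_max : exists g, M = spn (@zid T) (map phi g);
  dm_res : forall t, exists a, M (t - phi a);
  dm_reg : forall Q, isprime Q -> exists n, reg (ext phi (contr phi Q)) Q n }.

Definition sing (T : comNzRingType) (J : set T) : set T :=
  [set a | forall Q, isprime Q -> J `<=` Q -> ~ (exists n, reg J Q n) -> Q a].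

Lemma sing_id (T : comNzRingType) (J : set T) : isid (sing J).
Proof.
split=> [Q hQ _ _|x y hx hy Q hQ h1 h2|a x hx Q hQ h1 h2]; have hQi := prime_id hQ; first exact: isid0.
  by apply: isidD => //; [exact: hx | exact: hy].
by apply: isidM => //; exact: hx.
Qed.

(** Openness of the regular locus makes [sing J] a defining ideal of the singular locus: a regular
    prime does not contain it. *)
Lemma sing_open (S T : comNzRingType) (E : {rmorphism S -> T}) (J Q : set T) d :
  noeth S -> char0u S -> Jprop S -> (forall y, exists x, E x = y) -> isid J -> reg J Q d ->
  exists2 w, sing J w & ~ Q w.
Proof.
move=> hS hc hj hs hJ hreg; have hQ := reg_prime hreg.
have [w [hw hw']] := reg_open hS hc hj (contr_id E hJ) (proj2 (reg_surj hs d hJ hQ) hreg).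
exists (E w) => // Q' hQ' hJQ' hbad; apply: contrapT => hn; apply: hbad.
have [n hn'] := hw' _ (contr_prime E hQ') (fun x hx => hJQ' _ hx) hn.
by exists n; exact/(reg_surj hs n hJ hQ').
Qed.

Section Model.
Variables (T : comNzRingType) (M : set T) (mp Sp : list (set T)) (rho : nat -> T).
Hypotheses (hcl : complete_local M) (hch : forall n, ~ M n.+1%:R) (hred : forall (x : T) n, x ^+ n = 0 -> x = 0).
Hypothesis (hrho : forall t, exists n, M (t - rho n)).
Hypotheses (hmp1 : forall p, List.In p mp -> minimal_over (@zid T) p)
  (hmp2 : forall P, isprime P -> exists2 p, List.In p mp & p `<=` P) (hMp : forall p, List.In p mp -> ~ (M `<=` p)).
Hypothesis hSp : forall Q, List.In Q Sp -> isprime Q.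
Let hT : noeth T. Proof. by case: hcl. Qed.
Let hM : isid M. Proof. by case: hcl. Qed.

Lemma mp_red x : (forall p, List.In p mp -> p x) -> x = 0.
Proof.
move=> hx; apply: contrapT => x0.
have [|||P hP [h1 h2]] := @prime_avoid_mult T (@zid T) [set z | exists n, z = x ^+ n] hT (@zid_id T).
- by exists 0%N.
- by move=> _ _ [k ->] [l ->]; exists (k + l)%N; rewrite exprD.
- by move=> _ [k ->] /hred.
have [p hp hpP] := hmp2 hP; apply: (h2 x); first by exists 1%N.
by apply: hpP; exact: hx.
Qed.

(* Elements congruent modulo M Q to generators of Q still generate Q, by Nakayama's lemma. *)
Definition MQ (Q : set T) : set T := ideal_gen (prods M Q).
Lemma sing_prime (J Q : set T) d : isid J -> minimal_over (sing J) Q -> ~ reg J Q d.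
Proof.
move=> hJ [_ hs _] hreg; have [S [eps [hS hSc hSJ hsurj]]] := complete_local_cover hcl hch.
by have [w /hs hw] := sing_open hS hSc hSJ hsurj hJ hreg; apply.
Qed.

Lemma mq_gens Q gs u : isprime Q -> Q = spn (@zid T) gs -> (forall a, a \in u -> Q a) ->
  (forall g, g \in gs -> exists2 v, v \in u & MQ Q (v - g)) -> Q = spn (@zid T) u.
Proof.
move=> hQ hgs hu hg; have hQi := prime_id hQ; apply: (noeth_spn hQi hu).
have hMpr := complete_local_prime hcl.
have hid : isid (spn (@zid T) u) by apply: gen_id; [exact: setT_id | exact: zid_id].
have h : Q `<=` sat M (spn (@zid T) u).
  apply: nakayama_sub => //.
  have hid2 := ideal_gen_id (spn (@zid T) u `|` prods M Q).
  rewrite {1}hgs; apply: spn_min; first exact: sat_id.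
    by move=> x ->; exact: isid0 (sat_id hMpr hid2).
  move=> g /hg[v hv hvg]; apply: sat_sub => //.
  rewrite -(subKr v g); apply: isidB => //.
    by apply: ideal_gen_sub; left; apply: spn_mem => //; exact: zid_id.
  by move: hvg; apply: ideal_gen_min => // x hx; apply: ideal_gen_sub; right.
move=> x /h[w hw hwx]; have [_ _ hun _ _] := hcl; have [y hy] := hun _ hw.
by rewrite -(mul1r x) -hy -mulrA; exact: isidM.
Qed.

Definition offp (Q : set T) := isprime Q /\ forall p, List.In p mp -> ~ (Q `<=` p).

Lemma MQ_off Q : offp Q -> offmin mp (MQ Q).
Proof.
move=> [hQ hoff]; split; first exact: ideal_gen_id.
move=> p hp hsub; have [hpp _ _] := hmp1 hp.
have hne (J : set T) : ~ (J `<=` p) -> exists2 x, J x & ~ p x.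
  by move=> h; apply: contrapT => hno; apply: h => x hx; apply: contrapT => hn; apply: hno; exists x.
have [a ha1 ha2] := hne _ (hMp hp); have [b hb1 hb2] := hne _ (hoff _ hp).
apply: (primeNM hpp ha2 hb2); apply: hsub; apply: ideal_gen_sub; exists a, b; split=> //.
Qed.

Theorem model_exists : exists (A : comNzRingType) (phi : {rmorphism A -> T}), dense_model phi M /\
  forall Q, List.In Q Sp -> (forall p, List.In p mp -> ~ (Q `<=` p)) -> exists u, Q = spn (@zid T) (map phi u).
Proof.
have /choice[gens hgens] : forall Q, exists g, isid Q -> Q = spn (@zid T) g.
  by move=> Q; have [/hT[g hg]|h] := pselect (isid Q); [exists g | exists [::]].
have /choice[sp hsp] : forall s, exists ps : list (set T), (forall p, List.In p ps -> minimal_over (sing (spn (@zid T) s)) p) /\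
    forall P, isprime P -> sing (spn (@zid T) s) `<=` P -> exists2 p, List.In p ps & p `<=` P.
  by move=> s; have [ps h1 h2] := minprimes hT (sing_id (spn (@zid T) s)); exists ps.
have hMoff : offp M by split; [exact: complete_local_prime | exact: hMp].
pose Qs s := List.filter (fun Q => `[< offp Q >]) (M :: List.app Sp (sp s)).
have hQs s Q : List.In Q (Qs s) -> offp Q by move=> /List.filter_In[_ /asboolP].
(* The length of [s] serves as an index: the n-th residue class is requested by any sequence of
   length n, such as n copies of 1. *)
pose Req s := (rho (size s), M) :: List.flat_map (fun Q => List.map (fun g => (g, MQ Q)) (gens Q)) (Qs s).
have hReq s gJ : List.In gJ (Req s) -> offmin mp gJ.2.
  case=> [<-|/List.in_flat_map[Q [/hQs hQ /List.in_map_iff[g [<- _]]]]]; last exact: MQ_off.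
  by split => //; exact: hMp.
have hmp p : List.In p mp -> isprime p /\ ~ (M `<=` p) by move=> hp; split; [case: (hmp1 hp) | exact: hMp].
have [A0 [a1 a2 a3 a4 a5]] := construct hcl hmp mp_red hch hReq.
have [A [phi [hinj hA]]] := subring_exists a1.
have hphi x : A0 (phi x) by apply/hA; exists x.
exists A, phi.
have hrel s c : spn (@zid T) (map phi s) (phi c) -> spn (@zid A) s c.
  move=> /a4 h.
  have {}h : gen A0 (@zid T) (map phi s) (phi c) by apply: h => // x /mapP[y _ ->].
  elim: s c h => [|x s IH] c /=; first by rewrite /zid => h; apply: hinj; rewrite h rmorph0.
  by move=> [r /hA[r' <-]]; rewrite -rmorphM -rmorphB => /IH h; exists r'.
have hlift (s : seq T) : (forall x, x \in s -> A0 x) -> exists s', map phi s' = s.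
  elim: s => [|x s IH] hs; first by exists [::].
  have /hA[y hy] := hs x (mem_head _ _); have [|s' hs'] := IH; first by move=> z hz; apply: hs; rewrite inE hz orbT.
  by exists (y :: s'); rewrite /= hy hs'.
have hgen s Q : (forall x, x \in s -> A0 x) -> List.In Q (Qs s) -> exists u, Q = spn (@zid T) (map phi u).
  move=> hs hin; have [hQ hoff] := hQs _ _ hin; have hQi := prime_id hQ.
  have hMQ : MQ Q `<=` Q by apply: ideal_gen_min => // _ [q [i [h1 h2 ->]]]; exact: isidM.
  have hg (g : T) : exists v, g \in gens Q -> A0 v /\ MQ Q (v - g).
    have [hg|hg] := boolP (g \in gens Q); last by exists 0.
    have [|v hv1 hv2] := a5 s (g, MQ Q) hs; last by exists v.
    right; apply/List.in_flat_map; exists Q; split=> //; apply/List.in_map_iff; exists g; split=> //.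
    elim: (gens Q) hg => //= x l IH; rewrite inE => /predU1P[->|/IH h]; [by left | by right].
  have {hg}[v hv] := choice hg.
  have hgQ g : g \in gens Q -> Q g by move=> hg; rewrite (hgens _ hQi); apply: spn_mem => //; exact: zid_id.
  have [|u hu] := hlift (map v (gens Q)); first by move=> _ /mapP[g /hv[h _] ->].
  exists u; rewrite hu; apply: (mq_gens hQ (hgens _ hQi)).
    move=> _ /mapP[g hg ->]; have [_ h] := hv g hg.
    by apply: (isidBr hQi (hMQ _ h)); exact: hgQ.
  by move=> g hg; exists (v g); [exact: map_f | case: (hv g hg)].
split; last first.
  move=> Q hQ hoff; apply: (hgen [::]) => //; apply/List.filter_In; split.
    by right; apply/List.in_or_app; left.
  by apply/asboolP; split=> //; exact: hSp.
have [p0 hp0 _] := hmp2 (complete_local_prime hcl).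
split=> //.
- split; [exact: zid_id | by move=> /eqP; rewrite oner_eq0 |].
  have [hp0p _] := hmp _ hp0.
  have h0 z : p0 (phi z) -> z = 0 by move=> h; apply: hinj; rewrite rmorph0; exact: (a3 p0).
  move=> x y hxy; have : p0 (phi x * phi y) by rewrite -rmorphM hxy rmorph0; exact: isid0 (prime_id hp0p).
  by case/(primeM hp0p) => /h0; [left | right].
- have [e he] := a2; exists (fun n => if pselect (exists x, phi x = e n) is left h then projT1 (cid h) else 0) => x _.
  have [n hn] := he _ (hphi x); exists n; case: pselect => [h|[]]; last by exists x.
  by apply: hinj; rewrite (projT2 (cid h)).
- by apply: (hgen [::]) => //; apply/List.filter_In; split; [left | exact/asboolP].
- move=> t; have [n hn] := hrho t.
  have [||u /hA[a ha] /= hu] := a5 (nseq n 1) (rho n, M).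
  + by move=> x /nseqP[-> _]; case: a1.
  + by left; rewrite size_nseq.
  exists a; rewrite ha (_ : _ - _ = (t - rho n) - (u - rho n)); last by ring.
  exact: isidB.
move=> Q hQ; apply: contrapT => hno.
set p := contr phi Q in hno; have hp : isprime p := contr_prime phi hQ.
have hA' := dense_noeth hcl hrel.
have [s hs] := hA' _ (prime_id hp).
have eJ : ext phi p = spn (@zid T) (map phi s).
  have hid : isid (spn (@zid T) (map phi s)) by apply: gen_id; [exact: setT_id | exact: zid_id].
  apply: seteqI.
    apply: ext_min => // x; rewrite hs => /(ext_spn phi (@zid_id A)); apply: gen_mono => //.
    by apply: ext_min; [exact: zid_id | move=> y ->; exact: rmorph0].
  apply: spn_min; [exact: ext_id | exact: zid_sub (ext_id _ _) |].
  by move=> _ /mapP[y hy ->]; apply: ext_in; rewrite hs; apply: spn_mem => //; exact: zid_id.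
set J := ext phi p in eJ hno.
have hJ : isid J by exact: ext_id.
have hJQ : J `<=` Q by apply: ext_min; [exact: prime_id | ].
have hsQ : sing J `<=` Q by move=> a; apply.
(* A bad prime is replaced by a minimal prime of the singular locus, one of the finitely many whose
   generators were requested. *)
have [Q1 hQ1 hQ1Q] : exists2 p, List.In p (sp (map phi s)) & p `<=` Q.
  by have [_] := hsp (map phi s); rewrite -eJ => h; exact: h.
have hmin : minimal_over (sing J) Q1 by rewrite eJ; case: (hsp (map phi s)) => h _; exact: h.
have [hQ1p hQ1s _] := hmin.
have hJQ1 : J `<=` Q1 by move=> x hx; apply: hQ1s => Q' _ h _; exact: h.
have hns d := sing_prime hJ hmin (d := d).
have ep : contr phi Q1 = p.
  by apply: seteqI => x; [exact: hQ1Q | move=> hx; apply: hJQ1; exact: ext_in].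
(* If [Q1] is a minimal prime of T, its contraction is 0 and the fibre at [Q1] is a localization of
   the reduced ring T at a minimal prime. *)
have [hoff|hnoff] := pselect (forall p', List.In p' mp -> ~ (Q1 `<=` p')); last first.
  have [p' hp' hQp] : exists2 p', List.In p' mp & Q1 `<=` p'.
    by apply: contrapT => h; apply: hnoff => p' h1 h2; apply: h; exists p'.
  have [hp'p _ hp'm] := hmp1 hp'.
  have eQ : Q1 = p' by apply: seteqI => //; exact: hp'm (zid_sub (prime_id hQ1p)) hQp.
  apply: (hns 0); rewrite (_ : J = @zid T); first by rewrite eQ; apply: reg_minimal => //; exact: hmp1.
  apply: seteqI; last exact: zid_sub.
  apply: ext_min; first exact: zid_id.
  by move=> a; rewrite -ep eQ => ha; exact: (a3 p').
have [||u hu] := hgen (map phi s) Q1.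
- by move=> x /mapP[y _ ->].
- apply/List.filter_In; split; [by right; apply/List.in_or_app; right | by apply/asboolP].
have hQJ : Q1 `<=` J.
  rewrite {1}hu; apply: spn_min => //; first exact: zid_sub.
  move=> _ /mapP[a ha ->]; apply: ext_in; rewrite -ep /contr /= hu; apply: spn_mem; [exact: zid_id | exact: map_f].
apply: (hns 0%N); split; first by split.
by exists [::]; split=> // x hx; apply: sat_sub => //; exact: hQJ.
Qed.
End Model.

(** * Saturated chains through a prime of height one *)

Definition sat_chain (A : comNzRingType) (N : set A) m (c : nat -> set A) :=
  [/\ forall i, isprime (c i), c 0%N = @zid A, c m = N,
      forall i, (i < m)%N -> c i `<=` c i.+1 /\ ~ (c i.+1 `<=` c i) &
      forall i p, (i < m)%N -> isprime p -> c i `<=` p -> p `<=` c i.+1 -> p `<=` c i \/ c i.+1 `<=` p].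

(** A chain of maximal length admits no refinement; the maximality passes to each lower segment. *)
Lemma height_ge_chain (A : comNzRingType) (J Q : set A) n : isprime J -> height_ge J Q n -> ~ height_ge J Q n.+1 ->
  exists c : nat -> set A, [/\ forall i, isprime (c i), c 0%N = J, c n = Q,
      forall i, (i < n)%N -> c i `<=` c i.+1 /\ ~ (c i.+1 `<=` c i) &
      forall i p, (i < n)%N -> isprime p -> c i `<=` p -> p `<=` c i.+1 -> p `<=` c i \/ c i.+1 `<=` p].
Proof.
move=> hJ; elim: n Q => [|n IH] Q.
  move=> [hQ hJQ] h1; have e : J = Q.
    apply: seteqI => //; apply: contrapT => h; apply: h1; split=> //; exists J; split=> //; split=> //.
  by exists (fun=> J); split.
move=> hh hn; have [hQ [P [h1 h2 h3]]] := hh; have hP := height_ge_prime h1.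
have [|c [c1 c2 c3 c4 c5]] := IH P h1.
  by move=> h; apply: hn; split=> //; exists P.
exists (fun i => if (i <= n)%N then c i else Q); split.
- by move=> i; case: ifP.
- by rewrite leq0n.
- by rewrite ltnn.
- move=> i hi; have := hi; rewrite {1}ltnS {1}leq_eqVlt => /orP[/eqP->|hi']; first by rewrite leqnn ltnn c3.
  by rewrite (ltnW hi') hi'; exact: c4.
- move=> i p hi hp; have := hi; rewrite {1}ltnS {1}leq_eqVlt => /orP[/eqP->|hi']; last by rewrite (ltnW hi') hi'; exact: c5.
  rewrite leqnn ltnn c3 => hPp hpQ; apply: contrapT => /not_orP[g1 g2]; apply: hn; split=> //.
  by exists p; split=> //; split=> //; exists P.
Qed.

Section ChainPrime.
Variables (T : comNzRingType) (M : set T) (mp : list (set T)).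
Hypotheses (hcl : complete_local M) (hch : forall n, ~ M n.+1%:R).
Hypotheses (hmp1 : forall p, List.In p mp -> minimal_over (@zid T) p)
  (hmp2 : forall P, isprime P -> exists2 p, List.In p mp & p `<=` P).
Let hT : noeth T. Proof. by case: hcl. Qed.
Let hM : isid M. Proof. by case: hcl. Qed.

(** [Q] is a minimal prime of P + (x). Avoiding the primes minimal over P + p, for the other minimal
    primes p, makes [P] the only minimal prime inside [Q], so that [Q] has height one; [catenary]
    gives its dimension. *)
Lemma chain_prime P m : List.In P mp -> (0 < m)%N -> height_ge P M m.+1 -> ~ height_ge P M m.+2 ->
  exists Q, [/\ isprime Q, forall p, List.In p mp -> ~ (Q `<=` p), height_ge Q M m, ~ height_ge Q M m.+1 & ~ height_ge (@zid T) Q 2].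
Proof.
move=> hPin hm hh hnh; have [hP _ hPm] := hmp1 hPin; have hPi := prime_id hP.
have hMp := complete_local_prime hcl.
pose I p := ideal_gen (P `|` p).
have /choice[mpI hmpI] : forall p, exists ps : list (set T), (forall q, List.In q ps -> minimal_over (I p) q) /\
    forall Q, isprime Q -> I p `<=` Q -> exists2 q, List.In q ps & q `<=` Q.
  by move=> p; have [ps h1 h2] := minprimes hT (ideal_gen_id (P `|` p)); exists ps.
pose L := P :: List.filter (fun q => `[< ~ (M `<=` q) >]) (List.flat_map mpI mp).
have [|x hxM hx] := @avoid T L M hM.
  move=> q [<-|/List.filter_In[/List.in_flat_map[p [_ hq]] /asboolP hn]]; split=> //.
    by move=> h; have [_ [p [h1 _ h3]]] := hh; apply: h3 => z /h; exact: height_ge_sub h1 _.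
  by have [h _] := hmpI p; case: (h _ hq).
have hxP : ~ P x by apply: hx; left.
have hJ : isid (spn P [:: x]) by apply: gen_id; [exact: setT_id | exact: hPi].
have hJM : spn P [:: x] `<=` M.
  by apply: spn_min => //; [exact: complete_local_prime_sub | move=> a; rewrite inE => /eqP->].
have [Q hQm hQM] := minprime_exists hT hJ hMp hJM; have [hQ hJQ _] := hQm.
have hxQ : Q x by apply: hJQ; apply: spn_mem => //; rewrite inE.
have hPQ : P `<=` Q by move=> z hz; apply: hJQ; exact: gen_base.
have hQP : ~ (Q `<=` P) by move=> h; exact/hxP/h.
have hadj p : isprime p -> P `<=` p -> p `<=` Q -> p `<=` P \/ Q `<=` p.
  move=> hp h1 h2; have [h|h] := pselect (Q `<=` p); first by right.
  by left; exact: (krull_pit hT hP hp hQm h1 h2 h).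
have hQh := catenary hcl hch hP hQ hPQ hQP hadj hh.
have hno p : List.In p mp -> p `<=` Q -> p `<=` P.
  move=> hp hpQ; apply: contrapT => hpP; have [g1 g2] := hmpI p.
  have [|q hq hqQ] := g2 Q hQ; first by apply: ideal_gen_min => [|z [/hPQ|/hpQ]//]; exact: prime_id.
  have [hqp hIq _] := g1 q hq.
  have hPq : P `<=` q by move=> z hz; apply: hIq; apply: ideal_gen_sub; left.
  have hpq : p `<=` q by move=> z hz; apply: hIq; apply: ideal_gen_sub; right.
  case: (hadj q hqp hPq hqQ) => [h|h]; first by apply: hpP => z /hpq/h.
  have [hMq|hMq] := pselect (M `<=` q); last first.
    apply: (hx q); last exact: h.
    right; apply/List.filter_In; split; [by apply/List.in_flat_map; exists p | exact/asboolP].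
  (* A prime minimal over P + p that contains [M] was not avoided; then [Q] would be [M], which m >
     0 excludes. *)
  case: m hm hh hnh hQh => // m _ _ _ [_ [q' [k1 _ k3]]]; apply: k3 => z /hMq/hqQ.
  exact: (height_ge_sub k1).
exists Q; split=> //.
- move=> p hp hQp; have [_ _ hpm] := hmp1 hp; apply: hQP => z hz.
  exact: (hpm P hP (zid_sub hPi) (fun y hy => hQp _ (hPQ _ hy)) _ (hQp _ hz)).
- move=> h; apply: hnh; rewrite -[m.+2]add1n; apply: height_ge_trans h.
  by split=> //; exists P; split=> //; split.
- move=> [_ [p1 [[hp1 [p0 [h1 h2 h3]]] h4 h5]]]; apply: h3.
  have hp0 : isprime p0 by case: h1.
  have [p hp hpp0] := hmp2 hp0.
  have hpP : p `<=` P by apply: hno => // z /hpp0/h2/h4.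
  have [hpp _ _] := hmp1 hp.
  have hPp := hPm p hpp (zid_sub (prime_id hpp)) hpP.
  case: (hadj p1 hp1 _ h4) => // [z /hPp/hpp0/h2 //|h z /h/hPp/hpp0 //].
Qed.
End ChainPrime.

Section ModelChain.
Variables (A T : comNzRingType) (phi : {rmorphism A -> T}) (M : set T).
Hypotheses (hcl : complete_local M) (hmod : dense_model phi M).
Let N := contr phi M.
Let hrel := dm_rel hmod.
Let hT : noeth T. Proof. by case: hcl. Qed.
Let hA : noeth A. Proof. exact: dense_noeth hcl hrel. Qed.
Lemma model_ffl : faithfully_flat phi.
Proof. by apply: (dense_ffl hcl hrel); [by have [g hg] := dm_max hmod; exact: ext_max hg | exact: dm_res hmod]. Qed.

(** Since [Q] is extended from A, parameters of A/q are parameters of T/Q, so A/q has dimension at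
    least m; lifting chains bounds that dimension and the height of q from above. *)
Lemma model_chain Q u m : isprime Q -> Q = spn (@zid T) (map phi u) -> Q <> @zid T -> (0 < m)%N -> height_ge Q M m -> ~ height_ge Q M m.+1 ->
  ~ height_ge (@zid T) Q 2 -> exists c, sat_chain N m.+1 c.
Proof.
move=> hQ hu hQ0 hm hh hnh hn2; have [hfl _] := model_ffl.
pose q := contr phi Q; have hq : isprime q := contr_prime phi hQ.
have hMp := complete_local_prime hcl; have hN : isprime N := contr_prime phi hMp.
have hQM := complete_local_prime_sub hcl hQ.
have hqN : q `<=` N by move=> x; exact: hQM.
have eQ : ext phi q = Q.
  apply: seteqI; first by apply: ext_min => //; exact: prime_id.
  rewrite {1}hu; apply: spn_min; [exact: ext_id | exact: zid_sub (ext_id _ _) |].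
  move=> _ /mapP[a ha ->]; apply: ext_in; rewrite /q /contr /= hu.
  by apply: spn_mem; [exact: zid_id | exact: map_f].
have h1 : height_ge q N m.
  case: m hm hh {hnh} => // b _ hh; apply: contrapT => hno.
  have [|k hk1 hk2] := height_ge_max (b := b) _ hno; first by split.
  have hkb : (k <= b)%N.
    by rewrite leqNgt; apply/negP => h; apply: hno; apply: height_ge_le hk1.
  have [s [hs1 hs2 hs3]] := params hA (prime_id hq) hN hqN hk2.
  suff : (b.+1 <= size (map phi s))%N by rewrite size_map ltnNge (leq_trans hs1 hkb).
  apply: (krull_height hT (prime_id hQ) _ hh); split=> //.
    apply: spn_min; [exact: prime_id | exact: hQM |].
    by move=> _ /mapP[a /hs2 ha ->].
  move=> P hP hsP hPM; have [_ _ hmin] := hs3.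
  have hNP : N `<=` contr phi P.
    apply: hmin; [exact: contr_prime | | by move=> x; exact: hPM].
    apply: spn_min; [exact: contr_id (prime_id hP) | |].
      by move=> x hx; apply: hsP; exact: gen_base.
    by move=> a ha; apply: hsP; apply: spn_mem; [exact: prime_id | exact: map_f].
  have [g hg] := dm_max hmod; rewrite hg; apply: spn_min; [exact: prime_id | exact: zid_sub (prime_id hP) |].
  move=> _ /mapP[a ha ->]; apply: hNP; rewrite /N /contr /= hg.
  by apply: spn_mem; [exact: zid_id | exact: map_f].
have h2 : ~ height_ge q N m.+1.
  by move=> h; apply: hnh; rewrite -eQ; exact: (height_ge_lift hT hfl h hMp).
have [c [c1 c2 c3 c4 c5]] := height_ge_chain hq h1 h2.
have hz : isprime (@zid A) := dm_dom hmod.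
exists (fun i => if i is k.+1 then c k else @zid A); split=> //.
- by case.
- case=> [_|i]; last exact: c4.
  rewrite c2; split; first exact: zid_sub (prime_id hq).
  move=> h; apply: hQ0; apply: seteqI; last exact: zid_sub (prime_id hQ).
  rewrite -eQ; apply: ext_min; first exact: zid_id.
  by move=> x /h ->; exact: rmorph0.
- case=> [p _ hp h3|i p]; last exact: c5.
  rewrite c2 => h4; apply: contrapT => /not_orP[h5 h6]; apply: hn2.
  have : height_ge (@zid A) q 2.
    by split=> //; exists p; split=> //; split=> //; exists (@zid A); split=> //; split.
  by move=> /(height_ge_lift hT hfl)/(_ hQ erefl); apply: height_ge_mono; exact: zid_sub (ext_id _ _).
Qed.
End ModelChain.

(** * Ideals, localizations and completions as in the definitions *)

Section IdealSets.
Variables (R : comNzRingType) (I : set R).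
Definition iset of isid I & ~ I 1 : R -> bool := fun x => `[< I x >].
Hypotheses (hI : isid I) (h1 : ~ I 1).
Lemma iset_idealr : idealr_closed (iset hI h1).
Proof.
split; first by apply/asboolP; exact: isid0.
  by apply/negP => /asboolP.
by move=> a x y /asboolP hx /asboolP hy; apply/asboolP; apply: isidD => //; exact: isidM.
Qed.
HB.instance Definition _ := isIdealr.Build R (iset hI h1) iset_idealr.
Lemma ideal_set_idealr : exists J : idealr R, forall x, x \in J <-> I x.
Proof. by exists (iset hI h1) => x; split=> [/asboolP//|h]; apply/asboolP. Qed.
End IdealSets.

Section Interface.
Variable R : comNzRingType.

Lemma noetherianP : noetherian R <-> noeth R.
Proof.
split=> [h I hI|h J].
  have [h1|h1] := pselect (I 1).
    exists [:: 1]; apply: noeth_spn => // [x|x _]; first by rewrite inE => /eqP->.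
    by rewrite -(mulr1 x); apply: isidM; [apply: gen_id; [exact: setT_id | exact: zid_id] | apply: spn_mem; [exact: zid_id | rewrite inE]].
  have [J hJ] := ideal_set_idealr hI h1; have [s hs] := h J.
  exists s; apply: seteqI => x; first by move=> /hJ /hs; rewrite ideal_gen_spn.
  by rewrite -ideal_gen_spn => /hs /hJ.
have [s hs] := h _ (idealr_isid J); exists s => x; rewrite ideal_gen_spn -hs //.
Qed.

Lemma prime_chain_hge k (c : nat -> prime_idealr R) : prime_chain k c -> height_ge [set x | x \in c 0%N] [set x | x \in c k] k.
Proof.
elim: k => [|k IH] hc; first by split=> //; exact: prime_idealr_isprime.
split; first exact: prime_idealr_isprime.
exists [set x | x \in c k]; have [h1 h2] := hc k (ltnSn k).
split; [by apply: IH => i hi; apply: hc; exact: ltnW | by move=> x; exact: h1 |].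
by move=> h; apply: h2 => x; exact: h.
Qed.

Lemma sets_prime_idealr (c : nat -> set R) : (forall i, isprime (c i)) -> exists c' : nat -> prime_idealr R, forall i x, x \in c' i <-> c i x.
Proof. by move=> h; exists (fun i => projT1 (cid (prime_set_idealr (h i)))) => i; exact: (projT2 (cid (prime_set_idealr (h i)))). Qed.

Lemma height_ge_sets (J Q : set R) k : height_ge J Q k -> exists c : nat -> set R, [/\ forall i, isprime (c i), J `<=` c 0%N, c k = Q &
  forall i, (i < k)%N -> c i `<=` c i.+1 /\ ~ (c i.+1 `<=` c i)].
Proof.
elim: k Q => [|k IH] Q; first by move=> [h1 h2]; exists (fun=> Q).
move=> [hQ [P [/IH[c [c1 c2 c3 c4]] h2 h3]]].
exists (fun i => if (i <= k)%N then c i else Q); split=> //.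
- by move=> i; case: ifP.
- by rewrite ltnn.
- move=> i hi; have := hi; rewrite {1}ltnS {1}leq_eqVlt => /orP[/eqP->|hi']; first by rewrite leqnn ltnn c3.
  by rewrite (ltnW hi') hi'; exact: c4.
Qed.

Lemma height_ge_prime_chain (J Q : set R) k : height_ge J Q k -> exists c : nat -> prime_idealr R, prime_chain k c /\ forall x, x \in c k <-> Q x.
Proof.
move=> /height_ge_sets[c [c1 c2 c3 c4]]; have [c' hc'] := sets_prime_idealr c1.
exists c'; split; last by move=> x; rewrite -c3.
move=> i /c4[h1 h2]; split; first by move=> x /hc'/h1/hc'.
by move=> h; apply: h2 => x /hc'/h/hc'.
Qed.

Lemma krull_dimP d : has_krull_dim R d <-> (exists Q, height_ge (@zid R) Q d) /\ forall Q k, height_ge (@zid R) Q k -> (k <= d)%N.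
Proof.
have hz (c : nat -> prime_idealr R) : @zid R `<=` [set x | x \in c 0%N].
  by move=> x ->; exact: idealr0.
split=> [[[c hc] h]|[[Q hQ] h]]; split.
- by exists [set x | x \in c d]; apply: height_ge_mono (prime_chain_hge hc); exact: hz.
- by move=> Q k /height_ge_prime_chain[c' [hc' _]]; exact: h hc'.
- by have [c [hc _]] := height_ge_prime_chain hQ; exists c.
- by move=> k c hc; apply: (h [set x | x \in c k]); apply: height_ge_mono (prime_chain_hge hc); exact: hz.
Qed.

Lemma local_units (M : idealr R) : local_ring M -> forall x, x \notin M -> exists y, y * x = 1.
Proof.
move=> [/noetherianP hR hM huniq] x hx; apply: contrapT => hno.
pose I := spn (@zid R) [:: x]; have hI : isid I by apply: gen_id; [exact: setT_id | exact: zid_id].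
have h1 : ~ I 1.
  by move=> [y _ /subr0_eq e]; apply: hno; exists y.
have [I1 [[hI1 hI11 hII1] hmax]] : exists I1, [/\ isid I1, ~ I1 1 & I `<=` I1] /\ forall J, [/\ isid J, ~ J 1 & I `<=` J] -> I1 `<=` J -> J `<=` I1.
  have [||I1 h2 h3] := @noeth_max R [set J | [/\ isid J, ~ J 1 & I `<=` J]] I hR; [by split | by move=> J [] |].
  by exists I1.
have [J hJ] := ideal_set_idealr hI1 hI11.
have hJmax : maximal_ideal J.
  move=> K hK; have hK1 : ~ [set z | z \in K] 1 by rewrite /= idealr1.
  have h4 : I1 `<=` [set z | z \in K] by move=> z /hJ/hK.
  move=> z hz; apply/hJ; apply: (hmax [set z | z \in K]) => //; split=> //; first exact: idealr_isid.
  by move=> y /hII1/h4.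
have hxJ : x \in J by apply/hJ; apply: hII1; apply: spn_mem; [exact: zid_id | rewrite inE].
by move: hx; rewrite -(huniq J hJmax) hxJ.
Qed.

Lemma units_local (M : idealr R) : noeth R -> (forall x, x \notin M -> exists y, y * x = 1) -> local_ring M.
Proof.
move=> hR hu; have hsub (J : idealr R) : {subset J <= M}.
  move=> x hx; apply: contrapT => /negP /hu[y hy].
  have : 1 \in J by rewrite -hy; exact: idealMr.
  by rewrite idealr1.
split; [exact/noetherianP | by move=> J _; exact: hsub |].
move=> K hK x; apply/idP/idP; first exact: hsub.
by apply: hK; exact: hsub.
Qed.

End Interface.

(* [hE1] and [hE2] say that S_q is the localization of B/J at Q, as for localizations and for the
   fibres T (x) L, which are localizations of quotients of polynomial rings over T. *)
Section Essential.
Variables (B S : comNzRingType) (th : {rmorphism B -> S}) (J : set B) (q : set S).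
Hypotheses (hJ : isid J) (hq : isprime q).
Let Q := contr th q.
Let hQ : isprime Q. Proof. exact: contr_prime. Qed.
Hypotheses (hE1 : forall z, exists w t, ~ Q w /\ th w * z = th t) (hE2 : forall t, th t = 0 -> sat Q J t)
  (hJ0 : forall t, J t -> th t = 0).

Lemma ess_lift P : isprime P -> J `<=` P -> P `<=` Q -> exists P', [/\ isprime P', P' `<=` q & contr th P' = P].
Proof.
move=> hP hJP hPQ; pose P' : set S := [set z | exists w t, [/\ ~ Q w, P t & th w * z = th t]].
have hPi := prime_id hP.
have hker t : th t = 0 -> P t.
  by move=> /hE2[u hu /hJP]; apply: primeMl => // h; apply: hu; exact: hPQ.
have hPQn w : ~ Q w -> ~ P w by move=> h h'; apply: h; exact: hPQ.
have e : contr th P' = P.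
  apply: seteqI => x; last by move=> hx; exists 1, x; rewrite rmorph1 mul1r; split=> //; exact: prime1.
  move=> [w [t [hw ht e]]]; apply: (primeMl hP (hPQn _ hw)).
  by apply: (isidBr hPi (y := t)) => //; apply: hker; rewrite rmorphB rmorphM e subrr.
exists P'; split=> //; last first.
  move=> z [w [t [hw ht e']]]; apply: (primeMl hq (u := th w)) => //.
  by rewrite e'; exact: hPQ.
split.
- split.
  + by exists 1, 0; rewrite mulr0 rmorph0; split; [exact: prime1 | exact: isid0 |].
  + move=> x y [w [t [hw ht e1]]] [w' [t' [hw' ht' e2]]].
    exists (w * w'), (w' * t + w * t'); split; [exact: primeNM | by apply: isidD => //; exact: isidM |].
    by rewrite !rmorphD !rmorphM -e1 -e2; ring.
  + move=> a x [w [t [hw ht e1]]]; have [w' [t' [hw' e2]]] := hE1 a.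
    exists (w * w'), (t' * t); split; [exact: primeNM | exact: isidM |].
    by rewrite !rmorphM -e1 -e2; ring.
- by move=> h1; apply: (prime1 hP); rewrite -e /contr /= rmorph1.
- move=> x y [w [t [hw ht e1]]]; have [w1 [t1 [hw1 e2]]] := hE1 x; have [w2 [t2 [hw2 e3]]] := hE1 y.
  have : P (w * (t1 * t2)).
    apply: (isidBr hPi (y := w1 * w2 * t)); last exact: isidM.
    by apply: hker; rewrite rmorphB !rmorphM -e1 -e2 -e3; ring.
  move=> /(primeMl hP (hPQn _ hw)) /(primeM hP)[h|h]; [left | right]; first by exists w1, t1.
  by exists w2, t2.
Qed.

Lemma reg_ess n : reg J Q n <-> reg (@zid S) q n.
Proof.
split=> [[h1 [s [h2 h3 h4]]]|[h1 [s [h2 h3 h4]]]]; split.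
- have key P P' k : height_ge J P k -> isprime P' -> P' `<=` q -> contr th P' = P -> height_ge (@zid S) P' k.
    elim: k P P' => [|k IH] P P'; first by move=> [_ hJP] hP' _ _; split=> // x ->; exact: isid0 (prime_id hP').
    move=> [hP [P1 [g1 g2 g3]]] hP' hq' e; split=> //.
    have hP1 := height_ge_prime g1.
    have [|P1' [k1 k2 k3]] := ess_lift hP1 (height_ge_sub g1); first by move=> x /g2; rewrite -e; exact: hq'.
    have hsub : P1' `<=` P'.
      move=> z hz; have [w [t [hw ht]]] := hE1 z.
      apply: (primeMl hP' (u := th w)); first by move=> h; apply: hw; exact: hq'.
      rewrite ht; have : P1 t by rewrite -k3 /contr /= -ht; exact: isidM (prime_id k1) _.
      by move=> /g2; rewrite -e.
    exists P1'; split=> //; first exact: IH g1 k1 k2 k3.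
    by move=> h; apply: g3; rewrite -e -k3 => x; exact: h.
  exact: key h1 hq _ _.
- exists (map th s); split; [by rewrite size_map | by move=> _ /mapP[a /h3 ha ->] |].
  move=> z hz; have [w [t [hw ht]]] := hE1 z.
  have [u hu hut] : sat Q (spn J s) t by apply: h4; rewrite /Q /contr /= -ht; exact: isidM (prime_id hq) _.
  exists (th (u * w)); first exact: (primeNM hQ hu hw).
  rewrite rmorphM -mulrA ht -rmorphM; move: (ext_spn th hJ hut); apply: gen_mono => //.
  by apply: ext_min; [exact: zid_id | move=> x /hJ0].
- have key P' k : height_ge (@zid S) P' k -> P' `<=` q -> height_ge J (contr th P') k.
    elim: k P' => [|k IH] P'.
      by move=> [hP' _] _; split; [exact: contr_prime | move=> x /hJ0 h; rewrite /contr /= h; exact: isid0 (prime_id hP')].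
    move=> [hP' [P1 [g1 g2 g3]]] hq'; split; first exact: contr_prime.
    exists (contr th P1); split; [by apply: IH => // z /g2/hq' | by move=> x /g2|].
    move=> h; apply: g3 => z hz; have [w [t [hw ht]]] := hE1 z.
    have hP1 := height_ge_prime g1.
    apply: (primeMl hP1 (u := th w)); first by move=> h'; apply: hw; apply: hq'; exact: g2.
    by rewrite ht; apply: h; rewrite /contr /= -ht; exact: isidM (prime_id hP') _.
  exact: key h1 _.
- have /choice[wt hwt] : forall z, exists wt : B * B, ~ Q wt.1 /\ th wt.1 * z = th wt.2.
    by move=> z; have [w [t h]] := hE1 z; exists (w, t).
  exists (map (fun z => (wt z).2) s); split; first by rewrite size_map.
    move=> _ /mapP[z hz ->]; have [_ e] := hwt z; rewrite /Q /contr /= -e.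
    by apply: isidM (prime_id hq) _; exact: h3.
  set s2 := map _ s; have hid : isid (spn J s2) by exact: gen_id.
  move=> x hx; have [u hu hux] := h4 (th x) hx.
  have [w [t [hw ht]]] := hE1 u.
  (* Up to a factor outside [q], members of the ideal generated by [s] in the local ring are images
     of members of J + (s2); the factor is then replaced by its numerator in B. *)
  suff h5 : sat q [set z | exists t, spn J s2 t /\ th t = z] (th x).
    have [v hv [t' [ht1 ht2]]] := h5; have [w' [t2 [hw' ht']]] := hE1 v.
    have ht2Q : ~ Q t2 by move=> h; apply: (primeNM hq hw' hv); rewrite ht'.
    have : sat Q J (t2 * x - w' * t') by apply: hE2; rewrite rmorphB !rmorphM -ht' ht2; ring.
    move=> [y hy hy']; exists (y * t2); first exact: primeNM.
    rewrite (_ : _ * _ = y * (t2 * x - w' * t') + y * w' * t'); last by ring.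
    by apply: isidD => //; [exact: gen_base | exact: isidM].
  apply: (sat_sat hq); exists u => //.
  move: hux; apply: (spn_min (I := sat q [set z | exists t, spn J s2 t /\ th t = z])).
  - split.
    + by exists 1; [exact: prime1 | exists 0; rewrite rmorph0 mulr0; split=> //; exact: isid0].
    + move=> a b [v hv [t1 [k1 k2]]] [v' hv' [t1' [k3 k4]]].
      have [c [r [hc hr]]] := hE1 v; have [c' [r' [hc' hr']]] := hE1 v'.
      exists (th r * th r').
        by apply: (primeNM hq); rewrite -?hr -?hr'; exact: primeNM.
      exists (c * r' * t1 + c' * r * t1'); split; first by apply: isidD => //; exact: isidM.
      by rewrite !rmorphD !rmorphM k2 k4 -hr -hr'; ring.
    + move=> a b [v hv [t1 [k1 k2]]]; have [c [r [hc hr]]] := hE1 a.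
      exists (th c * v); first exact: primeNM.
      exists (r * t1); split; first exact: isidM.
      by rewrite rmorphM k2 -hr; ring.
  - move=> z ->; exists 1; first exact: prime1.
    by exists 0; rewrite rmorph0 mulr0; split=> //; exact: isid0.
  - move=> a ha; have [k1 k2] := hwt a; exists (th (wt a).1) => //.
    exists (wt a).2; split=> //; apply: spn_mem => //; exact: (map_f (fun z => (wt z).2)).
Qed.
End Essential.

Lemma local_prime (R : comNzRingType) (M : idealr R) : local_ring M -> isprime [set x | x \in M].
Proof.
move=> hM; have hMi := idealr_isid M; split=> //; first by rewrite /= idealr1.
move=> x y /= hxy; have [h|/(local_units hM)[z hz]] := boolP (x \in M); [by left | right].
by rewrite -(mul1r y) -hz -mulrA; exact: (isidM z hMi).
Qed.

Lemma local_sub (R : comNzRingType) (M : idealr R) (I : set R) : local_ring M -> isid I -> ~ I 1 -> I `<=` [set x | x \in M].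
Proof.
move=> hM hI h1 x hx /=; apply: contrapT => /negP /(local_units hM)[y hy].
by apply: h1; rewrite -hy; exact: isidM.
Qed.

Lemma reg_local (R : comNzRingType) (M : idealr R) : local_ring M ->
  regular_local_ring R <-> exists d, reg (@zid R) [set x | x \in M] d.
Proof.
move=> hM; have hp := local_prime hM; have hsub P : isprime P -> P `<=` [set x | x \in M].
  by move=> hP; exact: (local_sub hM (prime_id hP) (prime1 hP)).
have [/noetherianP hR _ _] := hM.
split=> [[M' [hM' [d [/krull_dimP[[Q hQ] hd] [s hs]]]]]|[d hreg]].
  have e : [set x | x \in M'] = [set x | x \in M].
    apply: seteqI; apply: local_sub => //; try exact: idealr_isid; by rewrite /= idealr1.
  have es x : [set x | x \in M] x <-> ideal_gen [set` s] x by rewrite -e; exact: hs.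
  exists d; split; first by apply: (height_ge_up hQ hp); exact: hsub (height_ge_prime hQ).
  exists s; split; [exact: size_tuple | by move=> a ha; apply/es; exact: ideal_gen_sub |].
  by move=> x /es; rewrite ideal_gen_spn; exact: sat_sub.
exists M; split=> //; exists d; split.
  apply/krull_dimP; split; first by exists [set x | x \in M]; case: hreg.
  move=> Q k hQ; apply: (reg_le hR (@zid_id R) hreg); apply: (height_ge_up hQ hp); exact: hsub (height_ge_prime hQ).
have [_ [s [hs1 hs2 hs3]]] := hreg; have hs : size s == d by apply/eqP.
exists (Tuple hs) => x; rewrite ideal_gen_spn /=; split.
  move=> /hs3[u /negP /(local_units hM)[y hy] hu].
  have hid : isid (spn (@zid R) s) by apply: gen_id; [exact: setT_id | exact: zid_id].
  by rewrite -(mul1r x) -hy -mulrA; exact: isidM.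
apply: (spn_min (idealr_isid M)) => // z ->; exact: idealr0.
Qed.

Section Loc.
Variables (R : comNzRingType) (P : prime_idealr R).
Local Notation L := (localization P).
Local Notation th := (loc_map P : {rmorphism R -> L}).
Let q : set L := [set z | z \in (loc_max P : idealr L)].
Let hP := prime_idealr_isprime P.

Lemma loc_max_mk a s (hs : s \notin P) : q (loc_mk a hs) <-> a \in P.
Proof.
split=> [/asboolP[b [t [ht [hb /loc_mkP[u hu]]]]]|ha]; last by apply/asboolP; exists a, s, hs.
rewrite mulrBr => /subr0_eq e.
have : u * (a * t) \in P by rewrite e mulrCA mulrC idealMr.
by rewrite !prime_idealrM (negPf hu) (negPf ht) orbF.
Qed.

Lemma loc_unit a s (hs : s \notin P) (ha : a \notin P) : loc_mk s ha * loc_mk a hs = 1.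
Proof.
change (loc_mul (loc_mk s ha) (loc_mk a hs) = loc_one P).
by rewrite loc_mulE; apply: loc_mk_eq; ring.
Qed.

Lemma loc_frac_eq a s (hs : s \notin P) : th s * loc_mk a hs = th a.
Proof.
change (loc_mul (loc_mk s (primeN1 P)) (loc_mk a hs) = loc_mk a (primeN1 P)).
by rewrite loc_mulE; apply: loc_mk_eq; ring.
Qed.

Lemma loc_map_q a : q (th a) <-> a \in P.
Proof. exact: loc_max_mk. Qed.

Lemma loc_map_eq0 a : th a = 0 -> exists2 u, u \notin P & u * a = 0.
Proof. by move=> /loc_mkP[u hu]; rewrite mul0r subr0 mulr1 => e; exists u. Qed.

Lemma loc_noeth : noeth R -> noeth L.
Proof.
move=> hR J hJ; have [s hs] := hR _ (contr_id th hJ).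
exists (map th s); apply: noeth_spn => //.
  move=> _ /mapP[a ha ->]; have : contr th J a by rewrite hs; apply: spn_mem => //; exact: zid_id.
  by [].
have hid : isid (spn (@zid L) (map th s)) by apply: gen_id; [exact: setT_id | exact: zid_id].
move=> z hz; have [a [t [ht e]]] := loc_mkW z.
have ha : contr th J a by rewrite /contr /= -(loc_frac_eq a ht) -e; exact: isidM.
rewrite hs in ha; have h := ext_spn th (@zid_id R) ha.
have {}h : spn (@zid L) (map th s) (th a).
  by move: h; apply: gen_mono => //; apply: ext_min; [exact: zid_id | move=> x ->; exact: rmorph0].
have -> : z = loc_mk 1 ht * th a.
  rewrite e; change (loc_mk a ht = loc_mul (loc_mk 1 ht) (loc_mk a (primeN1 P))).
  by rewrite loc_mulE; apply: loc_mk_eq; ring.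
exact: isidM.
Qed.

Lemma loc_local : noeth R -> local_ring (loc_max P : idealr L).
Proof.
move=> hR; apply: units_local; first exact: loc_noeth.
move=> z; have [a [s [hs ->]]] := loc_mkW z => h.
have ha : a \notin P by apply: contra h => ha; exact: (proj2 (loc_max_mk a hs)).
by exists (loc_mk s ha); exact: loc_unit.
Qed.

Lemma loc_ess1 z : exists w t, ~ contr th q w /\ th w * z = th t.
Proof.
have [a [s [hs ->]]] := loc_mkW z; exists s, a; split; last exact: loc_frac_eq.
by move=> /loc_map_q h; rewrite h in hs.
Qed.

Lemma reg_localizationP : noeth R ->
  regular_local_ring L <-> exists d, reg (@zid R) [set x | x \in P] d.
Proof.
move=> hR; have hL := loc_local hR; have hq : isprime q := local_prime hL.
have e : contr th q = [set x | x \in P] by apply: seteqI => x /loc_map_q.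
have h n : reg (@zid R) [set x | x \in P] n <-> reg (@zid L) q n.
  rewrite -e; apply: (reg_ess (@zid_id R) hq loc_ess1).
    by move=> t /loc_map_eq0[u hu hut]; exists u => // /loc_map_q h; rewrite h in hu.
  by move=> t ->; exact: rmorph0.
split=> [/(reg_local hL)[d /h hd]|[d /h hd]]; first by exists d.
by apply/(reg_local hL); exists d.
Qed.
End Loc.

Lemma quot_projP (R : comNzRingType) (I : idealr R) x y :
  \pi_{ideal_quot I} x = \pi_{ideal_quot I} y <-> x - y \in I.
Proof. by rewrite Quotient.idealrBE; split => [->|/eqP]. Qed.

Lemma quot_dim (R : comNzRingType) (M : idealr R) (P : prime_idealr R) m : local_ring M ->
  has_krull_dim {ideal_quot P} m <-> height_ge [set x | x \in P] [set x | x \in M] m /\ ~ height_ge [set x | x \in P] [set x | x \in M] m.+1.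
Proof.
move=> hM; pose pr : {rmorphism R -> {ideal_quot P}} := \pi_{ideal_quot P}.
have hs : forall y, exists x, pr x = y by move=> y; exists (repr y); exact: reprK.
have hk : contr pr (@zid _) = [set x | x \in P].
  have h0 x : (pr x = 0) <-> x \in P.
    by rewrite -(rmorph0 pr) -[X in X \in P]subr0; exact: quot_projP.
  by apply: seteqI => x /h0.
have hp := local_prime hM; have hz := @zid_id {ideal_quot P}.
have h1 Q k : height_ge (@zid {ideal_quot P}) Q k -> height_ge [set x | x \in P] [set x | x \in M] k.
  move=> /(coprime_reg_surj hs) h; rewrite hk in h; apply: (height_ge_up h hp).
  exact: (local_sub hM (prime_id (height_ge_prime h)) (prime1 (height_ge_prime h))).
have h2 k : height_ge [set x | x \in P] [set x | x \in M] k -> exists Q, height_ge (@zid {ideal_quot P}) Q k.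
  move=> h; have [|Q hQ e] := surj_prime_img hs hp; first by rewrite hk; exact: (height_ge_sub h).
  by exists Q; apply: (height_ge_surj hs) => //; rewrite hk e.
rewrite krull_dimP; split=> [[[Q hQ] h]|[h h']].
  by split; [exact: h1 hQ | move=> /h2[Q' /h]; rewrite ltnn].
split; first exact: h2.
by move=> Q k /h1 hk'; rewrite leqNgt; apply/negP => hlt; apply: h'; exact: height_ge_le hk'.
Qed.

Section DomOf.
Variables (R : comNzRingType).
(* An alias of R, to which the idomainType structure is attached. *)
Definition dom_of of isprime (@zid R) : Type := R.
Hypothesis h : isprime (@zid R).
Local Notation D := (dom_of h).
HB.instance Definition _ := GRing.ComNzRing.on D.
Definition dom_unit : {pred D} := fun x => `[< exists y : D, y * x = 1 >].
Definition dom_inv (x : D) : D := if pselect (exists y : D, y * x = 1) is left e then projT1 (cid e) else x.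
Lemma dom_mulV : {in dom_unit, left_inverse 1 dom_inv *%R}.
Proof. by move=> x /asboolP hx; rewrite /dom_inv; case: pselect => [e|//]; exact: (projT2 (cid e)). Qed.
Lemma dom_unitP (x y : D) : y * x = 1 -> dom_unit x.
Proof. by move=> e; apply/asboolP; exists y. Qed.
Lemma dom_inv_out : {in [predC dom_unit], dom_inv =1 id}.
Proof. by move=> x /negP hx; rewrite /dom_inv; case: pselect => // e; case: hx; apply/asboolP. Qed.
HB.instance Definition _ := GRing.ComNzRing_hasMulInverse.Build D dom_mulV dom_unitP dom_inv_out.
Lemma dom_integral : GRing.integral_domain_axiom D.
Proof.
move=> x y e; have [_ _ hp] := h; have : @zid R (x * y) by [].
by case/hp => ->; rewrite eqxx ?orbT.
Qed.
HB.instance Definition _ := GRing.ComUnitRing_isIntegral.Build D dom_integral.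
Lemma dom_exists : exists (D : idomainType) (f : {rmorphism R -> D}), bijective f.
Proof.
have [f hf] : exists f : {rmorphism R -> D}, forall x, f x = x by apply: rmorph_exists.
by exists D, f; exists id => x; rewrite ?hf.
Qed.
End DomOf.

Lemma inj_surj_bij (A B : Type) (f : A -> B) : injective f -> (forall y, exists x, f x = y) -> bijective f.
Proof.
move=> hi hs; pose g y := projT1 (cid (hs y)); have hg y : f (g y) = y := projT2 (cid (hs y)).
by exists g => // x; apply: hi; rewrite hg.
Qed.

Section Comp.
Variables (R : comNzRingType) (I : idealr R).
Local Notation J := [set x | x \in I].

Lemma pow_projP n x y : pow_proj I n x = pow_proj I n y <-> pw J n.+1 (x - y).
Proof. by rewrite /pow_proj quot_projP; split=> [/asboolP|h] //; apply/asboolP. Qed.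

Lemma comp_repr (x : completion I) n : exists a, comp_val x n = pow_proj I n a.
Proof. by have [a [h _]] := comp_valP x (leqnn n); exists a. Qed.

Lemma comp_repr_le (x : completion I) m n a : (m <= n)%N -> comp_val x n = pow_proj I n a -> comp_val x m = pow_proj I m a.
Proof.
move=> hmn h; have [b [h1 h2]] := comp_valP x hmn; rewrite h1; apply/pow_projP.
have /pow_projP h3 : pow_proj I n b = pow_proj I n a by rewrite -h2.
by apply: pw_sub h3.
Qed.

Lemma comp_exists (a : nat -> R) : (forall k, pw J k (a k)) ->
  exists x : completion I, forall n, comp_val x n = pow_proj I n (\sum_(k < n.+1) a k).
Proof.
move=> ha; have hc : compatible (fun n => pow_proj I n (\sum_(k < n.+1) a k)).
  move=> m n hmn; exists (\sum_(k < n.+1) a k); split=> //; apply/pow_projP.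
  rewrite -(big_mkord xpredT a) -(big_mkord xpredT a) (@big_cat_nat _ _ _ m.+1 0 n.+1) //.
  rewrite opprD addrA subrr sub0r; apply: isidN; first exact: pw_id.
  rewrite big_nat_cond; apply: isid_sum; first exact: pw_id.
  by move=> i /andP[/andP[hi _] _]; apply: pw_sub (ha i).
by exists (Completion hc).
Qed.

Lemma adic_complete : adically_complete I -> complete J.
Proof.
move=> [g hg1 hg2]; split.
  move=> x hx; apply: (can_inj hg1); apply: completion_eq => n /=; apply/pow_projP.
  by rewrite subr0; exact: hx.
move=> a /comp_exists[x hx]; exists (g x) => -[|n] //.
apply/pow_projP; rewrite -hx -{2}(hg2 x) //.
Qed.

(** An element with vanishing n-th component is a series of differences of representatives, lying in
    increasing powers of the ideal. Written on generators of I^(n+1), the coefficients form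
    convergent series, which gives finitely many terms. *)
Lemma comp_ker (hR : noeth R) n (x : completion I) : comp_val x n = pow_proj I n 0 -> ext (completion_map I) (pw J n.+1) x.
Proof.
move=> hx; have [m hm] := hR _ (pw_id J n.+1).
have /choice[a ha] := comp_repr x.
have hab k l : (k <= l)%N -> pw J k.+1 (a l - a k).
  by move=> hkl; apply/pow_projP; rewrite -ha; apply/esym; exact: (comp_repr_le hkl (ha l)).
have han : pw J n.+1 (a n).
  have /pow_projP : pow_proj I n (a n) = pow_proj I n 0 by rewrite -ha.
  by rewrite subr0.
have hd k b : pw J (k + n.+1) b -> exists c : nat -> R, (forall j, pw J k (c j)) /\ b = \sum_(j < size m) c j * m`_j.
  move=> /pw_addP hb; suff hgen : gen (pw J k) (@zid R) m b.
    have /gen_sumP[|c h1 h2] := hgen; first exact: pw_id.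
    by exists c; split=> //; exact: subr0_eq.
  have hgid : isid (gen (pw J k) (@zid R) m) by apply: gen_id; [exact: pw_id | exact: zid_id].
  move: b hb; apply: ideal_gen_min => // _ [y [z [hy hz ->]]].
  move: hz; rewrite hm; apply: (spn_min (I := [set z | gen (pw J k) (@zid R) m (y * z)])).
  - split=> [|u v hu hv|c u hu] /=; first by rewrite mulr0; exact: isid0.
      by rewrite mulrDr; exact: isidD.
    by rewrite mulrCA; exact: isidM.
  - by move=> _ -> /=; rewrite mulr0; exact: isid0.
  - by move=> z' hz' /=; exact: gen_memc (pw_id _ _) (@zid_id R) hz' hy.
have [d [_ hd0]] := hd 0%N (a n) han.
have /choice[c hc] : forall k, exists c : nat -> R, (forall j, pw J k (c j)) /\ a (n + k).+1 - a (n + k)%N = \sum_(j < size m) c j * m`_j.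
  by move=> k; apply: hd; rewrite addnC addSn; apply: hab.
have /choice[z hz] : forall j, exists z : completion I, forall l, comp_val z l = pow_proj I l (\sum_(k < l.+1) c k j).
  by move=> j; apply: (comp_exists (a := fun k => c k j)) => k; case: (hc k).
have -> : x = \sum_(j < size m) (completion_map I (d j) + z j) * completion_map I m`_j.
  apply: completion_eq => l.
  have cvs (T : Type) (r : seq T) (F : T -> completion I) : comp_val (\sum_(i <- r) F i) l = \sum_(i <- r) comp_val (F i) l.
    elim: r => [|i r IH]; first by rewrite !big_nil; exact: (rmorph0 (pow_proj I l)).
    by rewrite !big_cons -IH.
  rewrite cvs.
  have -> : comp_val x l = pow_proj I l (a (n + l.+1)%N).
    by apply: comp_repr_le (ha _); rewrite addnS -addSn leq_addl.
  have -> : a (n + l.+1)%N = \sum_(j < size m) (d j + \sum_(k < l.+1) c k j) * m`_j.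
    have -> : a (n + l.+1)%N = a n + \sum_(k < l.+1) (a (n + k).+1 - a (n + k)%N).
      elim: (l.+1) => [|l' IH]; first by rewrite addn0 big_ord0 addr0.
      by rewrite big_ord_recr /= addrA -IH addnS subrKC.
    rewrite hd0 (eq_bigr (fun k : 'I_l.+1 => \sum_(j < size m) c k j * m`_j)); last by move=> k _; case: (hc k).
    rewrite exchange_big -big_split; apply: eq_bigr => j _ /=.
    by rewrite mulrDl mulr_suml.
  rewrite rmorph_sum; apply: eq_bigr => j _; rewrite rmorphM rmorphD -hz //.
apply: isid_sum; first exact: ext_id.
move=> j _; apply: isidM; first exact: ext_id.
by apply: ext_in; rewrite hm; apply: spn_mem; [exact: zid_id | exact: mem_nth].
Qed.
End Comp.

Lemma complete_local_of (T : comNzRingType) (M : idealr T) : local_ring M -> adically_complete M -> complete_local [set x | x \in M].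
Proof.
move=> hM hc; have [/noetherianP hT _ _] := hM; split=> //.
- exact: idealr_isid.
- by move=> x /negP; exact: local_units hM _.
- by rewrite /= idealr1.
- exact: adic_complete.
Qed.

Section ToCompletion.
Variables (A T : comNzRingType) (phi : {rmorphism A -> T}) (N : idealr A) (M : set T).
Hypotheses (hcl : complete_local M) (hpw : forall k x, pw [set x | x \in N] k x <-> pw M k (phi x)) (happ : forall k t, exists a, pw M k (t - phi a)).
Let hc : complete M. Proof. by case: hcl. Qed.

(** The image of a compatible family is the limit in T of its representatives; [G] characterizes
    this limit. *)
Lemma to_completion : exists g : {rmorphism completion N -> T}, bijective g /\ forall a, g (completion_map N a) = phi a.
Proof.
pose G (x : completion N) s := forall n a, comp_val x n = pow_proj N n a -> pw M n.+1 (s - phi a).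
have huniq x s t : G x s -> G x t -> s = t.
  move=> h1 h2; apply: (cont_uniq hc) => -[|n] //; have [a ha] := comp_repr x n.
  rewrite (_ : _ - _ = (s - phi a) - (t - phi a)); last by ring.
  by apply: isidB; [exact: pw_id | exact: h1 | exact: h2].
have hGr x s : (forall n, exists2 a, comp_val x n = pow_proj N n a & pw M n.+1 (s - phi a)) -> G x s.
  move=> h n a ha; have [b hb1 hb2] := h n.
  rewrite (_ : _ - _ = (s - phi b) + phi (b - a)); last by rewrite rmorphB; ring.
  apply: isidD; [exact: pw_id | by [] | apply/hpw; apply/pow_projP; by rewrite -hb1].
have hG x : exists s, G x s.
  have /choice[a ha] := comp_repr x.
  pose b k := if k is k'.+1 then phi (a k) - phi (a k') else phi (a 0%N).
  case: (hc) => _ h; have [|s hs] := h b.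
    case=> [|k]; first by [].
    change (pw M k.+1 (phi (a k.+1) - phi (a k))); rewrite -rmorphB; apply/hpw/pow_projP; rewrite -ha; apply/esym.
    exact: (comp_repr_le (leqnSn k) (ha k.+1)).
  exists s; apply: hGr => n; exists (a n) => //.
  have e : \sum_(k < n.+1) b k = phi (a n).
    elim: n => [|n IH]; first by rewrite big_ord_recl big_ord0 addr0.
    by rewrite big_ord_recr IH /= subrKC.
  by rewrite -e; exact: hs.
have [g0 hg0] := choice hG.
have [|||g hg] := @rmorph_exists (completion N) T g0.
- move=> x y; apply: huniq (hg0 _) _; apply: hGr => n.
  have [a ha] := comp_repr x n; have [b hb] := comp_repr y n.
  exists (a + b); first by rewrite rmorphD -ha -hb.
  rewrite rmorphD opprD addrACA; apply: isidD; [exact: pw_id | exact: hg0 | exact: hg0].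
- move=> x y; apply: huniq (hg0 _) _; apply: hGr => n.
  have [a ha] := comp_repr x n; have [b hb] := comp_repr y n.
  exists (a * b); first by rewrite rmorphM -ha -hb.
  rewrite rmorphM (_ : _ - _ = g0 x * (g0 y - phi b) + (g0 x - phi a) * phi b); last by ring.
  by apply: isidD; [exact: pw_id | apply: isidM | apply: isidMr] => //; try exact: pw_id; exact: hg0.
- apply: huniq (hg0 _) _; apply: hGr => n; exists 1 => //.
  by rewrite rmorph1 subrr; exact: isid0 (pw_id _ _).
exists g; split; last first.
  move=> a; rewrite hg; apply: huniq (hg0 _) _; apply: hGr => n; exists a => //.
  by rewrite subrr; exact: isid0 (pw_id _ _).
apply: inj_surj_bij => [x y|t].
  rewrite !hg => e; apply: completion_eq => n.
  have [a ha] := comp_repr x n; have [b hb] := comp_repr y n; rewrite ha hb.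
  apply/pow_projP/hpw; rewrite rmorphB.
  rewrite (_ : _ - _ = (g0 y - phi b) - (g0 x - phi a)); last by rewrite e; ring.
  by apply: isidB; [exact: pw_id | exact: hg0 | exact: hg0].
have /choice[a ha] := fun n => happ n.+1 t.
have hcomp : compatible (fun n => pow_proj N n (a n)).
  move=> m n hmn; exists (a n); split=> //; apply/pow_projP/hpw; rewrite rmorphB.
  rewrite (_ : _ - _ = (t - phi (a n)) - (t - phi (a m))); last by ring.
  by apply: isidB; [exact: pw_id | apply: pw_sub (ha n) | exact: ha].
exists (Completion hcomp); rewrite hg; apply: huniq (hg0 _) _; apply: hGr => n; by exists (a n).
Qed.
End ToCompletion.

Section FromCompletion.
Variables (A T : comNzRingType) (N : idealr A) (M : idealr T) (g : {rmorphism completion N -> T}).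
Hypotheses (hN : local_ring N) (hM : local_ring M) (hMc : adically_complete M) (hg : bijective g).
Let phi : {rmorphism A -> T} := g \o completion_map N.
Local Notation MS := [set x | x \in M].
Local Notation NS := [set x | x \in N].
Let hcl : complete_local MS. Proof. exact: complete_local_of. Qed.
Let hA : noeth A. Proof. by have [/noetherianP] := hN. Qed.

Lemma comp_zero_id n : isid [set t | exists2 x, comp_val x n = pow_proj N n 0 & g x = t].
Proof.
split.
- by exists 0 => //; exact: rmorph0.
- move=> _ _ [x hx <-] [y hy <-]; exists (x + y); last exact: rmorphD.
  by rewrite (_ : comp_val (x + y) n = comp_val x n + comp_val y n) // hx hy -rmorphD addr0.
- move=> a _ [x hx <-]; case: hg => g' h1 h2; exists (g' a * x); last by rewrite rmorphM h2.
  by rewrite (_ : comp_val (g' a * x) n = comp_val (g' a) n * comp_val x n) // hx rmorph0 mulr0.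
Qed.

Lemma ext_zero n : ext phi (pw NS n.+1) `<=` [set t | exists2 x, comp_val x n = pow_proj N n 0 & g x = t].
Proof.
apply: ext_min; first exact: comp_zero_id.
by move=> a ha; exists (completion_map N a) => //; apply/pow_projP; rewrite subr0.
Qed.

Lemma zero_ext n t : (exists2 x, comp_val x n = pow_proj N n 0 & g x = t) -> ext phi (pw NS n.+1) t.
Proof.
move=> [x /(comp_ker hA) hx <-]; move: x hx; apply: (ext_min (Q := contr g (ext phi (pw NS n.+1)))).
  by apply: contr_id; exact: ext_id.
by move=> a ha; rewrite /contr /=; exact: (ext_in phi).
Qed.

(** Elements with zero component modulo [N] form a proper ideal, hence lie in [M]. If t in [M] had
    nonzero residue, an inverse y of it in A would put t * phi y - 1 there and 1 into [M]. *)
Lemma fc_max : MS `<=` ext phi NS.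
Proof.
have [g' h1 h2] := hg; have hMp := local_prime hM.
have hK : [set t | exists2 x, comp_val x 0%N = pow_proj N 0 0 & g x = t] `<=` MS.
  apply: local_sub => //; first exact: comp_zero_id.
  move=> [x hx /(congr1 g')]; rewrite h1 -(rmorph1 g) h1 => e.
  have /pow_projP : pow_proj N 0 1 = pow_proj N 0 0 by rewrite -hx e.
  by rewrite subr0 pw1; [rewrite /= idealr1 | exact: idealr_isid].
move=> t ht; have := @zero_ext 0%N t; rewrite pw1; last exact: idealr_isid.
apply; exists (g' t) => //; apply: contrapT => hne.
have [a ha] := comp_repr (g' t) 0%N.
have haN : a \notin N.
  apply/negP => h; apply: hne; rewrite ha; apply/pow_projP; rewrite subr0 pw1 //; exact: idealr_isid.
have [y hy] := local_units hN haN.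
apply: (prime1 hMp); have hz : MS (t * phi y - 1).
  apply: hK; exists (g' t * completion_map N y - 1); last by rewrite rmorphB rmorphM rmorph1 h2.
  rewrite (_ : comp_val _ _ = comp_val (g' t) 0%N * pow_proj N 0 y - pow_proj N 0 1) //.
  by rewrite ha -rmorphM -rmorphB mulrC hy subrr.
by have := isidB (prime_id hMp) (isidMr (phi y) (prime_id hMp) ht) hz; rewrite subKr.
Qed.

Lemma fc_contr : contr phi MS = NS.
Proof.
have hMp := local_prime hM; have hp : isprime (contr phi MS) := contr_prime phi hMp.
have [g' h1 h2] := hg.
apply: seteqI; first exact: (local_sub hN (prime_id hp) (prime1 hp)).
move=> x hx; have := fc_max; have : ext phi NS (phi x) by exact: ext_in.
move=> h _; have := @ext_zero 0%N (phi x); rewrite pw1; last exact: idealr_isid.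
move=> /(_ h) h'; apply: (local_sub hM (comp_zero_id 0)) h'.
move=> [z hz /(congr1 g')]; rewrite h1 -(rmorph1 g) h1 => e.
have /pow_projP : pow_proj N 0 1 = pow_proj N 0 0 by rewrite -hz e.
by rewrite subr0 pw1; [rewrite /= idealr1 | exact: idealr_isid].
Qed.

Lemma fc_pw k x : pw NS k x <-> pw MS k (phi x).
Proof.
have hMN : MS `<=` ext phi (contr phi MS) by rewrite fc_contr; exact: fc_max.
rewrite -fc_contr; split; first by move=> h; apply: ext_pw; exact: ext_in.
case: k => // k /(pw_ext hMN); rewrite fc_contr => /ext_zero[z hz e].
have [g' h1 h2] := hg; have ez : z = completion_map N x by apply: (can_inj h1).
by move: hz; rewrite ez => /pow_projP; rewrite subr0.
Qed.

Lemma fc_approx k t : exists a, pw MS k (t - phi a).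
Proof.
case: k => [|n]; first by exists 0.
have [g' h1 h2] := hg; have [a ha] := comp_repr (g' t) n; exists a.
have h : ext phi (pw NS n.+1) (t - phi a).
  apply: zero_ext; exists (g' t - completion_map N a); last by rewrite rmorphB h2.
  by rewrite (_ : comp_val _ _ = comp_val (g' t) n - pow_proj N n a) // ha subrr rmorph0.
by rewrite -fc_contr in h; exact: ext_pw h.
Qed.

Lemma fc_ffl : faithfully_flat phi.
Proof.
apply: (completion_ffl hA (idealr_isid N) hcl fc_pw fc_approx) => J; exact: local_sub.
Qed.
End FromCompletion.

(** The variables come from the polynomial ring over A, so T and that ring generate everything. *)
Lemma polyn_hom_ext (A T X : comNzRingType) (phi : {rmorphism A -> T}) m (al be : {rmorphism polyn T m -> X}) :
  (forall t, al (polynC T m t) = be (polynC T m t)) -> (forall b, al (polynM phi m b) = be (polynM phi m b)) ->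
  forall t, al t = be t.
Proof.
elim: m al be => [|m IH] al be h1 h2 t; first exact: h1.
have hC a : al a%:P = be a%:P.
  apply: (IH (al \o polyC) (be \o polyC)) => [t'|b] /=; first exact: h1.
  by have := h2 b%:P; rewrite /= map_polyC.
have hX : al 'X = be 'X by have := h2 'X; rewrite /= map_polyX.
elim/poly_ind: t => [|p c IHp]; first by rewrite !rmorph0.
by rewrite !rmorphD !rmorphM IHp hX hC.
Qed.

(** Universal property of fractions, stated for any ring whose elements are fractions, so that it
    serves for residue fields and for fibres alike. *)
Lemma frac_factor (B L : comNzRingType) (X : comPzRingType) (h : {rmorphism B -> L}) (k : {rmorphism B -> X}) (U : set B) :
  U 1 -> (forall u v, U u -> U v -> U (u * v)) -> (forall y, exists u b, U u /\ h u * y = h b) ->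
  (forall u, U u -> exists v, v * k u = 1) -> (forall b, h b = 0 -> k b = 0) ->
  exists w : {rmorphism L -> X}, forall b, w (h b) = k b.
Proof.
move=> hU1 hUM hfr hunit h0.
pose W y x := forall u b, U u -> h u * y = h b -> k u * x = k b.
have hWu y x x' : W y x -> W y x' -> x = x'.
  move=> g1 g2; have [u [b [hu e]]] := hfr y; have [v hv] := hunit u hu.
  by rewrite -(mul1r x) -hv -mulrA (g1 _ _ hu e) -(g2 _ _ hu e) mulrA hv mul1r.
have hWi y x u b : U u -> h u * y = h b -> k u * x = k b -> W y x.
  move=> hu e ex u' b' hu' e'; have [v hv] := hunit u hu.
  have /h0 : h (u' * b - u * b') = 0 by rewrite rmorphB !rmorphM -e -e'; ring.
  rewrite rmorphB !rmorphM => /subr0_eq e3.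
  have e4 : k u * (k u' * x) = k u * k b' by rewrite -e3 -ex; ring.
  by rewrite -(mul1r (_ * x)) -hv -mulrA e4 mulrA hv mul1r.
have /choice[w0 hw0] : forall y, exists x, W y x.
  move=> y; have [u [b [hu e]]] := hfr y; have [v hv] := hunit u hu.
  exists (v * k b); apply: (hWi _ _ u b) => //.
  by rewrite mulrCA mulrA hv mul1r.
have [|||w hw] := @rmorph_exists L X w0.
- move=> x y; apply: (hWu (x + y)) => //.
  have [u [b [hu e]]] := hfr x; have [u' [b' [hu' e']]] := hfr y.
  apply: (hWi _ _ (u * u') (u' * b + u * b')); first exact: hUM.
    by rewrite rmorphD !rmorphM -e -e'; ring.
  by rewrite rmorphD !rmorphM -(hw0 x _ _ hu e) -(hw0 y _ _ hu' e'); ring.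
- move=> x y; apply: (hWu (x * y)) => //.
  have [u [b [hu e]]] := hfr x; have [u' [b' [hu' e']]] := hfr y.
  apply: (hWi _ _ (u * u') (b * b')); first exact: hUM.
    by rewrite !rmorphM -e -e'; ring.
  by rewrite !rmorphM -(hw0 x _ _ hu e) -(hw0 y _ _ hu' e'); ring.
- by apply: (hWu 1) => //; apply: (hWi _ _ 1 1); rewrite ?rmorph1 ?mulr1.
by exists w => b; rewrite hw; have := hw0 (h b) 1 b hU1; rewrite !rmorph1 !mul1r => ->.
Qed.

(** * Quasi-excellence *)

Section Tensor.
Variables (A T : comNzRingType) (phi : {rmorphism A -> T}) (P : prime_idealr A) (L : fieldType) (f : {rmorphism residue_field P -> L}).
Variables (S : comNzRingType) (i : {rmorphism T -> S}) (j : {rmorphism L -> S}).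
Hypotheses (hf : finite_extension f) (hS : is_tensor_product phi (f \o residue_map P) i j).
Let h : {rmorphism A -> L} := f \o residue_map P.
Let hij a : i (phi a) = j (h a). Proof. by case: hS => e _; exact: e. Qed.

Lemma res_neq0 u : u \notin P -> h u != 0.
Proof.
move=> hu; have e : h u * f (residue_proj P (loc_mk 1 hu)) = 1.
  by rewrite /h /= -rmorphM residue_frac_inv !rmorph1.
by apply/eqP => h0; move: e; rewrite h0 mul0r => /eqP; rewrite eq_sym oner_eq0.
Qed.

(** The variables are sent to [s] in L and to their images in S; S thereby becomes a localization of
    a quotient of a polynomial ring over T. *)
Lemma eval_exists (s : seq L) : exists (psi : {rmorphism polyn A (size s) -> L}) (th : {rmorphism polyn T (size s) -> S}),
  [/\ forall a, psi (polynC A _ a) = h a, forall t, th (polynC T _ t) = i t,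
      forall b, th (polynM phi _ b) = j (psi b) & forall x, x \in s -> exists b, psi b = x].
Proof.
elim: s => [|x s [psi [th [h1 h2 h3 h4]]]] /=; first by exists h, i; split=> //; exact: hij.
have c1 : commr_rmorph psi x by move=> a; exact: mulrC.
have c2 : commr_rmorph th (j x) by move=> a; exact: mulrC.
pose psi' : {rmorphism {poly polyn A (size s)} -> L} := horner_morph c1.
pose th' : {rmorphism {poly polyn T (size s)} -> S} := horner_morph c2.
exists psi', th'; split.
- by move=> a /=; rewrite /psi' /= horner_morphC h1.
- by move=> t /=; rewrite /th' /= horner_morphC h2.
- move=> b; rewrite /th' /psi' /= /horner_morph -horner_map -!map_poly_comp; congr (_.[_]).
  by apply: eq_map_poly => a /=; rewrite h3.
- move=> y; rewrite inE => /predU1P[->|/h4[b hb]]; first by exists 'X; exact: horner_morphX.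
  by exists b%:P; rewrite /psi' /= horner_morphC hb.
Qed.

(** The fractions form a subring of S through which both T and L map. The universal property gives a
    retraction of S onto it, and uniqueness makes this the identity. *)
Lemma tensor_frac (m : nat) (psi : {rmorphism polyn A m -> L}) (th : {rmorphism polyn T m -> S}) :
  (forall a, psi (polynC A _ a) = h a) -> (forall t, th (polynC T _ t) = i t) ->
  (forall b, th (polynM phi _ b) = j (psi b)) -> (forall y, exists u b, u \notin P /\ h u * y = psi b) ->
  forall z, exists u t, u \notin P /\ i (phi u) * z = th t.
Proof.
move=> h1 h2 h3 h4; pose Z : set S := [set z | exists u t, u \notin P /\ i (phi u) * z = th t].
have hZ : subr_closed Z.
  split.
  - by exists 1, 1; rewrite primeN1 !rmorph1 mulr1.
  - move=> x y [u [t [hu e1]]] [v [t' [hv e2]]]; exists (u * v), (polynC T m (phi v) * t - polynC T m (phi u) * t').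
    by rewrite primeN_mul // rmorphB !rmorphM !h2 -e1 -e2; split=> //; ring.
  - move=> x y [u [t [hu e1]]] [v [t' [hv e2]]]; exists (u * v), (t * t').
    by rewrite primeN_mul // !rmorphM -e1 -e2; split=> //; ring.
have [B [inc [hinj hB]]] := subring_exists hZ.
have hiZ t : Z (i t) by exists 1, (polynC T m t); rewrite primeN1 !rmorph1 mul1r h2.
have hjZ y : Z (j y).
  have [u [b [hu e]]] := h4 y; exists u, (polynM phi m b); split=> //.
  by rewrite hij -rmorphM e h3.
have /choice[i0 hi0] := fun t => proj1 (hB _) (hiZ t).
have /choice[j0 hj0] := fun y => proj1 (hB _) (hjZ y).
have [|||i' hi'] := @rmorph_exists T B i0; try by [move=> x y; apply: hinj; rewrite ?rmorphD ?rmorphM !hi0 ?rmorphD ?rmorphM | apply: hinj; rewrite hi0 !rmorph1].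
have [|||j' hj'] := @rmorph_exists L B j0; try by [move=> x y; apply: hinj; rewrite ?rmorphD ?rmorphM !hj0 ?rmorphD ?rmorphM | apply: hinj; rewrite hj0 !rmorph1].
have [_ huniv] := hS.
have [[r [hr1 hr2]] _] := huniv B i' j' (fun a => hinj _ _ (etrans (congr1 inc (hi' _)) (etrans (hi0 _) (etrans (hij a) (esym (etrans (congr1 inc (hj' _)) (hj0 _))))))).
have [_ hu] := huniv S i j (proj1 hS).
have e z : inc (r z) = z.
  apply: (hu (inc \o r) idfun) => x /=.
    by have /= -> := hr1 x; rewrite hi' hi0.
  by have /= -> := hr2 x; rewrite hj' hj0.
by move=> z; rewrite -(e z); apply/hB; exists (r z).
Qed.

(* The kernel is determined by mapping the tensor product to the fibre of F over contr F Q localized at Q. *)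
Lemma tensor_ker (m : nat) (psi : {rmorphism polyn A m -> L}) (th : {rmorphism polyn T m -> S}) (q : set S) :
  isprime q -> (forall a, psi (polynC A _ a) = h a) -> (forall t, th (polynC T _ t) = i t) ->
  (forall b, th (polynM phi _ b) = j (psi b)) -> (forall y, exists u b, u \notin P /\ h u * y = psi b) ->
  forall t, th t = 0 -> sat (contr th q) (ext (polynM phi m) (contr (polynM phi m) (contr th q))) t.
Proof.
move=> hq h1 h2 h3 h4; set Q := contr th q; have hQ : isprime Q := contr_prime th hq.
set F := polynM phi m; set J := ext F (contr F Q).
have hJ : isid J by exact: ext_id.
have hJQ : J `<=` Q by apply: ext_min; [exact: prime_id | ].
have [Qi hQi] := prime_set_idealr hQ.
pose lm : {rmorphism polyn T m -> localization Qi} := loc_map Qi.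
have hext z : ext lm J z -> exists a s, [/\ ~ Q s, J a & lm s * z = lm a].
  move: z; apply: ext_min; last by move=> a ha; exists a, 1; rewrite rmorph1 mul1r; split=> //; exact: prime1.
  split.
  - by exists 0, 1; rewrite mulr0 rmorph0; split=> //; [exact: prime1 | exact: isid0].
  - move=> x y [a [s [hs ha e1]]] [b [r [hr hb e2]]]; exists (r * a + s * b), (s * r); split; first exact: primeNM.
      by apply: isidD => //; exact: isidM.
    by rewrite rmorphD !rmorphM -e1 -e2; ring.
  - move=> c x [a [s [hs ha e1]]]; have [d [r [hr ec]]] := loc_mkW c.
    exists (d * a), (r * s); split; [apply: primeNM => //; by apply/hQi/negP | exact: isidM |].
    by rewrite !rmorphM -e1 -(loc_frac_eq d hr) ec -/lm; ring.
have hsat t : ext lm J (lm t) -> sat Q J t.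
  move=> /hext[a [s [hs ha e]]]; have [|u hu e'] := @loc_map_eq0 _ Qi (s * t - a).
    by rewrite rmorphB rmorphM -/lm e subrr.
  exists (u * s); first by apply: primeNM => //; apply/hQi/negP.
  rewrite (_ : u * s * t = u * (s * t - a) + u * a); last by ring.
  by rewrite e' add0r; exact: isidM.
have hp1 : ~ ext lm J 1.
  by rewrite -(rmorph1 lm) => /hsat[u hu]; rewrite mulr1 => /hJQ.
have [K hK] := ideal_set_idealr (ext_id lm J) hp1.
pose X : comNzRingType := {ideal_quot K}.
pose rho : {rmorphism polyn T m -> X} := (\pi_{ideal_quot K} : {rmorphism localization Qi -> X}) \o lm.
have rho0 t : rho t = 0 <-> ext lm J (lm t).
  rewrite -(rmorph0 (\pi_{ideal_quot K} : {rmorphism localization Qi -> X})) /rho /=.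
  by rewrite quot_projP subr0; exact: hK.
have rhoF b : psi b = 0 -> rho (F b) = 0.
  move=> hb; apply/rho0; apply: ext_in; apply: ext_in.
  by rewrite /contr /= /Q /contr /= h3 hb rmorph0; exact: isid0 (prime_id hq).
have hjq y : y != 0 -> ~ q (j y).
  move=> hy hq'; apply: (prime1 hq); rewrite -(rmorph1 j) -(mulVf hy) rmorphM; exact: isidM (prime_id hq) hq'.
have hCQ u : u \notin P -> ~ Q (polynC T m (phi u)).
  by move=> /res_neq0 hu; rewrite /Q /contr /= h2 hij; exact: hjq.
have hunit u : u \notin P -> exists x, x * rho (polynC T m (phi u)) = 1.
  move=> /hCQ hu; have hu' : polynC T m (phi u) \notin Qi by apply/negP => /hQi.
  exists (\pi_{ideal_quot K} (loc_mk 1 hu')); rewrite /rho /= -rmorphM mulrC.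
  by rewrite (loc_frac_eq 1 hu') !rmorph1.
have [||||w hw] := frac_factor (h := psi) (k := rho \o F) (U := [set polynC A m u | u in [set u | u \notin P]]) _ _ _ _ rhoF.
- by exists 1; [exact: primeN1 | exact: rmorph1].
- by move=> _ _ [u hu <-] [v hv <-]; exists (u * v); [exact: primeN_mul | exact: rmorphM].
- move=> y; have [u [b [hu e]]] := h4 y; exists (polynC A m u), b; rewrite h1; split=> //.
  by exists u.
- by move=> _ [u hu <-]; have [v hv] := hunit u hu; exists v; rewrite -hv /F /= polynM_C.
pose v : {rmorphism T -> X} := rho \o polynC T m.
have [_ huniv] := hS; have [|[g [hg1 hg2]] _] := huniv X v w.
  by move=> a; change (rho (polynC T m (phi a)) = w (h a)); rewrite -h1 hw /F /= polynM_C.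
have e : forall t, (g \o th) t = rho t.
  apply: (polyn_hom_ext (phi := phi)) => [t|b] /=; first by rewrite h2; exact: hg1.
  rewrite h3; have /= -> := hg2 (psi b); exact: hw.
by move=> t ht; apply: hsat; apply/rho0; rewrite -e /= ht rmorph0.
Qed.
End Tensor.

Section TensorRegular.
Variables (A T S0 : comNzRingType) (phi : {rmorphism A -> T}) (eps : {rmorphism S0 -> T}).
Hypotheses (hA : noeth A) (hAc : char0u A) (hT : noeth T).
Hypotheses (hS : noeth S0) (hSc : char0u S0) (hSJ : Jprop S0) (hsurj : forall y, exists x, eps x = y).
Hypothesis hfib : forall q, isprime q -> exists n, reg (ext phi (contr phi q)) q n.

Lemma tensor_regular (P : prime_idealr A) (L : fieldType) (f : {rmorphism residue_field P -> L})
  (S : comNzRingType) (i : {rmorphism T -> S}) (j : {rmorphism L -> S}) :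
  finite_extension f -> is_tensor_product phi (f \o residue_map P) i j -> regular_ring S.
Proof.
move=> [s hs] hten.
have [psi [th [h1 h2 h3 h4]]] := eval_exists hten s.
(* Members of L are combinations of [s] over the residue field; a common denominator in A outside
   [P] turns them into values of [psi]. *)
have hY y : exists u b, u \notin P /\ f (residue_map P u) * y = psi b.
  have [c ->] := hs y; pose Z : set L := [set y | exists u b, u \notin P /\ f (residue_map P u) * y = psi b].
  have hZ0 : Z 0 by exists 1, 0; rewrite primeN1 mulr0 rmorph0.
  suff hZs (n : nat) (F : 'I_n -> L) : (forall k, Z (F k)) -> Z (\sum_k F k).
    apply: hZs => k; have [b [u [hu e]]] := residue_frac (c k).
    have [b' hb'] := h4 _ (mem_nth 0 (ltn_ord k)).
    exists u, (polynC A _ b * b'); split=> //.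
    by rewrite mulrA -rmorphM e rmorphM h1 hb'.
  move=> hF; elim/big_rec: _ => // k y' _ [u [b [hu e]]]; have [u' [b' [hu' e']]] := hF k.
  exists (u' * u), (polynC A _ u * b' + polynC A _ u' * b); split; first exact: primeN_mul.
  by rewrite rmorphD !rmorphM !h1 /= -e -e'; ring.
have hfr := tensor_frac hten h1 h2 h3 hY.
have hunit u : u \notin P -> exists y, y * i (phi u) = 1.
  move=> hu; have h0 := res_neq0 f hu; exists (j ((f \o residue_map P) u)^-1).
  by have [e _] := hten; rewrite [i _]e -rmorphM mulVf ?rmorph1.
have hnS : noeth S.
  move=> J hJ; have [t ht] := polyn_noeth hT (contr_id th hJ).
  exists (map th t); apply: noeth_spn => //.
    move=> _ /mapP[a ha ->]; have : contr th J a by rewrite ht; apply: spn_mem => //; exact: zid_id.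
    by [].
  have hid : isid (spn (@zid S) (map th t)) by apply: gen_id; [exact: setT_id | exact: zid_id].
  move=> z hz; have [u [a [hu e]]] := hfr z; have [y hy] := hunit u hu.
  rewrite -(mul1r z) -hy -mulrA e; apply: isidM => //.
  have ha : contr th J a by rewrite /contr /= -e; exact: isidM.
  rewrite ht in ha; have := ext_spn th (@zid_id _) ha; apply: gen_mono => //.
  by apply: ext_min; [exact: zid_id | move=> x ->; exact: rmorph0].
split; first exact/noetherianP.
move=> q; apply/(reg_localizationP q hnS); have hq := prime_idealr_isprime q.
have hQ := contr_prime th hq.
have [n hn] := fiber_reg hA hAc hS hSc hSJ hsurj hfib hQ.
exists n; have hk := tensor_ker hten hq h1 h2 h3 hY.
apply: (proj1 (reg_ess (ext_id _ _) hq _ hk _ n)) hn.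
  move=> z; have [u [t [hu e]]] := hfr z; exists (polynC T _ (phi u)), t; rewrite h2; split=> //.
  rewrite /contr /= h2 => hqu; have [y hy] := hunit u hu.
  by apply: (prime1 hq); rewrite -hy; exact: isidM (prime_id hq) hqu.
move=> t; apply: (ext_min (Q := [set t | th t = 0])).
  split=> [|x y /= hx hy|a x /= hx]; rewrite /= ?rmorph0 ?rmorphD ?rmorphM ?hx ?hy ?addr0 ?mulr0 //.
move=> b; rewrite /contr /= h3 => hb; have [->|hb0] := eqVneq (psi b) 0; first exact: rmorph0.
exfalso; apply: (prime1 hq); rewrite -(rmorph1 j) -(mulVf hb0) rmorphM; exact: isidM (prime_id hq) hb.
Qed.
End TensorRegular.

Section OpenDescent.
Variables (A T S0 : comNzRingType) (phi : {rmorphism A -> T}) (eps : {rmorphism S0 -> T}).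
Hypotheses (hA : noeth A) (hAc : char0u A) (hT : noeth T) (hffl : faithfully_flat phi).
Hypotheses (hS : noeth S0) (hSc : char0u S0) (hSJ : Jprop S0) (hsurj : forall y, exists x, eps x = y).
Hypothesis hfib : forall q, isprime q -> exists n, reg (ext phi (contr phi q)) q n.

Lemma polynM_ffl m : faithfully_flat (polynM phi m).
Proof. by elim: m => [|m IH] //=; exact: ffl_poly. Qed.

Lemma reg_polynM m (J : set (polyn A m)) Q : isid J -> isprime Q -> J `<=` contr (polynM phi m) Q ->
  (exists n, reg J (contr (polynM phi m) Q) n) <-> (exists n, reg (ext (polynM phi m) J) Q n).
Proof.
move=> hJ hQ hJQ; have [hfl _] := polynM_ffl m.
have [e he] := fiber_reg hA hAc hS hSc hSJ hsurj hfib hQ.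
have hnA := polyn_noeth (m := m) hA; have hnT := polyn_noeth (m := m) hT.
split=> -[n hn]; first by exists (n + e)%N; exact: (reg_ascent hnT hfl hJ hQ (erefl _) hn he).
exact: (reg_descent hnA hnT hfl hJ (contr_prime _ hQ) hJQ (erefl _) hn he).
Qed.

(* A minimal prime Qj of the singular locus of T[X]/J T[X] contracting into q0 would be a
   generization of a prime over q0, hence regular. *)
Lemma reg_open_descent m (J q0 : set (polyn A m)) d : isid J -> reg J q0 d ->
  exists2 e, ~ q0 e & forall q, isprime q -> J `<=` q -> ~ q e -> exists n, reg J q n.
Proof.
move=> hJ hreg; set F := polynM phi m; set J' := ext F J.
have [hfl hfl1] := polynM_ffl m; have hnT := polyn_noeth (m := m) hT.
have hJ' : isid J' := ext_id F J.
have hop Q n : reg J' Q n -> exists2 w, sing J' w & ~ Q w.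
  apply: (@sing_open (polyn S0 m) _ (polynM eps m)) => //; first exact: polyn_noeth.
  - exact: (char0u_map (polynC S0 m)).
  - exact: polyn_Jprop.
  - exact: polynM_surj.
have hsing : isid (sing J') := sing_id J'.
have hq0 := reg_prime hreg.
have hlift Q : J `<=` contr F Q -> isprime Q -> J' `<=` Q.
  by move=> h hQ; apply: ext_min; [exact: prime_id | exact: h].
have [hC|[e he1 he2]] : contr F (sing J') `<=` q0 \/ exists2 e, contr F (sing J') e & ~ q0 e.
- have [h|h] := pselect (contr F (sing J') `<=` q0); [by left | right].
  by apply: contrapT => h'; apply: h => x hx; apply: contrapT => hx'; apply: h'; exists x.
- exfalso; have [ps hps1 hps2] := minprimes hnT hsing.
  have [Qj hj1 hj2] : exists2 Qj, List.In Qj ps & contr F Qj `<=` q0.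
    apply: contrapT => hno.
    have [| |w hw [_ hw']] := @avoid_witness _ (List.map (contr F) ps) setT q0 (@setT_id _) hq0.
    - move=> q /List.in_map_iff[Qj [<- hin]]; have [hp _ _] := hps1 _ hin.
      split; first exact: contr_id (prime_id hp).
      by move=> hsub; apply: hno; exists Qj.
    - by move=> h; apply: (prime1 hq0); exact: h.
    apply: hw; apply: hC => Q hQ hJQ hbad.
    have [p hp hpQ] := hps2 Q hQ (fun x (hx : sing J' x) => hx Q hQ hJQ hbad).
    by apply: hpQ; apply: (hw' (contr F p)); apply/List.in_map_iff; exists p.
  have [hQj hsj _] := hps1 _ hj1.
  have hJj : J `<=` contr F Qj.
    by move=> x hx; apply: hsj => Q hQ hJQ _; apply: hJQ; exact: ext_in.
  have [Q hQ eQ] := lying_over_flat hnT (conj hfl hfl1) hq0.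
  have [|Q' hQ' [hQ'Q eQ']] := going_down hnT hfl (contr_prime F hQj) hQ; first by rewrite eQ.
  have hJQ : J `<=` contr F Q by rewrite eQ; exact: reg_sub hreg.
  have [|n hn] := proj1 (reg_polynM hJ hQ hJQ); first by exists d; rewrite eQ.
  have [w hw hwQ] := hop _ _ hn.
  have hJQ' : J `<=` contr F Q' by rewrite eQ'.
  have hreg' : exists n, reg J' Q' n.
    by apply: contrapT => hbad; apply: hwQ; apply: hQ'Q; apply: hw => //; exact: hlift.
  have := proj2 (reg_polynM hJ hQ' hJQ') hreg'; rewrite eQ' => /(reg_polynM hJ hQj hJj)[n' hn'].
  by have [w' hw' hwQj] := hop _ _ hn'; apply: hwQj; exact: hsj.
- exists e => // q hq hJq hqe; apply: contrapT => hbad; apply: hqe.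
  have [Q hQ eQ] := lying_over_flat hnT (conj hfl hfl1) hq; rewrite -eQ.
  have hJQ : J `<=` contr F Q by rewrite eQ.
  apply: he1 => //; first exact: hlift.
  by move=> /(reg_polynM hJ hQ hJQ); rewrite eQ.
Qed.

Lemma fg_surj (B : comNzRingType) (f : {rmorphism A -> B}) : finitely_generated_algebra f ->
  exists m (ev : {rmorphism polyn A m -> B}), forall b, exists x, ev x = b.
Proof.
move=> [s hs].
have [ev [hev1 hev2]] : exists ev : {rmorphism polyn A (size s) -> B}, (forall a, ev (polynC A _ a) = f a) /\ forall x, x \in s -> exists b, ev b = x.
  elim: {hs} s => [|x s [ev [h1 h2]]] /=; first by exists f.
  have c1 : commr_rmorph ev x by move=> a; exact: mulrC.
  exists (horner_morph c1); split=> [a|y] /=; first by rewrite horner_morphC h1.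
  rewrite inE => /predU1P[->|/h2[b hb]]; first by exists 'X; exact: horner_morphX.
  by exists b%:P; rewrite horner_morphC hb.
exists (size s), ev => b; pose Z : {pred B} := fun b => `[< exists x, ev x = b >].
have /asboolP // : b \in Z; apply: hs.
- split; first by apply/asboolP; exists 1; rewrite rmorph1.
  + by move=> _ _ /asboolP[x <-] /asboolP[y <-]; apply/asboolP; exists (x - y); rewrite rmorphB.
  + by move=> _ _ /asboolP[x <-] /asboolP[y <-]; apply/asboolP; exists (x * y); rewrite rmorphM.
- by move=> a; apply/asboolP; exists (polynC A _ a).
- by move=> x /hev2 h; apply/asboolP.
Qed.

Lemma fg_regular_open (B : comNzRingType) (f : {rmorphism A -> B}) :
  finitely_generated_algebra f -> zariski_open (@regular_locus B).
Proof.
move=> /fg_surj[m [ev hev]].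
have hnB : noeth B.
  move=> I hI; have [t ht] := polyn_noeth hA (contr_id ev hI).
  exists (map ev t); apply: seteqI.
    move=> z hz; have [x ex] := hev z; rewrite -ex; apply/spn_surj => //.
    have hx : contr ev I x by rewrite /contr /= ex.
    by rewrite ht in hx; apply: gen_mono hx => //; exact: zid_sub (contr_id ev (@zid_id B)).
  apply: spn_min => //; first exact: zid_sub.
  by move=> _ /mapP[a ha ->]; change (contr ev I a); rewrite ht; apply: spn_mem => //; exact: zid_id.
pose J := contr ev (@zid B); have hJ : isid J := contr_id ev (@zid_id B).
have hlocus q : regular_locus q <-> exists n, reg J (contr ev [set x | x \in q]) n.
  have hq := prime_idealr_isprime q.
  split=> [/(reg_localizationP q hnB)[n hn]|[n hn]].
    by exists n; apply/(reg_surj hev n (@zid_id B) hq).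
  by apply/(reg_localizationP q hnB); exists n; apply/(reg_surj hev n (@zid_id B) hq).
(* The largest possible choice: all e whose nonvanishing forces regularity. *)
exists [set e | forall q : prime_idealr B, e \notin q -> regular_locus q] => q; split; last by move=> [e he]; exact: he.
move=> /hlocus[n hn]; have [e he he'] := reg_open_descent hJ hn.
exists (ev e); last exact/negP.
move=> q' hq'; apply/hlocus; apply: he'.
- exact: contr_prime (prime_idealr_isprime q').
- by move=> x hx; change (ev x \in q'); rewrite hx idealr0.
- by move=> h; move/negP: hq'; apply.
Qed.
End OpenDescent.

Lemma mem_In (I : eqType) (x : I) s : x \in s -> List.In x s.
Proof.
by elim: s => [|y s IH] //=; rewrite inE => /predU1P[->|/IH h]; [left | right].
Qed.

Lemma bij_inv_rmorph (A B : comNzRingType) (f : {rmorphism A -> B}) : bijective f ->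
  exists g : {rmorphism B -> A}, cancel f g /\ cancel g f.
Proof.
move=> [g0 h1 h2]; have hi := can_inj h1.
have [|||g hg] := @rmorph_exists B A g0.
- by move=> x y; apply: hi; rewrite rmorphD !h2.
- by move=> x y; apply: hi; rewrite rmorphM !h2.
- by apply: hi; rewrite h2 rmorph1.
by exists g; split=> x; rewrite hg.
Qed.

Lemma enumerable_countable (T : Type) : enumerable (@setT T) -> countable [set: T].
Proof.
move=> [e he]; have /choice[f hf] := fun x => he x Logic.I.
by apply/countable_injP; exists f => x y _ _ exy; rewrite -(hf x) exy hf.
Qed.

Lemma countable_reps (T : comNzRingType) (M : idealr T) : countable [set: {ideal_quot M}] ->
  exists rho : nat -> T, forall t, exists n, t - rho n \in M.
Proof.
move=> /countable_injP[f hf].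
pose rho n := if pselect (exists t, f (\pi_{ideal_quot M} t) = n) is left e then projT1 (cid e) else 0.
exists rho => t; exists (f (\pi_{ideal_quot M} t)); apply/quot_projP.
rewrite /rho; case: pselect => [e|[]]; last by exists t.
by apply: hf; rewrite ?in_setT //; rewrite (projT2 (cid e)).
Qed.

Lemma minimal_prime_minover (R : comNzRingType) (P : prime_idealr R) : minimal_prime P -> minimal_over (@zid R) [set x | x \in P].
Proof.
move=> hP; split; [exact: prime_idealr_isprime | exact: zid_sub (prime_id (prime_idealr_isprime P)) |].
move=> Q hQ _ hQP; have [Qi hQi] := prime_set_idealr hQ.
apply: contrapT => hn; apply: (hP Qi); split; first by move=> x /hQi; exact: hQP.
by move=> hsub; apply: hn => x /hsub /hQi.
Qed.

Lemma schain_max_chain (A : comNzRingType) (N : idealr A) m (c : nat -> set A) :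
  sat_chain [set x | x \in N] m c -> exists c', max_saturated_chain N m c'.
Proof.
move=> [h1 h2 h3 h4 h5]; have [c' hc'] := sets_prime_idealr h1.
exists c'; split.
- move=> i hi; have [h6 h7] := h4 i hi; split; first by move=> x /hc' /h6 /hc'.
  by move=> hs; apply: h7 => x /hc' /hs /hc'.
- move=> i hi Q [[a1 a2] [b1 b2]].
  have [|||h|h] := h5 i [set x | x \in Q] hi; first exact: prime_idealr_isprime.
  + by move=> x /hc' /a1.
  + by move=> x /= /b1 /hc'.
  + by apply: a2 => x hx; apply/hc'; exact: h.
  + by apply: b2 => x /hc' /h.
- by move=> x; rewrite hc' h2.
- move=> x; have e : (x \in c' m) <-> (x \in N) by rewrite hc' h3.
  by apply/idP/idP => /e.
Qed.

Section QuasiExcellent.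
Variables (A T : comNzRingType) (phi : {rmorphism A -> T}) (N : idealr A) (M : set T) (g : {rmorphism completion N -> T}).
Hypotheses (hcl : complete_local M) (hch : forall n, ~ M n.+1%:R) (hA : noeth A) (hAc : char0u A) (hffl : faithfully_flat phi).
Hypothesis hfib : forall q, isprime q -> exists n, reg (ext phi (contr phi q)) q n.
Hypotheses (hg : bijective g) (hgphi : forall a, g (completion_map N a) = phi a).

Lemma quasi_excellent_of_fibres : quasi_excellent N.
Proof.
have [S0 [eps [hS hSc hSJ hs]]] := complete_local_cover hcl hch; have [hT _ _ _ _] := hcl.
split=> [P L f hf S i j [e huniv]|B f]; last exact: (fg_regular_open hA hAc hT hffl hS hSc hSJ hs hfib).
have [k [hk1 hk2]] := bij_inv_rmorph hg.
apply: (tensor_regular (phi := phi) hA hAc hT hS hSc hSJ hs hfib (i := i \o k) hf (j := j)).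
split=> [a|X u v huv]; first by rewrite /= -hgphi hk1; exact: e.
have [|[r [hr1 hr2]] hu] := huniv X (u \o g) v; first by move=> a; rewrite /= hgphi; exact: huv.
split; first by exists r; split=> // t; have /= -> := hr1 (k t); rewrite hk2.
by move=> h h' e1 e2; apply: hu => // x; have := e1 (g x); rewrite /= hk1.
Qed.
End QuasiExcellent.

(** Transports the model to the isomorphic [idomainType] that the theorem asks for. *)
Lemma dense_model_iso (A D T : comNzRingType) (phi : {rmorphism A -> T}) (M : set T) (f : {rmorphism A -> D}) (k : {rmorphism D -> A}) :
  cancel f k -> cancel k f -> dense_model phi M -> dense_model (phi \o k) M.
Proof.
move=> hf hk [h1 h2 [e he] h4 [s hs] h6 h7].
have ek : contr k (@zid A) = @zid D.
  by apply: seteqI => x; rewrite /contr /= /zid => hx; [apply: (can_inj hk); rewrite hx rmorph0 | rewrite hx rmorph0].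
have ksurj y : exists x, k x = y by exists (f y).
split.
- exact: inj_comp h1 (can_inj hk).
- by rewrite -ek; exact: contr_prime.
- by exists (f \o e) => x _; have [n hn] := he (k x) Logic.I; exists n; rewrite /= hn.
- by move=> s' c; rewrite map_comp => /h4 /(spn_surj ksurj); rewrite ek.
- by exists (map f s); rewrite hs -map_comp; congr (spn _ _); apply: eq_map => a /=; rewrite hf.
- by move=> t; have [a ha] := h6 t; exists (f a); rewrite /= hf.
- move=> Q hQ; have [n hn] := h7 Q hQ; exists n.
  suff -> : ext (phi \o k) (contr (phi \o k) Q) = ext phi (contr phi Q) by [].
  apply: seteqI; apply: ext_min; try exact: ext_id.
    by move=> x hx; exact: (ext_in phi).
  move=> x hx; rewrite -(hf x); apply: (ext_in (phi \o k)); by rewrite /contr /= hf.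
Qed.

Section Existence.
Variables (T : comNzRingType) (M : idealr T).
Hypotheses (hloc : local_ring M) (hcomp : adically_complete M) (hrat : contains_rationals T) (hred : reduced T).
Local Notation MS := [set x | x \in M].

Lemma rat_unit n : exists y : T, y * n.+1%:R = 1.
Proof.
have [f _] := hrat; exists (f (n.+1%:R^-1)).
by rewrite -(rmorph_nat f) -rmorphM mulVf ?rmorph1 // Num.Theory.pnatr_eq0.
Qed.

Lemma natS_notin_max n : ~ MS n.+1%:R.
Proof.
move=> /= h; have [y hy] := rat_unit n.
have h1 : isid MS := prime_id (local_prime hloc).
by apply: (prime1 (local_prime hloc)); rewrite -hy; exact: isidM.
Qed.

Lemma exists_quasi_excellent (n : nat) (m : 'I_n -> nat) (P : 'I_n -> prime_idealr T) :
  (1 <= n)%N -> (forall i, (1 < m i)%N) -> countable [set: {ideal_quot M}] ->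
  (forall i, minimal_prime (P i) /\ has_krull_dim {ideal_quot (P i)} (m i)) ->
  exists (A : idomainType) (N : idealr A),
     [/\ local_ring N, countable [set: A], quasi_excellent N, is_completion_of T N &
         forall i, exists c : nat -> prime_idealr A, max_saturated_chain N (m i) c].
Proof.
move=> n1 hm hcnt hP; have hcl := complete_local_of hloc hcomp; have [hT _ _ _ _] := hcl.
have hch := natS_notin_max; have hM := local_prime hloc.
have [rho hrho] := countable_reps hcnt.
have [mp hmp1 hmp2] := minprimes hT (@zid_id T).
have {}hmp2 Q : isprime Q -> exists2 p, List.In p mp & p `<=` Q.
  by move=> hQ; apply: hmp2 => //; exact: zid_sub (prime_id hQ).
have hPd i := proj1 (quot_dim (P i) (m i) hloc) (proj2 (hP i)).
(* T has positive dimension, since n >= 1 provides a quotient of dimension greater than 1; so [M] is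
   not a minimal prime. *)
have hMp p : List.In p mp -> ~ (MS `<=` p).
  move=> /hmp1[hp _ hmin] hMp; have [hd _] := hPd (Ordinal n1).
  have hd1 := height_ge_le (hm _) hd.
  have hPp : [set x | x \in P (Ordinal n1)] `<=` p by move=> x hx; apply: hMp; exact: height_ge_sub hd _ hx.
  have [P' [h1 h2 h3]] := proj2 (height_ge_leS hd1).
  have [hP' _] := h1; apply: h3 => x hx.
  by apply: (hmin P') => //; [exact: zid_sub (prime_id hP') | move=> y /h2 /hMp | exact: hMp].
have hPmp i : List.In [set x | x \in P i] mp.
  have [h1 h2 h3] := minimal_prime_minover (proj1 (hP i)).
  have [p hp1 hp2] := hmp2 _ h1; have [hp _ _] := hmp1 _ hp1.
  suff -> : [set x | x \in P i] = p by [].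
  by apply: seteqI => //; apply: h3 => //; exact: zid_sub (prime_id hp).
have hpos i : (0 < (m i).-1)%N by have := hm i; case: (m i) => [|[]].
have hS i : (m i).-1.+1 = m i by rewrite prednK //; exact: ltnW (hm i).
have /choice[Q hQ] : forall i, exists Q, [/\ isprime Q, forall p, List.In p mp -> ~ (Q `<=` p), height_ge Q MS (m i).-1, ~ height_ge Q MS (m i).-1.+1 & ~ height_ge (@zid T) Q 2].
  move=> i; apply: (chain_prime hcl hch hmp1 hmp2 (hPmp i) (hpos i)); rewrite hS.
    exact: (hPd i).1.
  exact: (hPd i).2.
have [|A0 [phi0 [hmod0 hgen0]]] := model_exists (Sp := List.map Q (enum 'I_n)) hcl hch (fun x k => hred (x := x) (k := k)) hrho hmp1 hmp2 hMp.
  by move=> _ /List.in_map_iff[i [<- _]]; have [] := hQ i.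
have hgen i : exists u, Q i = spn (@zid T) (map phi0 u).
  have [_ h _ _ _] := hQ i; apply: hgen0 => //.
  by apply/List.in_map_iff; exists i; split=> //; apply: mem_In; rewrite mem_enum.
have [D [f hf]] := dom_exists (dm_dom hmod0); have [k [hk1 hk2]] := bij_inv_rmorph hf.
pose phi : {rmorphism D -> T} := phi0 \o k.
have hmod : dense_model phi MS := dense_model_iso hk1 hk2 hmod0.
have [h1 h2 h3 h4 [s hs] h6 h7] := hmod.
have hNp := contr_prime phi hM.
have [N hN] := ideal_set_idealr (prime_id hNp) (prime1 hNp).
have eN : [set x | x \in N] = contr phi MS by apply: seteqI => x /hN.
have hMN := ext_max hs; have hnD := dense_noeth hcl h4.
have [||g [hg1 hg2]] := @to_completion D T phi N MS hcl.
- by move=> j x; rewrite eN; exact: dense_pw.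
- exact: dense_approx.
exists D, N; split.
- apply: units_local => // x /negP hx; apply: (dense_unit hcl h4) => hx'.
  by apply: hx; apply/hN.
- exact: enumerable_countable.
- apply: (quasi_excellent_of_fibres hcl hch hnD _ _ h7 hg1 hg2); last exact: model_ffl hmod.
  move=> j; apply: (dense_unit hcl h4); rewrite /contr /= !rmorph_nat; exact: hch.
- by exists g.
move=> i; have [q1 q2 q3 q4 q5] := hQ i; have [u hu] := hgen i.
have [||c hc] := @model_chain D T phi MS hcl hmod (Q i) (map f u) (m i).-1 q1 _ _ (hpos i) q3 q4 q5.
- by rewrite hu -map_comp; congr (spn _ _); apply: eq_map => a /=; rewrite hk1.
- move=> e; have [p hp _] := hmp2 _ hM; apply: (q2 p hp); rewrite e.
  by have [] := hmp1 _ hp.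
rewrite -eN hS in hc; exact: schain_max_chain hc.
Qed.
End Existence.

(** * Necessity of the conditions *)

Section Fractions.
Variables (T : comNzRingType) (W : set T).
(** With nonzerodivisors as denominators, equality of fractions is plain cross multiplication and T
    embeds. *)
Definition regular_mult := [/\ W 1, forall x y, W x -> W y -> W (x * y) & forall w t, W w -> w * t = 0 -> t = 0].

Record frac := Frac { fnum : T; fden : T; fdenP : W fden }.
HB.instance Definition _ := gen_eqMixin frac.
HB.instance Definition _ := gen_choiceMixin frac.

Definition frac_equiv of regular_mult : rel frac :=
  fun x y => `[< fnum x * fden y = fnum y * fden x >].

Hypothesis hW : regular_mult.

Lemma frac_equiv_is_equiv : equiv_class_of (frac_equiv hW).
Proof.
have [_ _ hreg] := hW; split=> [x|x y|y x z].
- exact/asboolP.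
- by apply/asboolP/asboolP => ->.
- move=> /asboolP e /asboolP e'; apply/asboolP; apply/subr0_eq.
  apply: (hreg _ _ (fdenP y)).
  have -> : fden y * (fnum x * fden z - fnum z * fden x) =
    fden z * (fnum x * fden y) - fden x * (fnum z * fden y) by ring.
  by rewrite e -e'; ring.
Qed.

Canonical frac_equiv_equiv := EquivRelPack frac_equiv_is_equiv.
Canonical frac_equiv_encModRel := defaultEncModRel (frac_equiv hW).
Definition fracs := {eq_quot (frac_equiv hW)}.
HB.instance Definition _ : EqQuotient frac (frac_equiv hW) fracs := EqQuotient.on fracs.
HB.instance Definition _ := Choice.on fracs.

Definition fmk t a (ha : W a) : fracs := \pi_fracs (Frac t ha).

Lemma fmkP t a (ha : W a) s b (hb : W b) : fmk t ha = fmk s hb <-> t * b = s * a.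
Proof.
split=> [/eqP|h]; first by rewrite /fmk piE => /asboolP.
by apply/eqP; rewrite /fmk piE; apply/asboolP.
Qed.

Lemma fmkW (z : fracs) : exists t a (ha : W a), z = fmk t ha.
Proof.
by exists (fnum (repr z)), (fden (repr z)), (fdenP (repr z)); rewrite /fmk; case: (repr z) (reprK z) => //= a s h <-.
Qed.

Let h1 : W 1. Proof. by case: hW. Qed.
Let hM x y : W x -> W y -> W (x * y). Proof. by case: hW => _ h _; exact: h. Qed.

Definition fr_opp (x : fracs) : fracs := fmk (- fnum (repr x)) (fdenP (repr x)).
Definition fr_add (x y : fracs) : fracs :=
  fmk (fnum (repr x) * fden (repr y) + fnum (repr y) * fden (repr x)) (hM (fdenP (repr x)) (fdenP (repr y))).
Definition fr_mul (x y : fracs) : fracs :=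
  fmk (fnum (repr x) * fnum (repr y)) (hM (fdenP (repr x)) (fdenP (repr y))).

Lemma fmk_repr t a (ha : W a) : fnum (repr (fmk t ha)) * a = t * fden (repr (fmk t ha)).
Proof.
apply/(fmkP _ (fdenP (repr (fmk t ha))) t ha).
by rewrite {1}/fmk; case: (repr (fmk t ha)) (reprK (fmk t ha)).
Qed.

Lemma fr_addE t a (ha : W a) s b (hb : W b) : fr_add (fmk t ha) (fmk s hb) = fmk (t * b + s * a) (hM ha hb).
Proof.
apply/fmkP; move: (fmk_repr t ha) (fmk_repr s hb).
move: (repr (fmk t ha)) (repr (fmk s hb)) => [t' a' ha'] [s' b' hb'] /= e f.
rewrite (_ : _ * _ = t' * a * (b * b') + s' * b * (a * a')); last by ring.
by rewrite e f; ring.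
Qed.

Lemma fr_mulE t a (ha : W a) s b (hb : W b) : fr_mul (fmk t ha) (fmk s hb) = fmk (t * s) (hM ha hb).
Proof.
apply/fmkP; move: (fmk_repr t ha) (fmk_repr s hb).
move: (repr (fmk t ha)) (repr (fmk s hb)) => [t' a' ha'] [s' b' hb'] /= e f.
rewrite (_ : _ * _ = t' * a * (s' * b)); last by ring.
by rewrite e f; ring.
Qed.

Lemma fr_oppE t a (ha : W a) : fr_opp (fmk t ha) = fmk (- t) ha.
Proof. by apply/fmkP; rewrite !mulNr fmk_repr. Qed.

Lemma fr_addA : associative fr_add.
Proof.
move=> x y z; have [a [s [hs ->]]] := fmkW x; have [b [t [ht ->]]] := fmkW y; have [c [r [hr ->]]] := fmkW z.
by rewrite !fr_addE; apply/fmkP; ring.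
Qed.
Lemma fr_addC : commutative fr_add.
Proof. by move=> x y; have [a [s [hs ->]]] := fmkW x; have [b [t [ht ->]]] := fmkW y; rewrite !fr_addE; apply/fmkP; ring. Qed.
Lemma fr_add0 : left_id (fmk 0 h1) fr_add.
Proof. by move=> x; have [a [s [hs ->]]] := fmkW x; rewrite fr_addE; apply/fmkP; ring. Qed.
Lemma fr_addN : left_inverse (fmk 0 h1) fr_opp fr_add.
Proof. by move=> x; have [a [s [hs ->]]] := fmkW x; rewrite fr_oppE fr_addE; apply/fmkP; ring. Qed.
HB.instance Definition _ := GRing.isZmodule.Build fracs fr_addA fr_addC fr_add0 fr_addN.

Lemma fr_mulA : associative fr_mul.
Proof.
move=> x y z; have [a [s [hs ->]]] := fmkW x; have [b [t [ht ->]]] := fmkW y; have [c [r [hr ->]]] := fmkW z.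
by rewrite !fr_mulE; apply/fmkP; ring.
Qed.
Lemma fr_mulC : commutative fr_mul.
Proof. by move=> x y; have [a [s [hs ->]]] := fmkW x; have [b [t [ht ->]]] := fmkW y; rewrite !fr_mulE; apply/fmkP; ring. Qed.
Lemma fr_mul1 : left_id (fmk 1 h1) fr_mul.
Proof. by move=> x; have [a [s [hs ->]]] := fmkW x; rewrite fr_mulE; apply/fmkP; ring. Qed.
Lemma fr_mulD : left_distributive fr_mul fr_add.
Proof.
move=> x y z; have [a [s [hs ->]]] := fmkW x; have [b [t [ht ->]]] := fmkW y; have [c [r [hr ->]]] := fmkW z.
by rewrite !(fr_mulE, fr_addE); apply/fmkP; ring.
Qed.
Lemma fr_one_neq0 : fmk 1 h1 != fmk 0 h1.
Proof. by apply/eqP => /fmkP /eqP; rewrite mul0r mulr1 oner_eq0. Qed.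
HB.instance Definition _ := GRing.Zmodule_isComNzRing.Build fracs fr_mulA fr_mulC fr_mul1 fr_mulD fr_one_neq0.

Lemma fraction_ring : exists (S : comNzRingType) (i : {rmorphism T -> S}),
  [/\ injective i, forall w, W w -> exists v, v * i w = 1 & forall z, exists w t, W w /\ i w * z = i t].
Proof.
have hi t s : fmk t h1 = fmk s h1 -> t = s by move=> /fmkP; rewrite !mulr1.
have [|||i ei] := @rmorph_exists T fracs (fun t => fmk t h1).
- by move=> x y; change (fmk (x + y) h1 = fr_add (fmk x h1) (fmk y h1)); rewrite fr_addE; apply/fmkP; ring.
- by move=> x y; change (fmk (x * y) h1 = fr_mul (fmk x h1) (fmk y h1)); rewrite fr_mulE; apply/fmkP; ring.
- by [].
exists fracs, i; split.
- by move=> x y; rewrite !ei; exact: hi.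
- move=> w hw; exists (fmk 1 hw); rewrite ei.
  by change (fr_mul (fmk 1 hw) (fmk w h1) = fmk 1 h1); rewrite fr_mulE; apply/fmkP; ring.
- move=> z; have [t [a [ha ->]]] := fmkW z; exists a, t; split=> //; rewrite !ei.
  by change (fr_mul (fmk a h1) (fmk t ha) = fmk t h1); rewrite fr_mulE; apply/fmkP; ring.
Qed.
End Fractions.

(** The annihilator of a nonzero nilpotent would lie in some prime; localized there the ring is a
    domain, so the nilpotent is killed by an element outside the prime. *)
Lemma regular_ring_reduced (S : comNzRingType) : regular_ring S -> reduced S.
Proof.
move=> [/noetherianP hS hreg] x k hx; apply: contrapT => hx0.
have hI := colon_id x (@zid_id S).
have [|q hq hIq] := prime_over hS hI; first by rewrite /zid /= mul1r.
have [Q hQ] := prime_set_idealr hq.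
have eQ : [set z | z \in Q] = q by apply: seteqI => z /hQ.
have [d] := proj1 (reg_localizationP Q hS) (hreg Q); rewrite eQ => hd.
have hp := reg_domain hS (@zid_id S) hd.
have [u hu hux] : sat q (@zid S) x by apply: (primeX (n := k) hp); rewrite hx; exact: isid0 (prime_id hp).
exact: hu (hIq _ hux).
Qed.

Section GenericFibre.
Variables (A : idomainType) (T : comNzRingType) (phi : {rmorphism A -> T}).
Hypothesis hreg : forall a t, a <> 0 -> phi a * t = 0 -> t = 0.

(** The residue field at 0 is Frac A, a finite extension of itself, and inverting the nonzero
    elements of A in T gives the tensor product, in which T embeds. *)
Lemma generic_fibre_reduced : (forall (P : prime_idealr A) (L : fieldType) (f : {rmorphism residue_field P -> L}), finite_extension f ->
   forall (S : comNzRingType) (i : {rmorphism T -> S}) (j : {rmorphism L -> S}),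
   is_tensor_product phi (f \o residue_map P) i j -> regular_ring S) -> reduced T.
Proof.
move=> hten; have hz : isprime (@zid A).
  split; [exact: zid_id | by move=> /eqP; rewrite oner_eq0 |].
  by move=> x y /eqP; rewrite mulf_eq0 => /orP[/eqP ->|/eqP ->]; [left | right].
have [P hP] := prime_set_idealr hz.
have hP0 u : u \notin P <-> u <> 0 by split=> [/negP h e|h]; [apply: h; apply/hP | apply/negP => /hP].
have [L [f hf]] := residue_field_exists P; pose h : {rmorphism A -> L} := f \o residue_map P.
have hh u : u <> 0 -> h u != 0 by move=> /hP0; exact: res_neq0.
have hfr y : exists u b, u <> 0 /\ h u * y = h b.
  case: hf => k fk kf; have [b [u [/hP0 hu e]]] := residue_frac (k y); exists u, b; split=> //.
  by change (f (residue_map P u) * y = f (residue_map P b)); rewrite -e rmorphM kf.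
pose W := phi @` [set a | a <> 0].
have hW : regular_mult W.
  split.
  - by exists 1; [apply/eqP; exact: oner_neq0 | exact: rmorph1].
  - move=> _ _ [a ha <-] [b hb <-]; exists (a * b); last exact: rmorphM.
    by move=> /eqP; rewrite mulf_eq0 => /orP[] /eqP.
  - by move=> _ t [a ha <-]; exact: hreg.
have [S [i [hinj hunit hS]]] := fraction_ring hW.
have huA u : u <> 0 -> exists v, v * i (phi u) = 1 by move=> hu; apply: hunit; exists u.
have U1 : [set a : A | a <> 0] 1 by apply/eqP; exact: oner_neq0.
have UM (a b : A) : a <> 0 -> b <> 0 -> a * b <> 0 by move=> /eqP ha /eqP hb; apply/eqP; rewrite mulf_neq0.
have [|j hj] := @frac_factor A L S h (i \o phi) [set a | a <> 0] U1 UM hfr huA.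
  by move=> b hb /=; have [->|/eqP /hh] := eqVneq b 0; [rewrite !rmorph0 | rewrite hb eqxx].
suff hreg' : regular_ring S.
  by move=> x k hx; apply: hinj; rewrite rmorph0; apply: (regular_ring_reduced hreg' (k := k)); rewrite -rmorphXn hx rmorph0.
apply: (hten P L f _ S i j).
  exists [:: 1] => y; have [k fk kf] := hf; exists (fun=> k y).
  by rewrite big_ord1 /= mulr1 kf.
split=> [a|X u v huv]; first by rewrite -[RHS]/(j (h a)) hj.
have hvu a : a <> 0 -> v (h a)^-1 * u (phi a) = 1.
  move=> ha; rewrite -[u (phi a)]/((u \o phi) a) huv -[(v \o _) a]/(v (h a)) -rmorphM mulVf ?rmorph1 //; exact: hh.
split.
  have [|||||r hr] := @frac_factor T S X i u W.
  - by case: hW.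
  - by case: hW.
  - exact: hS.
  - by move=> _ [a ha <-]; exists (v (h a)^-1); exact: hvu.
  - by move=> b; rewrite -(rmorph0 i) => /hinj ->; rewrite rmorph0.
  exists r; split=> // y; have [a [b [ha e]]] := hfr y.
  have e1 : u (phi a) * r (j y) = u (phi a) * v y.
    rewrite -[in LHS](hr (phi a)) -rmorphM -[i _]/((i \o phi) a) -hj -rmorphM e hj /= hr.
    rewrite -[u (phi b)]/((u \o phi) b) -[u (phi a)]/((u \o phi) a) !huv -[(v \o _) a]/(v (h a)) -rmorphM e //.
  by rewrite /= -(mul1r (r _)) -(hvu a ha) -mulrA e1 mulrA hvu // mul1r.
move=> r r' e1 e2 z; have [w [t [[a ha ew] e]]] := hS z; rewrite -ew in e.
have [x hx] := huA a ha.
have e3 : r (i (phi a)) * r z = r (i (phi a)) * r' z.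
  by rewrite -rmorphM e; have /= -> := e1 t; have /= -> := e1 (phi a); rewrite -rmorphM e.
by rewrite -(mul1r (r z)) -(mul1r (r' z)) -(rmorph1 r) -hx rmorphM -!mulrA e3.
Qed.
End GenericFibre.

Section Forward.
Variables (A : idomainType) (T : comNzRingType) (N : idealr A) (M : idealr T) (g : {rmorphism completion N -> T}).
Hypotheses (hN : local_ring N) (hM : local_ring M) (hMc : adically_complete M) (hrat : contains_rationals T) (hg : bijective g).
Local Notation MS := [set x | x \in M].
Local Notation NS := [set x | x \in N].
Let phi : {rmorphism A -> T} := g \o completion_map N.

Lemma quasi_excellent_reduced : quasi_excellent N -> reduced T.
Proof.
move=> [hqe _]; have [hfl hfl1] := fc_ffl hN hM hMc hg.
apply: (generic_fibre_reduced (phi := phi)).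
  move=> a t ha hat.
  have : ext phi (@zid A) (phi a * t) by rewrite hat; exact: isid0 (ext_id _ _).
  move=> /(flat_mod1 hfl (@zid_id A)) ht.
  have : zid t.
    apply: (ext_min (@zid_id T) _ ht) => x /eqP; rewrite mulf_eq0 => /orP[/eqP->|/eqP //]; exact: rmorph0.
  by [].
move=> P L f hf S i j [e huniv].
have [k [hk1 hk2]] := bij_inv_rmorph hg.
apply: (hqe P L f hf S (i \o g) j); split=> [a|X u v huv]; first exact: e.
have [|[r [hr1 hr2]] hu] := huniv X (u \o k) v; first by move=> a; rewrite /= hk1; exact: huv.
split; first by exists r; split=> // t; have /= -> := hr1 (g t); rewrite hk1.
by move=> h h' e1 e2; apply: hu => // x; have := e1 (k x); rewrite /= hk2.
Qed.

Lemma countable_residues : countable [set: A] -> countable [set: {ideal_quot M}].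
Proof.
move=> /countable_injP[f hf].
have /choice[a ha] : forall z : {ideal_quot M}, exists a, \pi_{ideal_quot M} (phi a) = z.
  move=> z; rewrite -(reprK z); have [a ha] := fc_approx hN hM hg 1 (repr z).
  exists a; apply/esym/quot_projP; rewrite pw1 in ha => //; exact: idealr_isid.
apply/countable_injP; exists (f \o a) => x y _ _ /= exy.
by rewrite -(ha x) -(ha y) (hf _ _ _ _ exy) ?in_setT.
Qed.

(** [Q'] is a minimal prime of pT inside [Q]; it contracts to [p] by going down. A prime between
    [Q'] and [Q] that contracts into [p] misses an a of [q] outside [p], while [Q] is minimal over
    Q' + (a), so it is [Q'] by the principal ideal theorem. [catenary] then counts dimensions. *)
Lemma adjacent_lift (p q : set A) (Q : set T) m : isprime p -> p `<=` q -> ~ (q `<=` p) ->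
  (forall r, isprime r -> p `<=` r -> r `<=` q -> r `<=` p \/ q `<=` r) ->
  isprime Q -> contr phi Q = q -> minimal_over (ext phi q) Q -> height_ge Q MS m -> ~ height_ge Q MS m.+1 ->
  exists Q', [/\ isprime Q', contr phi Q' = p, minimal_over (ext phi p) Q', height_ge Q' MS m.+1 & ~ height_ge Q' MS m.+2].
Proof.
move=> hp hpq hqp hadj hQ eQ [_ _ hmin] h1 h2.
have [hfl hfl1] := fc_ffl hN hM hMc hg; have hcl := complete_local_of hM hMc; have [hT _ _ _ _] := hcl.
have hextQ : ext phi p `<=` Q by apply: ext_min; [exact: prime_id | rewrite -eQ in hpq; exact: hpq].
have [Q' [hQ' hpQ' hmin'] hQ'Q] := minprime_exists hT (ext_id phi p) hQ hextQ.
have hpc : p `<=` contr phi Q' by move=> x hx; apply: hpQ'; exact: ext_in.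
have eQ' : contr phi Q' = p.
  have [Q1 h3 [h4 h5]] := going_down hT hfl hp hQ' hpc.
  apply: seteqI => //; rewrite -h5 => x hx; apply: (hmin' Q1) => //.
  by apply: ext_min; [exact: prime_id | rewrite -h5].
have hnQ : ~ (Q `<=` Q').
  by move=> h; apply: hqp; rewrite -eQ -eQ' => x hx; exact: h.
have hover P' : isprime P' -> P' `<=` Q -> q `<=` contr phi P' -> Q `<=` P'.
  by move=> hP' hP'Q hq; apply: (hmin P') => //; apply: ext_min; [exact: prime_id | exact: hq].
have hmid P' : isprime P' -> Q' `<=` P' -> P' `<=` Q -> contr phi P' `<=` p \/ q `<=` contr phi P'.
  move=> hP' h3 h4; apply: hadj; first exact: contr_prime.
    by rewrite -eQ' => x; exact: h3.
  by rewrite -eQ => x; exact: h4.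
have hadj' P' : isprime P' -> Q' `<=` P' -> P' `<=` Q -> P' `<=` Q' \/ Q `<=` P'.
  move=> hP' h3 h4; have [h5|/(hover P' hP' h4) h5] := hmid P' hP' h3 h4; last by right.
  left; have [a ha hna] : exists2 a, q a & ~ p a.
    by apply: contrapT => hno; apply: hqp => a ha; apply: contrapT => hna; apply: hno; exists a.
  apply: (krull_pit (Q := Q) (x := phi a) hT hQ' hP') => //; last first.
    by move=> h6; apply: hna; apply: h5; apply: h6; rewrite -eQ in ha.
  split=> //.
    apply: spn_min => //.
    by move=> b; rewrite inE => /eqP ->; rewrite -eQ in ha.
  move=> P2 hP2 hs h6; have h7 : Q' `<=` P2 by move=> x hx; apply: hs; apply: gen_base.
  have h8 : P2 (phi a) by apply: hs; apply: spn_mem; [exact: prime_id | rewrite inE].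
  by have [h9|h9] := hmid P2 hP2 h7 h6; [have := h9 a h8 | exact: hover].
exists Q'; split=> //.
  have h3 : height_ge Q' Q 1 by split=> //; exists Q'; split=> //; split.
  exact: height_ge_trans h3 h1.
move=> h3; apply: h2; exact: (catenary hcl (natS_notin_max hM hrat) hQ' hQ hQ'Q hnQ hadj' h3).
Qed.

Lemma chain_minimal_prime m (c : nat -> prime_idealr A) : max_saturated_chain N m c ->
  exists P : prime_idealr T, minimal_prime P /\ has_krull_dim {ideal_quot P} m.
Proof.
move=> [hc hsat hc0 hcm]; pose c' i := [set x | x \in c i].
(* The index counts from the top: after j steps the prime of T lies over the (m - j)-th term and has
   coheight j. *)
have lift j : (j <= m)%N -> exists Q, [/\ isprime Q, contr phi Q = c' (m - j)%N, minimal_over (ext phi (c' (m - j)%N)) Q, height_ge Q MS j & ~ height_ge Q MS j.+1].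
  elim: j => [_|j IH hj].
    have eN : c' (m - 0)%N = NS by rewrite subn0; apply: seteqI => x; rewrite /c' /= hcm.
    have hMp := local_prime hM.
    exists MS; rewrite eN; split=> //.
    - exact: fc_contr hN hM hg.
    - split=> // [|P hP hN' _]; last by move=> x hx; apply: hN'; exact: (fc_max hN hM hg).
      rewrite -(fc_contr hN hM hg); apply: ext_min; first exact: prime_id.
      by move=> x.
    - by split.
    - by move=> [_ [P [[_ h1] h2 h3]]]; exact: h3.
  have [Q [h1 h2 h3 h4 h5]] := IH (ltnW hj).
  have ek : (m - j)%N = (m - j.+1).+1 by rewrite subnSK.
  rewrite ek in h2 h3; have hi : (m - j.+1 < m)%N by rewrite ltn_subrL (leq_trans _ hj).
  have [a1 a2] := hc _ hi.
  apply: (@adjacent_lift (c' (m - j.+1)%N) (c' (m - j.+1).+1) Q j (prime_idealr_isprime _) a1 a2 _ h1 h2 h3 h4 h5).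
  move=> r hr hr1 hr2; have [Ri hRi] := prime_set_idealr hr.
  apply: contrapT => /not_orP[b1 b2]; apply: (hsat _ hi Ri); split; split.
  - by move=> x hx; apply/hRi; exact: hr1.
  - by move=> h; apply: b1 => x hx; apply: h; apply/hRi.
  - by move=> x /hRi; exact: hr2.
  - by move=> h; apply: b2 => x hx; apply/hRi; exact: h.
have [Q [h1 h2 [_ _ h3] h4 h5]] := lift m (leqnn m).
have [P hP] := prime_set_idealr h1.
have eP : [set x | x \in P] = Q by apply: seteqI => x /hP.
exists P; split; last by apply/(quot_dim P m hM); rewrite eP.
move=> Q' [s1 s2]; apply: s2 => x /hP; apply: (h3 [set x | x \in Q']).
- exact: prime_idealr_isprime.
- apply: ext_min; first exact: idealr_isid.
  by move=> y; rewrite subnn /c' /= => /hc0 ->; rewrite rmorph0 idealr0.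
- by move=> y hy; apply/hP; exact: s1.
Qed.
End Forward.

Theorem theorem4p8 (T : comNzRingType) (M : idealr T)
    (T_local : local_ring M) (T_complete : adically_complete M)
    (T_rat : contains_rationals T)
    (d : nat) (T_dim : has_krull_dim T d)
    (n : nat) (n_ge1 : (1 <= n)%N) (m : 'I_n -> nat)
    (m_gt1 : forall i, (1 < m i)%N)
    (m_incr : forall i j : 'I_n, (i < j)%N -> (m i < m j)%N)
    (m_ltd : forall i, (m i < d)%N) :
  (exists (A : idomainType) (N : idealr A),
     [/\ local_ring N,
         countable [set: A]%classic,
         quasi_excellent N,
         is_completion_of T N &
         forall i, exists c : nat -> prime_idealr A,
           max_saturated_chain N (m i) c])
  <->
  [/\ reduced T,
      exists P : 'I_n -> prime_idealr T, forall i,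
        minimal_prime (P i) /\ has_krull_dim {ideal_quot (P i)} (m i) &
      countable [set: {ideal_quot M}]%classic].
Proof.
split=> [[A [N [hN hcnt hqe [g hg] hch]]]|[hred [P hP] hcnt]].
  split.
  - exact: (quasi_excellent_reduced hN T_local T_complete hg hqe).
  - have hP i : exists P : prime_idealr T, minimal_prime P /\ has_krull_dim {ideal_quot P} (m i).
      have [c hc] := hch i.
      exact: (chain_minimal_prime hN T_local T_complete T_rat hg hc).
    by exists (fun i => projT1 (cid (hP i))) => i; exact: (projT2 (cid (hP i))).
  - exact: (countable_residues hN T_local hg hcnt).
exact: (exists_quasi_excellent T_local T_complete T_rat hred n_ge1 m_gt1 hcnt hP).
Qed.
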